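(* Let $m$ be the normalized Lebesgue measure on $\mathbb{T}$, and let $X$ be a Banach ideal space such that $L^\infty(\mathbb{T},m)\subseteq X\subseteq L^1(\mathbb{T},m)$. Let $\alpha\in\mathbb{T}$ be not a root of unity and $\varphi(z)=\alpha z$, $z\in\mathbb{T}$. Assume that the operator $U$, $Ux=x\circ\varphi$, is bounded on $X$ and that $\sigma(U)\subseteq\mathbb{T}$. Identify $H^1(\mathbb{U})$ with a closed subspace of $L^1(\mathbb{T},m)$ and let $Y=H^1(\mathbb{U})\cap X$, a closed subspace of $X$. Let $w\in H^\infty(\mathbb{U})$ and let $T=wU$. Then $T$ considered as an operator on $Y$ and $T$ considered as an operator on $H^\infty(\mathbb{U})$ satisfy $$\sigma(T,Y)=\sigma(T,H^\infty(\mathbb{U}))\quad\text{and}\quad\sigma_i(T,Y)=\sigma_i(T,H^\infty(\mathbb{U})),\ i=1,\dots,5.$$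
   Context: $\mathbb{T}$ is the unit circle, $\mathbb{U}$ the open unit disc. A Banach ideal space here is an order ideal in the lattice $L^0(\mathbb{T},m)$ of classes of measurable functions, which is a Banach space under a lattice norm ($|x|\le|y|$ implies $\|x\|\le\|y\|$). $H^1(\mathbb{U})$, $H^\infty(\mathbb{U})$ are the Hardy spaces, identified with spaces of boundary values on $\mathbb{T}$. $\sigma(T,E)$, $\sigma_i(T,E)$ denote the spectrum and essential spectra of $T$ as an operator on $E$. An operator $S$ is semi-Fredholm ($S\in\Phi$) if its range is closed and either $\dim\ker S<\infty$ or $\mathrm{codim}\,R(S)<\infty$; $\Phi_+$ (resp. $\Phi_-$) consists of $S\in\Phi$ with $\dim\ker S<\infty$ (resp. $\mathrm{codim}\,R(S)<\infty$); Fredholm means in $\Phi_+\cap\Phi_-$; Weyl means Fredholm of index $0$. $\sigma_1,\sigma_2,\sigma_3,\sigma_4$ of $T$ are the sets of $\lambda$ for which $\lambda I-T$ is not semi-Fredholm, not in $\Phi_+$, not Fredholm, not Weyl, respectively; $\sigma_5(T)=\sigma(T)\setminus\{\zeta\in\mathbb{C}:$ there is a component $C$ of $\mathbb{C}\setminus\sigma_1(T)$ with $\zeta\in C$ and $C$ meeting the resolvent set of $T\}$. *)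

(* Defs.v *)
From HB Require Import structures.
From mathcomp Require Import all_boot all_order all_algebra.
From mathcomp Require Import complex.
From mathcomp Require Import all_classical all_reals all_analysis.
From mathcomp Require Import measurable_realfun ess_sup_inf.

Set Implicit Arguments.
Unset Strict Implicit.
Unset Printing Implicit Defensive.

Import Order.TTheory GRing.Theory Num.Theory.
Import numFieldNormedType.Exports.
Import Normc.

Local Open Scope classical_set_scope.
Local Open Scope ring_scope.
Local Open Scope complex_scope.

HB.instance Definition _ (R : realType) :=
  PseudoPointedMetric.copy R[i] R[i]^o.
HB.instance Definition _ (R : realType) := NormedModule.copy R[i] R[i]^o.

(* Borel sets of the complex numbers, as the product sigma-algebra of R * R. *)
Section complex_measurable.
Variable R : realType.

Definition complex_display : measure_display.
Proof. exact: (measure_prod_display (default_measure_display,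
  default_measure_display)). Qed.

Local Notation reC := (@complex.Re R : R[i] -> measurableTypeR R).
Local Notation imC := (@complex.Im R : R[i] -> measurableTypeR R).

Let complex_set0 : g_sigma_preimageU reC imC set0.
Proof. exact: sigma_algebra0. Qed.

Let complex_setC A : g_sigma_preimageU reC imC A ->
  g_sigma_preimageU reC imC (~` A).
Proof. exact: sigma_algebraC. Qed.

Let complex_bigcup (F : (set R[i])^nat) :
  (forall i, g_sigma_preimageU reC imC (F i)) ->
  g_sigma_preimageU reC imC (\bigcup_i F i).
Proof. exact: sigma_algebra_bigcup. Qed.

HB.instance Definition _ := @isMeasurable.Build complex_display R[i]
  (g_sigma_preimageU reC imC) complex_set0 complex_setC complex_bigcup.

Lemma measurable_fun_complexP d (T : measurableType d) (f : T -> R[i]) :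
  measurable_fun setT f <->
  measurable_fun setT (reC \o f) /\ measurable_fun setT (imC \o f).
Proof.
apply: (@iff_trans _ (g_sigma_preimageU (reC \o f) (imC \o f) `<=` measurable)).
- rewrite g_sigma_preimageU_comp; split=> [mf A [B HB <-]|f12]; first exact: mf.
  by move=> _ A mA; apply: f12; exists A.
- split => [h12|[mf1 mf2]].
    split => _ A mA; apply: h12; apply: sub_sigma_algebra;
    by [left; exists A|right; exists A].
  apply: smallest_sub; first exact: sigma_algebra_measurable.
  by rewrite subUset; split=> [|] A [B mB <-]; [exact: mf1|exact: mf2].
Qed.

End complex_measurable.

Section complex_measurable_fun.
Variables (R : realType) (d : measure_display) (T : measurableType d).
Implicit Types f g : T -> R[i].

Lemma measurable_complexD f g : measurable_fun setT f -> measurable_fun setT g ->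
  measurable_fun setT (fun t => f t + g t).
Proof.
move=> /measurable_fun_complexP[fr fi] /measurable_fun_complexP[gr gi].
apply/measurable_fun_complexP; split.
  rewrite (_ : _ \o _ = (fun t => complex.Re (f t) + complex.Re (g t))).
    exact: measurable_funD.
  by apply/funext => t /=; case: (f t) (g t) => [? ?] [].
rewrite (_ : _ \o _ = (fun t => complex.Im (f t) + complex.Im (g t))).
  exact: measurable_funD.
by apply/funext => t /=; case: (f t) (g t) => [? ?] [].
Qed.

Lemma measurable_complexM f g : measurable_fun setT f -> measurable_fun setT g ->
  measurable_fun setT (fun t => f t * g t).
Proof.
move=> /measurable_fun_complexP[fr fi] /measurable_fun_complexP[gr gi].
apply/measurable_fun_complexP; split.
  rewrite (_ : _ \o _ = (fun t => complex.Re (f t) * complex.Re (g t) -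
      complex.Im (f t) * complex.Im (g t))).
    by apply: measurable_funB; apply: measurable_funM.
  by apply/funext => t /=; case: (f t) (g t) => [? ?] [].
rewrite (_ : _ \o _ = (fun t => complex.Re (f t) * complex.Im (g t) +
    complex.Im (f t) * complex.Re (g t))).
  by apply: measurable_funD; apply: measurable_funM.
by apply/funext => t /=; case: (f t) (g t) => [? ?] [].
Qed.

End complex_measurable_fun.

(* The space L^0 of classes of complex measurable functions modulo equality
   almost everywhere; it is a module over the complex numbers, with pointwise
   multiplication [mulL0]. *)
Section L0.
Variables (R : realType) (d : measure_display) (T : measurableType d).
Variable mu : {measure set T -> \bar R}.

Definition L0 : Type := @aeEqMfun d _ R T R[i] mu.

HB.instance Definition _ := Choice.on L0.

Definition L0_fun (x : L0) : {mfun T >-> R[i]} := repr x.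
Coercion L0_fun : L0 >-> MeasurableFun.type.

Definition L0_class (f : {mfun T >-> R[i]}) : L0 :=
  (\pi_(@aeEqMfun _ _ R T R[i] mu) f)%qT.

Lemma L0P (x y : L0) : {ae mu, forall z, x z = y z} -> x = y.
Proof.
move=> xy; rewrite -[x]reprK -[y]reprK; apply/eqP; rewrite eqmodE.
by apply/asboolP; apply: filterS xy => z ->.
Qed.

Lemma L0_classE f : {ae mu, forall z, L0_class f z = f z}.
Proof.
have : (repr (L0_class f) == f %[mod @aeEqMfun _ _ R T R[i] mu])%qT.
  by apply/eqP; rewrite reprK.
by rewrite eqmodE => /asboolP; apply: filterS => z ->.
Qed.

Definition mkL0 (f : T -> R[i]) (mf : measurable_fun setT f) : L0 :=
  L0_class (mfun_Sub (mem_set mf)).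

Lemma mkL0E f (mf : measurable_fun setT f) :
  {ae mu, forall z, mkL0 mf z = f z}.
Proof. exact: L0_classE. Qed.

Definition zeroL0 : L0 := mkL0 (@measurable_cst _ _ T R[i] setT 0).
Definition addL0 (x y : L0) : L0 :=
  mkL0 (measurable_complexD (measurable_funPT x) (measurable_funPT y)).
Definition scaleL0 (c : R[i]) (x : L0) : L0 :=
  mkL0 (measurable_complexM (@measurable_cst _ _ T R[i] setT c)
    (measurable_funPT x)).
Definition mulL0 (x y : L0) : L0 :=
  mkL0 (measurable_complexM (measurable_funPT x) (measurable_funPT y)).

Let addE x y := mkL0E
  (measurable_complexD (measurable_funPT x) (measurable_funPT y)).
Let scaleE c x := mkL0E (measurable_complexM
  (@measurable_cst _ _ T R[i] setT c) (measurable_funPT x)).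

Let addL0A : associative addL0.
Proof.
move=> x y z; apply: L0P.
near=> t; rewrite (near (addE x (addL0 y z)) t)// (near (addE y z) t)//.
by rewrite (near (addE (addL0 x y) z) t)// (near (addE x y) t)// addrA.
Unshelve. all: end_near. Qed.

Let addL0C : commutative addL0.
Proof.
move=> x y; apply: L0P.
by near=> t; rewrite (near (addE x y) t)// (near (addE y x) t)// addrC.
Unshelve. all: end_near. Qed.

Let add0L0 : left_id zeroL0 addL0.
Proof.
move=> x; apply: L0P; near=> t; rewrite (near (addE zeroL0 x) t)//.
by rewrite (near (mkL0E (@measurable_cst _ _ T R[i] setT 0)) t)// add0r.
Unshelve. all: end_near. Qed.

Let addNL0 : left_inverse zeroL0 (scaleL0 (-1)) addL0.
Proof.
move=> x; apply: L0P; near=> t; rewrite (near (addE (scaleL0 (-1) x) x) t)//.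
rewrite (near (scaleE (-1) x) t)// mulN1r addNr.
by rewrite (near (mkL0E (@measurable_cst _ _ T R[i] setT 0)) t).
Unshelve. all: end_near. Qed.

HB.instance Definition _ :=
  GRing.isZmodule.Build L0 addL0A addL0C add0L0 addNL0.

Let scaleL0A a b x : scaleL0 a (scaleL0 b x) = scaleL0 (a * b) x.
Proof.
apply: L0P; near=> t; rewrite (near (scaleE a (scaleL0 b x)) t)//.
by rewrite (near (scaleE b x) t)// (near (scaleE (a * b) x) t)// mulrA.
Unshelve. all: end_near. Qed.

Let scaleL01 : left_id 1 scaleL0.
Proof.
by move=> x; apply: L0P; near=> t; rewrite (near (scaleE 1 x) t)// mul1r.
Unshelve. all: end_near. Qed.

Let scaleL0Dr : right_distributive scaleL0 +%R.
Proof.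
move=> a x y; apply: L0P; near=> t.
rewrite (near (scaleE a (addL0 x y)) t)// (near (addE x y) t)//.
rewrite (near (addE (scaleL0 a x) (scaleL0 a y)) t)//.
by rewrite (near (scaleE a x) t)// (near (scaleE a y) t)// mulrDr.
Unshelve. all: end_near. Qed.

Let scaleL0Dl x : {morph scaleL0^~ x : a b / a + b}.
Proof.
move=> a b; apply: L0P; near=> t; rewrite (near (scaleE (a + b) x) t)//.
rewrite (near (addE (scaleL0 a x) (scaleL0 b x)) t)//.
by rewrite (near (scaleE a x) t)// (near (scaleE b x) t)// mulrDl.
Unshelve. all: end_near. Qed.

HB.instance Definition _ := GRing.Zmodule_isLmodule.Build R[i] L0
  scaleL0A scaleL01 scaleL0Dr scaleL0Dl.

End L0.

(* The unit circle with the trace of the Borel sets, and its normalized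
   Lebesgue measure: the image of the Lebesgue measure of [0, 1] under
   t |-> exp(2 pi i t). *)
Section circle.
Variable R : realType.

Record circle := Circle { circle_val :> R[i]; _ : `|circle_val| == 1 }.

HB.instance Definition _ := [isSub for circle_val].
HB.instance Definition _ := [Choice of circle by <:].

Lemma circle_norm (z : circle) : `|z : R[i]| = 1.
Proof. by apply/eqP; case: z. Qed.

Let norm1 : `|1 : R[i]| == 1. Proof. by rewrite normr1. Qed.

HB.instance Definition _ := isPointed.Build circle (Circle norm1).

Let circle_set0 : g_sigma_algebra_preimage circle_val set0.
Proof. exact: (@measurable0 _ (g_sigma_algebra_preimageType circle_val)). Qed.

Let circle_setC A : g_sigma_algebra_preimage circle_val A ->
  g_sigma_algebra_preimage circle_val (~` A).
Proof. exact: (@measurableC _ (g_sigma_algebra_preimageType circle_val)). Qed.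

Let circle_bigcup (F : (set circle)^nat) :
  (forall i, g_sigma_algebra_preimage circle_val (F i)) ->
  g_sigma_algebra_preimage circle_val (\bigcup_i F i).
Proof.
exact: (@bigcupT_measurable _ (g_sigma_algebra_preimageType circle_val)).
Qed.

HB.instance Definition _ := @isMeasurable.Build (preimage_display circle_val)
  circle (g_sigma_algebra_preimage circle_val)
  circle_set0 circle_setC circle_bigcup.

Lemma measurable_circle_val : measurable_fun setT circle_val.
Proof. by move=> _ A mA; exists A. Qed.

Lemma measurable_fun_circle d (T : measurableType d) (f : T -> circle) :
  measurable_fun setT (circle_val \o f) -> measurable_fun setT f.
Proof.
move=> mf _ _ [A mA <-]; rewrite !setTI -comp_preimage.
by rewrite -[X in measurable X]setTI; exact: mf.
Qed.

Lemma circle_mul_subproof (a z : circle) : `|(a : R[i]) * z| == 1.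
Proof. by rewrite normrM !circle_norm mulr1. Qed.

Definition rotation (a z : circle) : circle := Circle (circle_mul_subproof a z).

Lemma measurable_rotation a : measurable_fun setT (rotation a).
Proof.
apply: measurable_fun_circle; apply: measurable_complexM => //.
exact: measurable_circle_val.
Qed.

Lemma circle_exp_subproof (t : R) :
  `|cos (2 * pi * t) +i* sin (2 * pi * t)| == 1.
Proof. by rewrite normc_def /= cos2Dsin2 sqrtr1. Qed.

Definition circle_exp (t : R) : circle := Circle (circle_exp_subproof t).

Lemma measurable_circle_exp :
  measurable_fun [set: measurableTypeR R] circle_exp.
Proof.
have ml : measurable_fun [set: R] (fun t : R => 2 * pi * t).
  exact: mulrl_measurable.
apply: measurable_fun_circle; apply/measurable_fun_complexP; split.
  rewrite (_ : _ \o _ = cos \o (fun t : R => 2 * pi * t))//.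
  apply: measurableT_comp => //; apply: continuous_measurable_fun.
  exact: continuous_cos.
rewrite (_ : _ \o _ = sin \o (fun t : R => 2 * pi * t))//.
apply: measurableT_comp => //; apply: continuous_measurable_fun.
exact: continuous_sin.
Qed.

HB.instance Definition _ := isMeasurableFun.Build _ _ (measurableTypeR R) circle
  circle_exp measurable_circle_exp.

Definition circle_measure : set circle -> \bar R :=
  pushforward (mrestr (@lebesgue_measure R) (measurable_itv `[0, 1]))
    circle_exp.

Let circle_measure0 : circle_measure set0 = 0%E.
Proof. by rewrite /circle_measure /pushforward preimage_set0 measure0. Qed.

Let circle_measure_ge0 A : (0 <= circle_measure A)%E.
Proof. exact: (measure_ge0 (mrestr (@lebesgue_measure R) _)). Qed.

Let circle_measure_sigma_additive : semi_sigma_additive circle_measure.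
Proof.
move=> F mF tF mUF; rewrite /circle_measure /pushforward preimage_bigcup.
have mG n : measurable (circle_exp @^-1` F n).
  by rewrite -[X in measurable X]setTI; exact: measurable_circle_exp.
apply: measure_semi_sigma_additive => //.
  apply/trivIsetP => /= i j _ _ ij; rewrite -preimage_setI.
  by move/trivIsetP : tF => /(_ _ _ _ _ ij) ->//; rewrite preimage_set0.
exact: bigcupT_measurable.
Qed.

HB.instance Definition _ := isMeasure.Build _ _ _ circle_measure
  circle_measure0 circle_measure_ge0 circle_measure_sigma_additive.

Lemma circle_measureT : circle_measure setT = 1%E.
Proof.
rewrite /circle_measure /pushforward /mrestr preimage_setT setTI.
by rewrite lebesgue_measure_itv /= lte_fin ltr01 oppr0 adde0.
Qed.

End circle.

Arguments circle_measure : clear implicits.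

(* A normed space carried by a linear subspace [carrier] of an ambient space V;
   the values of [nnorm] outside [carrier] are irrelevant. *)
Record subnormed (R : realType) (V : lmodType R[i]) := Subnormed {
  carrier : set V;
  nnorm : V -> R
}.

(* Operators on E are given by functions V -> V that map [carrier E] into
   itself. *)
Section operators.
Variables (R : realType) (V : lmodType R[i]).
Implicit Types (E : subnormed V) (S T : V -> V) (A B : set V) (n : nat).

Definition is_submodule A := A 0 /\
  forall (c : R[i]) x y, A x -> A y -> A (c *: x + y).

Definition is_norm E :=
  [/\ forall x, carrier E x -> 0 <= nnorm E x,
      forall x, carrier E x -> nnorm E x = 0 -> x = 0,
      forall (c : R[i]) x, carrier E x -> nnorm E (c *: x) = normc c * nnorm E x
    & forall x y, carrier E x -> carrier E y ->
        nnorm E (x + y) <= nnorm E x + nnorm E y].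

Definition is_complete E := forall u : nat -> V,
  (forall n, carrier E (u n)) ->
  (forall e : R, 0 < e -> exists N, forall p q, (N <= p)%N -> (N <= q)%N ->
    nnorm E (u p - u q) < e) ->
  exists2 l, carrier E l & nnorm E (u n - l) @[n --> \oo] --> (0 : R).

Definition is_banach E :=
  [/\ is_submodule (carrier E), is_norm E & is_complete E].

Definition bounded_on E S :=
  (forall x, carrier E x -> carrier E (S x)) /\
  exists M : R, forall x, carrier E x -> nnorm E (S x) <= M * nnorm E x.

Definition ker_on E S : set V := [set x | carrier E x /\ S x = 0].

Definition range_on E S : set V := S @` carrier E.

Definition closed_in E A := forall y, carrier E y ->
  (forall e : R, 0 < e -> exists2 x, A x & nnorm E (y - x) < e) -> A y.

(* dim (B / A) = n, for subspaces A of B. *)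
Definition dim_mod B A n := exists v : 'I_n -> V,
  [/\ forall i, B (v i),
      forall c : 'I_n -> R[i], A (\sum_i c i *: v i) -> forall i, c i = 0
    & forall y, B y -> exists c : 'I_n -> R[i], A (y - \sum_i c i *: v i)].

Definition dim_ker E S n := dim_mod (ker_on E S) [set 0] n.
Definition codim_range E S n := dim_mod (carrier E) (range_on E S) n.

Definition semi_fredholm E S := closed_in E (range_on E S) /\
  ((exists n, dim_ker E S n) \/ (exists n, codim_range E S n)).
Definition Phi_plus E S := semi_fredholm E S /\ exists n, dim_ker E S n.
Definition Phi_minus E S := semi_fredholm E S /\ exists n, codim_range E S n.
Definition fredholm E S := Phi_plus E S /\ Phi_minus E S.
(* Index 0: the dimension of the kernel is the codimension of the range. *)
Definition weyl E S :=
  fredholm E S /\ exists n, dim_ker E S n /\ codim_range E S n.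

(* Bijective on [carrier E] with a bounded inverse. *)
Definition invertible_on E S :=
  [/\ forall x, carrier E x -> S x = 0 -> x = 0,
      forall y, carrier E y -> exists2 x, carrier E x & S x = y
    & exists M : R, forall x, carrier E x -> nnorm E x <= M * nnorm E (S x)].

Definition lambda_minus T (lam : R[i]) : V -> V := fun x => lam *: x - T x.

Definition resolvent_set T E : set R[i] :=
  [set lam | invertible_on E (lambda_minus T lam)].
Definition spectrum T E : set R[i] := ~` resolvent_set T E.

Definition sigma1 T E : set R[i] := [set lam | ~ semi_fredholm E (lambda_minus T lam)].
Definition sigma2 T E : set R[i] := [set lam | ~ Phi_plus E (lambda_minus T lam)].
Definition sigma3 T E : set R[i] := [set lam | ~ fredholm E (lambda_minus T lam)].
Definition sigma4 T E : set R[i] := [set lam | ~ weyl E (lambda_minus T lam)].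

Definition is_component (A C : set R[i]) :=
  exists2 z, A z & C = connected_component A z.

Definition sigma5 T E : set R[i] := spectrum T E `\`
  [set zeta | exists C : set R[i], [/\ is_component (~` sigma1 T E) C,
    C zeta & C `&` resolvent_set T E !=set0]].

End operators.

Section spaces_on_circle.
Variable R : realType.

Local Notation m := (circle_measure R).
Local Notation L0T := (L0 m).
Implicit Types (x y w : L0T) (X : subnormed L0T) (f : R[i] -> R[i]).

Definition Linfty : set L0T :=
  [set x : L0T | exists M : R, {ae m, forall z, normc (x z) <= M}].

Definition Linfty_norm x : R := fine (ess_sup m (fun z => (normc (x z))%:E)).

Definition Lone : set L0T :=
  [set x : L0T | (\int[m]_z (normc (x z))%:E < +oo)%E].

Definition order_ideal (A : set L0T) := is_submodule A /\
  forall x y, {ae m, forall z, normc (x z) <= normc (y z)} -> A y -> A x.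

Definition lattice_norm X := forall x y, carrier X x -> carrier X y ->
  {ae m, forall z, normc (x z) <= normc (y z)} -> nnorm X x <= nnorm X y.

Definition banach_ideal_space X :=
  [/\ order_ideal (carrier X), is_banach X & lattice_norm X].

Definition holomorphic_disc f := forall z : R[i], `|z| < 1 -> derivable f z 1.

Definition hardy1 f := holomorphic_disc f /\
  exists M : R, forall r : R, 0 <= r < 1 ->
    (\int[m]_z (normc (f (r%:C * circle_val z)))%:E <= M%:E)%E.

Definition hardy_infty f := holomorphic_disc f /\
  exists M : R, forall z : R[i], `|z| < 1 -> normc (f z) <= M.

(* Almost everywhere radial limits. *)
Definition boundary_value f x :=
  {ae m, forall z, f (r%:C * circle_val z) @[r --> (1 : R)^'-] --> x z}.

Definition H1 : set L0T := [set x : L0T | exists2 f, hardy1 f & boundary_value f x].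

Definition Hinfty : set L0T :=
  [set x : L0T | exists2 f, hardy_infty f & boundary_value f x].

Definition Hinfty_space : subnormed L0T := Subnormed Hinfty Linfty_norm.

(* H^1 intersected with X, normed as a subspace of X. *)
Definition H1_inter X : subnormed L0T :=
  Subnormed (H1 `&` carrier X) (nnorm X).

(* x |-> x \o (rotation a), computed on a representative; the class of the
   result does not depend on it because rotations preserve m. *)
Definition rotation_op (a : circle R) x : L0T :=
  mkL0 m (measurableT_comp (measurable_funPT x) (measurable_rotation a)).

Definition weighted_rotation_op w (a : circle R) x : L0T :=
  mulL0 w (rotation_op a x).

End spaces_on_circle.

Arguments Linfty : clear implicits.
Arguments Lone : clear implicits.
Arguments H1 : clear implicits.
Arguments Hinfty : clear implicits.
Arguments Hinfty_space : clear implicits.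

(* Main.v *)
From HB Require Import structures.
From mathcomp Require Import all_boot all_order all_algebra.
From mathcomp Require Import complex ring lra zify.
From mathcomp Require Import all_classical all_reals all_analysis.
From mathcomp Require Import measurable_realfun ess_sup_inf.
Require Import Defs.

(** Write [w_n] for the weight of the [n]-th power of [T], the product of [w]
    over [n] consecutive points of an orbit. For each [lam] one of three
    things happens, and which one depends on [w] and [lam] only.

    Contraction: some [|w_n|] is almost everywhere at most a constant smaller
    than [|lam| ^ n]. The powers of the rotation grow subexponentially on [X];
    this is [rotation_growth], which extracts from the spectral hypothesis
    that the resolvent of the rotation is a positive operator at every real
    number larger than 1. Hence a power of [T / lam] is a contraction and [lam
    - T] is invertible on the analytic part of every space
    ([contracts_invertible]).

    Expansion: some [|w_n|] is almost everywhere at least a constant larger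
    than [|lam| ^ n]. Then [lam - T] is invertible on the whole of [X] and
    bounded below in mean, so on the analytic part it is injective with closed
    range. A function [y] is in that range when its preimage is analytic, that
    is, when the Fourier coefficients of negative index of the preimage
    vanish. These coefficients are continuous functionals of [y] in mean, and
    bounded analytic functions are dense in [H^1], so the codimension of the
    range is the same for all spaces ([expanding_codim], by [dim_transfer]).

    Otherwise, unless [w = 0], the range is not closed
    ([closed_range_dichotomy]). If it were, the open mapping theorem and the
    shape of the kernel (an eigenfunction with leading term [z ^ n] has
    eigenvalue [a ^ n] times the mean of [w]) bound [lam - T] below on
    functions vanishing to a high order at the centre. Test this on [z ^ n0 *
    f] with [f] an outer function of modulus 1 on a small set and of tiny
    modulus elsewhere, summed along its orbit with coefficients that increase
    and then decrease geometrically with ratio close to 1: [lam - T] nearly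
    annihilates such a hump except at its two ends. The lower bound forces [3
    b_p (phi ^ p z) <= 1 + b_2p z] almost everywhere, where [b_n = |w_n| /
    |lam| ^ n], for a suitable [p]. As [b_2p z = b_p z * b_p (phi ^ p z)], the
    set where [b_p <= 2 / 3] is mapped into itself by the [p]-th power of the
    rotation. By ergodicity it is null or conull, which is expansion or
    contraction ([below_dichotomy]). The value [lam = 0] needs a simpler test
    function, and [w = 0] is treated directly.

    The spaces [X] and [L^oo] both satisfy what is used, so the kernels,
    ranges and inverses agree in each case and the spectra coincide.

    The analysis on the disc that supports this is that of boundary values.
    [H1P] identifies [H^1] with the integrable functions whose Fourier
    coefficients of negative index vanish: radial limits of a function with
    bounded circle means are limits in mean ([hardy_L1radial]), because the
    square root of its modulus is subharmonic. [outer_Hinfty] provides the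
    outer functions. Both rest on Goursat's theorem, the Poisson kernel and
    Fatou's theorem on radial limits. *)

Set Implicit Arguments.
Unset Strict Implicit.
Unset Printing Implicit Defensive.

Import Order.TTheory GRing.Theory Num.Theory.
Import numFieldNormedType.Exports.
Import Normc.

Local Open Scope classical_set_scope.
Local Open Scope ring_scope.
Local Open Scope complex_scope.

(** * Complex limits and complex derivatives *)

Section complex_numbers.
Variable R : realType.
Implicit Types (x y z w : R[i]).

Lemma norm_normc z : `|z| = (normc z)%:C.
Proof. by rewrite normc_def; case: z => a b. Qed.

Lemma normc_ge0 z : 0 <= normc z.
Proof. by case: z => a b; exact: sqrtr_ge0. Qed.

Lemma normc_eq0 z : (normc z == 0) = (z == 0).
Proof.
by apply/eqP/eqP => [/eq0_normc//|->]; rewrite -[LHS]/(normc 0%C) normc0.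
Qed.

Lemma normc_gt0 z : (0 < normc z) = (z != 0).
Proof. by rewrite lt_def normc_eq0 normc_ge0 andbT. Qed.

Lemma normcR (a : R) : normc a%:C = `|a|.
Proof. by rewrite /= expr0n/= addr0 sqrtr_sqr. Qed.

Lemma normc_0 : normc (0 : R[i]) = 0. Proof. exact: normc0. Qed.
Lemma normc_1 : normc (1 : R[i]) = 1. Proof. exact: normc1. Qed.

Lemma normcB x y : normc (x - y) = normc (y - x).
Proof. by rewrite -normcN opprB. Qed.

Lemma ler_normcB x y : normc x - normc y <= normc (x - y).
Proof. by rewrite lerBlDr (le_trans _ (le_normcD _ _)) ?subrK. Qed.

Lemma normcX z n : normc (z ^+ n) = normc z ^+ n.
Proof.
by elim: n => [|n IH]; rewrite ?expr0 ?normc_1// !exprS normcM IH.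
Qed.

Lemma conjcM x y : conjc (x * y) = conjc x * conjc y.
Proof. by rewrite rmorphM. Qed.

Lemma conjcB x y : conjc (x - y) = conjc x - conjc y.
Proof. by rewrite rmorphB. Qed.

Lemma normc_conjc z : normc (conjc z) = normc z.
Proof. by case: z => a b /=; rewrite sqrrN. Qed.

Lemma mulc_conjc z : z * conjc z = (normc z ^+ 2)%:C.
Proof. by rewrite -sqr_normc norm_normc rmorphXn. Qed.

Lemma ler_ReN z : `|complex.Re z| <= normc z.
Proof. by have := normc_ge_Re z; rewrite norm_normc lecR. Qed.

Lemma ler_ImN z : `|complex.Im z| <= normc z.
Proof.
case: z => a b /=; rewrite -sqrtr_sqr ler_wsqrtr// lerDr; exact: sqr_ge0.
Qed.

Lemma ler_normc_ReIm z : normc z <= `|complex.Re z| + `|complex.Im z|.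
Proof.
case: z => a b /=; rewrite -[leRHS]ger0_norm ?addr_ge0//.
rewrite -sqrtr_sqr ler_wsqrtr// sqrrD !real_normK ?num_real//.
by rewrite -addrA [X in _ <= _ + X]addrC addrA lerDl mulrn_wge0// mulr_ge0.
Qed.

Lemma ReM_real (a : R) z : complex.Re (a%:C * z) = a * complex.Re z.
Proof. by case: z => b c /=; rewrite mul0r subr0. Qed.

Lemma ImM_real (a : R) z : complex.Im (a%:C * z) = a * complex.Im z.
Proof. by case: z => b c /=; rewrite mul0r addr0. Qed.

Lemma cReD z w : complex.Re (z + w) = complex.Re z + complex.Re w.
Proof. by case: z w => a b []. Qed.

Lemma cImD z w : complex.Im (z + w) = complex.Im z + complex.Im w.
Proof. by case: z w => a b []. Qed.

Lemma cReN z : complex.Re (- z) = - complex.Re z.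
Proof. by case: z. Qed.

Lemma cImN z : complex.Im (- z) = - complex.Im z.
Proof. by case: z. Qed.

Lemma cReM z w : complex.Re (z * w) =
  complex.Re z * complex.Re w - complex.Im z * complex.Im w.
Proof. by case: z w => a b []. Qed.

Lemma cImM z w : complex.Im (z * w) =
  complex.Re z * complex.Im w + complex.Im z * complex.Re w.
Proof. by case: z w => a b []. Qed.

Lemma normc_sqr z : normc z ^+ 2 = complex.Re z ^+ 2 + complex.Im z ^+ 2.
Proof. by case: z => a b /=; rewrite sqr_sqrtr// addr_ge0// sqr_ge0. Qed.

Lemma complexP z w : complex.Re z = complex.Re w ->
  complex.Im z = complex.Im w -> z = w.
Proof. by case: z w => a b [c d] /= -> ->. Qed.

Lemma normr_lt1 z : (`|z| < 1) = (normc z < 1).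
Proof. by rewrite norm_normc -[1]/((1 : R)%:C) ltcR. Qed.

(** Convergence tested by real moduli: the norm of complex numbers takes
    complex values, and this form keeps the topology of the field folded. *)
Definition ccvg (T : Type) (F : set_system T) (f : T -> R[i]) (l : R[i]) :=
  forall e : R, 0 < e -> \forall t \near F, normc (f t - l) < e.

Section ccvg.
Context (T : Type) (F : set_system T) {FF : Filter F}.
Implicit Types (f g : T -> R[i]) (l m : R[i]).

Lemma ccvgP f l : f @ F --> l <-> ccvg F f l.
Proof.
split=> [/cvgrPdist_lt fl e e0|fl].
  have := fl e%:C; rewrite ltcR => /(_ e0); apply: filterS => t.
  by rewrite norm_normc ltcR normcB.
apply/cvgrPdist_lt => e; rewrite ltcE/= => /andP[/eqP ie re].
move: (fl _ re); apply: filterS => t h.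
by rewrite norm_normc normcB ltcE/= ie eqxx.
Qed.

Lemma ccvg0P f l : ccvg F f l <-> normc (f t - l) @[t --> F] --> (0 : R).
Proof.
split=> [h|/cvgrPdist_lt h e /h].
  apply/cvgrPdist_lt => e /h; apply: filterS => t.
  by rewrite sub0r normrN ger0_norm// normc_ge0.
by apply: filterS => t; rewrite sub0r normrN ger0_norm// normc_ge0.
Qed.

Lemma ccvg_norm f l : ccvg F f l -> normc (f t) @[t --> F] --> normc l.
Proof.
move=> fl; apply/cvgrPdist_lt => e e0; move: (fl _ e0).
apply: filterS => t h; rewrite distrC; apply: le_lt_trans h.
rewrite ler_norml lerNl opprB; apply/andP; split; last exact: ler_normcB.
by rewrite normcB ler_normcB.
Qed.

Lemma ccvg_Re f l : ccvg F f l -> complex.Re (f t) @[t --> F] --> complex.Re l.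
Proof.
move=> fl; apply/cvgrPdist_lt => e e0; move: (fl _ e0).
apply: filterS => t h; rewrite distrC; apply: le_lt_trans h.
by rewrite -cReN -cReD ler_ReN.
Qed.

Lemma ccvg_Im f l : ccvg F f l -> complex.Im (f t) @[t --> F] --> complex.Im l.
Proof.
move=> fl; apply/cvgrPdist_lt => e e0; move: (fl _ e0).
apply: filterS => t h; rewrite distrC; apply: le_lt_trans h.
by rewrite -cImN -cImD ler_ImN.
Qed.

Lemma ccvg_ReIm f l : complex.Re (f t) @[t --> F] --> complex.Re l ->
  complex.Im (f t) @[t --> F] --> complex.Im l -> ccvg F f l.
Proof.
move=> /cvgrPdist_lt rl /cvgrPdist_lt il e e0.
have e2 : 0 < e / 2 by rewrite divr_gt0.
near=> t; apply: le_lt_trans (ler_normc_ReIm _) _.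
rewrite cReD cReN cImD cImN [e]splitr ltrD// distrC; near: t; [exact: rl|exact: il].
Unshelve. all: end_near. Qed.

Lemma ccvg_conjc f l : ccvg F f l -> ccvg F (fun t => conjc (f t)) (conjc l).
Proof.
by move=> fl e /fl; apply: filterS => t; rewrite -conjcB normc_conjc.
Qed.

Lemma ccvgD f g l m : ccvg F f l -> ccvg F g m ->
  ccvg F (fun t => f t + g t) (l + m).
Proof.
move=> fl gm; apply: ccvg_ReIm.
  rewrite cReD; under eq_fun do rewrite cReD.
  by apply: (@cvgD R R); exact: ccvg_Re.
rewrite cImD; under eq_fun do rewrite cImD.
by apply: (@cvgD R R); exact: ccvg_Im.
Qed.

Lemma ccvgM f g l m : ccvg F f l -> ccvg F g m ->
  ccvg F (fun t => f t * g t) (l * m).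
Proof.
move=> fl gm; apply: ccvg_ReIm.
  rewrite cReM; under eq_fun do rewrite cReM.
  apply: (@cvgB R R); apply: (@cvgM R); by [exact: ccvg_Re|exact: ccvg_Im].
rewrite cImM; under eq_fun do rewrite cImM.
apply: (@cvgD R R); apply: (@cvgM R); by [exact: ccvg_Re|exact: ccvg_Im].
Qed.

Lemma ccvgN f l : ccvg F f l -> ccvg F (fun t => - f t) (- l).
Proof.
by move=> fl e /fl; apply: filterS => t; rewrite -opprD normcN.
Qed.

Lemma ccvg_cst l : ccvg F (fun=> l) l.
Proof. by move=> e e0; near=> t; rewrite subrr normc_0. Unshelve. all: end_near. Qed.

Lemma ccvg_realc (f : T -> R) (l : R) : f @ F --> l -> ccvg F (fun t => (f t)%:C) l%:C.
Proof. by move=> fl; apply: ccvg_ReIm => //=; exact: cvg_cst. Qed.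

Lemma ccvgV f l : l != 0 -> ccvg F f l -> ccvg F (fun t => (f t)^-1) l^-1.
Proof.
move=> l0 fl; have nl := ccvg_norm fl.
have E (z : R[i]) : z^-1 = ((normc z ^+ 2)^-1)%:C * conjc z.
  have [->|z0] := eqVneq z 0; first by rewrite invr0 conjc0 mulr0.
  apply: (mulfI z0); rewrite divff// mulrCA mulc_conjc -rmorphM/= mulVf//.
  by rewrite expf_neq0// normc_eq0.
rewrite E; under eq_fun do rewrite E.
apply: ccvgM; last exact: ccvg_conjc.
apply: ccvg_realc; apply: cvgV; first by rewrite expf_neq0// normc_eq0.
by rewrite expr2; under eq_fun do rewrite expr2; exact: cvgM.
Qed.

End ccvg.

(** The neighbourhoods of a complex number, as a filter that is not unfolded to
    the instance of the topology of the field. *)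
Definition near_pt z : set_system R[i] := [set P | exists2 d : R, 0 < d &
  forall w, normc (w - z) < d -> P w].

#[global] Instance near_pt_filter z : Filter (near_pt z).
Proof.
split=> [|P Q [d d0 dP] [e e0 eQ]|P Q PQ [d d0 dP]].
- by exists 1.
- exists (Num.min d e) => [|w]; first by rewrite lt_min d0.
  by rewrite lt_min => /andP[wd we]; split; [exact: dP|exact: eQ].
- by exists d => // w /dP; exact: PQ.
Qed.

Lemma near_ptE z : near_pt z = nbhs z.
Proof.
apply/seteqP; split=> P.
  move=> [d d0 dP]; apply/nbhs_ballP; exists d%:C; rewrite /= ?ltcR//.
  move=> w; rewrite -ball_normE/= distrC norm_normc ltcR; exact: dP.
move=> /nbhs_ballP[d /= d0 dP]; move: d0; rewrite ltcE/= => /andP[/eqP id rd].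
exists (complex.Re d) => // w wz; apply: dP.
by rewrite -ball_normE/= distrC norm_normc ltcE/= id eqxx.
Qed.

(** Complex differentiability in the form of Caratheodory: the difference
    quotient extends continuously to the point. *)
Definition holo (f : R[i] -> R[i]) z := exists2 phi : R[i] -> R[i],
  (forall w, f w = f z + phi w * (w - z)) & ccvg (near_pt z) phi (phi z).

Lemma holoP f z : holo f z <-> derivable f z 1.
Proof.
split=> [[phi fE cphi]|/cvg_ex[D fD]].
- apply/cvg_ex; exists (phi z); apply/ccvgP => e e0.
  move: (cphi _ e0); rewrite near_ptE => /nbhs_ballP[d /= d0 dphi].
  near=> h; rewrite /= fE.
  have h0 : h != 0 by near: h; exact: nbhs_dnbhs_neq.
  rewrite scaler1 [h + z]addrC addrAC subrr add0r [z + h]addrC addrK.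
  rewrite /GRing.scale/= mulrC mulfK//; apply: dphi.
  rewrite -ball_normE/= opprD addrCA subrr addr0 normrN.
  by near: h; apply: dnbhs0_lt.
- exists (fun w => if w == z then D else (f w - f z) / (w - z)) => [w|].
    case: eqVneq => [->|wz]; first by rewrite subrr mulr0 addr0.
    by rewrite divfK ?subr_eq0// subrKC.
  rewrite eqxx => e e0.
  move/ccvgP : fD => /(_ _ e0)/nbhs_ballP[d /= d0 dD].
  rewrite near_ptE; apply/nbhs_ballP; exists d => //= w; rewrite -ball_normE/= => wd.
  case: eqVneq => [_|wz]; first by rewrite subrr normc_0.
  have := dD (w - z); rewrite -ball_normE/= sub0r normrN.
  rewrite scaler1 subrK /GRing.scale/= mulrC; apply; last by rewrite subr_eq0.
  by rewrite distrC.
Unshelve. all: end_near. Qed.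

Lemma holo_continuous f z : holo f z -> ccvg (near_pt z) f (f z).
Proof.
move=> [phi fE cphi] e e0.
have : 0 < e / (normc (phi z) + 1) by rewrite divr_gt0// ltr_wpDl// normc_ge0.
set d := e / _ => d0.
near=> w; rewrite fE addrAC subrr add0r normcM.
have -> : e = (normc (phi z) + 1) * d.
  by rewrite /d mulrC divfK// gt_eqF// ltr_wpDl// normc_ge0.
apply: ltr_pM; rewrite ?normc_ge0//.
  rewrite -ltrBlDl; apply: le_lt_trans (ler_normcB _ _) _.
  by near: w; exact: cphi.
by near: w; exists d.
Unshelve. all: end_near. Qed.

Lemma ccvg_near_pt z : ccvg (near_pt z) id z.
Proof. by move=> e e0; exists e. Qed.

Lemma holo_id z : holo id z.
Proof. exists (cst 1) => [w|]; [by rewrite /= mul1r subrKC|exact: ccvg_cst]. Qed.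

Lemma holo_cst c z : holo (cst c) z.
Proof. exists (cst 0) => [w|]; [by rewrite /= mul0r addr0|exact: ccvg_cst]. Qed.

Lemma holoD f g z : holo f z -> holo g z -> holo (fun w => f w + g w) z.
Proof.
move=> [p fE cp] [q gE cq]; exists (fun w => p w + q w) => [w|].
  by rewrite fE gE; ring.
exact: ccvgD.
Qed.

Lemma holoM f g z : holo f z -> holo g z -> holo (fun w => f w * g w) z.
Proof.
move=> hf hg; have cg := holo_continuous hg.
move: hf hg => [p fE cp] [q gE cq].
exists (fun w => p w * g w + f z * q w) => [w|].
  by rewrite mulrDl -[_ * g w * _]mulrA [f w]fE [in f z * q w]mulrC gE; ring.
by apply: ccvgD; apply: ccvgM => //; exact: ccvg_cst.
Qed.

Lemma holoN f z : holo f z -> holo (fun w => - f w) z.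
Proof.
move=> [p fE cp]; exists (fun w => - p w) => [w|]; last exact: ccvgN.
by rewrite fE; ring.
Qed.

Lemma holoB f g z : holo f z -> holo g z -> holo (fun w => f w - g w) z.
Proof. by move=> hf hg; apply: holoD => //; exact: holoN. Qed.

Lemma holoX n z : holo (fun w => w ^+ n) z.
Proof.
elim: n => [|n IH]; first exact: holo_cst.
rewrite [X in holo X](_ : _ = fun w => w * w ^+ n).
  by apply: holoM => //; exact: holo_id.
by apply/funext => w; rewrite exprS.
Qed.

Lemma holo_comp f g z : holo g z -> holo f (g z) -> holo (fun w => f (g w)) z.
Proof.
move=> hg; have := holo_continuous hg.
move: hg => [q gE cq] cg [p fE cp].
exists (fun w => p (g w) * q w) => [w|].
  by rewrite [f (g w)]fE -mulrA; congr (_ + _ * _); rewrite [g w]gE; ring.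
apply: ccvgM => // e /cp[d d0 dp].
by apply: filterS (cg _ d0) => w /dp.
Qed.

Lemma holo_inv z : z != 0 -> holo (fun w => w^-1) z.
Proof.
move=> z0; exists (fun w => if w == 0 then z^-1 ^+ 2 else - (w^-1 * z^-1)) => [w|].
  case: eqVneq => [->|w0]; first by rewrite invr0; field.
  by field; apply/andP.
rewrite (negPf z0).
have c : ccvg (near_pt z) (fun w => - (w^-1 * z^-1)) (- (z^-1 * z^-1)).
  apply: ccvgN; apply: ccvgM; last exact: ccvg_cst.
  by apply: ccvgV => //; exact: ccvg_near_pt.
move=> e e0; near=> w.
have /negPf -> : w != 0.
  near: w; exists (normc z); first by rewrite normc_gt0.
  by move=> w; apply: contraTneq => ->; rewrite sub0r normcN ltxx.
by near: w; exact: c.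
Unshelve. all: end_near. Qed.

Lemma holo_conj f z : holo f (conjc z) -> holo (fun w => conjc (f (conjc w))) z.
Proof.
move=> [p fE cp]; exists (fun w => conjc (p (conjc w))) => [w|].
  by rewrite [f (conjc w)]fE !rmorphD rmorphM rmorphB/= !conjcK.
apply: ccvg_conjc => e /cp[d d0 dp]; exists d => // w wz.
by apply: dp; rewrite -conjcB normc_conjc.
Qed.

Lemma holoP_eps f z : holo f z -> exists D : R[i], forall e : R, 0 < e ->
  exists2 d : R, 0 < d & forall w, normc (w - z) < d ->
    normc (f w - f z - D * (w - z)) <= e * normc (w - z).
Proof.
move=> [p fE cp]; exists (p z) => e /cp[d d0 H].
exists d => // w /H h.
have -> : f w - f z - p z * (w - z) = (p w - p z) * (w - z).
  by rewrite [f w]fE; ring.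
by rewrite normcM ler_wpM2r ?normc_ge0// ltW.
Qed.

End complex_numbers.

(** * Integrals of complex functions *)

Section complex_integral.
Context d (T : measurableType d) (R : realType) (mu : {measure set T -> \bar R}).
Implicit Types (D : set T) (u v : T -> R[i]) (f g : T -> R).

Definition cint D u : R[i] :=
  (\int[mu]_(x in D) complex.Re (u x)) +i* (\int[mu]_(x in D) complex.Im (u x)).

Definition rintg D f := mu.-integrable D (EFin \o f).

Definition cintg D u :=
  rintg D (fun x => complex.Re (u x)) /\ rintg D (fun x => complex.Im (u x)).

Lemma rintgD D f g : measurable D -> rintg D f -> rintg D g ->
  rintg D (fun x => f x + g x).
Proof. by move=> mD; exact: (@integrableD _ _ _ mu D mD (EFin \o f) (EFin \o g)). Qed.

Lemma rintgZ D f (k : R) : measurable D -> rintg D f ->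
  rintg D (fun x => k * f x).
Proof. by move=> mD; exact: (@integrableZl _ _ _ mu D mD k (EFin \o f)). Qed.

Lemma rintgN D f : measurable D -> rintg D f -> rintg D (fun x => - f x).
Proof.
move=> mD fi; under eq_fun do rewrite -mulN1r; exact: rintgZ.
Qed.

Lemma rintgB D f g : measurable D -> rintg D f -> rintg D g ->
  rintg D (fun x => f x - g x).
Proof. by move=> mD fi gi; apply: rintgD => //; exact: rintgN. Qed.

Lemma rintg_norm D f : measurable D -> rintg D f -> rintg D (fun x => `|f x|).
Proof. by move=> mD /integrable_norm. Qed.

Lemma rintg_le D f g : measurable D -> measurable_fun D f ->
  (forall x, D x -> `|f x| <= g x) -> rintg D g -> rintg D f.
Proof.
move=> mD mf fg; apply: le_integrable => //; first exact/measurable_EFinP.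
move=> x Dx /=; rewrite lee_fin; apply: le_trans (fg _ Dx) _; exact: ler_norm.
Qed.

Lemma rintg_meas D f : rintg D f -> measurable_fun D f.
Proof. by move=> /measurable_int/measurable_EFinP. Qed.

Lemma cintgD D u v : measurable D -> cintg D u -> cintg D v ->
  cintg D (fun x => u x + v x).
Proof.
move=> mD [ru iu] [rv iv]; split.
  by under eq_fun do rewrite cReD; exact: rintgD.
by under eq_fun do rewrite cImD; exact: rintgD.
Qed.

Lemma cintgZ D u c : measurable D -> cintg D u -> cintg D (fun x => c * u x).
Proof.
move=> mD [ru iu]; split.
  by under eq_fun do rewrite cReM; apply: rintgB => //; exact: rintgZ.
by under eq_fun do rewrite cImM; apply: rintgD => //; exact: rintgZ.
Qed.

Lemma cintgN D u : measurable D -> cintg D u -> cintg D (fun x => - u x).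
Proof.
by move=> mD iu; under eq_fun do rewrite -mulN1r; exact: cintgZ.
Qed.

Lemma cintgB D u v : measurable D -> cintg D u -> cintg D v ->
  cintg D (fun x => u x - v x).
Proof. by move=> mD iu iv; apply: cintgD => //; exact: cintgN. Qed.

Lemma measurable_normc D u :
  measurable_fun D (fun x => complex.Re (u x)) ->
  measurable_fun D (fun x => complex.Im (u x)) ->
  measurable_fun D (fun x => normc (u x)).
Proof.
move=> ru iu.
have -> : (fun x => normc (u x)) = (fun x => Num.sqrt
    (complex.Re (u x) ^+ 2 + complex.Im (u x) ^+ 2)).
  by apply/funext => x; case: (u x).
apply: measurableT_comp.
  by apply: continuous_measurable_fun; exact: sqrt_continuous.
by apply: measurable_funD; exact: measurable_funX.
Qed.

Lemma cintg_norm D u : measurable D -> cintg D u -> rintg D (fun x => normc (u x)).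
Proof.
move=> mD [ru iu].
have := rintgD mD (rintg_norm mD ru) (rintg_norm mD iu); apply: rintg_le => //.
  by apply: measurable_normc; exact: rintg_meas.
by move=> x _; rewrite ger0_norm ?normc_ge0//; exact: ler_normc_ReIm.
Qed.

Lemma cintg_real D f : measurable D -> rintg D f -> cintg D (fun x => (f x)%:C).
Proof.
move=> mD fi; split => //=; have := rintgZ 0 mD fi.
by under eq_fun do rewrite mul0r.
Qed.

Lemma cintD D u v : measurable D -> cintg D u -> cintg D v ->
  cint D (fun x => u x + v x) = cint D u + cint D v.
Proof.
move=> mD [ru iu] [rv iv]; apply: complexP => /=.
  by under eq_Rintegral do rewrite cReD; exact: RintegralD.
by under eq_Rintegral do rewrite cImD; exact: RintegralD.
Qed.

Lemma cintZ D u c : measurable D -> cintg D u ->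
  cint D (fun x => c * u x) = c * cint D u.
Proof.
move=> mD [ru iu]; apply: complexP; rewrite ?cReM ?cImM /=.
  under eq_Rintegral do rewrite cReM.
  by rewrite RintegralB// ?RintegralZl//; exact: rintgZ.
under eq_Rintegral do rewrite cImM.
by rewrite RintegralD// ?RintegralZl//; exact: rintgZ.
Qed.

Lemma cintN D u : measurable D -> cintg D u -> cint D (fun x => - u x) = - cint D u.
Proof.
move=> mD iu; rewrite -[RHS]mulN1r -cintZ//.
by congr cint; apply/funext => x; rewrite mulN1r.
Qed.

Lemma cintB D u v : measurable D -> cintg D u -> cintg D v ->
  cint D (fun x => u x - v x) = cint D u - cint D v.
Proof. by move=> mD iu iv; rewrite cintD ?cintN//; exact: cintgN. Qed.

Lemma cint_real D f : cint D (fun x => (f x)%:C) = (\int[mu]_(x in D) f x)%:C.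
Proof.
apply: complexP => //=; rewrite /Rintegral.
by rewrite (_ : (fun _ => _) = cst 0%E) ?integral0//; apply/funext.
Qed.

(** Rotate the value of the integral to the positive half-line, and take real
    parts under the integral sign. *)
Lemma ler_norm_cint D u : measurable D -> cintg D u ->
  normc (cint D u) <= \int[mu]_(x in D) normc (u x).
Proof.
move=> mD iu; have [->|I0] := eqVneq (cint D u) 0.
  by rewrite normc_0 Rintegral_ge0// => x _; exact: normc_ge0.
set I := cint D u in I0 *; pose c := conjc I / (normc I)%:C.
have nI : normc I != 0 by rewrite normc_eq0.
have nc : normc c = 1.
  by rewrite /c normcM normc_conjc normcV normcR ger0_norm ?normc_ge0// divff.
have -> : normc I = complex.Re (cint D (fun x => c * u x)).
  rewrite cintZ// -/I /c mulrAC [conjc I * I]mulrC mulc_conjc.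
  by rewrite -fmorphV -rmorphM/= expr2 mulfK.
apply: le_Rintegral => //.
- by have [] := cintgZ c mD iu.
- exact: cintg_norm.
- move=> x Dx; apply: le_trans (ler_norm _) _; apply: le_trans (ler_ReN _) _.
  by rewrite normcM nc mul1r.
Qed.

Lemma eq_cint D u v : (forall x, D x -> u x = v x) -> cint D u = cint D v.
Proof.
by move=> uv; apply: complexP => /=; apply: eq_Rintegral => x;
  rewrite inE => /uv ->.
Qed.

End complex_integral.

Section interval_integral.
Variable R : realType.
Local Notation mu := (@lebesgue_measure R).
Implicit Types (u v : R -> R[i]) (a b c t : R).

Definition ccont u t := forall e : R, 0 < e -> exists2 d : R, 0 < d &
  forall s, `|s - t| < d -> normc (u s - u t) < e.

Definition ccontI a b u := forall t, a <= t <= b -> ccont u t.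

Lemma ccont_Re u t : ccont u t -> {for t, continuous (fun s => complex.Re (u s))}.
Proof.
move=> ut; apply/cvgrPdist_lt => e /ut[d d0 ud].
apply/nbhs_ballP; exists d => //= s; rewrite /ball/= distrC => /ud h.
by rewrite distrC -cReN -cReD; apply: le_lt_trans h; exact: ler_ReN.
Qed.

Lemma ccont_Im u t : ccont u t -> {for t, continuous (fun s => complex.Im (u s))}.
Proof.
move=> ut; apply/cvgrPdist_lt => e /ut[d d0 ud].
apply/nbhs_ballP; exists d => //= s; rewrite /ball/= distrC => /ud h.
by rewrite distrC -cImN -cImD; apply: le_lt_trans h; exact: ler_ImN.
Qed.

Lemma ccontI_cintg a b u : ccontI a b u -> cintg mu `[a, b] u.
Proof.
move=> cu; split; apply: continuous_compact_integrable;
  try exact: segment_compact; apply: continuous_in_subspaceT => t;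
  rewrite inE/= in_itv/= => /cu ?; [exact: ccont_Re|exact: ccont_Im].
Qed.

Definition cinti a b u := cint mu `[a, b] u.

Lemma cinti_split a c b u : a <= c -> c <= b -> ccontI a b u ->
  cinti a b u = cinti a c u + cinti c b u.
Proof.
move=> ac cb /ccontI_cintg[ru iu]; apply: complexP; rewrite ?cReD ?cImD /=.
  rewrite -[X in _ + X]Rintegral_itv_obnd_cbnd; last first.
    by apply: integrableS ru => //; apply: subset_itvScc; rewrite ?bnd_simp.
  by rewrite -(Rintegral_itvB ru) ?bnd_simp// addrC subrK.
rewrite -[X in _ + X]Rintegral_itv_obnd_cbnd; last first.
  by apply: integrableS iu => //; apply: subset_itvScc; rewrite ?bnd_simp.
by rewrite -(Rintegral_itvB iu) ?bnd_simp// addrC subrK.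
Qed.

Lemma ccontI_sub a b c e u : a <= c -> e <= b -> ccontI a b u -> ccontI c e u.
Proof.
move=> ac eb cu t /andP[ct te]; apply: cu.
by rewrite (le_trans ac ct) (le_trans te eb).
Qed.

Lemma ccont_cst (c : R[i]) t : ccont (fun=> c) t.
Proof. by move=> e e0; exists 1 => // s _; rewrite subrr normc_0. Qed.

Lemma ccontD u v t : ccont u t -> ccont v t -> ccont (fun s => u s + v s) t.
Proof.
move=> cu cv e e0; have e2 : 0 < e / 2 by rewrite divr_gt0.
have [d d0 ud] := cu _ e2; have [d' d'0 vd] := cv _ e2.
exists (Num.min d d') => [|s]; first by rewrite lt_min d0.
rewrite lt_min => /andP[/ud us /vd vs].
rewrite opprD addrACA; apply: le_lt_trans (le_normcD _ _) _.
by rewrite [e]splitr ltrD.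
Qed.

Lemma ccontN u t : ccont u t -> ccont (fun s => - u s) t.
Proof.
move=> cu e /cu[d d0 ud]; exists d => // s /ud.
by rewrite -opprD normcN.
Qed.

Lemma cinti_cst a b (c : R[i]) : a <= b -> cinti a b (fun=> c) = c * (b - a)%:C.
Proof.
move=> ab; apply: complexP; rewrite ?cReM ?cImM /= ?mulr0 ?subr0 ?add0r.
  by rewrite Rintegral_cst//= lebesgue_measure_itv/= lte_fin; case: ltgtP ab => // ->; rewrite subrr.
by rewrite Rintegral_cst//= lebesgue_measure_itv/= lte_fin; case: ltgtP ab => // ->; rewrite subrr.
Qed.

Lemma ler_norm_cinti a b u M : a <= b -> ccontI a b u ->
  (forall t, a <= t <= b -> normc (u t) <= M) ->
  normc (cinti a b u) <= M * (b - a).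
Proof.
move=> ab /ccontI_cintg iu uM; apply: le_trans (ler_norm_cint _ iu) _ => //.
have -> : M * (b - a) = \int[mu]_(x in `[a, b]) M.
  rewrite Rintegral_cst//= lebesgue_measure_itv/= lte_fin.
  by case: ltgtP ab => // ->; rewrite subrr.
apply: le_Rintegral => //.
- exact: cintg_norm.
- apply: continuous_compact_integrable; first exact: segment_compact.
  by apply: continuous_subspaceT => x; exact: cvg_cst.
Qed.

End interval_integral.

(** * Goursat's theorem *)

Section goursat.
Variables (R : realType) (G : R -> R -> R[i]) (k : R[i]).
Implicit Types s t a b x y : R.

(** Complex differentiability of a function of two real variables, for the
    linear structure in which the second variable is multiplied by [k]. *)
Definition gdiff s t := exists D : R[i], forall e : R, 0 < e ->
  exists2 d : R, 0 < d & forall x y, `|x - s| < d -> `|y - t| < d ->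
    normc (G x y - G s t - D * ((x - s)%:C + k * (y - t)%:C))
      <= e * (`|x - s| + `|y - t|).

(** The integral over the boundary of a rectangle, as the two horizontal and
    the two vertical sides; [k] is the factor relating the vertical to the
    horizontal direction. *)
Definition rbd s t a b := cinti s (s + a) (fun x => G x t - G x (t + b)) +
  k * cinti t (t + b) (fun y => G (s + a) y - G s y).

Lemma gdiff_bound s t : gdiff s t -> exists2 M : R, 0 < M &
  exists2 d : R, 0 < d & forall x y, `|x - s| < d -> `|y - t| < d ->
    normc (G x y - G s t) <= M * (`|x - s| + `|y - t|).
Proof.
move=> [D /(_ 1 ltr01)[d d0 H]].
exists (1 + normc D * (1 + normc k)).
  by rewrite ltr_wpDr// mulr_ge0 ?addr_ge0 ?normc_ge0.
exists d => // x y xs yt; have {}H := H x y xs yt.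
rewrite -[G x y - G s t](subrK (D * ((x - s)%:C + k * (y - t)%:C))).
apply: le_trans (le_normcD _ _) _; rewrite mulrDl lerD// normcM -mulrA.
rewrite ler_wpM2l ?normc_ge0//; apply: le_trans (le_normcD _ _) _.
rewrite normcM !normcR.
have := mulr_ge0 (normc_ge0 k) (normr_ge0 (x - s)); have := normr_ge0 (y - t).
lra.
Qed.

Lemma gdiff_contl s t : gdiff s t -> ccont (fun x => G x t) s.
Proof.
move=> /gdiff_bound[M M0 [d d0 H]] e e0.
exists (Num.min d (e / M)) => [|x]; first by rewrite lt_min d0 divr_gt0.
rewrite lt_min => /andP[xd xe]; have := H x t xd; rewrite subrr normr0 addr0.
move=> /(_ d0) h; apply: le_lt_trans h _.
by rewrite mulrC -ltr_pdivlMr.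
Qed.

Lemma gdiff_contr s t : gdiff s t -> ccont (fun y => G s y) t.
Proof.
move=> /gdiff_bound[M M0 [d d0 H]] e e0.
exists (Num.min d (e / M)) => [|x]; first by rewrite lt_min d0 divr_gt0.
rewrite lt_min => /andP[xd xe]; have := H s x _ xd; rewrite subrr normr0 add0r.
move=> /(_ d0) h; apply: le_lt_trans h _.
by rewrite mulrC -ltr_pdivlMr.
Qed.

Definition gdiff_on s t a b := forall x y, s <= x <= s + a -> t <= y <= t + b ->
  gdiff x y.

Lemma gdiff_cinth s t a b y : gdiff_on s t a b -> t <= y <= t + b ->
  ccontI s (s + a) (fun x => G x y).
Proof. by move=> h yt x xs; apply: gdiff_contl; exact: h. Qed.

Lemma gdiff_cintv s t a b x : gdiff_on s t a b -> s <= x <= s + a ->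
  ccontI t (t + b) (fun y => G x y).
Proof. by move=> h xs y yt; apply: gdiff_contr; exact: h. Qed.

Lemma ccontIB (u v : R -> R[i]) a b : ccontI a b u -> ccontI a b v ->
  ccontI a b (fun t => u t - v t).
Proof. by move=> cu cv t tab; apply: ccontD; [exact: cu|apply: ccontN; exact: cv]. Qed.

Lemma cintiB (u v : R -> R[i]) a b : ccontI a b u -> ccontI a b v ->
  cinti a b (fun t => u t - v t) = cinti a b u - cinti a b v.
Proof. by move=> /ccontI_cintg cu /ccontI_cintg cv; exact: cintB. Qed.

(** The contributions of the inner sides cancel. *)
Lemma rbd_split s t a b : 0 <= a -> 0 <= b -> gdiff_on s t (a + a) (b + b) ->
  rbd s t (a + a) (b + b) = rbd s t a b + rbd (s + a) t a b +
    (rbd s (t + b) a b + rbd (s + a) (t + b) a b).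
Proof.
move=> a0 b0 h; rewrite /rbd !addrA.
have ya : t <= t + b <= t + b + b by rewrite !lerDl b0.
have y0 : t <= t <= t + b + b by rewrite lexx/= -addrA lerDl addr_ge0.
have y2 : t <= t + b + b <= t + b + b by rewrite lexx -addrA lerDl addr_ge0.
have xa : s <= s + a <= s + a + a by rewrite !lerDl a0.
have x0 : s <= s <= s + a + a by rewrite lexx/= -addrA lerDl addr_ge0.
have x2 : s <= s + a + a <= s + a + a by rewrite lexx -addrA lerDl addr_ge0.
rewrite /gdiff_on !addrA in h.
have ch y : t <= y <= t + b + b -> ccontI s (s + a + a) (fun x => G x y).
  by move=> yt x xs; apply: gdiff_contl; exact: h.
have cv x : s <= x <= s + a + a -> ccontI t (t + b + b) (fun y => G x y).
  by move=> xs y yt; apply: gdiff_contr; exact: h.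
have s1 : s + a <= s + a + a by rewrite lerDl.
have s0 : s <= s + a by rewrite lerDl.
have t1 : t + b <= t + b + b by rewrite lerDl.
have t0 : t <= t + b by rewrite lerDl.
have chl y : t <= y <= t + b + b -> ccontI s (s + a) (fun x => G x y).
  by move=> /ch; apply: ccontI_sub.
have chr y : t <= y <= t + b + b -> ccontI (s + a) (s + a + a) (fun x => G x y).
  by move=> /ch; apply: ccontI_sub.
have cvl x : s <= x <= s + a + a -> ccontI t (t + b) (fun y => G x y).
  by move=> /cv; apply: ccontI_sub.
have cvr x : s <= x <= s + a + a -> ccontI (t + b) (t + b + b) (fun y => G x y).
  by move=> /cv; apply: ccontI_sub.
rewrite (cintiB (ch _ y0) (ch _ y2)) (cintiB (cv _ x2) (cv _ x0)).
rewrite (cintiB (chl _ y0) (chl _ ya)) (cintiB (chr _ y0) (chr _ ya)).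
rewrite (cintiB (chl _ ya) (chl _ y2)) (cintiB (chr _ ya) (chr _ y2)).
rewrite (cintiB (cvl _ xa) (cvl _ x0)) (cintiB (cvl _ x2) (cvl _ xa)).
rewrite (cintiB (cvr _ xa) (cvr _ x0)) (cintiB (cvr _ x2) (cvr _ xa)).
rewrite (cinti_split s0 s1 (ch _ y0)) (cinti_split s0 s1 (ch _ y2)).
rewrite (cinti_split t0 t1 (cv _ x0)) (cinti_split t0 t1 (cv _ x2)).
ring.
Qed.

(** The boundary integral of an affine function vanishes, so that only the
    first-order remainder of [G] counts. *)
Lemma rbd_small s t a b x y D M : 0 <= a -> 0 <= b -> gdiff_on s t a b ->
  (forall x' y', s <= x' <= s + a -> t <= y' <= t + b ->
    normc (G x' y' - G x y - D * ((x' - x)%:C + k * (y' - y)%:C)) <= M) ->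
  normc (rbd s t a b) <= 2 * M * (a + normc k * b).
Proof.
move=> a0 b0 h HM.
have y0 : t <= t <= t + b by rewrite lexx lerDl.
have y1 : t <= t + b <= t + b by rewrite lexx lerDl b0.
have x0 : s <= s <= s + a by rewrite lexx lerDl.
have x1 : s <= s + a <= s + a by rewrite lexx lerDl a0.
have sa : s <= s + a by rewrite lerDl.
have tb : t <= t + b by rewrite lerDl.
have c1 := ccontIB (gdiff_cinth h y0) (gdiff_cinth h y1).
have c2 := ccontIB (gdiff_cintv h x1) (gdiff_cintv h x0).
pose u1 x' := G x' t - G x' (t + b) - (- (D * (k * b%:C))).
pose u2 y' := G (s + a) y' - G s y' - D * a%:C.
have cu1 : ccontI s (s + a) u1.
  by apply: ccontIB => // z _; exact: ccont_cst.
have cu2 : ccontI t (t + b) u2.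
  by apply: ccontIB => // z _; exact: ccont_cst.
have cc c a' b' : ccontI a' b' (fun=> c : R[i]) by move=> z _; exact: ccont_cst.
have -> : rbd s t a b = cinti s (s + a) u1 + k * cinti t (t + b) u2.
  rewrite (cintiB c1 (cc _ _ _)) (cintiB c2 (cc _ _ _)).
  have ca : s + a - s = a by ring.
  have cb : t + b - t = b by ring.
  by rewrite (cinti_cst _ sa) (cinti_cst _ tb) ca cb /rbd; ring.
have n1 x' : s <= x' <= s + a -> normc (u1 x') <= 2 * M.
  move=> xs; rewrite mulr_natl mulr2n; have A := HM _ _ xs y0; have B := HM _ _ xs y1.
  apply: le_trans (lerD A B); rewrite -[X in _ + X]normcN.
  apply: le_trans (le_normcD _ _); rewrite le_eqVlt; apply/orP; left.
  by apply/eqP; congr normc; rewrite /u1 !rmorphB !rmorphD/=; ring.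
have n2 y' : t <= y' <= t + b -> normc (u2 y') <= 2 * M.
  move=> yt; rewrite mulr_natl mulr2n; have A := HM _ _ x1 yt; have B := HM _ _ x0 yt.
  apply: le_trans (lerD A B); rewrite -[X in _ + X]normcN.
  apply: le_trans (le_normcD _ _); rewrite le_eqVlt; apply/orP; left.
  by apply/eqP; congr normc; rewrite /u2 !rmorphB !rmorphD/=; ring.
have A := ler_norm_cinti sa cu1 n1; have B := ler_norm_cinti tb cu2 n2.
apply: le_trans (le_normcD _ _) _; rewrite mulrDr lerD//.
  by rewrite (_ : s + a - s = a) in A; last ring.
rewrite (_ : t + b - t = b) in B; last ring.
by rewrite normcM mulrCA ler_wpM2l// normc_ge0.
Qed.

Section bisection.
Variables (s t a b : R).
Hypotheses (a0 : 0 <= a) (b0 : 0 <= b) (hG : gdiff_on s t a b).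

Let sz n (c : R) := c / 2 ^+ n.

Let szS n c : sz n.+1 c + sz n.+1 c = sz n c.
Proof. by rewrite /sz exprS; field; rewrite expf_neq0. Qed.

Let sz_ge0 n c : 0 <= c -> 0 <= sz n c.
Proof. by move=> c0; rewrite divr_ge0// exprn_ge0. Qed.

Let inside n (p : R * R) := [/\ s <= p.1, p.1 + sz n a <= s + a,
  t <= p.2 & p.2 + sz n b <= t + b].

Let inside_on n p : inside n p -> gdiff_on p.1 p.2 (sz n a) (sz n b).
Proof.
move=> [sp ps tp pt] x y /andP[px xp] /andP[py yp]; apply: hG.
  by rewrite (le_trans sp)// (le_trans xp).
by rewrite (le_trans tp)// (le_trans yp).
Qed.

Let step n (p : R * R) : inside n p -> exists q : R * R,
  [/\ inside n.+1 q, p.1 <= q.1, q.1 + sz n.+1 a <= p.1 + sz n a,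
      p.2 <= q.2 & q.2 + sz n.+1 b <= p.2 + sz n b] /\
  normc (rbd p.1 p.2 (sz n a) (sz n b)) / 4 <=
  normc (rbd q.1 q.2 (sz n.+1 a) (sz n.+1 b)).
Proof.
move=> ip; have quarter dx dy : 0 <= dx <= sz n.+1 a -> 0 <= dy <= sz n.+1 b ->
    [/\ inside n.+1 (p.1 + dx, p.2 + dy), p.1 <= p.1 + dx,
      p.1 + dx + sz n.+1 a <= p.1 + sz n a, p.2 <= p.2 + dy &
      p.2 + dy + sz n.+1 b <= p.2 + sz n b].
  move: ip => [sp ps tp pt] /andP[x0 x1] /andP[y0 y1]; rewrite /inside /=.
  have := szS n a; have := szS n b; move: (sz n.+1 a) (sz n.+1 b) x1 y1 => A B.
  move: (sz n a) (sz n b) ps pt => A' B' ps pt x1 y1 eb ea.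
  clear - sp ps tp pt x0 x1 y0 y1 ea eb.
  by rewrite -ea in ps *; rewrite -eb in pt *; split; [split|..]; lra.
have := @rbd_split p.1 p.2 (sz n.+1 a) (sz n.+1 b) (sz_ge0 _ a0) (sz_ge0 _ b0).
rewrite !szS => /(_ (inside_on ip)) E.
have na := sz_ge0 n.+1 a0; have nb := sz_ge0 n.+1 b0.
have q0a : 0 <= (0 : R) <= sz n.+1 a by apply/andP; split.
have q0b : 0 <= (0 : R) <= sz n.+1 b by apply/andP; split.
have qa : 0 <= sz n.+1 a <= sz n.+1 a by apply/andP; split.
have qb : 0 <= sz n.+1 b <= sz n.+1 b by apply/andP; split.
set r1 := rbd _ _ _ _ in E; set r2 := rbd _ _ _ _ in E.
set r3 := rbd _ _ _ _ in E; set r4 := rbd _ _ _ _ in E.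
set r5 := rbd _ _ _ _ in E.
have N : normc r1 <= normc r2 + normc r3 + (normc r4 + normc r5).
  rewrite E; apply: le_trans (le_normcD _ _) _.
  by apply: lerD; exact: le_normcD.
have [h|h1] := leP (normc r1 / 4) (normc r2).
  by exists (p.1 + 0, p.2 + 0); split; [exact: quarter|rewrite /= !addr0].
have [h|h2] := leP (normc r1 / 4) (normc r3).
  by exists (p.1 + sz n.+1 a, p.2 + 0); split; [exact: quarter|rewrite /= addr0].
have [h|h3] := leP (normc r1 / 4) (normc r4).
  by exists (p.1 + 0, p.2 + sz n.+1 b); split; [exact: quarter|rewrite /= addr0].
exists (p.1 + sz n.+1 a, p.2 + sz n.+1 b); split; first exact: quarter.
rewrite /= -/r1 -/r5; move: N h1 h2 h3; clear.
by move: (normc r1) (normc r2) (normc r3) (normc r4) (normc r5) => *; lra.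
Qed.

(** Goursat's theorem. Repeated bisection yields nested rectangles whose
    boundary integrals decay at most like [4 ^- n], whereas differentiability
    at their common point makes them smaller than any multiple of [4 ^- n]. *)
Lemma rbd_eq0 : rbd s t a b = 0.
Proof.
pose T n := {p : R * R | inside n p}.
have i0 : inside 0 (s, t) by rewrite /inside /sz expr0 !divr1; split=> /=.
pose f n (p : R * R) := if pselect (inside n p) is left ip
  then sval (cid (step ip)) else p.
pose q := fix q n := if n is n'.+1 then f n' (q n') else (s, t).
have iq n : inside n (q n).
  elim: n => [//|n IH] /=; rewrite /f; case: pselect => // ip.
  by case: cid => q' /= [[]].
have qs n : [/\ (q n).1 <= (q n.+1).1, (q n.+1).1 + sz n.+1 a <= (q n).1 + sz n a,
      (q n).2 <= (q n.+1).2 & (q n.+1).2 + sz n.+1 b <= (q n).2 + sz n b] /\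
  normc (rbd (q n).1 (q n).2 (sz n a) (sz n b)) / 4 <=
  normc (rbd (q n.+1).1 (q n.+1).2 (sz n.+1 a) (sz n.+1 b)).
  rewrite [q n.+1]/(f n (q n)) /f; case: pselect => [ip|]; last by move/(_ (iq n)).
  by case: cid => q' /= [[? ? ? ? ?] ?].
have mono1 n j : (q n).1 <= (q (n + j)%N).1 /\
    (q (n + j)%N).1 + sz (n + j) a <= (q n).1 + sz n a.
  elim: j => [|j [IH1 IH2]]; first by rewrite addn0.
  by rewrite addnS; have [[] *] := qs (n + j)%N; split; lra.
have mono2 n j : (q n).2 <= (q (n + j)%N).2 /\
    (q (n + j)%N).2 + sz (n + j) b <= (q n).2 + sz n b.
  elim: j => [|j [IH1 IH2]]; first by rewrite addn0.
  by rewrite addnS; have [[] *] := qs (n + j)%N; split; lra.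
have le1 n j : (q n).1 <= (q j).1 + sz j a.
  have [nj|/ltnW jn] := leqP n j.
    have [+ _] := mono1 n (j - n)%N; rewrite subnKC// => /le_trans; apply.
    by rewrite lerDl sz_ge0.
  have [_] := mono1 j (n - j)%N; rewrite subnKC//; apply: le_trans.
  by rewrite lerDl sz_ge0.
have le2 n j : (q n).2 <= (q j).2 + sz j b.
  have [nj|/ltnW jn] := leqP n j.
    have [+ _] := mono2 n (j - n)%N; rewrite subnKC// => /le_trans; apply.
    by rewrite lerDl sz_ge0.
  have [_] := mono2 j (n - j)%N; rewrite subnKC//; apply: le_trans.
  by rewrite lerDl sz_ge0.
pose x := sup (range (fun n => (q n).1)); pose y := sup (range (fun n => (q n).2)).
have sx : has_sup (range (fun n => (q n).1)).
  split; first by exists (q 0%N).1, 0%N.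
  by exists ((q 0%N).1 + sz 0 a) => _ [n _ <-].
have sy : has_sup (range (fun n => (q n).2)).
  split; first by exists (q 0%N).2, 0%N.
  by exists ((q 0%N).2 + sz 0 b) => _ [n _ <-].
have xq n : (q n).1 <= x <= (q n).1 + sz n a.
  rewrite (sup_upper_bound sx) ?andTb; last by exists n.
  by apply: sup_le_ub; [exact: sx.1|move=> _ [j _ <-]].
have yq n : (q n).2 <= y <= (q n).2 + sz n b.
  rewrite (sup_upper_bound sy) ?andTb; last by exists n.
  by apply: sup_le_ub; [exact: sy.1|move=> _ [j _ <-]].
have [D hD] : gdiff x y by have := inside_on (iq 0%N); apply; [exact: xq|exact: yq].
have B4 n : normc (rbd s t a b) / 4 ^+ n <=
    normc (rbd (q n).1 (q n).2 (sz n a) (sz n b)).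
  elim: n => [|n IH]; first by rewrite /sz expr0 !divr1.
  have [_] := qs n; apply: le_trans.
  by rewrite exprSr invfM mulrA ler_wpM2r.
apply/eqP; rewrite -normc_eq0 eq_le normc_ge0 andbT.
apply/ler_addgt0Pl => e e0; rewrite addr0.
pose C := 2 * (a + b) * (a + normc k * b) + 1.
have C0 : 0 < C.
  by rewrite ltr_wpDl// !mulr_ge0 ?addr_ge0// mulr_ge0// normc_ge0.
have [d d0 H] := hD (e / C) (divr_gt0 e0 C0).
have [n hn] : exists n, (a + b) / 2 ^+ n < d.
  have : ((a + b) * (2^-1) ^+ n)@[n --> \oo] --> (a + b) * 0.
    by apply: cvgMr; apply: cvg_expr; rewrite ger0_norm// invf_lt1// ltr1n.
  rewrite mulr0 => /cvgrPdist_lt/(_ _ d0)[n _ /(_ n (leqnn n))].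
  rewrite sub0r normrN exprVn => h; exists n; apply: le_lt_trans h; exact: ler_norm.
have da : sz n a < d by apply: le_lt_trans hn; rewrite ler_wpM2r// lerDl.
have db : sz n b < d by apply: le_lt_trans hn; rewrite ler_wpM2r// lerDr.
have := @rbd_small (q n).1 (q n).2 (sz n a) (sz n b) x y D
  (e / C * (sz n a + sz n b)) (sz_ge0 _ a0) (sz_ge0 _ b0) (inside_on (iq n)).
have /andP[xq1 xq2] := xq n; have /andP[yq1 yq2] := yq n.
have xn x' : (q n).1 <= x' <= (q n).1 + sz n a -> `|x' - x| <= sz n a.
  by move=> /andP[? ?]; rewrite ler_norml; apply/andP; split; lra.
have yn y' : (q n).2 <= y' <= (q n).2 + sz n b -> `|y' - y| <= sz n b.
  by move=> /andP[? ?]; rewrite ler_norml; apply/andP; split; lra.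
have HH x' y' : (q n).1 <= x' <= (q n).1 + sz n a ->
    (q n).2 <= y' <= (q n).2 + sz n b ->
    normc (G x' y' - G x y - D * ((x' - x)%:C + k * (y' - y)%:C)) <=
    e / C * (sz n a + sz n b).
  move=> hx hy; apply: le_trans (H _ _ (le_lt_trans (xn _ hx) da) (le_lt_trans (yn _ hy) db)) _.
  by rewrite ler_wpM2l ?divr_ge0 ?(ltW e0) ?(ltW C0)// lerD// ?xn ?yn.
move=> /(_ HH) h; have {}h := le_trans (B4 n) h.
have E : 2 * (e / C * (sz n a + sz n b)) * (sz n a + normc k * sz n b) =
    e / C * (2 * (a + b) * (a + normc k * b)) / 4 ^+ n.
  have -> : 4 ^+ n = 2 ^+ n * 2 ^+ n :> R by rewrite -exprMn; congr (_ ^+ _); ring.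
  by rewrite /sz; field; rewrite expf_neq0// gt_eqF.
move: h; rewrite E ler_pM2r ?invr_gt0 ?exprn_gt0// => /le_trans; apply.
rewrite mulrAC ler_pdivrMr//; apply: ler_wpM2l; first exact: ltW.
by rewrite /C lerDl.
Qed.

End bisection.

End goursat.

(** * The exponential and the parametrization of the circle *)

Section complex_exponential.
Variable R : realType.
Implicit Types (z w : R[i]) (x y t : R).

Lemma is_derive_small (f : R -> R) x D : is_derive x 1 f D ->
  forall e : R, 0 < e -> exists2 d : R, 0 < d & forall h, `|h| < d ->
    `|f (x + h) - f x - D * h| <= e * `|h|.
Proof.
move=> [/cvg_ex[l fl] dl] e e0.
have lD : l = D by rewrite -dl; apply/esym/cvg_lim.
move/cvgrPdist_lt : fl => /(_ _ e0)/nbhs_ballP[d /= d0 H].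
exists d => // h hd; have [->|h0] := eqVneq h 0.
  by rewrite addr0 subrr mulr0 subr0 normr0 mulr0.
have := H h; rewrite /ball/= sub0r normrN => /(_ hd h0).
rewrite scaler1 /GRing.scale/= lD [h + x]addrC => /ltW.
have -> : f (x + h) - f x - D * h = - (D - h^-1 * (f (x + h) - f x)) * h.
  by field.
by rewrite normrM normrN => ?; rewrite ler_wpM2r.
Qed.

Definition cexp z : R[i] :=
  (expR (complex.Re z))%:C * (cos (complex.Im z) +i* sin (complex.Im z)).

Lemma cexpD z w : cexp (z + w) = cexp z * cexp w.
Proof.
rewrite /cexp cReD cImD expRD cosD sinD rmorphM/= -!mulrA; congr (_ * _).
rewrite mulrCA; congr (_ * _).
apply: complexP; rewrite ?cReM ?cImM //=.
by rewrite addrC.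
Qed.

Lemma cexp0 : cexp 0 = 1.
Proof. by rewrite /cexp /= expR0 cos0 sin0 mul1r. Qed.

Lemma normc_cexp z : normc (cexp z) = expR (complex.Re z).
Proof.
rewrite /cexp normcM normcR ger0_norm ?expR_ge0//.
by rewrite /= cos2Dsin2 sqrtr1 mulr1.
Qed.

Lemma cexp_neq0 z : cexp z != 0.
Proof. by rewrite -normc_eq0 normc_cexp gt_eqF// expR_gt0. Qed.

(** Combine the first-order expansions of the real exponential, the cosine and
    the sine. *)
Lemma cexp_small e : 0 < e -> exists2 d : R, 0 < d &
  forall w, normc w < d -> normc (cexp w - 1 - w) <= e * normc w.
Proof.
move=> e0; have [c [c0 c1 ce]] : exists c : R, [/\ 0 < c, c <= 1 & c * 10 <= e].
  exists (Num.min 1 (e / 10)); split; first by rewrite lt_min ltr01 divr_gt0.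
    by rewrite ge_min lexx.
  by rewrite -ler_pdivlMr// ge_min lexx orbT.
have [d1 d10 H1] := is_derive_small (is_derive_expR (0 : R)) c0.
have [d2 d20 H2] := is_derive_small (is_derive_cos (0 : R)) c0.
have [d3 d30 H3] := is_derive_small (is_derive_sin (0 : R)) c0.
exists (Num.min (Num.min d1 d2) (Num.min d3 c)).
  by rewrite !lt_min d10 d20 d30 c0.
move=> w; rewrite !lt_min => /andP[/andP[w1 w2] /andP[w3 wc]].
have rw := ler_ReN w; have iw := ler_ImN w.
set x := complex.Re w in rw *; set y := complex.Im w in iw *.
have := H1 x (le_lt_trans rw w1); have := H2 y (le_lt_trans iw w2).
have := H3 y (le_lt_trans iw w3).
rewrite !add0r expR0 cos0 sin0 oppr0 mul0r ?addr0 !subr0 !mul1r.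
set N := normc w in rw iw wc *; move=> h3 h2 h1.
have N0 : 0 <= N by exact: normc_ge0.
apply: le_trans (ler_normc_ReIm _) _.
have -> : complex.Re (cexp w - 1 - w) =
    (expR x - 1 - x) * cos y + (1 + x) * (cos y - 1).
  by rewrite !cReD !cReN /cexp ReM_real /= -/x -/y; ring.
have -> : complex.Im (cexp w - 1 - w) = (expR x - 1) * sin y + (sin y - y).
  by rewrite !cImD !cImN /cexp ImM_real /= -/x -/y; ring.
have A1 : `|expR x - 1 - x| <= c * N.
  by apply: le_trans h1 _; rewrite ler_wpM2l// ltW.
have A2 : `|cos y - 1| <= c * N.
  by apply: le_trans h2 _; rewrite ler_wpM2l// ltW.
have A3 : `|sin y - y| <= c * N.
  by apply: le_trans h3 _; rewrite ler_wpM2l// ltW.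
have B1 : `|(expR x - 1 - x) * cos y| <= c * N.
  by rewrite normrM -[leRHS]mulr1 ler_pM// cos_max.
have B2 : `|(1 + x) * (cos y - 1)| <= 2 * (c * N).
  rewrite normrM ler_pM//; apply: le_trans (ler_normD _ _) _.
  rewrite normr1 -[2]/(1 + 1) lerD2l; apply: le_trans rw _.
  by apply: le_trans (ltW wc) _.
have cN : c * N <= N by rewrite -[leRHS]mul1r ler_wpM2r.
have B3 : `|expR x - 1| <= 2 * N.
  rewrite -[expR x - 1](subrK x) mulr_natl mulr2n.
  apply: le_trans (ler_normD _ _) _; rewrite lerD// (le_trans A1)//.
have B4 : `|sin y| <= 2 * c.
  rewrite -[sin y](subrK y) mulr_natl mulr2n.
  apply: le_trans (ler_normD _ _) _; rewrite lerD//; last exact: le_trans iw (ltW wc).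
  by apply: le_trans A3 _; rewrite -[leRHS]mulr1 ler_wpM2l// ?(ltW c0)// (le_trans (ltW wc)).
have B5 : `|(expR x - 1) * sin y| <= 4 * (c * N).
  rewrite normrM (le_trans (ler_pM _ _ B3 B4))//; lra.
apply: le_trans (lerD (ler_normD _ _) (ler_normD _ _)) _.
have : (c * 10) * N <= e * N by rewrite ler_wpM2r.
have : 0 <= c * N by rewrite mulr_ge0// ltW.
move: B1 B2 B5 A3; clear.
move: `|(expR x - 1 - x) * cos y| `|(1 + x) * (cos y - 1)|.
by move: `|(expR x - 1) * sin y| `|sin y - y| => *; lra.
Qed.

Lemma holo_cexp z : holo cexp z.
Proof.
exists (fun w => cexp z * (if w == z then 1 else (cexp (w - z) - 1) / (w - z))).
  move=> w; case: eqVneq => [->|wz]; first by rewrite subrr mulr0 addr0.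
  rewrite -mulrA divfK ?subr_eq0// mulrBr mulr1 -cexpD.
  by rewrite !subrKC.
apply: ccvgM; first exact: ccvg_cst.
rewrite eqxx => e e0; have e2 : 0 < e / 2 by rewrite divr_gt0.
have [d d0 H] := cexp_small e2.
exists d => // w wd; case: eqVneq => [_|wz]; first by rewrite subrr normc_0.
have nz : w - z != 0 by rewrite subr_eq0.
have -> : (cexp (w - z) - 1) / (w - z) - 1 =
  (cexp (w - z) - 1 - (w - z)) / (w - z) by field.
rewrite normcM normcV ltr_pdivrMr ?normc_gt0//.
apply: le_lt_trans (H _ wd) _.
by rewrite ltr_pM2r ?normc_gt0// ltr_pdivrMr// ltr_pMr// ltr1n.
Qed.

End complex_exponential.

Section circle_parametrization.
Variable R : realType.
Local Notation C := (circle R).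
Local Notation mu := (@lebesgue_measure R).
Local Notation m := (circle_measure R).
Implicit Types (z : C) (s t : R).

Definition twopi_i : R[i] := 0 +i* (2 * pi).

Lemma circle_expE t : (circle_exp t : R[i]) = cexp (twopi_i * t%:C).
Proof. by rewrite /cexp /= mul0r mulr0 subrr expR0 mul0r add0r mul1r. Qed.

Lemma circle_eqP (z w : C) : (z : R[i]) = w -> z = w.
Proof. exact: val_inj. Qed.

Lemma circle_expD s t : (circle_exp (s + t) : R[i]) = (circle_exp s : R[i]) * circle_exp t.
Proof. by rewrite !circle_expE rmorphD/= mulrDr cexpD. Qed.

Lemma circle_exp0 : (circle_exp 0 : R[i]) = 1.
Proof. by rewrite circle_expE mulr0 cexp0. Qed.

Lemma circle_exp1 : (circle_exp 1 : R[i]) = 1.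
Proof. by apply: complexP => /=; rewrite mulr1 mulr2n mulrDl mul1r ?cos2pi ?sin2pi. Qed.

Lemma circle_expD1 t : circle_exp (t + 1) = circle_exp t.
Proof. by apply: circle_eqP; rewrite circle_expD circle_exp1 mulr1. Qed.

Lemma circle_normc z : normc (z : R[i]) = 1.
Proof. by have := circle_norm z; rewrite norm_normc => -[]. Qed.

Definition circle_arg z : R :=
  if 0 <= complex.Im (z : R[i]) then acos (complex.Re (z : R[i])) / (2 * pi)
  else 1 - acos (complex.Re (z : R[i])) / (2 * pi).

Lemma circle_Re_itv z : -1 <= complex.Re (z : R[i]) <= 1.
Proof. by rewrite -ler_norml -(circle_normc z) ler_ReN. Qed.

(** The inverse cosine recovers the argument on the upper half circle; the
    lower one is its reflection. *)
Lemma circle_argK z : circle_exp (circle_arg z) = z.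
Proof.
apply: circle_eqP; have zr := circle_Re_itv z.
have p0 : 2 * pi != 0 :> R by rewrite mulf_neq0// gt_eqF// pi_gt0.
have zi : complex.Im (z : R[i]) ^+ 2 = 1 - complex.Re (z : R[i]) ^+ 2.
  by have := normc_sqr (z : R[i]); rewrite circle_normc expr1n => ->; rewrite addrC addKr.
rewrite /circle_arg; case: ifPn => [i0|].
  apply: complexP => /=; rewrite [2 * pi * _]mulrC divfK// ?acosK//.
  by rewrite sin_acos// -zi sqrtr_sqr ger0_norm.
rewrite -ltNge => i0; apply: complexP => /=;
  rewrite mulrBr mulr1 [2 * pi * (_ / _)]mulrC divfK// mulr_natl.
  by rewrite cosB cos2pi sin2pi mul1r mul0r addr0 acosK.
rewrite sinB cos2pi sin2pi mul1r mul0r add0r sin_acos// -zi sqrtr_sqr ltr0_norm//.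
by rewrite opprK.
Qed.

Lemma circle_arg_itv z : 0 <= circle_arg z <= 1.
Proof.
have zr := circle_Re_itv z; have a0 := acos_ge0 zr; have ap := acos_lepi zr.
have p0 : 0 < 2 * pi :> R by rewrite mulr_gt0// pi_gt0.
have h : 0 <= acos (complex.Re (z : R[i])) / (2 * pi) <= 1.
  rewrite divr_ge0 ?(ltW p0)//= ler_pdivrMr// mul1r (le_trans ap)//.
  by rewrite mulr_natl mulr2n lerDl pi_ge0.
rewrite /circle_arg; case: ifP => // _.
by move: h => /andP[h1 h2]; rewrite subr_ge0 h2 lerBlDr lerDl h1.
Qed.

Lemma measurable_circle_Re : measurable_fun [set: C] (fun z => complex.Re (z : R[i])).
Proof.
have /measurable_fun_complexP[] := @measurable_circle_val R; exact.
Qed.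

Lemma measurable_circle_Im : measurable_fun [set: C] (fun z => complex.Im (z : R[i])).
Proof.
have /measurable_fun_complexP[] := @measurable_circle_val R; exact.
Qed.

Lemma measurable_acos : measurable_fun (`[-1, 1]%classic : set R) (@acos R).
Proof.
have -> : `[-1, 1]%classic = [set (-1 : R)] `|` (`]-1, 1[%classic `|` [set (1 : R)]).
  apply/seteqP; split=> x /=; rewrite !in_itv/=.
    move=> /andP[]; rewrite le_eqVlt => /predU1P[<-|a]; first by left.
    by rewrite le_eqVlt => /predU1P[->|b]; right; [right|left; rewrite a b].
  by move=> [->|[/andP[a b]|->]]; rewrite ?lexx ?ltW// ?lerN10 ?(le_trans lerN10)//.
apply/measurable_funU => //; first exact: measurableU.
split; first exact: measurable_fun_set1.
apply/measurable_funU => //; split; last exact: measurable_fun_set1.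
apply: open_continuous_measurable_fun; first exact: interval_open.
by move=> x; rewrite inE/= in_itv/= => /continuous_acos.
Qed.

Lemma measurable_circle_arg :
  measurable_fun [set: C] circle_arg.
Proof.
have macos : measurable_fun [set: C] (fun z => acos (complex.Re (z : R[i])) / (2 * pi)).
  apply: measurable_funM => //.
  apply: (measurable_comp _ _ measurable_acos measurable_circle_Re) => //.
  by move=> _ [z _ <-] /=; rewrite in_itv/= circle_Re_itv.
apply: measurable_fun_ifT => //.
  by apply: measurable_fun_ler => //; exact: measurable_circle_Im.
exact: measurable_funB.
Qed.

(** The argument is a measurable section of the parametrization. *)
Lemma measurable_circle_lift d (T : measurableType d) (f : C -> T) :
  measurable_fun [set: measurableTypeR R] (f \o @circle_exp R) ->
  measurable_fun [set: C] f.
Proof.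
move=> mf; have -> : f = (f \o @circle_exp R) \o circle_arg.
  by apply/funext => z /=; rewrite circle_argK.
by apply: measurableT_comp => //; exact: measurable_circle_arg.
Qed.

Lemma ge0_circle_integral (f : C -> \bar R) : measurable_fun setT f ->
  (forall z, (0 <= f z)%E) ->
  (\int[m]_z f z = \int[mu]_(t in `[0%R, 1%R]) f (circle_exp t))%E.
Proof.
move=> mf f0.
have mI : measurable (`[0%R, 1%R]%classic : set (measurableTypeR R)) by [].
rewrite (@ge0_integral_pushforward _ _ _ _ _ _ (@measurable_circle_exp R)
  (mrestr mu mI) setT f)//.
rewrite preimage_setT.
have mfe : measurable_fun setT (f \o @circle_exp R).
  by apply: measurableT_comp => //; exact: measurable_circle_exp.
rewrite (@ge0_negligible_integral _ _ _ (mrestr mu mI) setT (~` `[0%R, 1%R]%classic))//.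
- rewrite setTD setCK; apply: eq_measure_integral => A mA AI.
  by rewrite /mrestr /=; congr (mu _); exact/setIidPl.
- exact: measurableC.
- by move=> x _; exact: f0.
- have <- : mu set0 = 0%E by exact: measure0.
  by rewrite /mrestr; congr (mu _); exact: setICl.
Qed.

Lemma circle_rintg (f : C -> R) : measurable_fun setT f ->
  rintg m setT f <-> rintg mu `[0, 1] (f \o @circle_exp R).
Proof.
move=> mf.
have mfe : measurable_fun setT (f \o @circle_exp R).
  by apply: measurableT_comp => //; exact: measurable_circle_exp.
have mn : measurable_fun setT (fun z => `|(f z)%:E|%E).
  by apply: measurableT_comp => //; exact/measurable_EFinP.
split=> /integrableP[_ h]; apply/integrableP; split.
- by apply/measurable_EFinP; exact: measurable_funS mfe.
- by rewrite ge0_circle_integral// in h.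
- exact/measurable_EFinP.
- by rewrite ge0_circle_integral.
Qed.

Lemma circle_Rintegral (f : C -> R) : measurable_fun setT f -> rintg m setT f ->
  \int[m]_z f z = \int[mu]_(t in `[0, 1]) f (circle_exp t).
Proof.
move=> mf fi; rewrite /Rintegral; congr fine.
rewrite integralE [in RHS]integralE; congr (_ - _)%E.
  rewrite ge0_circle_integral//; first by apply: eq_integral => t _; rewrite !funeposE.
  by apply: measurable_funepos; exact/measurable_EFinP.
rewrite ge0_circle_integral//; first by apply: eq_integral => t _; rewrite !funenegE.
by apply: measurable_funeneg; exact/measurable_EFinP.
Qed.

Lemma circle_cint (u : C -> R[i]) : measurable_fun setT u -> cintg m setT u ->
  cint m setT u = cinti 0 1 (u \o @circle_exp R).
Proof.
by move=> /measurable_fun_complexP[mr mi] [ri ii]; apply: complexP => /=;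
  apply: circle_Rintegral.
Qed.

(** Continuity on the circle, tested on the parameter so that results on
    intervals apply. *)
Definition circle_cont (u : C -> R[i]) := forall t, ccont (u \o @circle_exp R) t.

Lemma circle_cont_meas u : circle_cont u -> measurable_fun setT u.
Proof.
move=> cu; apply: measurable_circle_lift; apply/measurable_fun_complexP; split.
  by apply: continuous_measurable_fun => t; exact: (ccont_Re (cu t)).
by apply: continuous_measurable_fun => t; exact: (ccont_Im (cu t)).
Qed.

Lemma circle_cont_cintg u : circle_cont u -> cintg m setT u.
Proof.
move=> cu; have [mr mi] := (measurable_fun_complexP _).1 (circle_cont_meas cu).
have [ri ii] := @ccontI_cintg R 0 1 _ (fun t _ => cu t).
by split; apply/circle_rintg.
Qed.

End circle_parametrization.

(** * Circle means of holomorphic functions and rotation invariance *)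

Section annulus.
Variable R : realType.
Local Notation C := (circle R).
Local Notation m := (circle_measure R).
Local Notation k := (twopi_i R).

Lemma holo_gdiff (h : R[i] -> R[i]) (s t : R) : holo h (s%:C + k * t%:C) ->
  gdiff (fun x y => h (x%:C + k * y%:C)) k s t.
Proof.
move=> /holoP_eps[D HD]; exists D => e e0.
pose K := 1 + normc k.
have K0 : 0 < K by rewrite ltr_wpDr// normc_ge0.
have [d d0 H] := HD (e / K) (divr_gt0 e0 K0).
exists (d / (2 * K)) => [|x y xs yt]; first by rewrite divr_gt0// mulr_gt0.
have E : x%:C + k * y%:C - (s%:C + k * t%:C) = (x - s)%:C + k * (y - t)%:C.
  by rewrite !rmorphB/=; ring.
have nk : normc ((x - s)%:C + k * (y - t)%:C) <= K * (`|x - s| + `|y - t|).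
  apply: le_trans (le_normcD _ _) _; rewrite normcM !normcR /K.
  have := mulr_ge0 (normc_ge0 k) (normr_ge0 (x - s)).
  have := normr_ge0 (y - t); lra.
have := H (x%:C + k * y%:C); rewrite E => /(_ _)/le_trans; apply.
  apply: le_lt_trans nk _; rewrite mulrC -ltr_pdivlMr//.
  rewrite invfM mulrA in xs yt.
  by rewrite [d / K]splitr ltrD// mulrAC.
apply: le_trans (ler_wpM2l (divr_ge0 (ltW e0) (ltW K0)) nk) _.
by rewrite mulrA divfK// gt_eqF.
Qed.

Section mean.
Variables (g : R[i] -> R[i]) (r0 r1 : R).
Hypotheses (r0_ge0 : 0 <= r0)
  (hg : forall z, r0 < normc z < r1 -> holo g z).

Let polar x t : g (cexp (x%:C + k * t%:C)) = g ((expR x)%:C * circle_exp t).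
Proof.
by rewrite cexpD -circle_expE; congr (g (_ * _)); rewrite /cexp /= cos0 sin0 mulr1.
Qed.

Let gdiff_polar x t : r0 < expR x < r1 ->
  gdiff (fun x y => g (cexp (x%:C + k * y%:C))) k x t.
Proof.
move=> xr; apply: (@holo_gdiff (fun z => g (cexp z))).
apply: holo_comp; first exact: holo_cexp.
apply: hg; rewrite normc_cexp cReD cReM /=.
by rewrite !mul0r mulr0 subr0 addr0.
Qed.

Lemma annulus_circle_cont r : r0 < r < r1 ->
  circle_cont (fun z : C => g (r%:C * (z : R[i]))).
Proof.
move=> /andP[r0r rr1] t; have rp : 0 < r by exact: le_lt_trans r0r.
have := @gdiff_polar (ln r) t; rewrite lnK ?posrE// r0r => /(_ rr1)/gdiff_contr.
rewrite [X in ccont X](_ : _ = (fun y : R => g (r%:C * circle_exp y)))//.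
by apply/funext => y; rewrite polar lnK ?posrE.
Qed.

(** By Goursat's theorem in logarithmic polar coordinates, where the two
    vertical sides of the rectangle cancel by periodicity. *)
Lemma annulus_mean_le r s : r0 < r -> r <= s -> s < r1 ->
  cint m setT (fun z : C => g (r%:C * (z : R[i]))) =
  cint m setT (fun z : C => g (s%:C * (z : R[i]))).
Proof.
move=> r0r rs sr1.
have rp : 0 < r by exact: le_lt_trans r0r.
have sp : 0 < s by exact: lt_le_trans rs.
have cr : circle_cont (fun z : C => g (r%:C * (z : R[i]))).
  by apply: annulus_circle_cont; rewrite r0r (le_lt_trans rs).
have cs : circle_cont (fun z : C => g (s%:C * (z : R[i]))).
  by apply: annulus_circle_cont; rewrite sr1 (lt_le_trans r0r).
rewrite (circle_cint (circle_cont_meas cr) (circle_cont_cintg cr)).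
rewrite (circle_cint (circle_cont_meas cs) (circle_cont_cintg cs)).
have ab : 0 <= ln s - ln r by rewrite subr_ge0 ler_ln ?posrE.
have on : gdiff_on (fun x y => g (cexp (x%:C + k * y%:C))) k
    (ln r) 0 (ln s - ln r) 1.
  move=> x y /andP[x1 x2] _; apply: gdiff_polar.
  rewrite subrKC in x2; apply/andP; split.
    by apply: lt_le_trans r0r _; rewrite -[leLHS]lnK ?posrE// ler_expR.
  by apply: le_lt_trans sr1; rewrite -[leRHS]lnK ?posrE// ler_expR.
have := rbd_eq0 ab ler01 on; rewrite /rbd subrKC add0r.
have -> : cinti (ln r) (ln s) (fun x => g (cexp (x%:C + k * 0%:C)) -
    g (cexp (x%:C + k * 1%:C))) = 0.
  transitivity (cinti (ln r) (ln s) (fun=> 0 : R[i])).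
    by apply: eq_cint => x _; rewrite (polar x 0) (polar x 1) circle_exp1 circle_exp0 subrr.
  by rewrite cinti_cst ?mul0r// ler_ln ?posrE.
rewrite add0r => /eqP; rewrite mulf_eq0 => /orP[/eqP/(congr1 (@complex.Im R))/=|].
  by move/eqP; rewrite mulf_eq0 pnatr_eq0/= gt_eqF// pi_gt0.
rewrite cintiB ?subr_eq0//.
- move=> /eqP E; transitivity (cinti 0 1 (fun y => g (cexp ((ln r)%:C + k * y%:C)))).
    by apply: eq_cint => y _ /=; rewrite polar lnK ?posrE.
  by rewrite -E; apply: eq_cint => y _ /=; rewrite polar lnK ?posrE.
- move=> y _; apply: (@gdiff_contr _ (fun x y => g (cexp (x%:C + k * y%:C))) k (ln s)).
  apply: gdiff_polar.
  by rewrite lnK ?posrE// sr1 (lt_le_trans r0r).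
- move=> y _; apply: (@gdiff_contr _ (fun x y => g (cexp (x%:C + k * y%:C))) k (ln r)).
  apply: gdiff_polar.
  by rewrite lnK ?posrE// r0r (le_lt_trans rs).
Qed.

Lemma annulus_mean r s : r0 < r < r1 -> r0 < s < r1 ->
  cint m setT (fun z : C => g (r%:C * (z : R[i]))) =
  cint m setT (fun z : C => g (s%:C * (z : R[i]))).
Proof.
move=> /andP[r0r rr1] /andP[r0s sr1]; have [rs|/ltW sr] := leP r s.
  exact: annulus_mean_le.
by apply/esym; exact: annulus_mean_le.
Qed.

End mean.
End annulus.

Section rotation_invariance.
Variable R : realType.
Local Notation C := (circle R).
Local Notation mu := (@lebesgue_measure R).
Local Notation m := (circle_measure R).

Lemma measurable_shiftR (s : R) :
  measurable_fun [set: measurableTypeR R] (fun x : measurableTypeR R => x + s).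
Proof. by apply: continuous_measurable_fun => x; apply: cvgD => //; exact: cvg_cst. Qed.

Lemma lebesgue_shift (s : R) (A : set (measurableTypeR R)) : measurable A ->
  mu ((fun x => x + s) @^-1` A) = mu A.
Proof.
move=> mA; pose f : measurableTypeR R -> measurableTypeR R := fun x => x + s.
pose mf := isMeasurableFun.Build _ _ _ _ f (@measurable_shiftR s).
pose F : {mfun measurableTypeR R >-> measurableTypeR R} := HB.pack f mf.
apply/esym; apply: (@lebesgue_measure_unique R (pushforward mu F)) => //.
move=> X [[a b] /= _ <-]; rewrite /pushforward /=.
have -> : F @^-1` `]a, b] = `](a - s), (b - s)]%classic.
  apply/seteqP; split=> x /=; rewrite !in_itv/= /F /= /f ltrBlDr lerBrDr//.
rewrite !lebesgue_measure_itv /= !lte_fin ltrD2r; case: ifP => // _.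
by rewrite -!EFinB; congr EFin; ring.
Qed.

Lemma ge0_integral_shift (s : R) (D : set (measurableTypeR R)) (f : R -> \bar R) :
  measurable D -> measurable_fun [set: measurableTypeR R] f ->
  (forall t, (0 <= f t)%E) ->
  (\int[mu]_(t in (fun x => (x + s)%R) @^-1` D) f (t + s)%R = \int[mu]_(t in D) f t)%E.
Proof.
move=> mD mf f0.
have mfD : measurable_fun D (f : measurableTypeR R -> \bar R) by exact: measurable_funTS.
rewrite -(@ge0_integral_pushforward _ _ (measurableTypeR R) (measurableTypeR R) R _
  (@measurable_shiftR s) mu D f mD mfD (fun y _ => f0 y)).
apply: eq_measure_integral => [mT A mA|mT A mA _].
  exact: (@measurable_shiftR s mT A mA).
exact: lebesgue_shift.
Qed.

Lemma lebesgue_itv01 (A : set (measurableTypeR R)) : measurable A ->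
  mu (A `&` `[0, 1]) = mu (A `&` `]0, 1]).
Proof.
move=> mA.
have -> : `[0, 1]%classic = [set (0 : R)] `|` `]0, 1]%classic.
  apply/seteqP; split=> x /=; rewrite !in_itv/=.
    by rewrite le_eqVlt => /andP[/predU1P[<-|->]]; [left|right].
  by move=> [->|/andP[/ltW-> ->]]; rewrite ?lexx ?ler01.
have A0 : mu (A `&` [set 0]) = 0%E.
  apply/eqP; rewrite eq_le measure_ge0 andbT -(lebesgue_measure_set1 (0 : R)).
  by apply: le_measure; rewrite ?inE//; exact: measurableI.
rewrite setIUr; apply/eqP; rewrite eq_le; apply/andP; split.
  rewrite -[leRHS]add0e -A0; apply: measureU2; exact: measurableI.
apply: le_measure; rewrite ?inE.
- exact: measurableI.
- by apply: measurableU; exact: measurableI.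
- by move=> x ?; right.
Qed.

Lemma lebesgue_periodic (s : R) (A : set (measurableTypeR R)) : measurable A ->
  0 <= s <= 1 -> (forall t, A (t + 1) <-> A t) ->
  mu ((fun x => x + s) @^-1` A `&` `[0, 1]) = mu (A `&` `[0, 1]).
Proof.
move=> mA /andP[s0 s1] pA.
have mAs : measurable ((fun x : measurableTypeR R => x + s) @^-1` A).
  by rewrite -[X in measurable X]setTI; exact: measurable_shiftR.
rewrite !lebesgue_itv01//.
have -> : (fun x => x + s) @^-1` A `&` `]0, 1] =
    (fun x => x + s) @^-1` (A `&` `]s, (1 + s)]).
  apply/seteqP; split=> x /= [Ax]; rewrite !in_itv/= ltrDr lerD2r => ->//.
rewrite lebesgue_shift; last exact: measurableI.
have U1 : A `&` `]s, (1 + s)] = (A `&` `]s, 1]) `|` (A `&` `]1, (1 + s)]).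
  rewrite -setIUr; congr (_ `&` _); apply/seteqP; split=> x /=; rewrite !in_itv/=.
    by move=> /andP[sx xs]; have [x1|x1] := leP x 1; [left|right]; rewrite ?sx ?xs.
  move=> [/andP[-> x1]|/andP[x1 ->]]; first by rewrite (le_trans x1)// lerDl.
  by rewrite (le_lt_trans s1).
have U2 : A `&` `]0, 1] = (A `&` `]0, s]) `|` (A `&` `]s, 1]).
  rewrite -setIUr; congr (_ `&` _); apply/seteqP; split=> x /=; rewrite !in_itv/=.
    by move=> /andP[sx xs]; have [x1|x1] := leP x s; [left|right]; rewrite ?sx ?xs.
  move=> [/andP[-> x1]|/andP[x1 ->]]; first by rewrite (le_trans x1).
  by rewrite (le_lt_trans s0).
rewrite U1 U2 !measureU//.
- rewrite addeC; congr (_ + _)%E.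
  transitivity (mu ((fun x => x + 1) @^-1` (A `&` `]1, (1 + s)]))).
    by apply/esym; apply: lebesgue_shift; exact: measurableI.
  congr (mu _); apply/seteqP; split=> x /= []; rewrite !in_itv/= => Ax xi; split.
  + exact/pA.
  + by move: xi; rewrite ltrDr addrC lerD2l.
  + exact/pA.
  + by move: xi; rewrite ltrDr [1 + s]addrC lerD2r.
- exact: measurableI.
- exact: measurableI.
- apply/seteqP; split=> x //= [[_ +] [_]]; rewrite !in_itv/=.
  by move=> /andP[_ xs] /andP[sx _]; have := lt_le_trans sx xs; rewrite ltxx.
- exact: measurableI.
- exact: measurableI.
- apply/seteqP; split=> x //= [[_ +] [_]]; rewrite !in_itv/=.
  by move=> /andP[_ xs] /andP[sx _]; have := lt_le_trans sx xs; rewrite ltxx.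
Qed.

Lemma rotationE (a z : C) : (rotation a z : R[i]) = (a : R[i]) * z.
Proof. by []. Qed.

Lemma rotation_exp (a : C) t :
  rotation a (circle_exp t) = circle_exp (t + circle_arg a).
Proof.
apply: circle_eqP; rewrite rotationE circle_expD mulrC; congr (_ * _).
by rewrite circle_argK.
Qed.

(** A rotation is a translation of the parameter, and the preimages on the
    line are periodic sets. *)
Lemma rotation_measure (a : C) (A : set C) : measurable A ->
  m (rotation a @^-1` A) = m A.
Proof.
move=> mA; rewrite /circle_measure /pushforward /mrestr.
have mE : measurable (@circle_exp R @^-1` A : set (measurableTypeR R)).
  by rewrite -[X in measurable X]setTI; exact: measurable_circle_exp.
rewrite -(@lebesgue_periodic (circle_arg a) (@circle_exp R @^-1` A))//.
- congr (mu (_ `&` _)); apply/seteqP; split=> t /=; by rewrite rotation_exp.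
- exact: circle_arg_itv.
- by move=> t /=; rewrite circle_expD1.
Qed.

Lemma rotation_mT (a : C) : measurable_fun setT (rotation a).
Proof. exact: measurable_rotation. Qed.

Lemma ae_rotation (a : C) (P : C -> Prop) : {ae m, forall z, P z} ->
  {ae m, forall z, P (rotation a z)}.
Proof.
move=> [N [mN N0 PN]]; exists (rotation a @^-1` N); split.
- by rewrite -[X in measurable X]setTI; exact: rotation_mT.
- by rewrite rotation_measure.
- by move=> z Pz; exact: (PN (rotation a z)).
Qed.

Lemma ge0_integral_rotation (a : C) (f : C -> \bar R) : measurable_fun setT f ->
  (forall z, (0 <= f z)%E) ->
  (\int[m]_z f (rotation a z) = \int[m]_z f z)%E.
Proof.
move=> mf f0.
have := @ge0_integral_pushforward _ _ _ _ R _ (rotation_mT a) m setT f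
  measurableT mf (fun y _ => f0 y).
rewrite preimage_setT => <-; apply: eq_measure_integral => [mT A mA|mT A mA _].
  exact: (rotation_mT a mT mA).
exact: rotation_measure.
Qed.

Lemma rintg_rotation (a : C) (f : C -> R) :
  rintg m setT f -> rintg m setT (fun z => f (rotation a z)).
Proof.
move=> fi; have mf := rintg_meas fi.
move/integrableP : (fi) => [_ h]; apply/integrableP; split.
  by apply/measurable_EFinP; apply: measurableT_comp => //; exact: rotation_mT.
rewrite (ge0_integral_rotation a (f := fun z => `|(f z)%:E|%E))//.
by apply: measurableT_comp => //; exact/measurable_EFinP.
Qed.

Lemma Rintegral_rotation (a : C) (f : C -> R) : rintg m setT f ->
  \int[m]_z f (rotation a z) = \int[m]_z f z.
Proof.
move=> fi; have mf := rintg_meas fi.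
rewrite /Rintegral; congr fine.
rewrite integralE [in RHS]integralE; congr (_ - _)%E.
  rewrite -[RHS](ge0_integral_rotation a)//.
    by apply: eq_integral => z _; rewrite !funeposE.
  by apply: measurable_funepos; exact/measurable_EFinP.
rewrite -[RHS](ge0_integral_rotation a)//.
  by apply: eq_integral => z _; rewrite !funenegE.
by apply: measurable_funeneg; exact/measurable_EFinP.
Qed.

Lemma cintg_rotation (a : C) (u : C -> R[i]) :
  cintg m setT u -> cintg m setT (fun z => u (rotation a z)).
Proof.
by move=> [ru iu]; split; [exact: (rintg_rotation a ru)|exact: (rintg_rotation a iu)].
Qed.

Lemma cint_rotation (a : C) (u : C -> R[i]) : cintg m setT u ->
  cint m setT (fun z => u (rotation a z)) = cint m setT u.
Proof.
by move=> [ru iu]; apply: complexP => /=;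
  [exact: (Rintegral_rotation a ru)|exact: (Rintegral_rotation a iu)].
Qed.

Lemma ge0_circle_integral_shift (f : C -> \bar R) : measurable_fun setT f ->
  (forall z, (0 <= f z)%E) ->
  (\int[m]_z f z = \int[mu]_(t in `[(- 2^-1)%R, (2^-1)%R]) f (circle_exp t))%E.
Proof.
move=> mf f0.
rewrite -(ge0_integral_rotation (circle_exp (- 2^-1)) mf f0).
have mfr : measurable_fun setT (fun z => f (rotation (circle_exp (- 2^-1)) z)).
  by apply: measurableT_comp => //; exact: rotation_mT.
rewrite (ge0_circle_integral mfr) => [|z]; last exact: f0.
have mI : measurable (`[- 2^-1, 2^-1]%classic : set (measurableTypeR R)) by [].
have mfe : measurable_fun setT (f \o @circle_exp R).
  by apply: measurableT_comp => //; exact: measurable_circle_exp.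
transitivity (\int[mu]_(t in `[0%R, 1%R]) (f \o @circle_exp R) (t - 2^-1)%R)%E.
  apply: eq_integral => t _ /=; congr f; apply: circle_eqP.
  by rewrite rotationE circle_expD mulrC.
rewrite -(ge0_integral_shift (- 2^-1) mI (f := f \o @circle_exp R))//.
  congr (integral mu _ _).
  by apply/seteqP; split=> x /=; rewrite !in_itv/= => /andP[? ?]; apply/andP; split; lra.
  by move=> t; exact: f0.
Qed.

End rotation_invariance.

(** * The Cauchy and Poisson kernels *)

Section circle_functions.
Variable R : realType.
Local Notation C := (circle R).
Local Notation m := (circle_measure R).
Implicit Types (u v : C -> R[i]) (f : C -> R).

Lemma cmeas_Re u : measurable_fun setT u -> measurable_fun setT (fun z => complex.Re (u z)).
Proof. by move=> /measurable_fun_complexP[]. Qed.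

Lemma cmeas_Im u : measurable_fun setT u -> measurable_fun setT (fun z => complex.Im (u z)).
Proof. by move=> /measurable_fun_complexP[]. Qed.

Lemma cmeas_ReIm u : measurable_fun setT (fun z => complex.Re (u z)) ->
  measurable_fun setT (fun z => complex.Im (u z)) -> measurable_fun setT u.
Proof. by move=> ? ?; apply/measurable_fun_complexP. Qed.

Lemma cmeas_normc u : measurable_fun setT u -> measurable_fun setT (fun z => normc (u z)).
Proof. by move=> mu; apply: measurable_normc; [exact: cmeas_Re|exact: cmeas_Im]. Qed.

Lemma cmeas_real f : measurable_fun setT f -> measurable_fun setT (fun z => (f z)%:C).
Proof. by move=> mf; apply: cmeas_ReIm. Qed.

Lemma cmeasN u : measurable_fun setT u -> measurable_fun setT (fun z => - u z).
Proof.
move=> mu; apply: cmeas_ReIm.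
  by under eq_fun do rewrite cReN; apply: measurableT_comp => //; exact: cmeas_Re.
by under eq_fun do rewrite cImN; apply: measurableT_comp => //; exact: cmeas_Im.
Qed.

Lemma cmeasB u v : measurable_fun setT u -> measurable_fun setT v ->
  measurable_fun setT (fun z => u z - v z).
Proof. by move=> mu mv; apply: measurable_complexD => //; exact: cmeasN. Qed.

Lemma cmeas_conjc u : measurable_fun setT u -> measurable_fun setT (fun z => conjc (u z)).
Proof.
move=> mu; apply: cmeas_ReIm.
  rewrite (_ : (fun _ => _) = fun z => complex.Re (u z)); first exact: cmeas_Re.
  by apply/funext => z; case: (u z).
rewrite (_ : (fun _ => _) = fun z => - complex.Im (u z)).
  by apply: measurableT_comp => //; exact: cmeas_Im.
by apply/funext => z; case: (u z).
Qed.

Lemma cmeasX u n : measurable_fun setT u -> measurable_fun setT (fun z => u z ^+ n).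
Proof.
move=> mu; elim: n => [|n IH]; first by under eq_fun do rewrite expr0; exact: measurable_cst.
by under eq_fun do rewrite exprS; exact: measurable_complexM.
Qed.

Lemma cintg_meas u : cintg m setT u -> measurable_fun setT u.
Proof.
by move=> [ru iu]; apply: cmeas_ReIm; [exact: (rintg_meas ru)|exact: (rintg_meas iu)].
Qed.

Lemma cintg_le u f : measurable_fun setT u -> (forall z, normc (u z) <= f z) ->
  rintg m setT f -> cintg m setT u.
Proof.
move=> mu uf fi; split.
  apply: rintg_le fi => //; first exact: cmeas_Re.
  by move=> z _; apply: le_trans (uf z); exact: ler_ReN.
apply: rintg_le fi => //; first exact: cmeas_Im.
by move=> z _; apply: le_trans (uf z); exact: ler_ImN.
Qed.

Lemma rintg_cst (M : R) : rintg m setT (fun=> M).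
Proof.
apply/integrableP; split; first exact: measurable_cst.
by rewrite integral_cst//= [X in (_ * X)%E](@circle_measureT R) mule1 ltry.
Qed.

Lemma cintg_bounded u (M : R) : measurable_fun setT u ->
  (forall z, normc (u z) <= M) -> cintg m setT u.
Proof. by move=> mu uM; apply: (cintg_le mu uM); exact: rintg_cst. Qed.

Lemma cintg_bddM u v (M : R) : measurable_fun setT u ->
  (forall z, normc (u z) <= M) -> cintg m setT v ->
  cintg m setT (fun z => u z * v z).
Proof.
move=> mu uM vi; apply: (@cintg_le _ (fun z => M * normc (v z))).
- by apply: measurable_complexM => //; exact: cintg_meas.
- by move=> z; rewrite normcM ler_wpM2r// normc_ge0.
- by apply: rintgZ => //; exact: cintg_norm.
Qed.

Lemma rintg_bddM f g (M : R) : measurable_fun setT f ->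
  (forall z, `|f z| <= M) -> rintg m setT g ->
  rintg m setT (fun z => f z * g z).
Proof.
move=> mf fM gi; apply: (@rintg_le _ _ _ _ _ _ (fun z => M * `|g z|)) => //.
- by apply: measurable_funM => //; exact: (rintg_meas gi).
- by move=> z _; rewrite normrM ler_wpM2r.
- by apply: rintgZ => //; exact: rintg_norm.
Qed.

Lemma Rint_cst (M : R) : \int[m]_z M = M.
Proof. by rewrite Rintegral_cst//= [X in _ * fine X](@circle_measureT R) mulr1. Qed.

Lemma le_Rint f g : rintg m setT f -> rintg m setT g -> (forall z, f z <= g z) ->
  \int[m]_z f z <= \int[m]_z g z.
Proof. by move=> fi gi fg; exact: le_Rintegral. Qed.

Lemma cint_cst (c : R[i]) : cint m setT (fun=> c) = c.
Proof. by apply: complexP => /=; rewrite Rint_cst. Qed.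

Lemma circle_conj (z : C) : conjc (z : R[i]) = (z : R[i])^-1.
Proof.
have z0 : (z : R[i]) != 0 by rewrite -normc_eq0 circle_normc oner_eq0.
by apply: (mulfI z0); rewrite mulc_conjc circle_normc expr1n divff.
Qed.

Lemma circle_neq0 (z : C) : (z : R[i]) != 0.
Proof. by rewrite -normc_eq0 circle_normc oner_eq0. Qed.

Lemma normc_circleX (z : C) n : normc ((z : R[i]) ^+ n) = 1.
Proof. by rewrite normcX circle_normc expr1n. Qed.

Lemma cmeas_circleX n : measurable_fun setT (fun z : C => (z : R[i]) ^+ n).
Proof. by apply: cmeasX; exact: measurable_circle_val. Qed.

Lemma cintg_circleX n : cintg m setT (fun z : C => (z : R[i]) ^+ n).
Proof.
apply: (@cintg_bounded _ 1) => [|z]; first exact: cmeas_circleX.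
by rewrite normc_circleX.
Qed.

(** Circle means do not depend on the radius, while [z ^ n] scales like its
    power. *)
Lemma cint_circleX n : (0 < n)%N -> cint m setT (fun z : C => (z : R[i]) ^+ n) = 0.
Proof.
move=> n0; have h z : 0 < normc z < 2 -> holo (fun w : R[i] => w ^+ n) z.
  by move=> _; exact: holoX.
have ab : (0 : R) < (1 : R) < (2 : R) by apply/andP; split; lra.
have cd : (0 : R) < (2^-1 : R) < (2 : R).
  by apply/andP; split; lra.
have := annulus_mean (lexx 0) h ab cd.
under eq_cint do rewrite mul1r.
under [X in _ = X -> _]eq_cint do rewrite exprMn.
rewrite cintZ//; last exact: cintg_circleX.
set I := cint _ _ _ => E.
have : (1 - (2^-1 : R)%:C ^+ n) * I = 0 by rewrite mulrBl mul1r -E subrr.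
move/eqP; rewrite mulf_eq0 => /orP[|/eqP//].
rewrite subr_eq0 -rmorphXn => /eqP/(congr1 (@complex.Re R))/= /eqP.
by rewrite eq_sym lt_eqF// exprn_ilt1 ?invf_lt1 ?ltr1n// -lt0n.
Qed.

End circle_functions.

Section poisson.
Variable R : realType.
Local Notation C := (circle R).
Local Notation m := (circle_measure R).
Implicit Types (u v : C -> R[i]) (a : R[i]) (z : C).

Definition cker a z : R[i] := (1 - a * conjc (z : R[i]))^-1.
Definition pker a z : R :=
  (1 - normc a ^+ 2) / normc (1 - a * conjc (z : R[i])) ^+ 2.

Lemma ker_ge a z : 1 - normc a <= normc (1 - a * conjc (z : R[i])).
Proof.
apply: le_trans (ler_normcB _ _).
by rewrite normc_1 normcM normc_conjc circle_normc mulr1.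
Qed.

Lemma ker_gt0 a z : normc a < 1 -> 0 < normc (1 - a * conjc (z : R[i])).
Proof. by move=> a1; apply: lt_le_trans (ker_ge a z); rewrite subr_gt0. Qed.

Lemma ker_neq0 a z : normc a < 1 -> 1 - a * conjc (z : R[i]) != 0.
Proof. by move=> a1; rewrite -normc_gt0 ker_gt0. Qed.

Lemma cker_le a z : normc a < 1 -> normc (cker a z) <= (1 - normc a)^-1.
Proof.
move=> a1; rewrite /cker normcV lef_pV2 ?posrE ?ker_gt0 ?subr_gt0//.
exact: ker_ge.
Qed.

Lemma pker_ge0 a z : normc a < 1 -> 0 <= pker a z.
Proof.
move=> a1; rewrite divr_ge0 ?exprn_ge0 ?normc_ge0// subr_ge0.
by rewrite expr_le1 ?normc_ge0// ltW.
Qed.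

Lemma pkerE a z : normc a < 1 ->
  (pker a z)%:C = cker a z + (conjc (cker a z) - 1).
Proof.
move=> a1; have d0 := ker_neq0 z a1; set d := 1 - _ in d0 *.
have cd0 : conjc d != 0 by rewrite conjc_eq0.
have dE : d * conjc d = (normc d ^+ 2)%:C by exact: mulc_conjc.
have zz : conjc (z : R[i]) * z = 1 by rewrite circle_conj mulVf// circle_neq0.
have aa : a * conjc a = (normc a ^+ 2)%:C by exact: mulc_conjc.
have cdE : conjc d = 1 - conjc a * z.
  by rewrite /d conjcB conjcM conjcK conjc1.
rewrite /cker -/d conjc_inv /pker -/d rmorphM fmorphV/= rmorphB/= -dE -aa.
apply: (mulIf (mulf_neq0 d0 cd0)); rewrite divfK ?mulf_neq0//.
transitivity (conjc d + d - d * conjc d); last by field; rewrite d0 cd0.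
rewrite cdE /d.
transitivity (1 - a * conjc a * (conjc (z : R[i]) * z)); last by ring.
by rewrite zz mulr1.
Qed.

Lemma pker_le a z : normc a < 1 -> pker a z <= 2 / (1 - normc a).
Proof.
move=> a1; have na := normc_ge0 a; have k0 := ker_gt0 z a1; have kg := ker_ge a z.
have e0 : 0 < 1 - normc a by rewrite subr_gt0.
have -> : 2 / (1 - normc a) = 2 * (1 - normc a) / (1 - normc a) ^+ 2.
  by field; rewrite gt_eqF.
rewrite /pker ler_pM//.
- by rewrite subr_ge0 expr_le1// ltW.
- by rewrite invr_ge0 exprn_ge0// ltW.
- by rewrite -[normc a ^+ 2]/(normc a * normc a); nra.
- by rewrite lef_pV2 ?posrE ?exprn_gt0// lerXn2r ?nnegrE// ltW.
Qed.

Lemma cker_cont a : normc a < 1 -> circle_cont (cker a).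
Proof.
move=> a1; have h (z : R[i]) : normc a < normc z < 2 -> holo (fun w => (1 - a * w^-1)^-1) z.
  move=> /andP[az _].
  have z0 : z != 0 by rewrite -normc_gt0 (le_lt_trans _ az)// normc_ge0.
  apply: (@holo_comp _ (fun w => w^-1) (fun w => 1 - a * w^-1)).
    apply: holoB; first exact: holo_cst.
    apply: holoM; [exact: holo_cst|exact: holo_inv].
  apply: holo_inv; rewrite subr_eq0; apply: contraTneq az => /(congr1 (@normc R)).
  rewrite normc_1 normcM normcV => /esym/eqP; rewrite -leNgt.
  by rewrite -(inj_eq (mulIf (_ : normc z != 0))) ?normc_eq0// divfK ?normc_eq0// mul1r => /eqP ->.
have ab : normc a < (1 : R) < (2 : R) by rewrite a1 ltr1n.
have := annulus_circle_cont (normc_ge0 a) h ab.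
rewrite [X in circle_cont X](_ : _ = cker a)//.
by apply/funext => z; rewrite /cker mul1r circle_conj.
Qed.

Lemma cker_meas a : normc a < 1 -> measurable_fun setT (cker a).
Proof. by move=> /cker_cont/circle_cont_meas. Qed.

Lemma pker_meas a : normc a < 1 -> measurable_fun setT (pker a).
Proof.
move=> a1; rewrite (_ : pker a = fun z => (1 - normc a ^+ 2) * normc (cker a z) ^+ 2).
  by apply: measurable_funM => //; apply: measurable_funX; apply: cmeas_normc; exact: cker_meas.
by apply/funext => z; rewrite /pker /cker normcV exprVn.
Qed.

Definition cauchy u a : R[i] := cint m setT (fun z => cker a z * u z).
Definition poisson u a : R[i] := cint m setT (fun z => (pker a z)%:C * u z).

Lemma cauchy_intg u a : normc a < 1 -> cintg m setT u ->
  cintg m setT (fun z => cker a z * u z).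
Proof.
move=> a1 ui; apply: (cintg_bddM (cker_meas a1)) ui => z.
exact: cker_le.
Qed.

Lemma poisson_intg u a : normc a < 1 -> cintg m setT u ->
  cintg m setT (fun z => (pker a z)%:C * u z).
Proof.
move=> a1 ui; apply: (cintg_bddM (M := 2 / (1 - normc a)) (cmeas_real (pker_meas a1))) ui => z.
by rewrite normcR ger0_norm ?pker_ge0// pker_le.
Qed.

(** The moments of positive order are the Fourier coefficients of negative
    order; they vanish for the boundary values of analytic functions. *)
Definition cmoment u n : R[i] := cint m setT (fun z => (z : R[i]) ^+ n * u z).

Lemma cmoment_intg u n : cintg m setT u -> cintg m setT (fun z => (z : R[i]) ^+ n * u z).
Proof.
move=> ui; apply: (cintg_bddM (M := 1) (@cmeas_circleX R n)) ui => z.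
by rewrite normc_circleX.
Qed.

Lemma geom_small (r K e : R) : 0 <= r -> r < 1 -> 0 < e -> exists n : nat, K * r ^+ n < e.
Proof.
move=> r0 r1 e0.
have : (K * r ^+ n) @[n --> \oo] --> K * 0.
  by apply: cvgMr; apply: cvg_expr; rewrite ger0_norm.
rewrite mulr0 => /cvgrPdist_lt/(_ _ e0)[n _ /(_ n (leqnn n))].
by rewrite sub0r normrN => h; exists n; apply: le_lt_trans h; exact: ler_norm.
Qed.

(** Expand the anti-analytic part of the kernel in a geometric series. *)
Lemma antianalytic_eq0 u a : normc a < 1 -> cintg m setT u ->
  (forall n, (0 < n)%N -> cmoment u n = 0) ->
  cint m setT (fun z => (conjc (cker a z) - 1) * u z) = 0.
Proof.
move=> a1 ui u0; set I := cint _ _ _.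
pose q z : R[i] := conjc (cker a z) * u z.
have qi : cintg m setT q.
  apply: (cintg_bddM (cmeas_conjc (cker_meas a1))) ui => z.
  by rewrite normc_conjc; exact: cker_le.
have step n : I = conjc a ^+ n.+1 * cmoment q n.+1.
  have E z : (conjc (cker a z) - 1) * u z =
      \sum_(i < n) (conjc a ^+ i.+1 * ((z : R[i]) ^+ i.+1 * u z)) +
      conjc a ^+ n.+1 * ((z : R[i]) ^+ n.+1 * q z).
    pose b := conjc a * z.
    have b1 : 1 - b != 0.
      rewrite -conjc_eq0 rmorphB rmorphM rmorph1/= conjcK; exact: ker_neq0.
    have cE : conjc (cker a z) = (1 - b)^-1.
      by rewrite /cker conjc_inv rmorphB rmorphM rmorph1/= conjcK.
    have G : \sum_(i < n) b ^+ i.+1 * (1 - b) = b - b ^+ n.+1.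
      elim: n => [|j IH]; first by rewrite big_ord0 expr1 subrr.
      by rewrite big_ord_recr/= IH !exprS; ring.
    rewrite /q cE mulrA mulrA.
    under eq_bigr do rewrite mulrA -exprMn -/b.
    rewrite -mulr_suml -mulrDl; congr (_ * _); rewrite -exprMn -/b.
    apply: (mulIf b1); rewrite [RHS]mulrDl mulr_suml G divfK//.
    by rewrite mulrBl mulVf// mul1r; ring.
  rewrite /I; under eq_cint do rewrite E.
  have si : cintg m setT (fun z => \sum_(i < n) conjc a ^+ i.+1 * ((z : R[i]) ^+ i.+1 * u z))
    /\ cint m setT (fun z => \sum_(i < n) conjc a ^+ i.+1 * ((z : R[i]) ^+ i.+1 * u z)) = 0.
    elim: n {E} => [|j [IH1 IH2]].
      under eq_fun do rewrite big_ord0.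
      split; last exact: cint_cst.
      by apply: (@cintg_bounded _ _ 0) => // z; rewrite normc_0.
    under eq_fun do rewrite big_ord_recr.
    split; first by apply: cintgD => //; apply: cintgZ => //; exact: cmoment_intg.
    rewrite cintD//; last by apply: cintgZ => //; exact: cmoment_intg.
    by rewrite IH2 add0r cintZ//; [rewrite -/(cmoment _ _) u0// mulr0|exact: cmoment_intg].
  rewrite cintD//; first by rewrite si.2 add0r cintZ//; exact: cmoment_intg.
    exact: si.1.
  by apply: cintgZ => //; exact: cmoment_intg.
apply/eqP; rewrite -normc_eq0 eq_le normc_ge0 andbT leNgt; apply/negP => I0.
pose K := \int[m]_z normc (q z).
have [n hn] := geom_small (normc a * K) (normc_ge0 a) a1 I0.
move: hn; rewrite ltNge => /negP; apply.
rewrite {1}(step n) normcM normcX normc_conjc exprS -!mulrA.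
rewrite ler_wpM2l ?normc_ge0// mulrC ler_wpM2r ?exprn_ge0 ?normc_ge0//.
apply: le_trans (ler_norm_cint _ (cmoment_intg n.+1 qi)) _ => //.
apply: le_Rint => [||z]; [|exact: cintg_norm|].
  by apply: cintg_norm => //; exact: cmoment_intg.
by rewrite normcM normc_circleX mul1r.
Qed.

End poisson.

(** * Poisson integrals at Lebesgue points *)

Section poisson_kernel.
Variable R : realType.
Local Notation C := (circle R).
Local Notation m := (circle_measure R).
Implicit Types (u v : C -> R[i]) (a : R[i]) (z : C).

Lemma cint_conjcE u : cintg m setT u ->
  cint m setT (fun z => conjc (u z)) = conjc (cint m setT u).
Proof.
move=> [ru iu]; apply: complexP => /=.
  by apply: eq_Rintegral => z _; case: (u z).
rewrite -mulN1r -RintegralZl//; apply: eq_Rintegral => z _.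
by case: (u z) => ? ? /=; rewrite mulN1r.
Qed.

Lemma cintg_conjc u : cintg m setT u -> cintg m setT (fun z => conjc (u z)).
Proof.
move=> ui; apply: (@cintg_le _ _ (fun z => normc (u z))).
- by apply: cmeas_conjc; exact: cintg_meas.
- by move=> z; rewrite normc_conjc.
- exact: cintg_norm.
Qed.

Lemma cker_intg a : normc a < 1 -> cintg m setT (cker a).
Proof.
move=> a1; apply: (cintg_bounded (M := (1 - normc a)^-1)) => [|z].
  exact: cker_meas.
exact: cker_le.
Qed.

Lemma pker_intg a : normc a < 1 -> rintg m setT (pker a).
Proof.
move=> a1; apply: (@rintg_le _ _ _ _ _ _ (fun=> 2 / (1 - normc a))) => //.
- exact: pker_meas.
- by move=> z _; rewrite ger0_norm ?pker_ge0// pker_le.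
- exact: rintg_cst.
Qed.

Lemma cker_mean a : normc a < 1 -> cint m setT (cker a) = 1.
Proof.
move=> a1; have ci := cker_intg a1; have c1 : cintg m setT (fun _ : C => 1 : R[i]).
  by apply: (@cintg_bounded _ _ 1) => // z; rewrite normc_1.
have : cint m setT (fun z => (conjc (cker a z) - 1) * 1) = 0.
  apply: antianalytic_eq0 => // n n0; rewrite /cmoment.
  by under eq_cint do rewrite mulr1; exact: cint_circleX.
under eq_cint do rewrite mulr1.
rewrite cintB//; last exact: cintg_conjc.
rewrite cint_cst (cint_conjcE ci).
by move/eqP; rewrite subr_eq0 => /eqP E; rewrite -[LHS]conjcK E conjc1.
Qed.

Lemma pker_mean a : normc a < 1 -> \int[m]_z pker a z = 1.
Proof.
move=> a1; have ci := cker_intg a1; have c1 : cintg m setT (fun _ : C => 1 : R[i]).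
  by apply: (@cintg_bounded _ _ 1) => // z; rewrite normc_1.
have cci := cintg_conjc ci.
suff : cint m setT (fun z => (pker a z)%:C) = 1 by rewrite cint_real => -[].
under eq_cint do rewrite pkerE//.
rewrite cintD//; last exact: cintgB.
rewrite cker_mean// cintB// cint_cst.
rewrite (cint_conjcE ci).
by rewrite cker_mean// conjc1 subrr addr0.
Qed.

(** The kernels differ by the anti-analytic part, which does not see [u]. *)
Lemma poisson_cauchy u a : normc a < 1 -> cintg m setT u ->
  (forall n, (0 < n)%N -> cmoment u n = 0) -> poisson u a = cauchy u a.
Proof.
move=> a1 ui u0; rewrite /poisson /cauchy.
have ci := cauchy_intg a1 ui.
have ai : cintg m setT (fun z => (conjc (cker a z) - 1) * u z).
  apply: (cintg_bddM (M := (1 - normc a)^-1 + 1)) => //.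
    by apply: cmeasB => //; apply: cmeas_conjc; exact: cker_meas.
  move=> z; apply: le_trans (le_normcD _ _) _.
  by rewrite normcN normc_1 normc_conjc lerD// cker_le.
under eq_cint do rewrite pkerE// mulrDl.
by rewrite cintD// antianalytic_eq0// addr0.
Qed.

Lemma poisson_cst a (c : R[i]) : normc a < 1 -> poisson (fun=> c) a = c.
Proof.
move=> a1; rewrite /poisson; under eq_cint do rewrite mulrC.
rewrite cintZ//; last by apply: cintg_real => //; exact: pker_intg.
by rewrite cint_real pker_mean// mulr1.
Qed.

Lemma normc_rz (r : R) z : 0 <= r -> normc (r%:C * (z : R[i])) = r.
Proof. by move=> r0; rewrite normcM normcR circle_normc mulr1 ger0_norm. Qed.

(** The Poisson kernel depends on the relative position of the two points
    only. *)
Lemma pker_rot (r : R) z z' :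
  pker (r%:C * (z : R[i])) (rotation z z') = pker r%:C z'.
Proof.
rewrite /pker; congr (_ / _); first by rewrite !normcM circle_normc mulr1.
congr (normc _ ^+ 2); rewrite rotationE conjcM.
have zz : (z : R[i]) * conjc (z : R[i]) = 1 by rewrite circle_conj divff// circle_neq0.
by rewrite -mulrA [(z : R[i]) * (_ * _)]mulrA zz mul1r.
Qed.

Lemma poisson_rot u (r : R) z : 0 <= r < 1 -> cintg m setT u ->
  poisson u (r%:C * (z : R[i])) =
  cint m setT (fun z' => (pker r%:C z')%:C * u (rotation z z')).
Proof.
move=> /andP[r0 r1] ui.
have a1 : normc (r%:C * (z : R[i])) < 1 by rewrite normc_rz.
rewrite /poisson -(cint_rotation z (poisson_intg a1 ui)).
by apply: eq_cint => z' _; rewrite pker_rot.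
Qed.

Lemma normc_rC (r : R) : 0 <= r -> normc r%:C = r.
Proof. by move=> r0; rewrite normcR ger0_norm. Qed.

Lemma poisson_dist u (r : R) z (c : R[i]) : 0 <= r < 1 -> cintg m setT u ->
  normc (poisson u (r%:C * (z : R[i])) - c) <=
  \int[m]_z' (pker r%:C z' * normc (u (rotation z z') - c)).
Proof.
move=> r01 ui; have /andP[r0 r1] := r01.
have a1 : normc r%:C < 1 by rewrite normc_rC.
have uri := cintg_rotation z ui.
have c1 : cintg m setT (fun _ : C => c).
  by apply: (@cintg_bounded _ _ (normc c)).
have d1 := cintgB measurableT uri c1.
rewrite poisson_rot// -[X in _ - X](poisson_cst c a1) /poisson -cintB//; last 2 first.
  exact: poisson_intg.
  exact: poisson_intg.
under eq_cint do rewrite -mulrBr.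
apply: le_trans (ler_norm_cint _ (poisson_intg a1 d1)) _ => //.
rewrite le_eqVlt; apply/orP; left; apply/eqP; apply: eq_Rintegral => z' _.
by rewrite normcM normcR ger0_norm// pker_ge0.
Qed.

End poisson_kernel.

Section fatou_point.
Variable R : realType.
Local Notation C := (circle R).
Local Notation m := (circle_measure R).
Implicit Types (u : C -> R[i]) (v : C -> R) (z : C).

Definition arc (h : R) : set C := [set z | normc (1 - (z : R[i])) <= h].

Lemma measurable_arc h : measurable (arc h).
Proof.
have mf : measurable_fun setT (fun z : C => normc (1 - (z : R[i]))).
  by apply: cmeas_normc; apply: cmeasB => //; exact: measurable_circle_val.
rewrite -[X in measurable X]setTI.
have -> : arc h = (fun z : C => normc (1 - (z : R[i]))) @^-1` [set` `]-oo, h]].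
  by apply/seteqP; split=> z /=; rewrite in_itv.
exact: mf.
Qed.

Lemma rintg_arc h v : rintg m setT v -> rintg m setT (fun z => \1_(arc h) z * v z).
Proof.
apply: (rintg_bddM (M := 1)); first exact: measurable_indic (measurable_arc h).
by move=> z; rewrite indicE; case: (_ \in _); rewrite ?normr1 ?normr0.
Qed.

(** A Lebesgue point of [u], where [c] is the value of [u]. *)
Definition circle_leb u z (c : R[i]) := forall e : R, 0 < e ->
  exists2 h0 : R, 0 < h0 & forall h, 0 < h -> h <= h0 ->
    \int[m]_z' (\1_(arc h) z' * normc (u (rotation z z') - c)) <= e * h.

Lemma rintg_sum n (f : nat -> C -> R) : (forall i, rintg m setT (f i)) ->
  rintg m setT (fun z => \sum_(i < n) f i z) /\
  \int[m]_z (\sum_(i < n) f i z) = \sum_(i < n) \int[m]_z f i z.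
Proof.
move=> fi; elim: n => [|n [IH1 IH2]].
  under eq_fun do rewrite big_ord0; rewrite big_ord0; split; first exact: rintg_cst.
  exact: Rint_cst.
under eq_fun do rewrite big_ord_recr; rewrite big_ord_recr/=; split; first exact: rintgD.
rewrite [LHS](@RintegralD _ _ _ m setT (fun z => \sum_(i < n) f i z) (f n))//.
  exact: (congr1 (fun t => t + _) IH2).
exact: fi.
Qed.

Lemma dyadic_scale (eta h : R) : 0 < eta -> eta <= h ->
  exists J, 2 ^+ J * eta <= h < 2 ^+ J.+1 * eta.
Proof.
move=> e0 eh.
have ex : exists n, h < 2 ^+ n * eta.
  have [n hn] := geom_small h (r := 2^-1) (ltac:(lra)) (ltac:(lra)) e0.
  exists n; move: hn; rewrite exprVn ltr_pdivrMr ?exprn_gt0// mulrC//.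
case: (ex_minnP ex) => -[|J]; first by rewrite expr0 mul1r ltNge eh.
move=> hJ Jmin; exists J; rewrite hJ andbT leNgt; apply/negP => /Jmin.
by rewrite ltnn.
Qed.

(** On the dyadic annulus where [1 - z] has modulus about [2 ^ j * (1 - r)], the
    Poisson kernel is of order [4 ^ - j / (1 - r)]. *)
Lemma pker_dyadic (r h0 : R) J z : 0 <= r < 1 ->
  2 ^+ J * (1 - r) <= h0 < 2 ^+ J.+1 * (1 - r) ->
  pker r%:C z <= \sum_(j < J.+1) (32 / (1 - r) / 4 ^+ j *
     \1_(arc (2 ^+ j * (1 - r))) z) + 32 * (1 - r) / h0 ^+ 2.
Proof.
move=> /andP[r0 r1] /andP[J1 J2].
have eta0 : 0 < 1 - r by rewrite subr_gt0.
set eta := 1 - r in eta0 J1 J2 *.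
have a1 : normc r%:C < 1 by rewrite normc_rC.
have h0p : 0 < h0 by apply: lt_le_trans J1; rewrite mulr_gt0// exprn_gt0.
set d := normc (1 - (z : R[i])).
have D1 : eta <= normc (1 - r%:C * conjc (z : R[i])).
  by have := ker_ge r%:C z; rewrite normc_rC.
have D2 : d / 2 <= normc (1 - r%:C * conjc (z : R[i])).
  have dc : d = normc (1 - conjc (z : R[i])) by rewrite -[RHS]normc_conjc conjcB conjcK conjc1.
  have : d <= normc (1 - r%:C * conjc (z : R[i])) + eta.
    rewrite dc (_ : 1 - conjc _ = (1 - r%:C * conjc (z : R[i])) - eta%:C * conjc (z : R[i])).
      apply: le_trans (le_normcD _ _) _; rewrite normcN lerD2l normcM normc_conjc.
      by rewrite circle_normc mulr1 normcR ger0_norm// ltW.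
    by rewrite /eta rmorphB/=; ring.
  move: D1; set D := normc _; lra.
set D := normc _ in D1 D2.
have D0 : 0 < D by exact: lt_le_trans D1.
have P1 : pker r%:C z <= 2 * eta / D ^+ 2.
  rewrite /pker -/D normc_rC// ler_wpM2r// ?invr_ge0 ?exprn_ge0 ?(ltW D0)//.
  rewrite /eta; nra.
have bnd b : 0 < b -> b <= D -> pker r%:C z <= 2 * eta / b ^+ 2.
  move=> b0 bD; apply: le_trans P1 _; rewrite ler_wpM2l ?mulr_ge0 ?(ltW eta0)//.
  by rewrite lef_pV2 ?posrE ?exprn_gt0// lerXn2r// nnegrE ltW.
have tail0 : 0 <= 32 * eta / h0 ^+ 2.
  by rewrite divr_ge0 ?exprn_ge0 ?(ltW h0p)// mulr_ge0// ltW.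
have t0 j : 0 <= 32 / eta / 4 ^+ j * \1_(arc (2 ^+ j * eta)) z.
  apply: mulr_ge0 => //.
  by rewrite !divr_ge0// ?exprn_ge0// ltW.
have [dJ|Jd] := leP d (2 ^+ J * eta); last first.
  apply: le_trans (bnd (h0 / 4) _ _) _; first lra.
    apply: le_trans D2; rewrite exprS -mulrA in J2; move: Jd J2.
    by move: (2 ^+ J * eta) => *; lra.
  apply: (@le_trans _ _ (32 * eta / h0 ^+ 2)); last by rewrite lerDr sumr_ge0.
  by rewrite le_eqVlt; apply/orP; left; apply/eqP; field; rewrite gt_eqF.
have ex : exists j, d <= 2 ^+ j * eta by exists J.
case: (ex_minnP ex) => j dj jmin.
have jJ : (j < J.+1)%N by rewrite ltnS; exact: jmin.
apply: (@le_trans _ _ (32 / eta / 4 ^+ j)); last first.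
  rewrite (bigD1 (Ordinal jJ))//= {1}indicE mem_set// mulr1 -addrA lerDl.
  by rewrite addr_ge0// sumr_ge0.
case: j dj jmin {jJ} => [_ _|j dj jmin].
  apply: le_trans (bnd _ eta0 D1) _; rewrite expr0 divr1.
  have -> : 2 * eta / eta ^+ 2 = 2 / eta by field; rewrite gt_eqF.
  by rewrite ler_wpM2r ?invr_ge0 ?(ltW eta0)// ler_nat.
have jd : 2 ^+ j * eta < d.
  by rewrite ltNge; apply/negP => /jmin; rewrite ltnn.
apply: le_trans (bnd (2 ^+ j * eta / 2) _ _) _.
- by rewrite divr_gt0// mulr_gt0// exprn_gt0.
- by apply: le_trans D2; rewrite ler_wpM2r ?invr_ge0// ltW.
have -> : 4 ^+ j.+1 = 4 * (2 ^+ j * 2 ^+ j) :> R.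
  by rewrite exprS -exprMn; congr (_ * _ ^+ _); ring.
rewrite le_eqVlt; apply/orP; left; apply/eqP.
by field; rewrite ?expf_neq0 ?gt_eqF.
Qed.

Lemma geom_sum2 n : \sum_(j < n) (2^-1 : R) ^+ j <= 2.
Proof.
have E : \sum_(j < n) (2^-1 : R) ^+ j = 2 - 2 * 2^-1 ^+ n.
  elim: n => [|n IH]; first by rewrite big_ord0 expr0; ring.
  by rewrite big_ord_recr/= IH exprS; field.
by rewrite E gerBl mulr_ge0// exprn_ge0// invr_ge0.
Qed.

(** The kernel is dominated by a combination of arcs of dyadic length, on each
    of which the mean oscillation of [u] is small. *)
Lemma poisson_leb u z (c : R[i]) : cintg m setT u -> circle_leb u z c ->
  forall e : R, 0 < e -> exists2 r0 : R, r0 < 1 & forall r : R, 0 <= r -> r0 < r ->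
    r < 1 -> normc (poisson u (r%:C * (z : R[i])) - c) < e.
Proof.
move=> ui leb e e0.
have e1 : 0 < e / 128 by rewrite divr_gt0.
have [h0 h00 H] := leb _ e1.
pose v z' := normc (u (rotation z z') - c).
have vi : rintg m setT v.
  apply: cintg_norm => //; apply: cintgB => //; first exact: cintg_rotation.
  exact: (@cintg_bounded _ _ (normc c)).
have v0 z' : 0 <= v z' by exact: normc_ge0.
pose V := \int[m]_z' v z'.
have V0 : 0 <= V by apply: Rintegral_ge0.
pose K := 32 / h0 ^+ 2 * V + 1.
have K0 : 0 < K by rewrite ltr_wpDl// mulr_ge0// divr_ge0// exprn_ge0// ltW.
exists (1 - Num.min h0 (e / 4 / K)).
  by rewrite gtrBl lt_min h00/= !divr_gt0.
move=> r r_ge0 r0r r1.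
have r01 : 0 <= r < 1 by rewrite r_ge0.
have eta0 : 0 < 1 - r by rewrite subr_gt0.
have : 1 - r < Num.min h0 (e / 4 / K) by lra.
rewrite lt_min => /andP[eh eK].
have [J J12] := dyadic_scale eta0 (ltW eh).
have := poisson_dist z c r01 ui; move/le_lt_trans; apply.
have a1 : normc r%:C < 1 by rewrite normc_rC.
pose f j z' := 32 / (1 - r) / 4 ^+ j * (\1_(arc (2 ^+ j * (1 - r))) z' * v z').
have fi j : rintg m setT (f j) by apply: rintgZ => //; exact: rintg_arc.
have [si sE] := rintg_sum J.+1 fi.
apply: (@le_lt_trans _ _ (\int[m]_z' (\sum_(j < J.+1) f j z' + 32 * (1 - r) / h0 ^+ 2 * v z'))).
  apply: le_Rint.
  - apply: (rintg_bddM (M := 2 / (1 - normc r%:C))) => //; first exact: pker_meas.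
    by move=> z'; rewrite ger0_norm ?pker_ge0// pker_le.
  - by apply: rintgD => //; exact: rintgZ.
  - move=> z'; apply: le_trans (ler_wpM2r (v0 z') (pker_dyadic z' r01 J12)) _.
    rewrite mulrDl lerD2r mulr_suml le_eqVlt; apply/orP; left; apply/eqP.
    by apply: eq_bigr => j _; rewrite /f mulrA.
rewrite RintegralD//; last exact: rintgZ.
rewrite sE RintegralZl// -/V.
have A : \sum_(j < J.+1) \int[m]_z' f j z' <= e / 2.
  apply: (@le_trans _ _ (\sum_(j < J.+1) (e / 4 * 2^-1 ^+ j))); last first.
    rewrite -mulr_sumr; have := geom_sum2 J.+1.
    move=> h; apply: le_trans (ler_wpM2l _ h) _; first by rewrite divr_ge0// ltW.
    lra.
  apply: ler_sum => j _; rewrite RintegralZl//; last exact: rintg_arc.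
  have hj : 2 ^+ j * (1 - r) <= h0.
    case/andP: J12 => + _; apply: le_trans; rewrite ler_wpM2r ?(ltW eta0)//.
    by rewrite ler_eXn2l ?ltr1n// -ltnS.
  have hj0 : 0 < 2 ^+ j * (1 - r) by rewrite mulr_gt0// exprn_gt0.
  apply: le_trans (ler_wpM2l _ (H _ hj0 hj)) _.
    by rewrite !divr_ge0// ?exprn_ge0// ltW.
  rewrite le_eqVlt; apply/orP; left; apply/eqP.
  have -> : 4 ^+ j = 2 ^+ j * 2 ^+ j :> R by rewrite -exprMn; congr (_ ^+ _); ring.
  by rewrite exprVn; field; rewrite ?expf_neq0 ?gt_eqF.
have B : 32 * (1 - r) / h0 ^+ 2 * V <= (1 - r) * K.
  rewrite /K; apply: (@le_trans _ _ ((1 - r) * (32 / h0 ^+ 2 * V))).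
    by rewrite le_eqVlt; apply/orP; left; apply/eqP; field; rewrite gt_eqF.
  by rewrite ler_wpM2l ?(ltW eta0)// lerDl.
have : (1 - r) * K < e / 4 by rewrite -ltr_pdivlMr.
lra.
Qed.

End fatou_point.

(** * Fatou's theorem and uniqueness of Fourier coefficients *)

Section lebesgue_points.
Variable R : realType.
Local Notation C := (circle R).
Local Notation m := (circle_measure R).
Local Notation mu := (@lebesgue_measure R).
Implicit Types (u : C -> R[i]) (f : C -> R) (z : C).

Lemma sin_ge_quarter (x : R) : 0 <= x <= pi / 2 -> x / 4 <= sin x.
Proof.
move=> /andP[x0 xp]; have p4 : pi / 2 < 2 :> R by exact: pihalf_lt2.
have x2 : x <= 2 by rewrite (le_trans xp)// ltW.
have s0 : 0 <= sin x.
  by apply: sin_ge0_pi; rewrite x0/=; have := @pi_ge0 R; lra.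
have [c|c] := leP 2^-1 (cos x).
  have [->|xn0] := eqVneq x 0; first by rewrite sin0 mul0r.
  have xp0 : 0 < x by rewrite lt_def xn0.
  have [y] := @MVT R sin cos 0 x xp0 (fun t _ => is_derive_sin t)
    (continuous_subspaceT (@continuous_sin R)).
  rewrite in_itv/= sin0 !subr0 => /andP[y0 yx] ->.
  have : cos x < cos y.
    rewrite ltr_cos ?in_itv/=//.
    - by rewrite ltW//= (le_trans (ltW yx))// (le_trans xp)//; have := @pi_ge0 R; lra.
    - by rewrite ltW//= (le_trans xp)//; have := @pi_ge0 R; lra.
  nra.
have : (2^-1) ^+ 2 <= sin x ^+ 2.
  rewrite sin2cos2; have c0 : 0 <= cos x.
    by apply: cos_ge0_pihalf; rewrite xp andbT (le_trans _ x0)// oppr_le0; have := @pi_ge0 R; lra.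
  nra.
rewrite ler_sqr ?nnegrE ?invr_ge0// => h; lra.
Qed.

Lemma normc_1Bexp (t : R) : `|t| <= 2^-1 -> `|t| <= normc (1 - (circle_exp t : R[i])).
Proof.
move=> t2; have pp := @pi_gt0 R.
have E : normc (1 - (circle_exp t : R[i])) ^+ 2 = (2 * sin (pi * `|t|)) ^+ 2.
  rewrite normc_sqr cReD cReN cImD cImN /=.
  have -> : cos (2 * pi * t) = 1 - 2 * sin (pi * `|t|) ^+ 2.
    have -> : cos (2 * pi * t) = cos (pi * `|t| + pi * `|t|).
      have -> : pi * `|t| + pi * `|t| = 2 * pi * `|t| by ring.
      have [t0|t0] := leP 0 t; first by rewrite ger0_norm.
      by rewrite ltr0_norm// mulrN cosN.
    by rewrite cosD -!expr2 cos2sin2; ring.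
  have -> : (0 - sin (2 * pi * t)) ^+ 2 = 4 * sin (pi * `|t|) ^+ 2 * cos (pi * `|t|) ^+ 2.
    have -> : (0 - sin (2 * pi * t)) ^+ 2 = sin (pi * `|t| + pi * `|t|) ^+ 2.
      have -> : pi * `|t| + pi * `|t| = 2 * pi * `|t| by ring.
      rewrite sub0r sqrrN; have [t0|t0] := leP 0 t; first by rewrite ger0_norm.
      by rewrite ltr0_norm// mulrN sinN sqrrN.
    by rewrite sinD; ring.
  by rewrite cos2sin2; ring.
have xx : 0 <= pi * `|t| <= pi / 2.
  by apply/andP; split; [rewrite mulr_ge0// ltW|rewrite ler_wpM2l// ltW].
have sx := sin_ge_quarter xx.
have p2 := @pi_ge2 R.
have s0 : 0 <= sin (pi * `|t|).
  by apply: le_trans sx; rewrite divr_ge0// mulr_ge0// ltW.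
have -> : normc (1 - (circle_exp t : R[i])) = 2 * sin (pi * `|t|).
  by apply/eqP; rewrite -(@eqrXn2 _ 2)// ?normc_ge0 ?mulr_ge0// E.
have := normr_ge0 t; nra.
Qed.

Lemma rintgU (A B : set (measurableTypeR R)) (F : R -> R) :
  measurable A -> measurable B -> measurable_fun [set: measurableTypeR R] F ->
  [disjoint A & B] -> rintg mu A F -> rintg mu B F -> rintg mu (A `|` B) F.
Proof.
move=> mA mB mF AB /integrableP[_ iA] /integrableP[_ iB]; apply/integrableP; split.
  by apply/measurable_EFinP; exact: measurable_funTS.
rewrite ge0_integral_setU//; first exact: lte_add_pinfty.
by apply: measurableT_comp => //; apply/measurable_EFinP; exact: measurable_funTS.
Qed.

Definition lift f (t : R) : R := f (circle_exp t).

Lemma lift_meas f : measurable_fun setT f ->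
  measurable_fun [set: measurableTypeR R] (lift f).
Proof. by move=> mf; apply: measurableT_comp => //; exact: measurable_circle_exp. Qed.

Lemma lift_shift f (s : R) (D : set (measurableTypeR R)) : measurable D ->
  measurable_fun setT f -> (forall t, circle_exp (t + s) = circle_exp t :> C) ->
  rintg mu ((fun x => x + s) @^-1` D) (lift f) -> rintg mu D (lift f).
Proof.
move=> mD mf sE /integrableP[_ h]; have ml := lift_meas mf; apply/integrableP; split.
  by apply/measurable_EFinP; exact: measurable_funTS.
rewrite -(@ge0_integral_shift R s D (fun t => `|(lift f t)%:E|%E))//.
  apply: le_lt_trans h; rewrite le_eqVlt; apply/orP; left; apply/eqP.
  by apply: eq_integral => t _; rewrite /lift sE.
by apply: measurableT_comp => //; exact/measurable_EFinP.
Qed.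

Lemma lift_intg f : rintg m setT f -> rintg mu `[-1, 2] (lift f).
Proof.
move=> fi; have mf := rintg_meas fi; have ml := lift_meas mf.
have i01 : rintg mu `[0, 1] (lift f) by exact/circle_rintg.
have i12 : rintg mu `]1, 2] (lift f).
  apply: (@lift_shift _ 1) => // [t|]; first exact: circle_expD1.
  apply: integrableS i01 => //.
  by rewrite -[X in measurable X]setTI; exact: measurable_shiftR.
  by move=> t /=; rewrite !in_itv/= => /andP[? ?]; apply/andP; split; lra.
have im1 : rintg mu `[-1, 0[ (lift f).
  apply: (@lift_shift _ (-1)) => // [t|].
    by rewrite -[LHS](circle_expD1 (t - 1)) subrK.
  apply: integrableS i01 => //.
  by rewrite -[X in measurable X]setTI; exact: measurable_shiftR.
  by move=> t /=; rewrite !in_itv/= => /andP[? ?]; apply/andP; split; lra.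
have -> : `[-1, 2]%classic = `[-1, 0[ `|` (`[0, 1] `|` `]1, (2 : R)]).
  apply/seteqP; split=> t /=; rewrite !in_itv/=.
    move=> /andP[a b]; have [t0|t0] := ltP t 0; first by left; rewrite a.
    by right; have [t1|t1] := leP t 1; [left|right]; rewrite ?b.
  by move=> [/andP[? ?]|[/andP[? ?]|/andP[? ?]]]; apply/andP; split; lra.
apply: rintgU => //; first exact: measurableU.
  apply/disj_setPS => t [/=]; rewrite !in_itv/= => /andP[_ t0].
  by move=> [/andP[t1 _]|/andP[t1 _]]; lra.
apply: rintgU => //; apply/disj_setPS => t [/=]; rewrite !in_itv/=.
by move=> /andP[_ t0] /andP[t1 _]; lra.
Qed.

Definition lift_res f : R -> R := lift f \_ `[-1, 2].

(** An arc of radius [h] is covered by the parameters of modulus at most [h]. *)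
Lemma arc_davg f z (c : R) (h : R) : rintg m setT f -> 0 < h -> h <= 8^-1 ->
  f z = c ->
  (\int[m]_z' (\1_(arc h) z' * `|f (rotation z z') - c|)%:E <=
   (4 * h)%:E * davg (lift_res f) (circle_arg z) (2 * h))%E.
Proof.
move=> fi h0 h8 fc; have mf := rintg_meas fi.
have [a0 a1] := andP (circle_arg_itv z); set t0 := circle_arg z in a0 a1 *.
pose w z' : \bar R := (\1_(arc h) z' * `|f (rotation z z') - c|)%:E.
have mw : measurable_fun setT w.
  apply/measurable_EFinP; apply: measurable_funM.
    exact: measurable_indic (@measurable_arc R h).
  apply: measurableT_comp => //; apply: measurable_funB => //.
  by apply: measurableT_comp => //; exact: measurable_rotation.
have w0 z' : (0 <= w z')%E by rewrite lee_fin mulr_ge0.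
have rB : (0 <= 2 * h) by rewrite mulr_ge0// ltW.
have h2 : 0 < 2 * h by rewrite mulr_gt0.
rewrite /davg /iavg lebesgue_measure_ball//.
have -> : ((4 * h)%:E * (((2 * h) *+ 2)%:E^-1 *
    \int[mu]_(y in ball t0 (2 * h)) `|((center (lift_res f t0) \o lift_res f) y)%:E|) =
    \int[mu]_(y in ball t0 (2 * h)) `|((center (lift_res f t0) \o lift_res f) y)%:E|)%E.
  rewrite muleA inver mulrn_eq0/= gt_eqF// -EFinM.
  have -> : 4 * h = (2 * h) *+ 2 by rewrite mulr2n; ring.
  by rewrite divff ?mul1e// mulrn_eq0/= gt_eqF.
pose F (t : R) : \bar R := `|(lift_res f t - c)%:E|%E.
have mlr : measurable_fun [set: measurableTypeR R] (lift_res f).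
  apply/(measurable_restrictT _ _).1 => //; exact: measurable_funTS (lift_meas mf).
have mF : measurable_fun [set: measurableTypeR R] F.
  apply: measurableT_comp => //; apply/measurable_EFinP.
  exact: measurable_funB.
have lrt0 : lift_res f t0 = c.
  rewrite /lift_res patchE mem_set; last by rewrite /= in_itv/=; apply/andP; split; lra.
  by rewrite /lift circle_argK.
have -> : (\int[mu]_(y in ball t0 (2 * h)) `|((center (lift_res f t0) \o lift_res f) y)%:E| =
    \int[mu]_(y in ball t0 (2 * h)) F y)%E.
  by apply: eq_integral => t _; rewrite /F /= lrt0.
have mB : measurable (ball t0 (2 * h) : set (measurableTypeR R)) by exact: measurable_ball.
rewrite -(@ge0_integral_shift R t0 _ F mB mF)//; last by move=> t; exact: abse_ge0.
rewrite (ge0_circle_integral_shift mw w0).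
rewrite integral_mkcond [leRHS]integral_mkcond; apply: ge0_le_integral => //.
- by move=> t _; apply: erestrict_ge0 => y _; exact: w0.
- apply/(measurable_restrictT _ _).1 => //; apply: measurable_funTS.
  by apply: (measurableT_comp mw); exact: measurable_circle_exp.
- apply/(measurable_restrictT _ _).1.
    by rewrite -[X in measurable X]setTI; exact: measurable_shiftR.
  apply: measurable_funTS; apply: (measurableT_comp mF); exact: measurable_shiftR.
move=> t _; rewrite !patchE; case: ifPn => [|_]; last first.
  by case: ifP => // _; exact: abse_ge0.
rewrite inE/= in_itv/= -ler_norml => t2.
rewrite /w indicE; have [ta|ta] := boolP (circle_exp t \in arc h); last first.
  by rewrite mul0r; case: ifP => // _; exact: abse_ge0.
rewrite mul1r.
have th : `|t| <= h.
  by apply: le_trans (normc_1Bexp t2) _; move: ta; rewrite inE.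
have /andP[th1 th2] : - h <= t <= h by rewrite -ler_norml.
have tb : t \in (fun x : R => x + t0) @^-1` ball t0 (2 * h).
  rewrite inE/= /ball/= opprD addrCA subrr addr0 normrN.
  by apply: le_lt_trans th _; lra.
rewrite tb /F /lift_res patchE mem_set; last first.
  by rewrite /= in_itv/=; apply/andP; split; lra.
rewrite /lift abse_EFin lee_fin le_eqVlt; apply/orP; left; apply/eqP; congr `|f _ - _|.
apply: circle_eqP; rewrite rotationE circle_expD mulrC; congr (_ * _).
by rewrite circle_argK.
Qed.

Lemma real_leb f z : rintg m setT f -> lebesgue_pt (lift_res f) (circle_arg z) ->
  forall e : R, 0 < e -> exists2 h0 : R, 0 < h0 & forall h, 0 < h -> h <= h0 ->
    \int[m]_z' (\1_(arc h) z' * `|f (rotation z z') - f z|) <= e * h.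
Proof.
move=> fi lp e e0.
have e4 : (0 < (e / 4)%:E)%E by rewrite lte_fin divr_gt0.
have : \forall r \near (0 : R)^'+, (davg (lift_res f) (circle_arg z) r < (e / 4)%:E)%E.
  have N : nbhs (0%R : R)%:E [set y | (y < (e / 4)%:E)%E].
    by apply: (@nbhs_open_ereal_lt R 0 (fun=> e / 4)); rewrite divr_gt0.
  exact: (lp _ N).
move=> /nbhs_ballP[d /= d0 H].
exists (Num.min 8^-1 (d / 4)); first by rewrite lt_min invr_gt0 ltr0n/= divr_gt0.
move=> h h0; rewrite le_min => /andP[h8 hd].
have := arc_davg fi h0 h8 (erefl (f z)).
have dl : (davg (lift_res f) (circle_arg z) (2 * h) < (e / 4)%:E)%E.
  apply: H; last by rewrite mulr_gt0.
  rewrite /ball/= sub0r normrN gtr0_norm ?mulr_gt0//; lra.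
have : ((4 * h)%:E * davg (lift_res f) (circle_arg z) (2 * h) <= (e * h)%:E)%E.
  apply: (@le_trans _ _ ((4 * h)%:E * (e / 4)%:E)%E).
    by rewrite lee_wpmul2l ?lee_fin ?mulr_ge0 ?(ltW h0)// ltW.
  by rewrite -EFinM lee_fin le_eqVlt; apply/orP; left; apply/eqP; field.
move=> h1 h2; have {h1 h2} := le_trans h2 h1; rewrite /Rintegral => h3.
have I0 : (0 <= \int[m]_x (\1_(arc h) x * `|f (rotation z x) - f z|)%:E)%E.
  by apply: integral_ge0 => x _; rewrite lee_fin mulr_ge0.
rewrite -[leRHS]/(fine (e * h)%:E) fine_le// ge0_fin_numE//.
exact: le_lt_trans h3 (ltry _).
Qed.

Lemma circle_leb_ReIm u z : cintg m setT u ->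
  lebesgue_pt (lift_res (fun x => complex.Re (u x))) (circle_arg z) ->
  lebesgue_pt (lift_res (fun x => complex.Im (u x))) (circle_arg z) ->
  circle_leb u z (u z).
Proof.
move=> ui lr li e e0; have [ri ii] := ui.
have e2 : 0 < e / 2 by rewrite divr_gt0.
have [h1 h10 H1] := real_leb ri lr e2.
have [h2 h20 H2] := real_leb ii li e2.
exists (Num.min h1 h2); first by rewrite lt_min h10.
move=> h h0; rewrite le_min => /andP[hh1 hh2].
have ib g : rintg m setT g ->
    rintg m setT (fun z' => \1_(arc h) z' * `|g (rotation z z') - g z|).
  move=> gi; apply: rintg_arc; apply: rintg_norm => //; apply: rintgB => //.
    exact: (rintg_rotation z gi).
  exact: rintg_cst.
have := lerD (H1 _ h0 hh1) (H2 _ h0 hh2).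
have -> : e / 2 * h + e / 2 * h = e * h by field.
rewrite -RintegralD//; [|exact: (ib _ ri)|exact: (ib _ ii)]; apply: le_trans.
apply: le_Rint.
- apply: rintg_arc; apply: cintg_norm => //; apply: cintgB => //.
    exact: cintg_rotation.
  exact: (@cintg_bounded _ _ (normc (u z))).
- by apply: rintgD => //; [exact: (ib _ ri)|exact: (ib _ ii)].
- move=> z'; rewrite -mulrDr ler_wpM2l//.
  by apply: le_trans (ler_normc_ReIm _) _; rewrite cReD cReN cImD cImN.
Qed.

Lemma circle_leb_cont u z : circle_cont u -> circle_leb u z (u z).
Proof.
move=> cu; have [ri ii] := circle_cont_cintg cu.
have [a0 a1] := andP (circle_arg_itv z).
have o : open_nbhs (circle_arg z) (`](-1), 2[%classic : set R).
  split; first exact: interval_open.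
  by rewrite /= in_itv/=; apply/andP; split; lra.
have key (f : C -> R) : (forall t, {for t, continuous (fun s => f (circle_exp s))}) ->
    lebesgue_pt (lift_res f) (circle_arg z).
  move=> cf; have E : {in `](-1), 2[%classic, lift_res f =1 lift f}.
    move=> t; rewrite inE/= in_itv/= => /andP[t1 t2].
    rewrite /lift_res patchE mem_set//= in_itv/=; apply/andP; split; lra.
  apply: (continuous_lebesgue_pt o) => //.
    apply: (eq_measurable_fun (lift f)); first by move=> t /E ->.
    apply: measurable_funTS; apply: continuous_measurable_fun => t; exact: cf.
  have Ez : lift_res f (circle_arg z) = lift f (circle_arg z).
    by apply: E; rewrite inE; exact: o.2.
  suff : lift_res f t @[t --> circle_arg z] --> lift f (circle_arg z) by rewrite -Ez.
  apply: cvg_trans (cf (circle_arg z)); apply: near_eq_cvg.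
  near=> t; rewrite E// inE; near: t; exact: (open_nbhs_nbhs o).
by apply: circle_leb_ReIm => //; apply: key => t;
  [exact: (ccont_Re (cu t))|exact: (ccont_Im (cu t))].
Unshelve. all: end_near. Qed.

Lemma circle_expK (t : R) : 0 <= t < 1 -> circle_arg (circle_exp t) = t.
Proof.
move=> /andP[t0 t1]; have pp := @pi_gt0 R.
have p2 : 2 * pi != 0 :> R by rewrite mulf_neq0// gt_eqF.
rewrite /circle_arg /=; have [th|th] := leP t 2^-1.
  have b : 0 <= 2 * pi * t <= pi by rewrite !mulr_ge0 ?(ltW pp)//=; nra.
  by rewrite sin_ge0_pi// cosK ?in_itv//= mulrC mulKf.
have b : 0 < 2 * pi * t - pi < pi by apply/andP; split; nra.
have : sin (2 * pi * t) < 0.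
  by rewrite -[2 * pi * t](subrK pi) sinDpi oppr_lt0 sin_gt0_pi.
rewrite ltNge => /negPf ->.
have -> : cos (2 * pi * t) = cos (2 * pi * (1 - t)).
  have -> : 2 * pi * (1 - t) = - (2 * pi * t) + pi *+ 2 by rewrite mulr2n; ring.
  by rewrite cosD2pi cosN.
rewrite cosK; last by rewrite in_itv/=; apply/andP; split; nra.
by rewrite mulrC mulKf//; ring.
Qed.

Lemma ae_circle_arg (P : R -> Prop) : {ae mu, forall t, P t} ->
  {ae m, forall z : C, P (circle_arg z)}.
Proof.
move=> [N [mN N0 PN]]; exists (@circle_arg R @^-1` N); split.
- by rewrite -[X in measurable X]setTI; exact: measurable_circle_arg.
- rewrite /circle_measure /pushforward /mrestr; apply/eqP.
  rewrite eq_le measure_ge0 andbT.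
  have mA : measurable (@circle_arg R @^-1` N).
    by rewrite -[X in measurable X]setTI; exact: measurable_circle_arg.
  have mE : measurable (@circle_exp R @^-1` (@circle_arg R @^-1` N) : set (measurableTypeR R)).
    by rewrite -[X in measurable X]setTI; exact: measurable_circle_exp.
  apply: (@le_trans _ _ (mu (N `|` [set (1 : R)]))).
    apply: le_measure; rewrite ?inE.
    + exact: measurableI.
    + exact: measurableU.
    + move=> t [/= Nt]; rewrite in_itv/= => /andP[t0].
      rewrite le_eqVlt => /predU1P[->|t1]; [by right|left].
      by move: Nt; rewrite circle_expK// t0.
  apply: (@le_trans _ _ (mu N + mu [set (1%R : R)])%E); first exact: measureU2.
  by rewrite N0 lebesgue_measure_set1 adde0.
- by move=> z Pz; exact: PN.
Qed.

Lemma ae_circle_leb u : cintg m setT u -> {ae m, forall z, circle_leb u z (u z)}.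
Proof.
move=> ui; have [ri ii] := ui.
have key f : rintg m setT f -> {ae m, forall z, lebesgue_pt (lift_res f) (circle_arg z)}.
  move=> fi; apply: (ae_circle_arg (P := lebesgue_pt (lift_res f))).
  apply: lebesgue_differentiation; apply: integrable_locally_restrict => //.
  exact: lift_intg.
apply: filterS2 (key _ ri) (key _ ii) => z lr li.
exact: circle_leb_ReIm.
Qed.

Definition radial (F : R[i] -> R[i]) z (c : R[i]) := forall e : R, 0 < e ->
  exists2 r0 : R, r0 < 1 & forall r : R, 0 <= r -> r0 < r -> r < 1 ->
    normc (F (r%:C * (z : R[i])) - c) < e.

(** Fatou's theorem: almost every point is a Lebesgue point. *)
Lemma poisson_radial u : cintg m setT u ->
  {ae m, forall z, radial (poisson u) z (u z)}.
Proof.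
move=> ui; have := ae_circle_leb ui; apply: filterS => z lz.
exact: poisson_leb.
Qed.

Lemma poisson_radial_cont u z : circle_cont u -> radial (poisson u) z (u z).
Proof.
move=> cu; apply: poisson_leb; first exact: circle_cont_cintg.
exact: circle_leb_cont.
Qed.

Lemma fourier_poisson0 u a : normc a < 1 -> cintg m setT u ->
  (forall n, (0 < n)%N -> cmoment u n = 0) ->
  (forall n, cmoment (fun z => conjc (u z)) n = 0) -> poisson u a = 0.
Proof.
move=> a1 ui u0 cu0; rewrite poisson_cauchy// /cauchy.
have cui := cintg_conjc ui.
have mk := cmeas_conjc (cker_meas a1).
have ki : cintg m setT (fun z => conjc (cker a z) * conjc (u z)).
  apply: (cintg_bddM mk (M := (1 - normc a)^-1)) => // z.
  by rewrite normc_conjc; exact: cker_le.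
have K : cint m setT (fun z => conjc (cker a z) * conjc (u z)) = 0.
  have := antianalytic_eq0 a1 cui (fun n _ => cu0 n).
  have -> : cint m setT (fun z => (conjc (cker a z) - 1) * conjc (u z)) =
      cint m setT (fun z => conjc (cker a z) * conjc (u z) - conjc (u z)).
    by apply: eq_cint => z _; rewrite mulrBl mul1r.
  rewrite cintB// => /eqP; rewrite subr_eq0 => /eqP ->.
  have := cu0 0%N; rewrite /cmoment.
  by under eq_cint do rewrite expr0 mul1r.
have : cint m setT (fun z => conjc (cker a z * u z)) = 0.
  by rewrite -[RHS]K; apply: eq_cint => z _; rewrite conjcM.
rewrite cint_conjcE; last exact: cauchy_intg.
by move/eqP; rewrite conjc_eq0 => /eqP.
Qed.

Lemma radial_unique F z c c' : radial F z c -> radial F z c' -> c = c'.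
Proof.
move=> h h'; apply/eqP; rewrite -subr_eq0 -normc_eq0 eq_le normc_ge0 andbT.
apply/ler_addgt0Pl => e e0; rewrite addr0.
have e2 : 0 < e / 2 by rewrite divr_gt0.
have [r0 r01 H] := h _ e2; have [r0' r01' H'] := h' _ e2.
pose r := (Num.max 0 (Num.max r0 r0') + 1) / 2.
have M1 : Num.max 0 (Num.max r0 r0') < 1 by rewrite !gt_max ltr01 r01.
have M0 : 0 <= Num.max 0 (Num.max r0 r0') by rewrite le_max lexx.
have M2 : r0 <= Num.max 0 (Num.max r0 r0') by rewrite !le_max lexx orbT.
have M3 : r0' <= Num.max 0 (Num.max r0 r0') by rewrite !le_max lexx !orbT.
have [A1 A2 A3 A4] : [/\ 0 <= r, r0 < r, r0' < r & r < 1].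
  by rewrite /r; move: M0 M1 M2 M3; move: (Num.max _ _) => *; split; lra.
have {H} H := H _ A1 A2 A4; have {H'} H' := H' _ A1 A3 A4.
rewrite [e]splitr -(subrKA (F (r%:C * (z : R[i])))).
apply: le_trans (le_normcD _ _) _; rewrite normcB; apply: lerD; exact: ltW.
Qed.

(** The Poisson integral of [u] vanishes, and it tends radially to [u]. *)
Lemma fourier_unique u : cintg m setT u ->
  (forall n, (0 < n)%N -> cmoment u n = 0) ->
  (forall n, cmoment (fun z => conjc (u z)) n = 0) -> {ae m, forall z, u z = 0}.
Proof.
move=> ui u0 cu0; have := poisson_radial ui; apply: filterS => z rz.
apply: radial_unique rz _ => e e0; exists 0 => // r r0 _ r1.
by rewrite fourier_poisson0// ?subrr ?normc_0// normc_rz.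
Qed.

Lemma fourier_unique_cont u z : circle_cont u ->
  (forall n, (0 < n)%N -> cmoment u n = 0) ->
  (forall n, cmoment (fun z => conjc (u z)) n = 0) -> u z = 0.
Proof.
move=> cu u0 cu0; have ui := circle_cont_cintg cu.
apply: radial_unique (poisson_radial_cont z cu) _ => e e0; exists 0 => // r r0 _ r1.
by rewrite fourier_poisson0// ?subrr ?normc_0// normc_rz.
Qed.

End lebesgue_points.

(** * Holomorphic functions on the disc *)

Section disc_functions.
Variable R : realType.
Local Notation C := (circle R).
Local Notation m := (circle_measure R).
Implicit Types (f g : R[i] -> R[i]) (u : C -> R[i]) (r s : R) (z : C).

Definition hdisc f := forall z : R[i], normc z < 1 -> holo f z.

Definition dil f r : C -> R[i] := fun z => f (r%:C * (z : R[i])).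

Lemma hdisc_annulus f : hdisc f -> forall z : R[i], 0 < normc z < 1 -> holo f z.
Proof. by move=> hf z /andP[_ /hf]. Qed.

Lemma dil_cont f r : hdisc f -> 0 < r < 1 -> circle_cont (dil f r).
Proof. by move=> hf r01; exact: (annulus_circle_cont (lexx 0) (hdisc_annulus hf) r01). Qed.

Lemma dil_intg f r : hdisc f -> 0 < r < 1 -> cintg m setT (dil f r).
Proof. by move=> hf r01; apply: circle_cont_cintg; exact: dil_cont. Qed.

Lemma dil_meas f r : hdisc f -> 0 < r < 1 -> measurable_fun setT (dil f r).
Proof. by move=> hf r01; apply: circle_cont_meas; exact: dil_cont. Qed.

Lemma hdisc_near0 f e : hdisc f -> 0 < e -> exists2 d : R, 0 < d &
  forall z : R[i], normc z < d -> normc (f z - f 0) < e.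
Proof.
move=> hf e0; have h0 : holo f 0 by apply: hf; rewrite normc_0.
by have [d d0 H] := holo_continuous h0 e0; exists d => // z zd; apply: H; rewrite subr0.
Qed.

Lemma le_norm_cint u (M : R) : cintg m setT u -> (forall z, normc (u z) <= M) ->
  normc (cint m setT u) <= M.
Proof.
move=> ui uM; apply: le_trans (ler_norm_cint _ ui) _ => //.
rewrite -(Rint_cst M); apply: le_Rint => //; [exact: cintg_norm|exact: rintg_cst].
Qed.

(** The mean over circles is constant, and tends to the value at the centre. *)
Lemma hdisc_mean f r : hdisc f -> 0 < r < 1 -> cint m setT (dil f r) = f 0.
Proof.
move=> hf r01; apply/eqP; rewrite -subr_eq0 -normc_eq0 eq_le normc_ge0 andbT.
apply/ler_addgt0Pl => e e0; rewrite addr0.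
have [d d0 H] := hdisc_near0 hf e0.
pose s := Num.min (d / 2) (2^-1).
have s0 : 0 < s by rewrite lt_min divr_gt0//= invr_gt0.
have sd : s < d by rewrite gt_min; apply/orP; left; lra.
have s1 : s < 1 by rewrite gt_min; apply/orP; right; lra.
have s01 : 0 < s < 1 by rewrite s0.
rewrite (annulus_mean (lexx 0) (hdisc_annulus hf) r01 s01) -/(dil f s).
rewrite -(cint_cst (f 0)) -cintB//; last 2 first.
- exact: dil_intg.
- exact: (@cintg_bounded _ _ (normc (f 0))).
apply: le_norm_cint.
  apply: cintgB => //; first exact: dil_intg.
  exact: (@cintg_bounded _ _ (normc (f 0))).
by move=> z; apply: ltW; apply: H; rewrite normc_rz// ltW.
Qed.

(** The moment is a power of [r] times the circle mean of [z ^ n * f z], whose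
    value at the centre is 0. *)
Lemma hdisc_moment f r n : hdisc f -> 0 < r < 1 -> (0 < n)%N ->
  cmoment (dil f r) n = 0.
Proof.
move=> hf r01 n0; have /andP[r0 r1] := r01.
have hg : hdisc (fun z : R[i] => z ^+ n * f z).
  by move=> z z1; apply: holoM; [exact: holoX|exact: hf].
have := hdisc_mean hg r01; rewrite expr0n gtn_eqF//= mul0r.
have -> : cint m setT (dil (fun z : R[i] => z ^+ n * f z) r) = r%:C ^+ n * cmoment (dil f r) n.
  rewrite /cmoment -cintZ//; last by apply: cmoment_intg; exact: dil_intg.
  by apply: eq_cint => z _; rewrite /dil exprMn mulrA.
move=> /eqP; rewrite mulf_eq0 => /orP[|/eqP//].
by rewrite expf_eq0 n0/= -normc_eq0 normc_rC ?(ltW r0)// gt_eqF.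
Qed.

(** Up to conjugation and the factor [r ^ n], the Taylor coefficient of order
    [n]. *)
Definition ccoef f r n : R[i] := cmoment (fun z => conjc (dil f r z)) n.

Lemma ccoefE f r n : hdisc f -> 0 < r < 1 ->
  ccoef f r n = conjc (cint m setT (fun z : C => (z : R[i])^-1 ^+ n * dil f r z)).
Proof.
move=> hf r01; rewrite /ccoef /cmoment -cint_conjcE; last first.
  apply: (cintg_bddM (M := 1)) (dil_intg hf r01).
    apply: (eq_measurable_fun (fun z : C => conjc (z : R[i]) ^+ n)).
      by move=> z _; rewrite circle_conj.
    by apply: cmeasX; apply: cmeas_conjc; exact: measurable_circle_val.
  by move=> z; rewrite normcX normcV circle_normc invr1 expr1n.
by apply: eq_cint => z _; rewrite conjcM rmorphXn/= -circle_conj conjcK.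
Qed.

(** Both sides are, up to conjugation, circle means of [f z / z ^ n], which is
    holomorphic outside the centre. *)
Lemma ccoef_scale f r s n : hdisc f -> 0 < r < 1 -> 0 < s < 1 ->
  s%:C ^+ n * ccoef f r n = r%:C ^+ n * ccoef f s n.
Proof.
move=> hf r01 s01.
pose g := fun z : R[i] => z^-1 ^+ n * f z.
have hg (z : R[i]) : 0 < normc z < 1 -> holo g z.
  move=> /andP[z0 z1]; apply: holoM; last exact: hf.
  apply: (holo_comp (f := fun w => w ^+ n)); last exact: holoX.
  by apply: holo_inv; rewrite -normc_gt0.
have key t : 0 < t < 1 -> t%:C ^+ n * cint m setT (fun z : C => g (t%:C * (z : R[i]))) =
    conjc (ccoef f t n).
  move=> t01; have /andP[t0 _] := t01.
  have tn : t%:C != 0 by rewrite -normc_gt0 normc_rC// ltW.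
  rewrite ccoefE// conjcK -cintZ//.
    have tt : t%:C ^+ n * t%:C^-1 ^+ n = 1 by rewrite -exprMn divff// expr1n.
    apply: eq_cint => z _; rewrite /g /dil invfM exprMn.
    by rewrite -[RHS]mul1r -tt; ring.
  exact: (circle_cont_cintg (annulus_circle_cont (lexx 0) hg t01)).
have := annulus_mean (lexx 0) hg r01 s01 => E.
have K1 := key _ r01; have K2 := key _ s01; rewrite E in K1.
have cX (t : R) : conjc (t%:C ^+ n) = t%:C ^+ n.
  by rewrite rmorphXn/=; congr (_ ^+ _); exact: conjc_real.
by apply: (can_inj (@conjcK _)); rewrite !conjcM -K1 -K2 !cX; ring.
Qed.

Lemma polar_form (w : R[i]) : exists z : C, w = (normc w)%:C * z.
Proof.
have [->|w0] := eqVneq w 0.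
  by exists (circle_exp 0); rewrite normc_0 mul0r.
have nw : normc w != 0 by rewrite normc_eq0.
have wc : `|w / (normc w)%:C| == 1.
  by rewrite norm_normc normcM normcV normc_rC ?normc_ge0// divff.
exists (Circle wc); rewrite /= mulrC divfK//.
by rewrite -normc_eq0 normc_rC ?normc_ge0.
Qed.

(** The Taylor coefficients scale like powers of the radius and are dominated
    by the circle means, so they all vanish. *)
Lemma hdisc_zero f : hdisc f ->
  (forall e r0, 0 < e -> r0 < 1 -> exists r, [/\ 0 < r, r0 < r, r < 1 &
    \int[m]_z normc (dil f r z) < e]) ->
  forall w : R[i], normc w < 1 -> f w = 0.
Proof.
move=> hf f0.
have c0 r n : 0 < r < 1 -> ccoef f r n = 0.
  move=> r01; apply/eqP; rewrite -normc_eq0 eq_le normc_ge0 andbT.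
  apply/ler_addgt0Pl => e e0; rewrite addr0.
  have e2 : 0 < e / 2 ^+ n by rewrite divr_gt0// exprn_gt0.
  have [s [s0 s2 s1 sI]] := f0 _ 2^-1 e2 (ltac:(lra)).
  have s01 : 0 < s < 1 by rewrite s0.
  have /andP[r_0 r1] := r01.
  have := ccoef_scale n hf r01 s01 => /(congr1 (@normc R)).
  rewrite !normcM !normcX !normc_rC ?(ltW s0) ?(ltW r_0)// => E.
  have B : normc (ccoef f s n) < e / 2 ^+ n.
    apply: le_lt_trans sI; have di := dil_intg hf s01.
    apply: le_trans (ler_norm_cint _ (cmoment_intg n (cintg_conjc di))) _ => //.
    apply: le_Rint; [|exact: cintg_norm|].
      by apply: cintg_norm => //; apply: cmoment_intg; exact: cintg_conjc.
    by move=> z; rewrite normcM normc_circleX mul1r normc_conjc.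
  have h2 : (2^-1) ^+ n <= s ^+ n by rewrite lerXn2r ?nnegrE ?invr_ge0 ?(ltW s0)// ltW.
  have h3 : s ^+ n * normc (ccoef f r n) <= e / 2 ^+ n.
    rewrite E; apply: le_trans (ltW B); rewrite -[leRHS]mul1r ler_wpM2r ?normc_ge0//.
    by rewrite exprn_ile1// ltW.
  have h4 : (2^-1) ^+ n * normc (ccoef f r n) <= e / 2 ^+ n.
    by apply: le_trans h3; rewrite ler_wpM2r ?normc_ge0.
  by move: h4; rewrite exprVn mulrC ler_pM2r// invr_gt0 exprn_gt0.
have circ r z : 0 < r < 1 -> f (r%:C * (z : R[i])) = 0.
  move=> r01; apply: (@fourier_unique_cont _ (dil f r) z (dil_cont hf r01)).
    by move=> n n0; exact: hdisc_moment.
  by move=> n; exact: c0.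
move=> w w1; have [->|w0] := eqVneq w 0.
  have h01 : 0 < (2^-1 : R) < (1 : R) by apply/andP; split; lra.
  rewrite -(hdisc_mean hf h01) -[RHS](cint_cst 0).
  by apply: eq_cint => z _; exact: circ.
have [z ->] := polar_form w.
by apply: circ; rewrite normc_gt0 w0.
Qed.

Lemma holo_quadratic f (w D : R[i]) (K d : R) : 0 < d -> 0 <= K ->
  (forall v, normc (v - w) < d ->
    normc (f v - f w - D * (v - w)) <= K * normc (v - w) ^+ 2) -> holo f w.
Proof.
move=> d0 K0 H.
exists (fun v => if v == w then D else (f v - f w) / (v - w)) => [v|].
  by case: eqVneq => [->|vw]; [rewrite subrr mulr0 addr0|rewrite divfK ?subr_eq0// subrKC].
rewrite eqxx => e e0; exists (Num.min d (e / (K + 1))).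
  by rewrite lt_min d0 divr_gt0// ltr_wpDl.
move=> v; rewrite lt_min => /andP[vd ve]; case: eqVneq => [_|vw].
  by rewrite subrr normc_0.
have v0 : v - w != 0 by rewrite subr_eq0.
have -> : (f v - f w) / (v - w) - D = (f v - f w - D * (v - w)) / (v - w) by field.
rewrite normcM normcV ltr_pdivrMr ?normc_gt0//; apply: le_lt_trans (H _ vd) _.
rewrite expr2 mulrA ltr_pM2r ?normc_gt0//.
move: ve; rewrite ltr_pdivlMr ?ltr_wpDl//; have := normc_ge0 (v - w); nra.
Qed.

(** The kernel is differentiable in the parameter with a remainder of second
    order, uniformly on the circle. *)
Lemma cauchy_holo u : cintg m setT u -> hdisc (cauchy u).
Proof.
move=> ui a a1; pose d := (1 - normc a) / 2.
have d0 : 0 < d by rewrite divr_gt0// subr_gt0.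
pose I := \int[m]_z normc (u z).
pose q b : C -> R[i] := fun z => conjc (z : R[i]) ^+ 2 * cker b z * cker a z ^+ 2.
pose p : C -> R[i] := fun z => conjc (z : R[i]) * cker a z ^+ 2.
have mc : measurable_fun setT (fun z : C => conjc (z : R[i])).
  by apply: cmeas_conjc; exact: measurable_circle_val.
have nc z : normc (conjc (z : R[i])) = 1 by rewrite normc_conjc circle_normc.
pose A := (1 - normc a)^-1.
have pi : cintg m setT (fun z => p z * u z).
  apply: (cintg_bddM (M := A ^+ 2)) ui.
    by apply: measurable_complexM => //; apply: cmeasX; exact: cker_meas.
  by move=> z; rewrite normcM nc mul1r normcX lerXn2r ?nnegrE ?normc_ge0 ?invr_ge0 ?subr_ge0 ?(ltW a1)// cker_le.
apply: (@holo_quadratic _ _ (cint m setT (fun z => p z * u z)) (d^-1 * A ^+ 2 * I) d) => //.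
  rewrite !mulr_ge0 ?invr_ge0 ?exprn_ge0 ?invr_ge0 ?(ltW d0) ?subr_ge0 ?(ltW a1)//.
  by apply: Rintegral_ge0 => z _; exact: normc_ge0.
move=> b ba.
have b1 : normc b < 1.
  rewrite -[b](subrK a); apply: le_lt_trans (le_normcD _ _) _.
  move: ba; rewrite /d; lra.
have qM z : normc (q b z) <= d^-1 * A ^+ 2.
  rewrite /q normcM normcM normcX normcX nc expr1n mul1r ler_pM ?exprn_ge0 ?normc_ge0//.
    apply: le_trans (cker_le z b1) _; rewrite lef_pV2 ?posrE ?subr_gt0//.
    have : normc b <= normc (b - a) + normc a by rewrite -{1}[b](subrK a) le_normcD.
    move: ba; rewrite /d; lra.
  by rewrite lerXn2r ?nnegrE ?normc_ge0 ?invr_ge0 ?subr_ge0 ?(ltW a1)// cker_le.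
have qi : cintg m setT (fun z => q b z * u z).
  apply: (cintg_bddM _ qM) ui; apply: measurable_complexM.
    by apply: measurable_complexM; [exact: cmeasX|exact: cker_meas].
  by apply: cmeasX; exact: cker_meas.
have -> : cauchy u b - cauchy u a - cint m setT (fun z => p z * u z) * (b - a) =
    (b - a) ^+ 2 * cint m setT (fun z => q b z * u z).
  rewrite -cintZ// /cauchy -cintB//; [|exact: cauchy_intg|exact: cauchy_intg].
  rewrite mulrC -cintZ// -cintB//; last 2 first.
  - by apply: cintgB => //; exact: cauchy_intg.
  - exact: cintgZ.
  apply: eq_cint => z _; rewrite /p /q /cker.
  have bz := ker_neq0 z b1; have az := ker_neq0 z a1.
  by field; rewrite az bz.
rewrite normcM normcX mulrC ler_wpM2r ?exprn_ge0 ?normc_ge0//.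
apply: le_trans (ler_norm_cint _ qi) _ => //.
rewrite -RintegralZl//; last exact: cintg_norm.
apply: le_Rint.
- exact: cintg_norm.
- by apply: rintgZ => //; exact: cintg_norm.
- by move=> z; rewrite normcM ler_wpM2r ?normc_ge0.
Qed.

(** Compactness of the closed discs, in polar coordinates. *)
Lemma hdisc_bounded f r : hdisc f -> 0 < r < 1 -> exists2 M : R, 0 < M &
  forall z : R[i], normc z <= r -> normc (f z) <= M.
Proof.
move=> hf /andP[r0 r1].
pose F (p : R * R) : R := normc (f (p.1%:C * circle_exp p.2)).
have cK : compact (`[0, r]%classic `*` `[0, 1]%classic : set (R * R)%type).
  by apply: compact_setX; exact: segment_compact.
have cF : {within (`[0, r]%classic `*` `[0, 1]%classic : set (R * R)%type), continuous F}.
  apply: continuous_in_subspaceT => -[s t]; rewrite inE/= => -[].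
  rewrite !in_itv/= => /andP[s0 sr] /andP[t0 t1].
  have hs : holo f (s%:C * circle_exp t).
    by apply: hf; rewrite normc_rz// (le_lt_trans sr).
  have ct : ccont (fun t : R => circle_exp t : R[i]) t.
    have h02 : 0 < (1 : R) < (2 : R) by rewrite ltr01 ltr1n.
    have h := @annulus_circle_cont R id 0 2 (lexx 0) (fun w _ => holo_id w) 1 h02 t.
    suff -> : (fun t : R => circle_exp t : R[i]) =
        (fun z : R[i] => (1 : R)%:C * z) \o @circle_exp R by [].
    by apply/funext => x; rewrite /= -[LHS]mul1r.
  apply/cvgrPdist_lt => e e0.
  have [d d0 H] := holo_continuous hs e0.
  have d2 : 0 < d / 2 by rewrite divr_gt0.
  have [d' d'0 H'] := ct _ d2.
  exists (ball s (d / 2), ball t d') => /=; first by split; exact: nbhsx_ballx.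
  move=> [s' t'] []; rewrite /ball/= => ss' tt'.
  rewrite /F /= distrC.
  have : normc (s'%:C * circle_exp t' - s%:C * circle_exp t) < d.
    have -> : s'%:C * (circle_exp t' : R[i]) - s%:C * (circle_exp t : R[i]) =
      (s' - s)%:C * (circle_exp t' : R[i]) + s%:C * ((circle_exp t' : R[i]) - (circle_exp t : R[i])).
      by rewrite rmorphB/=; ring.
    apply: le_lt_trans (le_normcD _ _) _; rewrite !normcM circle_normc mulr1 !normcR.
    rewrite [d]splitr; apply: ltr_leD; first by rewrite distrC.
    apply: (@le_trans _ _ (1 * normc ((circle_exp t' : R[i]) - (circle_exp t : R[i])))).
      by rewrite ler_wpM2r ?normc_ge0// ger0_norm// (le_trans sr)// ltW.
    by rewrite mul1r ltW// H'// distrC.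
  move=> /H h; apply: le_lt_trans h.
  rewrite ler_norml lerNl opprB ler_normcB andbT normcB; exact: ler_normcB.
have [M [_ HM]] := compact_bounded (continuous_compact cF cK).
exists (Num.max M 0 + 1); first by rewrite ltr_wpDl// le_max lexx orbT.
move=> z zr; have [z' zE] := polar_form z.
have MM : M < Num.max M 0 + 1 by rewrite ltr_pwDr// le_max lexx.
have FE : F (normc z, circle_arg z') = normc (f z) by rewrite [in RHS]zE -[in RHS](circle_argK z').
have := HM _ MM (F (normc z, circle_arg z')).
rewrite FE /= ger0_norm ?normc_ge0//; apply.
exists (normc z, circle_arg z') => //.
by split => /=; rewrite in_itv/= ?normc_ge0//; exact: circle_arg_itv.
Qed.

Lemma Rint_dct (f_ : nat -> C -> R) (f : C -> R) (G : C -> R) :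
  (forall n, measurable_fun setT (f_ n)) -> measurable_fun setT f ->
  {ae m, forall z, f_ ^~ z @ \oo --> f z} -> rintg m setT G ->
  {ae m, forall z, forall n, `|f_ n z| <= G z} ->
  \int[m]_z f_ n z @[n --> \oo] --> \int[m]_z f z.
Proof.
move=> mf_ mf ff Gi fG.
have mE n : measurable_fun setT (EFin \o f_ n) by exact/measurable_EFinP.
have mE' : measurable_fun setT (EFin \o f) by exact/measurable_EFinP.
have cE : {ae m, forall z, setT z -> (EFin \o f_ n) z @[n --> \oo] --> (EFin \o f) z}.
  by apply: filterS ff => z h _; apply: cvg_EFin => //; exact: nearW.
have bE : {ae m, forall z n, setT z -> (`|(EFin \o f_ n) z| <= (EFin \o G) z)%E}.
  by apply: filterS fG => z h n _; rewrite lee_fin.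
have [i _ c] := dominated_convergence measurableT mE mE' cE Gi bE.
apply: fine_cvg; rewrite fineK//; exact: integrable_fin_num.
Qed.

Definition rad n : R := 1 - n.+2%:R^-1.

Lemma rad_itv n : 0 < rad n < 1.
Proof.
have h : 0 < (n.+2%:R : R) by rewrite ltr0n.
rewrite /rad subr_gt0 invf_lt1// ltr1n/=.
by rewrite ltrBlDr ltrDl invr_gt0.
Qed.

Lemma rad_near r0 : r0 < 1 -> \forall n \near \oo, r0 < rad n.
Proof.
move=> r1; have e0 : 0 < 1 - r0 by rewrite subr_gt0.
exists (Num.truncn (1 - r0)^-1) => // n /= nN.
rewrite /rad ltrBrDl -ltrBrDr -[ltRHS]invrK ltf_pV2 ?posrE ?invr_gt0//.
apply: lt_le_trans (truncnS_gt _) _; rewrite ler_nat; exact: leqW.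
Qed.

Lemma radial_rad F z c : radial F z c -> normc (dil F (rad n) z - c) @[n --> \oo] --> (0 : R).
Proof.
move=> h; apply/cvgrPdist_lt => e e0; have [r0 r01 H] := h _ e0.
apply: filterS (rad_near r01) => n rn; have /andP[n0 n1] := rad_itv n.
by rewrite sub0r normrN ger0_norm ?normc_ge0//; apply: H => //; exact: ltW.
Qed.

Lemma normc_leDB (x y : R[i]) : normc x <= normc (x - y) + normc y.
Proof. by rewrite -{1}[x](subrK y) le_normcD. Qed.

Lemma normc_leDBr (x y : R[i]) : normc y <= normc (x - y) + normc x.
Proof. by rewrite normcB; exact: normc_leDB. Qed.

Lemma normc_leD3 (x y w : R[i]) : normc (x - w) <= normc (x - y) + normc (y - w).
Proof. by rewrite -[x - w](subrKA y) le_normcD. Qed.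

Lemma radial_pick F z c (e r1 : R) : radial F z c -> 0 < e -> r1 < 1 ->
  exists r, [/\ 0 < r, r1 < r, r < 1 & normc (F (r%:C * (z : R[i])) - c) < e].
Proof.
move=> h e0 r11; have [r0 r01 H] := h _ e0.
have h1 : Num.max r1 (Num.max 0 r0) < 1 by rewrite !gt_max r11 ltr01.
pose r := (Num.max r1 (Num.max 0 r0) + 1) / 2.
have h2 : Num.max r1 (Num.max 0 r0) < r by rewrite /r; move: (Num.max _ _) h1 => t; lra.
have rl : r < 1 by rewrite /r; move: (Num.max _ _) h1 => t; lra.
move: h2; rewrite !gt_max => /and3P[r1r r0r rr].
by exists r; split => //; apply: H => //; exact: ltW.
Qed.

Lemma radial_normc_le F z c M : radial F z c ->
  (forall w : R[i], normc w < 1 -> normc (F w) <= M) -> normc c <= M.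
Proof.
move=> h FM; apply/ler_addgt0Pl => e e0.
have [r [r0 _ r1 H]] := radial_pick h e0 (@ltr01 R).
apply: le_trans (normc_leDBr (F (r%:C * (z : R[i]))) c) _.
by rewrite lerD ?(ltW H)// FM// normc_rz// ltW.
Qed.

End disc_functions.

(** * Cauchy and Poisson representations *)

Section disc_representation.
Variable R : realType.
Local Notation C := (circle R).
Local Notation m := (circle_measure R).
Implicit Types (f g : R[i] -> R[i]) (u x : C -> R[i]) (r s : R) (z : C).

Lemma cmeas_nB u x : measurable_fun setT u -> measurable_fun setT x ->
  measurable_fun setT (fun z => normc (u z - x z)).
Proof. by move=> mu mx; apply: cmeas_normc; apply: cmeasB. Qed.

Lemma radial_dct f x (M : R) : (forall n, measurable_fun setT (dil f (rad R n))) ->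
  measurable_fun setT x -> (forall w : R[i], normc w < 1 -> normc (f w) <= M) ->
  {ae m, forall z, radial f z (x z)} ->
  \int[m]_z normc (dil f (rad R n) z - x z) @[n --> \oo] --> (0 : R).
Proof.
move=> mf mx fM fx.
have := @Rint_dct R (fun n z => normc (dil f (rad R n) z - x z)) (fun=> 0) (fun=> M + M).
rewrite Rint_cst; apply.
- by move=> n; exact: cmeas_nB.
- exact: measurable_cst.
- by apply: filterS fx => z; exact: radial_rad.
- exact: rintg_cst.
- apply: filterS fx => z h n; rewrite ger0_norm ?normc_ge0//.
  apply: le_trans (le_normcD _ _) _; rewrite normcN.
  rewrite lerD ?(radial_normc_le h)//; apply: fM.
  by have /andP[r0 r1] := rad_itv R n; rewrite normc_rz// ltW.
Qed.

Lemma hdisc_zero_bdd f M : hdisc f -> (forall w : R[i], normc w < 1 -> normc (f w) <= M) ->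
  {ae m, forall z, radial f z 0} -> forall w : R[i], normc w < 1 -> f w = 0.
Proof.
move=> hf fM f0; apply: (hdisc_zero hf) => e r0 e0 r01.
have mf n : measurable_fun setT (dil f (rad R n)) by apply: dil_meas => //; exact: rad_itv.
have := @radial_dct f (fun=> 0) M mf (@measurable_cst _ _ _ _ _ _) fM f0.
move=> /cvgrPdist_lt/(_ _ e0) h.
have [n [h1 h2]] := filter_ex (filterI h (rad_near r01)).
have /andP[n0 n1] := rad_itv R n.
exists (rad R n); split => //; move: h1; rewrite sub0r normrN; apply: le_lt_trans.
apply: le_trans (ler_norm _); rewrite le_eqVlt; apply/orP; left; apply/eqP.
by apply: eq_Rintegral => z _; rewrite subr0.
Qed.

Lemma normc_radial (b : R[i]) r : r <= 1 -> normc (r%:C * b - b) = (1 - r) * normc b.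
Proof.
move=> r1; rewrite -[X in _ - X]mul1r -mulrBl normcM; congr (_ * _).
by rewrite -(rmorphB (real_complex R)) normcR distrC ger0_norm// subr_ge0.
Qed.

Lemma hdisc_scale f r : hdisc f -> 0 < r < 1 -> hdisc (fun a => f (r%:C * a)).
Proof.
move=> hf /andP[r0 r1] a a1; apply: (holo_comp (f := f) (g := fun a => r%:C * a)).
  by apply: holoM; [exact: holo_cst|exact: holo_id].
apply: hf; rewrite normcM normc_rC ?ltW//; have := normc_ge0 a; nra.
Qed.

Lemma poisson_bounded u a (M : R) : measurable_fun setT u ->
  (forall z, normc (u z) <= M) -> normc a < 1 -> normc (poisson u a) <= M.
Proof.
move=> mu uM a1.
have ui : cintg m setT u by exact: cintg_bounded mu uM.
have i2 := pker_intg a1.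
apply: le_trans (ler_norm_cint _ (poisson_intg a1 ui)) _ => //.
have -> : M = \int[m]_z (M * pker a z) by rewrite RintegralZl// pker_mean// mulr1.
apply: le_Rint.
- by apply: cintg_norm => //; exact: poisson_intg.
- exact: rintgZ.
- move=> z; rewrite normcM normcR ger0_norm ?pker_ge0// mulrC.
  by rewrite ler_wpM2r ?pker_ge0.
Qed.

(** Both sides are bounded and holomorphic in [a], with the same radial
    limits. *)
Lemma hdisc_cauchy f r a : hdisc f -> 0 < r < 1 -> normc a < 1 ->
  f (r%:C * a) = cauchy (dil f r) a.
Proof.
move=> hf r01 a1; apply/eqP; rewrite -subr_eq0; apply/eqP; move: a a1.
have /andP[r0 r1] := r01.
have [M M0 fM] := hdisc_bounded hf r01.
have cd := dil_cont hf r01; have id := dil_intg hf r01.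
have hc := cauchy_holo id.
have cp b : normc b < 1 -> cauchy (dil f r) b = poisson (dil f r) b.
  by move=> b1; rewrite poisson_cauchy// => n n0; exact: hdisc_moment.
have rM (b : R[i]) : normc b < 1 -> normc (r%:C * b) <= r.
  move=> b1; rewrite normcM normc_rC ?(ltW r0)//; have := normc_ge0 b; nra.
have dM z : normc (dil f r z) <= M by apply: fM; rewrite normc_rz// ltW.
apply: (@hdisc_zero_bdd (fun a => f (r%:C * a) - cauchy (dil f r) a) (M + M)).
- by move=> b b1; apply: holoB; [exact: (hdisc_scale hf r01)|exact: hc].
- move=> b b1; apply: le_trans (le_normcD _ _) _; rewrite normcN lerD ?fM ?rM//.
  by rewrite cp//; apply: poisson_bounded => //; exact: dil_meas.
- apply: aeW => z e e0; have e2 : 0 < e / 2 by rewrite divr_gt0.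
  have [s0 s01 H] := poisson_radial_cont z cd e2.
  have rz1 : normc (r%:C * (z : R[i])) < 1 by rewrite normc_rz// ltW.
  have [d d0 H'] := holo_continuous (hf _ rz1) e2.
  exists (Num.max s0 (1 - d)) => [|s sg0]; first by rewrite gt_max s01 ltrBlDr ltrDl.
  rewrite gt_max => /andP[ss0 sd] s1.
  rewrite subr0 cp ?normc_rz//.
  apply: le_lt_trans (normc_leD3 _ (dil f r z) _) _; rewrite [e]splitr ltrD//.
    rewrite /dil; apply: H'; rewrite mulrCA normc_radial ?(ltW s1)// normc_rz ?(ltW r0)//; nra.
  by rewrite normcB; exact: H.
Qed.

Lemma hdisc_poisson f r a : hdisc f -> 0 < r < 1 -> normc a < 1 ->
  f (r%:C * a) = poisson (dil f r) a.
Proof.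
move=> hf r01 a1; rewrite hdisc_cauchy// poisson_cauchy//; first exact: dil_intg.
by move=> n n0; exact: hdisc_moment.
Qed.

(** Convergence in mean of the dilations to [x] identifies [f] with the Cauchy
    integral of [x]. *)
Definition L1radial f x := forall e r0 : R, 0 < e -> r0 < 1 ->
  exists r, [/\ 0 < r, r0 < r, r < 1 & \int[m]_z normc (dil f r z - x z) < e].

Lemma L1radial_moment f x n : hdisc f -> cintg m setT x -> L1radial f x ->
  (0 < n)%N -> cmoment x n = 0.
Proof.
move=> hf xi fx n0; apply/eqP; rewrite -normc_eq0 eq_le normc_ge0 andbT.
apply/ler_addgt0Pl => e e0; rewrite addr0.
have [r [r0 _ r1 H]] := fx _ 0 e0 (@ltr01 R).
have r01 : 0 < r < 1 by rewrite r0.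
have di := dil_intg hf r01; have dx := cintgB measurableT di xi.
apply: ltW; apply: le_lt_trans H.
rewrite -normcN -[X in normc X]add0r -(hdisc_moment hf r01 n0).
rewrite /cmoment -cintB//; [|exact: cmoment_intg|exact: cmoment_intg].
have -> : cint m setT (fun z : C => (z : R[i]) ^+ n * dil f r z - (z : R[i]) ^+ n * x z) =
    cmoment (fun z => dil f r z - x z) n.
  by apply: eq_cint => z _; rewrite mulrBr.
apply: le_trans (ler_norm_cint _ (cmoment_intg n dx)) _ => //.
apply: le_Rint; [|exact: cintg_norm|].
  by apply: cintg_norm => //; exact: cmoment_intg.
by move=> z; rewrite normcM normc_circleX mul1r.
Qed.

Lemma L1radial_cauchy f x a : hdisc f -> cintg m setT x -> L1radial f x ->
  normc a < 1 -> f a = cauchy x a.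
Proof.
move=> hf xi fx a1; apply/eqP; rewrite -subr_eq0 -normc_eq0 eq_le normc_ge0 andbT.
apply/ler_addgt0Pl => e e0; rewrite addr0.
have e2 : 0 < e / 2 by rewrite divr_gt0.
have [d d0 H'] := holo_continuous (hf _ a1) e2.
have b0 : 0 < 1 - normc a by rewrite subr_gt0.
have [r [r0 rd r1 H]] := fx _ (1 - d) (mulr_gt0 e2 b0) (ltac:(lra)).
have r01 : 0 < r < 1 by rewrite r0.
have di := dil_intg hf r01; have dx := cintgB measurableT di xi.
apply: le_trans (normc_leD3 _ (f (r%:C * a)) _) _; rewrite [e]splitr lerD//.
  rewrite normcB; apply: ltW; apply: H'.
  rewrite normc_radial ?(ltW r1)//; have := normc_ge0 a; nra.
rewrite hdisc_cauchy// /cauchy -cintB//; [|exact: cauchy_intg|exact: cauchy_intg].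
have -> : cint m setT (fun z : C => cker a z * dil f r z - cker a z * x z) =
    cauchy (fun z => dil f r z - x z) a.
  by apply: eq_cint => z _; rewrite mulrBr.
apply: le_trans (ler_norm_cint _ (cauchy_intg a1 dx)) _ => //.
rewrite -[e / 2](mulfK (lt0r_neq0 b0)) [leRHS]mulrC.
apply: (@le_trans _ _ ((1 - normc a)^-1 * \int[m]_z normc (dil f r z - x z))).
  have i2 : rintg m setT (fun z => normc (dil f r z - x z)) by exact: cintg_norm.
  rewrite -RintegralZl//; apply: le_Rint; [|exact: rintgZ|].
    by apply: cintg_norm => //; exact: cauchy_intg.
  by move=> z; rewrite normcM ler_wpM2r ?normc_ge0// cker_le.
by rewrite ler_wpM2l ?invr_ge0 ?(ltW b0)// ltW.
Qed.

(** The bound dominates the dilations. *)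
Lemma bdd_L1radial f x (M : R) : hdisc f -> measurable_fun setT x ->
  (forall w : R[i], normc w < 1 -> normc (f w) <= M) ->
  {ae m, forall z, radial f z (x z)} -> L1radial f x.
Proof.
move=> hf mx fM fx e r0 e0 r01.
have mf n : measurable_fun setT (dil f (rad R n)) by apply: dil_meas => //; exact: rad_itv.
have := radial_dct mf mx fM fx.
move=> /cvgrPdist_lt/(_ _ e0) h.
have [n [h1 h2]] := filter_ex (filterI h (rad_near r01)).
have /andP[n0 n1] := rad_itv R n.
by exists (rad R n); split => //; move: h1; rewrite sub0r normrN; apply: le_lt_trans; exact: ler_norm.
Qed.

End disc_representation.

(** * Outer functions *)

Section outer_modulus.
Variable R : realType.
Local Notation C := (circle R).
Local Notation m := (circle_measure R).
Implicit Types (f g : R[i] -> R[i]) (u x : C -> R[i]) (k l : C -> R) (r s : R) (z : C).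

Lemma ler_dist_normc (v w : R[i]) : `|normc v - normc w| <= normc (v - w).
Proof.
by rewrite ler_norml lerNl opprB ler_normcB andbT normcB ler_normcB.
Qed.

Definition rpoisson k a : R := \int[m]_z (pker a z * k z).

Lemma rpoisson_intg k a : normc a < 1 -> rintg m setT k ->
  rintg m setT (fun z => pker a z * k z).
Proof.
move=> a1 ki; apply: (rintg_bddM (M := 2 / (1 - normc a))) => //; first exact: pker_meas.
by move=> z; rewrite ger0_norm ?pker_ge0// pker_le.
Qed.

Lemma poisson_real k a : poisson (fun z => (k z)%:C) a = (rpoisson k a)%:C.
Proof.
rewrite /poisson /rpoisson -cint_real; apply: eq_cint => z _.
by rewrite -rmorphM.
Qed.

Lemma rpoisson_cst a (M : R) : normc a < 1 -> rpoisson (fun=> M) a = M.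
Proof.
move=> a1; have := poisson_cst M%:C a1.
by rewrite (poisson_real (fun=> M)) => -[].
Qed.

Lemma le_rpoisson k l a : normc a < 1 -> rintg m setT k -> rintg m setT l ->
  (forall z, k z <= l z) -> rpoisson k a <= rpoisson l a.
Proof.
move=> a1 ki li kl; apply: le_Rint; [exact: rpoisson_intg|exact: rpoisson_intg|].
by move=> z; rewrite ler_wpM2l ?pker_ge0.
Qed.

Lemma rpoissonD k l a : normc a < 1 -> rintg m setT k -> rintg m setT l ->
  rpoisson (fun z => k z + l z) a = rpoisson k a + rpoisson l a.
Proof.
move=> a1 ki li; rewrite /rpoisson -RintegralD//; [|exact: rpoisson_intg|exact: rpoisson_intg].
by apply: eq_Rintegral => z _; rewrite mulrDr.
Qed.

Lemma rpoissonZ k c a : normc a < 1 -> rintg m setT k ->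
  rpoisson (fun z => c * k z) a = c * rpoisson k a.
Proof.
move=> a1 ki; rewrite /rpoisson -RintegralZl//; last exact: rpoisson_intg.
by apply: eq_Rintegral => z _; rewrite mulrCA.
Qed.

Lemma normc_poisson_le u a : normc a < 1 -> cintg m setT u ->
  normc (poisson u a) <= rpoisson (fun z => normc (u z)) a.
Proof.
move=> a1 ui; apply: le_trans (ler_norm_cint _ (poisson_intg a1 ui)) _ => //.
rewrite le_eqVlt; apply/orP; left; apply/eqP; apply: eq_Rintegral => z _.
by rewrite normcM normcR ger0_norm// pker_ge0.
Qed.

Lemma rpoisson_dct (f_ : nat -> C -> R) l (K : R) a : normc a < 1 ->
  (forall n, measurable_fun setT (f_ n)) -> measurable_fun setT l ->
  {ae m, forall z, f_ ^~ z @ \oo --> l z} -> (forall n z, `|f_ n z| <= K) ->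
  rpoisson (f_ n) a @[n --> \oo] --> rpoisson l a.
Proof.
move=> a1 mf ml fl fK.
apply: (@Rint_dct R (fun n z => pker a z * f_ n z) _ (fun z => pker a z * K)).
- by move=> n; apply: measurable_funM => //; exact: pker_meas.
- by apply: measurable_funM => //; exact: pker_meas.
- by apply: filterS fl => z h; apply: (@cvgM R) => //; exact: cvg_cst.
- by apply: rpoisson_intg => //; exact: rintg_cst.
- apply: aeW => z n; rewrite normrM ger0_norm ?pker_ge0// ler_wpM2l ?pker_ge0//.
Qed.

(** The holomorphic completion of a Poisson integral. *)
Definition herglotz k a : R[i] :=
  2%:R * cauchy (fun z => (k z)%:C) a - (\int[m]_z k z)%:C.

Lemma herglotz_holo k : rintg m setT k -> hdisc (herglotz k).
Proof.
move=> ki a a1; apply: holoB; last exact: holo_cst.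
apply: holoM; first exact: holo_cst.
by apply: cauchy_holo => //; exact: cintg_real.
Qed.

Lemma Re_herglotz k a : normc a < 1 -> rintg m setT k ->
  complex.Re (herglotz k a) = rpoisson k a.
Proof.
move=> a1 ki; have kc : cintg m setT (fun z => (k z)%:C) by exact: cintg_real.
have ci := cauchy_intg a1 kc.
rewrite /herglotz /cauchy cReD cReN /= addr0 mul0r subr0.
have [ri _] := ci.
have i2 : rintg m setT (fun z => (1 + 1) * complex.Re (cker a z * (k z)%:C)) by exact: rintgZ.
rewrite -RintegralZl// -RintegralB//; apply: eq_Rintegral => z _.
have := congr1 (@complex.Re R) (pkerE z a1); rewrite /= !cReD cReN /= => ->.
rewrite cReM /=; case: (cker a z) => p q /=; ring.
Qed.

(** The holomorphic function whose logarithm of the modulus is the Poisson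
    integral of [k]. *)
Definition outer k a : R[i] := cexp (herglotz k a).

Lemma outer_holo k : rintg m setT k -> hdisc (outer k).
Proof.
move=> ki a a1; apply: (holo_comp (f := @cexp R)); last exact: holo_cexp.
exact: herglotz_holo.
Qed.

Lemma normc_outer k a : normc a < 1 -> rintg m setT k ->
  normc (outer k a) = expR (rpoisson k a).
Proof. by move=> a1 ki; rewrite normc_cexp Re_herglotz. Qed.

Lemma rpoisson_radial k : rintg m setT k ->
  {ae m, forall z, forall e : R, 0 < e -> exists2 r0 : R, r0 < 1 &
    forall r : R, 0 <= r -> r0 < r -> r < 1 ->
    `|rpoisson k (r%:C * (z : R[i])) - k z| < e}.
Proof.
move=> ki; have kc : cintg m setT (fun z => (k z)%:C) by exact: cintg_real.
apply: filterS (poisson_radial kc) => z h e /h[r0 r01 H]; exists r0 => // r rg r0r r1.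
by have := H r rg r0r r1; rewrite poisson_real -(rmorphB (real_complex R)) normcR.
Qed.

Lemma expR_cvg_rad k : rintg m setT k ->
  {ae m, forall z, expR (rpoisson k ((rad R n)%:C * (z : R[i]))) @[n --> \oo] --> expR (k z)}.
Proof.
move=> ki; apply: filterS (rpoisson_radial ki) => z h.
apply: continuous_cvg; first exact: continuous_expR.
apply/cvgrPdist_lt => e /h[r0 r01 H]; apply: filterS (rad_near r01) => n rn.
by have /andP[n0 n1] := rad_itv R n; rewrite distrC; apply: H => //; exact: ltW.
Qed.

(** A holomorphic function on a larger disc is dominated by the outer function
    of a larger modulus: the quotient is bounded and its radial limits have
    modulus at most [1]. *)
Lemma le_outer f r k (K : R) a : hdisc f -> 0 < r < 1 -> measurable_fun setT k ->
  (forall z, `|k z| <= K) -> (forall z, normc (dil f r z) <= expR (k z)) ->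
  normc a < 1 -> normc (f (r%:C * a)) <= expR (rpoisson k a).
Proof.
move=> hf r01 mk kK fk a1; have /andP[r0 r1] := r01.
have ki : rintg m setT k.
  apply: (@rintg_le _ _ _ _ _ _ (fun=> K)) => //; exact: rintg_cst.
have kl b : normc b < 1 -> - K <= rpoisson k b.
  move=> b1; rewrite -(rpoisson_cst (- K) b1); apply: le_rpoisson => //; first exact: rintg_cst.
  by move=> z; have := kK z; rewrite ler_norml => /andP[].
have [M M0 fM] := hdisc_bounded hf r01.
pose F b := f (r%:C * b) / outer k b.
have hF : hdisc F.
  move=> b b1; apply: holoM; first exact: (hdisc_scale hf r01).
  apply: (holo_comp (f := fun w => w^-1)); first exact: outer_holo.
  by apply: holo_inv; exact: cexp_neq0.
have rM (b : R[i]) : normc b < 1 -> normc (f (r%:C * b)) <= M.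
  move=> b1; apply: fM; rewrite normcM normc_rC ?(ltW r0)//; have := normc_ge0 b; nra.
have FM (b : R[i]) : normc b < 1 -> normc (F b) <= M * expR K.
  move=> b1; rewrite normcM normcV normc_outer//.
  rewrite ler_pM ?normc_ge0 ?invr_ge0 ?expR_ge0 ?rM//.
  by rewrite -expRN ler_expR lerNl; exact: kl.
suff F1 : normc (F a) <= 1.
  by move: F1; rewrite normcM normcV normc_outer// ler_pdivrMr ?expR_gt0// mul1r.
pose s n := rad R n.
have s01 n : 0 < s n < 1 := rad_itv R n.
have sz n z : normc ((s n)%:C * (z : R[i])) < 1.
  by have /andP[n0 n1] := s01 n; rewrite normc_rz// ltW.
have mF n : measurable_fun setT (dil F (s n)) by exact: dil_meas.
pose l z : R := normc (dil f r z) / expR (k z).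
have ml : measurable_fun setT l.
  apply: measurable_funM; first by apply: cmeas_normc; exact: dil_meas.
  rewrite (_ : (fun z => (expR (k z))^-1) = (fun z => expR (- k z))).
    by apply: measurableT_comp => //; exact: measurableT_comp.
  by apply/funext => z; rewrite expRN.
have c1 : rpoisson (fun z => normc (dil F (s n) z)) a @[n --> \oo] --> rpoisson l a.
  apply: (@rpoisson_dct _ _ (M * expR K)) => //.
  - by move=> n; apply: cmeas_normc.
  - apply: filterS (expR_cvg_rad ki) => z h.
    have -> : (fun n => normc (dil F (s n) z)) = (fun n =>
        normc (f (r%:C * ((s n)%:C * (z : R[i])))) * (expR (rpoisson k ((s n)%:C * (z : R[i]))))^-1).
      by apply/funext => n; rewrite /dil normcM normcV normc_outer.
    apply: (@cvgM R) => //; last first.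
      by apply: (@cvgV R) => //; rewrite gt_eqF// expR_gt0.
    apply/cvgrPdist_lt => e e0.
    have rz1 : normc (r%:C * (z : R[i])) < 1 by rewrite normc_rz// ltW.
    have [d d0 H'] := holo_continuous (hf _ rz1) e0.
    have d1 : 1 - d < 1 by rewrite ltrBlDr ltrDl.
    apply: filterS (rad_near d1) => n rn; have /andP[n0 n1] := s01 n.
    have h' : normc (f (r%:C * ((s n)%:C * (z : R[i]))) - dil f r z) < e.
      rewrite /dil; apply: H'; rewrite mulrCA normc_radial ?(ltW n1)// normc_rz ?(ltW r0)//.
      rewrite /s; nra.
    by apply: le_lt_trans h'; rewrite normcB; exact: ler_dist_normc.
  - by move=> n z; rewrite ger0_norm ?normc_ge0// FM.
have c2 : normc (F ((s n)%:C * a)) @[n --> \oo] --> normc (F a).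
  apply/cvgrPdist_lt => e e0; have [d d0 H'] := holo_continuous (hF _ a1) e0.
  have d1 : 1 - d < 1 by rewrite ltrBlDr ltrDl.
  apply: filterS (rad_near d1) => n rn; have /andP[n0 n1] := s01 n.
  have h' : normc (F ((s n)%:C * a) - F a) < e.
    apply: H'; rewrite normc_radial ?(ltW n1)//; have := normc_ge0 a.
    move: rn n1; rewrite -/(s n) => *; nra.
  by apply: le_lt_trans h'; rewrite normcB; exact: ler_dist_normc.
have : normc (F a) <= rpoisson l a.
  apply: ler_cvg_to c2 c1 _; apply: nearW => n.
  rewrite (hdisc_poisson hF (s01 n) a1); apply: normc_poisson_le => //.
  exact: dil_intg.
move=> /le_trans; apply; rewrite -(rpoisson_cst 1 a1); apply: le_rpoisson => //.
- apply: (@rintg_le _ _ _ _ _ _ (fun=> 1)) => //; last exact: rintg_cst.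
  move=> z _; rewrite ger0_norm ?divr_ge0 ?normc_ge0 ?expR_ge0//.
  by rewrite ler_pdivrMr ?expR_gt0// mul1r.
- exact: rintg_cst.
- by move=> z; rewrite ler_pdivrMr ?expR_gt0// mul1r.
Qed.

End outer_modulus.

(** * Boundary values of functions with bounded means *)

Section hardy_one.
Variable R : realType.
Local Notation C := (circle R).
Local Notation m := (circle_measure R).
Implicit Types (f g : R[i] -> R[i]) (u x : C -> R[i]) (k l : C -> R) (r s : R) (z : C).

Lemma sqrtD_le (s t : R) : 0 <= s -> 0 <= t -> Num.sqrt (s + t) <= Num.sqrt s + Num.sqrt t.
Proof.
move=> s0 t0; rewrite -[leRHS]ger0_norm ?addr_ge0 ?sqrtr_ge0//.
rewrite -sqrtr_sqr ler_sqrt ?sqr_ge0// sqrrD !sqr_sqrtr//.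
by rewrite lerD2r lerDl mulrn_wge0// mulr_ge0 ?sqrtr_ge0.
Qed.

Lemma sqrt_expR (c : R) : Num.sqrt (expR c) = expR (c / 2).
Proof.
have -> : expR c = expR (c / 2) ^+ 2.
  by rewrite expr2 -expRD; congr expR; field.
by rewrite sqrtr_sqr ger0_norm ?expR_ge0.
Qed.

Lemma meas_sqrt k : measurable_fun setT k -> measurable_fun setT (fun z => Num.sqrt (k z)).
Proof.
move=> mk; apply: (measurableT_comp (f := @Num.sqrt R)) => //.
by apply: continuous_measurable_fun; exact: sqrt_continuous.
Qed.

Lemma rintg_sqrt k : (forall z, 0 <= k z) -> rintg m setT k ->
  rintg m setT (fun z => Num.sqrt (k z)).
Proof.
move=> k0 ki; apply: (@rintg_le _ _ _ _ _ _ (fun z => 1 + k z)) => //.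
- by apply: meas_sqrt; exact: (rintg_meas ki).
- move=> z _; rewrite ger0_norm ?sqrtr_ge0//.
  have := sqrtr_ge0 (k z); have := sqr_sqrtr (k0 z); nra.
- by apply: rintgD => //; exact: rintg_cst.
Qed.

(** The square root of the modulus is subharmonic: Jensen's inequality applied
    to the domination by an outer function. *)
Lemma sqrt_subharmonic f r a : hdisc f -> 0 < r < 1 -> normc a < 1 ->
  Num.sqrt (normc (f (r%:C * a))) <= rpoisson (fun z => Num.sqrt (normc (dil f r z))) a.
Proof.
move=> hf r01 a1; have /andP[r0 r1] := r01.
apply/ler_addgt0Pr => d d0; pose e := d ^+ 2.
have e0 : 0 < e by rewrite exprn_gt0.
have [M M0 fM] := hdisc_bounded hf r01.
have dM z : normc (dil f r z) <= M by apply: fM; rewrite normc_rz// ltW.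
pose t z := normc (dil f r z) + e.
have te z : e <= t z by rewrite lerDr normc_ge0.
have t0 z : 0 < t z by exact: lt_le_trans e0 (te z).
pose k z := ln (t z).
have kE z : expR (k z) = t z by rewrite lnK ?posrE.
have di := dil_intg hf r01; have dm := cmeas_normc (dil_meas hf r01).
have ni : rintg m setT (fun z => normc (dil f r z)) by exact: cintg_norm.
have mt : measurable_fun setT t by apply: measurable_funD.
have mk : measurable_fun setT k by apply: measurableT_comp.
pose K := `|ln e| + `|ln (M + e)|.
have kK z : `|k z| <= K.
  rewrite ler_norml; apply/andP; split.
    rewrite lerNl; apply: (@le_trans _ _ (- ln e)); first by rewrite lerN2 ler_ln ?posrE.
    by apply: le_trans (ler_norm _) _; rewrite normrN lerDl.
  apply: (@le_trans _ _ (ln (M + e))).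
    by rewrite /k ler_ln ?posrE//; [rewrite /t lerD2r|exact: addr_gt0].
  by apply: le_trans (ler_norm _) _; rewrite lerDr.
have ki : rintg m setT k.
  apply: (@rintg_le _ _ _ _ _ _ (fun=> K)) => //; exact: rintg_cst.
have fk z : normc (dil f r z) <= expR (k z) by rewrite kE lerDl ltW.
have h1 := le_outer hf r01 mk kK fk a1.
set c := rpoisson k a in h1.
apply: (@le_trans _ _ (expR (c / 2))).
  by rewrite -sqrt_expR ler_sqrt ?expR_ge0.
have ti : rintg m setT t by apply: rintgD => //; exact: rintg_cst.
have qi : rintg m setT (fun z => Num.sqrt (t z)).
  by apply: rintg_sqrt => // z; exact: ltW.
(* the tangent line of [expR (_ / 2)] at [c], for Jensen's inequality *)
pose l z := expR (c / 2) * (1 - c / 2) + (expR (c / 2) / 2) * k z.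
have lki : rintg m setT (fun z => (expR (c / 2) / 2) * k z) by exact: rintgZ.
have li : rintg m setT l by apply: rintgD => //; exact: rintg_cst.
apply: (@le_trans _ _ (rpoisson l a)).
  rewrite /l rpoissonD//; last exact: rintg_cst.
  rewrite rpoisson_cst// rpoissonZ// -/c.
  by rewrite le_eqVlt; apply/orP; left; apply/eqP; field.
apply: (@le_trans _ _ (rpoisson (fun z => Num.sqrt (t z)) a)).
  apply: le_rpoisson => // z; rewrite -kE sqrt_expR /l.
  have -> : k z / 2 = c / 2 + (k z / 2 - c / 2) by ring.
  rewrite expRD; have := expR_ge1Dx (k z / 2 - c / 2); have := expR_gt0 (c / 2).
  have -> : expR (c / 2) * (1 - c / 2) + expR (c / 2) / 2 * k z =
    expR (c / 2) * (1 + (k z / 2 - c / 2)) by field.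
  by move=> ? ?; rewrite ler_pM2l.
have si : rintg m setT (fun z => Num.sqrt (normc (dil f r z))).
  by apply: rintg_sqrt => // z; exact: normc_ge0.
apply: (@le_trans _ _ (rpoisson (fun z => Num.sqrt (normc (dil f r z)) + d) a)).
  apply: le_rpoisson => //; first by apply: rintgD => //; exact: rintg_cst.
  move=> z; apply: le_trans (sqrtD_le (normc_ge0 _) (ltW e0)) _.
  by rewrite lerD2l /e sqrtr_sqr ger0_norm// ltW.
rewrite rpoissonD//; last exact: rintg_cst.
by rewrite rpoisson_cst.
Qed.

(** A bounded substitute for the square root, within [t / K] of it. *)
Definition tsqrt (K t : R) : R := K * Num.sqrt t / (K + Num.sqrt t).

Lemma tsqrt_ge0 (K t : R) : 0 < K -> 0 <= tsqrt K t.
Proof.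
by move=> K0; rewrite divr_ge0 ?addr_ge0 ?mulr_ge0 ?sqrtr_ge0// ltW.
Qed.

Lemma tsqrt_bound (K t : R) : 0 < K -> tsqrt K t <= K.
Proof.
move=> K0; have s0 := sqrtr_ge0 t; rewrite ler_pdivrMr ?ltr_wpDr//.
by rewrite ler_pM2l// lerDr ltW.
Qed.

Lemma tsqrt_le (K t : R) : 0 < K -> tsqrt K t <= Num.sqrt t.
Proof.
move=> K0; have s0 := sqrtr_ge0 t; rewrite ler_pdivrMr ?ltr_wpDr// mulrC.
by rewrite ler_wpM2l// lerDl.
Qed.

Lemma le_tsqrt (K t : R) : 0 < K -> 0 <= t -> Num.sqrt t <= tsqrt K t + K^-1 * t.
Proof.
move=> K0 t0; have s0 := sqrtr_ge0 t; have st := sqr_sqrtr t0.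
rewrite /tsqrt -[in X in _ <= _ + X]st; set s := Num.sqrt t in s0 *.
have Ks : 0 < K + s by rewrite ltr_wpDr.
rewrite -subr_ge0 (_ : _ - _ = s ^+ 3 / (K * (K + s))).
  by rewrite divr_ge0 ?mulr_ge0 ?exprn_ge0// ltW.
by field; rewrite !gt_eqF.
Qed.

Lemma tsqrt_cvg (K : R) (t_ : nat -> R) (t : R) : 0 < K -> t_ n @[n --> \oo] --> t ->
  tsqrt K (t_ n) @[n --> \oo] --> tsqrt K t.
Proof.
move=> K0 ht; have hs : Num.sqrt (t_ n) @[n --> \oo] --> Num.sqrt t.
  by apply: continuous_cvg => //; exact: sqrt_continuous.
apply: (@cvgM R); first by apply: (@cvgM R) => //; exact: cvg_cst.
apply: (@cvgV R); first by rewrite gt_eqF// ltr_wpDr// sqrtr_ge0.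
by apply: (@cvgD R R) => //; exact: cvg_cst.
Qed.

Lemma meas_tsqrt (K : R) k : 0 < K -> measurable_fun setT k ->
  measurable_fun setT (fun z => tsqrt K (k z)).
Proof.
move=> K0 mk; apply: (measurableT_comp (f := tsqrt K)) => //.
apply: continuous_measurable_fun => t.
have hs : Num.sqrt s @[s --> t] --> Num.sqrt t by exact: sqrt_continuous.
apply: (@cvgM R); first by apply: (@cvgM R) => //; exact: cvg_cst.
apply: (@cvgV R); first by rewrite gt_eqF// ltr_wpDr// sqrtr_ge0.
by apply: (@cvgD R R) => //; exact: cvg_cst.
Qed.

Section mean_bounded.
Variables (f : R[i] -> R[i]) (x : C -> R[i]) (M : R).
Hypotheses (hf : hdisc f) (mx : measurable_fun setT x).
Hypothesis fM : forall r, 0 < r < 1 -> \int[m]_z normc (dil f r z) <= M.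
Hypothesis fx : {ae m, forall z, radial f z (x z)}.

Let s n := rad R n.
Let s01 n : 0 < s n < 1. Proof. exact: rad_itv. Qed.
Let di n : cintg m setT (dil f (s n)). Proof. exact: dil_intg. Qed.
Let ni n : rintg m setT (fun z => normc (dil f (s n) z)).
Proof. exact: cintg_norm. Qed.
Let dm n : measurable_fun setT (dil f (s n)). Proof. exact: dil_meas. Qed.

Let nx : {ae m, forall z, normc (dil f (s n) z) @[n --> \oo] --> normc (x z)}.
Proof.
apply: filterS fx => z /radial_rad/cvgrPdist_lt h; apply/cvgrPdist_lt => e /h.
apply: filterS => n; rewrite sub0r normrN ger0_norm ?normc_ge0//; apply: le_lt_trans.
by rewrite normcB; exact: ler_dist_normc.
Qed.

(** Fatou's lemma. *)
Lemma hardy_bv_intg : cintg m setT x.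
Proof.
have mnx : measurable_fun setT (EFin \o (fun z => normc (x z))).
  by apply/measurable_EFinP; exact: cmeas_normc.
suff xi : rintg m setT (fun z => normc (x z)) by apply: (cintg_le mx _ xi).
apply/integrableP; split=> //; apply: (@le_lt_trans _ _ M%:E); last exact: ltry.
pose F n z := (normc (dil f (s n) z))%:E.
have mF n : measurable_fun setT (F n).
  by apply/measurable_EFinP; exact: cmeas_normc.
have F0 n z : setT z -> (0 <= F n z)%E by move=> _; rewrite lee_fin normc_ge0.
apply: (@le_trans _ _ (\int[m]_z limn_einf (F^~ z))%E).
  rewrite le_eqVlt; apply/orP; left; apply/eqP; apply: ge0_ae_eq_integral => //.
  - exact: measurableT_comp.
  - rewrite (_ : (fun z => _) = fun z => (- limn_esup (fun n => - F n z))%E); last first.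
      apply/funext => z; rewrite -limn_einfN; congr limn_einf.
      by apply/funext => n; exact/esym/oppeK.
    apply: measurableT_comp => //; apply: measurable_fun_limn_esup => n.
    exact: measurableT_comp.
  - move=> z _; rewrite limn_einf_lim; apply: lime_ge; first exact: is_cvg_einfs.
    by apply: nearW => n; apply: le_ereal_inf_tmp => _ [p _ <-]; exact: F0.
  - apply: filterS nx => z h _.
    have hF : F^~ z @ \oo --> (normc (x z))%:E by apply: cvg_EFin h; exact: nearW.
    have [-> _] := cvg_limn_einf_sup hF.
    by rewrite /= ger0_norm ?normc_ge0.
apply: le_trans (fatou m measurableT mF F0) _.
rewrite limn_einf_lim; apply: lime_le; first exact: is_cvg_einfs.
apply: nearW => n; apply: le_trans (ereal_inf_lbound _) _.
  by exists n => /=.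
have := fM (s01 n); rewrite -lee_fin /Rintegral fineK//.
exact: integrable_fin_num (ni n).
Qed.

Let xi := hardy_bv_intg.
Let nxi : rintg m setT (fun z => normc (x z)). Proof. exact: cintg_norm. Qed.

(** Square roots of functions with bounded means are uniformly integrable; the
    truncated square root makes this explicit and lets dominated convergence
    apply. *)
Lemma hardy_sqrt_le a : normc a < 1 ->
  Num.sqrt (normc (f a)) <= rpoisson (fun z => Num.sqrt (normc (x z))) a.
Proof.
move=> a1; have a0 : 0 < 1 - normc a by rewrite subr_gt0.
have M0 : 0 <= M.
  by apply: le_trans (fM (s01 0)); apply: Rintegral_ge0 => z _; exact: normc_ge0.
apply/ler_addgt0Pr => e e0.
pose B := 2 / (1 - normc a) * M + 1.
have B0 : 0 < B by rewrite ltr_wpDl// mulr_ge0// divr_ge0// ltW.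
(* The truncation error is [K^-1] times the mean, which [B] bounds. *)
pose K := B / e; have K0 : 0 < K by rewrite divr_gt0.
have Ke : K^-1 * B = e by rewrite /K invf_div divfK// gt_eqF.
have mdn n : measurable_fun setT (fun z => normc (dil f (s n) z)) by exact: cmeas_normc.
have mnx : measurable_fun setT (fun z => normc (x z)) by exact: cmeas_normc.
have c1 : rpoisson (fun z => tsqrt K (normc (dil f (s n) z))) a @[n --> \oo] -->
    rpoisson (fun z => tsqrt K (normc (x z))) a.
  apply: (@rpoisson_dct _ _ _ K) => //.
  - by move=> n; exact: meas_tsqrt.
  - exact: meas_tsqrt.
  - by apply: filterS nx => z; exact: tsqrt_cvg.
  - by move=> n z; rewrite ger0_norm ?tsqrt_ge0 ?tsqrt_bound.
have c1' : rpoisson (fun z => tsqrt K (normc (dil f (s n) z))) a + e @[n --> \oo] -->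
    rpoisson (fun z => tsqrt K (normc (x z))) a + e.
  by apply: (@cvgD R R) => //; exact: cvg_cst.
have c2 : Num.sqrt (normc (f ((s n)%:C * a))) @[n --> \oo] --> Num.sqrt (normc (f a)).
  apply: continuous_cvg; first exact: sqrt_continuous.
  apply/cvgrPdist_lt => d d0; have [d' d'0 H'] := holo_continuous (hf a1) d0.
  have d1 : 1 - d' < 1 by rewrite ltrBlDr ltrDl.
  apply: filterS (rad_near d1) => n rn; have /andP[n0 n1] := s01 n.
  have h' : normc (f ((s n)%:C * a) - f a) < d.
    apply: H'; rewrite normc_radial ?(ltW n1)//; have := normc_ge0 a.
    move: rn n1; rewrite -/(s n) => *; nra.
  by apply: le_lt_trans h'; rewrite normcB; exact: ler_dist_normc.
have ti k : measurable_fun setT k -> rintg m setT (fun z => tsqrt K (k z)).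
  move=> mk; apply: (@rintg_le _ _ _ _ _ _ (fun=> K)) => //; first exact: meas_tsqrt.
    by move=> z _; rewrite ger0_norm ?tsqrt_ge0 ?tsqrt_bound.
  exact: rintg_cst.
have : Num.sqrt (normc (f a)) <= rpoisson (fun z => tsqrt K (normc (x z))) a + e.
  apply: ler_cvg_to c2 c1' _; apply: nearW => n.
  apply: le_trans (sqrt_subharmonic hf (s01 n) a1) _.
  have ki : rintg m setT (fun z => K^-1 * normc (dil f (s n) z)) by exact: rintgZ.
  apply: (@le_trans _ _ (rpoisson (fun z => tsqrt K (normc (dil f (s n) z)) +
      K^-1 * normc (dil f (s n) z)) a)).
    apply: le_rpoisson => //.
    - by apply: rintg_sqrt => // z; exact: normc_ge0.
    - by apply: rintgD => //; exact: ti.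
    - by move=> z; apply: le_tsqrt => //; exact: normc_ge0.
  rewrite rpoissonD//; last exact: ti.
  rewrite lerD2l rpoissonZ// -Ke ler_pM2l ?invr_gt0//.
  apply: (@le_trans _ _ (2 / (1 - normc a) * \int[m]_z normc (dil f (s n) z))).
    rewrite -(RintegralZl _ measurableT (ni n)).
    apply: (@le_Rint R (fun z => pker a z * normc (dil f (s n) z))).
    - exact: rpoisson_intg.
    - exact: rintgZ.
    - by move=> z; rewrite ler_wpM2r ?normc_ge0// pker_le.
  rewrite ler_wpDr// ler_wpM2l ?divr_ge0 ?(ltW a0)//; exact: fM.
move=> /le_trans; apply; rewrite lerD2r; apply: le_rpoisson => //.
- exact: ti.
- by apply: rintg_sqrt => // z; exact: normc_ge0.
- by move=> z; exact: tsqrt_le.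
Qed.

(** Square the previous bound and expand the square of the distance to the
    mean, which is Jensen's inequality for the square. *)
Lemma hardy_le a : normc a < 1 -> normc (f a) <= rpoisson (fun z => normc (x z)) a.
Proof.
move=> a1; have := hardy_sqrt_le a1; set c := rpoisson _ a => h.
have qi : rintg m setT (fun z => Num.sqrt (normc (x z))).
  by apply: rintg_sqrt => // z; exact: normc_ge0.
have c0 : 0 <= c by apply: le_trans h; exact: sqrtr_ge0.
have : normc (f a) <= c ^+ 2.
  by rewrite -[leLHS]sqr_sqrtr ?normc_ge0// lerXn2r ?nnegrE ?sqrtr_ge0.
move=> /le_trans; apply.
have i1 : rintg m setT (fun z => (2 * c) * Num.sqrt (normc (x z))) by exact: rintgZ.
have i2 := rintg_cst (- c ^+ 2).
have -> : c ^+ 2 = rpoisson (fun z => (2 * c) * Num.sqrt (normc (x z)) + (- c ^+ 2)) a.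
  by rewrite rpoissonD// rpoissonZ// rpoisson_cst// -/c; ring.
apply: le_rpoisson => //; first exact: rintgD.
move=> z; rewrite -[leRHS](sqr_sqrtr (normc_ge0 _)).
have := sqr_ge0 (Num.sqrt (normc (x z)) - c); nra.
Qed.

End mean_bounded.

(** The Poisson integral is the real part of a holomorphic function. *)
Lemma rpoisson_mean k r : 0 < r < 1 -> rintg m setT k ->
  \int[m]_z rpoisson k (r%:C * (z : R[i])) = \int[m]_z k z.
Proof.
move=> r01 ki; have /andP[r0 r1] := r01.
have : \int[m]_z complex.Re (dil (herglotz k) r z) = complex.Re (herglotz k 0).
  by rewrite -(hdisc_mean (herglotz_holo ki) r01).
rewrite Re_herglotz ?normc_0// /rpoisson.
have -> : \int[m]_z (pker 0 z * k z) = \int[m]_z k z.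
  apply: eq_Rintegral => z _.
  by rewrite /pker normc_0 mul0r subr0 normc_1 expr0n expr1n subr0 divr1 mul1r.
move=> <-; apply: eq_Rintegral => z _.
by rewrite /dil Re_herglotz// normc_rz// ltW.
Qed.

Lemma rpoisson_rintg k r : 0 < r < 1 -> rintg m setT k ->
  rintg m setT (fun z => rpoisson k (r%:C * (z : R[i]))).
Proof.
move=> r01 ki; have /andP[r0 r1] := r01.
have [hi _] := dil_intg (herglotz_holo ki) r01.
rewrite (_ : (fun z => _) = (fun z => complex.Re (dil (herglotz k) r z)))//.
by apply/funext => z; rewrite /dil Re_herglotz// normc_rz// ltW.
Qed.

(** Scheffe's lemma: the circle means do not exceed that of the limit. *)
Lemma hardy_L1radial f x M : hdisc f -> measurable_fun setT x ->
  (forall r, 0 < r < 1 -> \int[m]_z normc (dil f r z) <= M) ->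
  {ae m, forall z, radial f z (x z)} -> cintg m setT x /\ L1radial f x.
Proof.
move=> hf mx fM fx; have xi := hardy_bv_intg hf mx fM fx; split=> //.
have nxi : rintg m setT (fun z => normc (x z)) by exact: cintg_norm.
have mean r : 0 < r < 1 -> \int[m]_z normc (dil f r z) <= \int[m]_z normc (x z).
  move=> r01; have /andP[r0 r1] := r01; rewrite -[leRHS](rpoisson_mean r01)//.
  apply: le_Rint; [by apply: cintg_norm => //; exact: dil_intg|exact: rpoisson_rintg|].
  by move=> z; apply: (hardy_le hf mx fM fx); rewrite normc_rz// ltW.
pose s n := rad R n.
have s01 n : 0 < s n < 1 := rad_itv R n.
have di n : cintg m setT (dil f (s n)) by exact: dil_intg.
have ni n : rintg m setT (fun z => normc (dil f (s n) z)) by exact: cintg_norm.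
have bi n : rintg m setT (fun z => normc (dil f (s n) z - x z)).
  by apply: cintg_norm => //; exact: cintgB.
pose g n z := normc (dil f (s n) z) - normc (dil f (s n) z - x z).
have gi n : rintg m setT (g n) by exact: rintgB.
have c : \int[m]_z g n z @[n --> \oo] --> \int[m]_z normc (x z).
  apply: (@Rint_dct R g _ (fun z => normc (x z))) => //.
  - by move=> n; exact: (rintg_meas (gi n)).
  - exact: (rintg_meas nxi).
  - apply: filterS fx => z /radial_rad h.
    rewrite -[X in _ --> X]subr0; apply: (@cvgB R R) => //.
    move/cvgrPdist_lt in h; apply/cvgrPdist_lt => e /h.
    apply: filterS => n; rewrite sub0r normrN ger0_norm ?normc_ge0//; apply: le_lt_trans.
    by rewrite normcB; exact: ler_dist_normc.
  - apply: aeW => z n; rewrite /g.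
    have := ler_dist_normc (dil f (s n) z) (dil f (s n) z - x z).
    by rewrite subKr.
move=> e r0 e0 r01.
move/cvgrPdist_lt : c => /(_ _ e0) h.
have [n [h1 h2]] := filter_ex (filterI h (rad_near r01)).
have /andP[n0 n1] := s01 n.
exists (s n); split => //; move: h1; rewrite /g (RintegralB measurableT (ni n) (bi n)).
have := mean _ (s01 n); move: (Rintegral _ _ _) (Rintegral _ _ _) (Rintegral _ _ _) => A B D AB.
rewrite ltr_norml => /andP[_]; lra.
Qed.

End hardy_one.

(** * Limits in mean *)

Section mean_limits.
Variable R : realType.
Local Notation C := (circle R).
Local Notation m := (circle_measure R).
Implicit Types (f g : R[i] -> R[i]) (z : C).

Lemma bounded_variation_cvg (a : nat -> R) (S : R) :
  (forall n, \sum_(0 <= k < n) `|a k.+1 - a k| <= S) -> cvgn a.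
Proof.
move=> aS; pose d k := a k.+1 - a k.
have cd : cvgn (series d).
  apply: normed_cvg; apply: nondecreasing_is_cvgn.
    by apply: nondecreasing_series => n _ _ /=.
  by exists S => _ [n _ <-]; exact: aS.
have -> : a = (fun n => a 0 + series d n).
  apply/funext => n; rewrite /series /= telescope_sumr//; ring.
by apply: (@is_cvgD R R) => //; exact: is_cvg_cst.
Qed.

Lemma sum_half n : \sum_(0 <= k < n) 2^-1 ^+ k = 2 - 2 * 2^-1 ^+ n :> R.
Proof.
elim: n => [|n IH]; first by rewrite big_nil expr0; ring.
by rewrite big_nat_recr//= IH exprS; field.
Qed.

(** The increments are summable almost everywhere, because their sum has a
    finite integral. *)
Lemma mean_limit (u : nat -> C -> R[i]) : (forall k, cintg m setT (u k)) ->
  (forall k, \int[m]_z normc (u k.+1 z - u k z) <= 2^-1 ^+ k) ->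
  exists x, [/\ cintg m setT x,
    {ae m, forall z, ccvg \oo (fun k => u k z) (x z)} &
    \int[m]_z normc (u k z - x z) @[k --> \oo] --> (0 : R)].
Proof.
move=> ui du.
pose d k z : R := normc (u k.+1 z - u k z).
have dint k : rintg m setT (d k) by apply: cintg_norm => //; exact: cintgB.
have mu k : measurable_fun setT (u k) by exact: cintg_meas.
pose S z : \bar R := (\sum_(0 <= k <oo) (d k z)%:E)%E.
have d0 k z : setT z -> (0 <= (d k z)%:E)%E by rewrite lee_fin normc_ge0.
have md k : measurable_fun setT (fun z => (d k z)%:E).
  by apply/measurable_EFinP; exact: (rintg_meas (dint k)).
have S0 z : (0 <= S z)%E by apply: nneseries_ge0 => k _ _; exact: d0.
have mS : measurable_fun setT S.
  by apply: ge0_emeasurable_sum => [n z hz _|n _]; [exact: d0|exact: md].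
have Si : m.-integrable setT S.
  apply/integrableP; split=> //.
  under eq_integral do rewrite gee0_abs//.
  rewrite integral_nneseries//; apply: (@le_lt_trans _ _ 2%:E); last exact: ltry.
  apply: lime_le; first by apply: is_cvg_nneseries => k _ _; apply: integral_ge0 => z; exact: d0.
  apply: nearW => n; apply: (@le_trans _ _ (\sum_(0 <= k < n) (2^-1 ^+ k)%:E)%E).
    apply: lee_sum => k _; have := du k; rewrite -lee_fin /Rintegral fineK//.
    exact: integrable_fin_num (dint k).
  rewrite sumEFin sum_half lee_fin; have : 0 <= 2^-1 ^+ n :> R by exact: exprn_ge0.
  lra.
have Sfin := integrable_ae measurableT Si.
pose G z := fine (S z).
have Gi : rintg m setT G.
  apply: (le_integrable measurableT _ _ Si).
    by apply/measurable_EFinP; apply: measurableT_comp => //; exact: fine_measurable.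
  move=> z _ /=; rewrite /G; case: (S z) => //= *; exact: leey.
have partS z : S z \is a fin_num -> forall n, \sum_(0 <= k < n) d k z <= G z.
  move=> Sz n; rewrite -lee_fin /G fineK// -sumEFin.
  by apply: nneseries_lim_ge => k _ _; exact: d0.
have reim z : S z \is a fin_num -> cvgn (fun k => complex.Re (u k z)) /\
    cvgn (fun k => complex.Im (u k z)).
  move=> Sz; split; apply: (@bounded_variation_cvg _ (G z)) => n.
    apply: le_trans (partS _ Sz n); apply: ler_sum => k _.
    by rewrite /d -cReN -cReD; exact: ler_ReN.
  apply: le_trans (partS _ Sz n); apply: ler_sum => k _.
  by rewrite /d -cImN -cImD; exact: ler_ImN.
pose L (v : nat -> C -> R) z : R := fine (limn_esup (fun k => (v k z)%:E)).
have mL v : (forall k, measurable_fun setT (v k)) -> measurable_fun setT (L v).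
  move=> mv; apply: (measurableT_comp (f := @fine R)) => //.
  by apply: measurable_fun_limn_esup => k; apply/measurable_EFinP.
have LE v z : cvgn (v ^~ z) -> v ^~ z @ \oo --> L v z.
  move=> cv; have h : (fun k => (v k z)%:E) @ \oo --> (limn (v ^~ z))%:E.
    by apply: cvg_EFin => //; exact: nearW.
  by rewrite /L; have [_ ->] := cvg_limn_einf_sup h.
pose x z : R[i] := L (fun k z => complex.Re (u k z)) z +i* L (fun k z => complex.Im (u k z)) z.
have mx : measurable_fun setT x.
  apply: cmeas_ReIm => /=; apply: mL => k; [exact: cmeas_Re|exact: cmeas_Im].
have ux : {ae m, forall z, ccvg \oo (fun k => u k z) (x z)}.
  apply: filterS Sfin => z /(_ Logic.I) Sz; have [cr ci] := reim z Sz.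
  apply: ccvg_ReIm => /=; [exact: (LE (fun k z => complex.Re (u k z)))|].
  exact: (LE (fun k z => complex.Im (u k z))).
have bnd z : S z \is a fin_num -> forall j k, normc (u (k + j)%N z - u k z) <= G z.
  move=> Sz j k; apply: le_trans (partS _ Sz (k + j)%N).
  rewrite (big_cat_nat (n := k)) ?leq_addr//=.
  apply: ler_wpDl; first by apply: sumr_ge0 => i _; exact: normc_ge0.
  elim: j => [|j IH]; first by rewrite addn0 subrr normc_0 big_geq.
  rewrite addnS big_nat_recr ?leq_addr//=.
  apply: le_trans (normc_leD3 _ (u (k + j)%N z) _) _.
  by rewrite addrC lerD.
have xbnd : {ae m, forall z, forall k, normc (u k z - x z) <= G z}.
  apply: filterS2 Sfin ux => z /(_ Logic.I) Sz uz k.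
  apply/ler_addgt0Pl => e e0; have [N _ H] := uz _ e0.
  have := H (k + N)%N (leq_addl _ _) => /= h.
  apply: le_trans (normc_leD3 _ (u (k + N)%N z) _) _.
  by rewrite addrC lerD ?(ltW h)// normcB; exact: bnd.
have c : \int[m]_z normc (u k z - x z) @[k --> \oo] --> (0 : R).
  rewrite -(Rint_cst (0 : R)); apply: (@Rint_dct R _ _ G) => //.
  - by move=> k; exact: cmeas_nB.
  - by apply: filterS ux => z /ccvg0P.
  - apply: filterS xbnd => z h k; rewrite ger0_norm ?normc_ge0//.
exists x; split => //.
pose B z := normc (u 0%N z) + G z.
have ki : rintg m setT B.
  by apply: rintgD => //; exact: cintg_norm.
suff xi : rintg m setT (fun z => normc (x z)) by apply: (cintg_le mx _ xi).
apply/integrableP; split; first by apply/measurable_EFinP; exact: cmeas_normc.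
apply: (@le_lt_trans _ _ (\int[m]_z `|(EFin \o B) z|)%E).
  apply: ae_ge0_le_integral => //.
  - by apply: measurableT_comp => //; apply/measurable_EFinP; exact: cmeas_normc.
  - by apply: measurableT_comp => //; apply/measurable_EFinP; exact: (rintg_meas ki).
  - apply: filterS xbnd => z /(_ 0%N) h _ /=.
    rewrite lee_fin ger0_norm ?normc_ge0//; apply: le_trans (ler_norm _).
    apply: le_trans (normc_leDBr (u 0%N z) (x z)) _.
    by rewrite addrC lerD2l.
by have /integrableP[_] := ki.
Qed.

End mean_limits.

(** * Boundary values of outer functions *)

Section outer_boundary.
Variable R : realType.
Local Notation C := (circle R).
Local Notation m := (circle_measure R).
Implicit Types (g : R[i] -> R[i]) (u x : C -> R[i]) (k l : C -> R) (r s : R) (z : C).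

Definition norm2 u : R := \int[m]_z normc (u z) ^+ 2.

Lemma norm2_intg u (M : R) : measurable_fun setT u -> (forall z, normc (u z) <= M) ->
  rintg m setT (fun z => normc (u z) ^+ 2).
Proof.
move=> mu uM; apply: (@rintg_le _ _ _ _ _ _ (fun=> M ^+ 2)) => //; last exact: rintg_cst.
  by apply: measurable_funX; exact: cmeas_normc.
move=> z _; rewrite ger0_norm ?exprn_ge0 ?normc_ge0//.
by rewrite lerXn2r ?nnegrE ?normc_ge0// (le_trans (normc_ge0 (u z))).
Qed.

Lemma dil_bounded g r : hdisc g -> 0 < r < 1 -> exists M : R, forall z, normc (dil g r z) <= M.
Proof.
move=> hg r01; have /andP[r0 r1] := r01; have [M _ H] := hdisc_bounded hg r01.
by exists M => z; apply: H; rewrite normc_rz// ltW.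
Qed.

(** The inner product of two dilations depends only on the product of the
    radii, because [z |-> g z * (g (r s / z^* ))^*] is holomorphic in an annulus. *)
Lemma dil_inner g r s : hdisc g -> 0 < r < 1 -> 0 < s < 1 ->
  cint m setT (fun z => dil g s z * conjc (dil g r z)) = (norm2 (dil g (Num.sqrt (r * s))))%:C.
Proof.
move=> hg /andP[r0 r1] /andP[s0 s1].
have q0 : 0 < r * s by rewrite mulr_gt0.
set p := Num.sqrt (r * s); have p0 : 0 < p by rewrite sqrtr_gt0.
have pp : p ^+ 2 = r * s by rewrite sqr_sqrtr// ltW.
have p1 : p < 1 by rewrite -sqrtr1 ltr_sqrt//; nra.
pose G := fun z : R[i] => g z * conjc (g ((r * s)%:C / conjc z)).
have hG (z : R[i]) : r * s < normc z < 1 -> holo G z.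
  move=> /andP[z0 z1]; apply: holoM; first exact: hg.
  have nz : 0 < normc z by exact: lt_trans q0 z0.
  apply: (holo_conj (f := fun v => g ((r * s)%:C / v))).
  apply: (holo_comp (f := g) (g := fun v => (r * s)%:C / v)).
    apply: holoM; first exact: holo_cst.
    by apply: holo_inv; rewrite -normc_gt0 normc_conjc.
  apply: hg; rewrite normcM normcV normc_conjc normc_rC ?ltW//.
  by rewrite ltr_pdivrMr// mul1r.
have dz (t t' : R) z : 0 < t -> r * s = t * t' ->
    (r * s)%:C / conjc (t%:C * (z : R[i])) = t'%:C * z.
  move=> t0 ->; have tC : t%:C != 0 by rewrite -normc_gt0 normc_rC// ltW.
  have zC : (z : R[i]) != 0 by exact: circle_neq0.
  have -> : conjc (t%:C * (z : R[i])) = t%:C * (z : R[i])^-1.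
    by rewrite conjcM circle_conj; congr (_ * _); exact: conjc_real.
  rewrite rmorphM/=; field; apply/andP; split => //.
have i1 : r * s < s < 1 by apply/andP; split => //; nra.
have i2 : r * s < p < 1 by apply/andP; split => //; nra.
transitivity (cint m setT (fun z : C => G (s%:C * (z : R[i])))).
  by apply: eq_cint => z _; rewrite /G (dz s r)// mulrC.
rewrite (annulus_mean (ltW q0) hG i1 i2) /norm2 -cint_real.
apply: eq_cint => z _; rewrite /G (dz p p)//.
by rewrite mulc_conjc.
Qed.

(** Expand the square and use [dil_inner] for the cross term. *)
Lemma dil_dist2 g r s : hdisc g -> 0 < r < 1 -> 0 < s < 1 ->
  norm2 (fun z => dil g s z - dil g r z) =
  norm2 (dil g s) + norm2 (dil g r) - 2 * norm2 (dil g (Num.sqrt (r * s))).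
Proof.
move=> hg r01 s01.
have [M HM] := dil_bounded hg r01; have [M' HM'] := dil_bounded hg s01.
have mr := dil_meas hg r01; have ms := dil_meas hg s01.
have ir := norm2_intg mr HM; have iS := norm2_intg ms HM'.
have ci : cintg m setT (fun z => dil g s z * conjc (dil g r z)).
  apply: (cintg_bddM ms HM'); apply: cintg_conjc; exact: dil_intg.
have [ri _] := ci.
have i3 : rintg m setT (fun z => - 2 * complex.Re (dil g s z * conjc (dil g r z))).
  exact: rintgZ.
have i4 := rintgD measurableT iS ir.
have E := congr1 (@complex.Re R) (dil_inner hg r01 s01).
have {}E : \int[m]_z complex.Re (dil g s z * conjc (dil g r z)) =
  norm2 (dil g (Num.sqrt (r * s))) by exact: E.
rewrite -E -mulNr /norm2 -(RintegralZl _ measurableT ri) -(RintegralD measurableT iS ir).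
rewrite -(RintegralD measurableT i4 i3); apply: eq_Rintegral => z _.
move: (dil g s z) (dil g r z) => [a b] [a' b'].
rewrite !normc_sqr /=; ring.
Qed.

Lemma norm1_le2 u (e : R) : 0 <= e -> cintg m setT u -> rintg m setT (fun z => normc (u z) ^+ 2) ->
  norm2 u <= e ^+ 2 -> \int[m]_z normc (u z) <= e.
Proof.
move=> e0 ui u2; have ni := cintg_norm measurableT ui.
set c := \int[m]_z normc (u z) => h.
suff : c ^+ 2 <= e ^+ 2.
  have c0 : 0 <= c by apply: Rintegral_ge0 => z _; exact: normc_ge0.
  by rewrite ler_sqr ?nnegrE.
apply: le_trans h.
have i1 : rintg m setT (fun z => (2 * c) * normc (u z)) by exact: rintgZ.
have i2 := rintg_cst (- c ^+ 2).
rewrite -subr_ge0; have : 0 <= \int[m]_z (normc (u z) ^+ 2 - (2 * c * normc (u z) + (- c ^+ 2))).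
  by apply: Rintegral_ge0 => z _; have := sqr_ge0 (normc (u z) - c); nra.
have i3 := rintgD measurableT i1 i2.
rewrite (RintegralB measurableT u2 i3) (RintegralD measurableT i1 i2).
rewrite (RintegralZl _ measurableT ni) Rint_cst -/c /norm2; move=> h.
by apply: le_trans h _; rewrite le_eqVlt; apply/orP; left; apply/eqP; ring.
Qed.

Section outer.
Variables (k : C -> R) (K : R).
Hypotheses (mk : measurable_fun setT k) (kK : forall z, `|k z| <= K).

Let ki : rintg m setT k.
Proof. by apply: (@rintg_le _ _ _ _ _ _ (fun=> K)) => //; exact: rintg_cst. Qed.

Let g := outer k.
Let hg : hdisc g. Proof. exact: outer_holo. Qed.

Let gK a : normc a < 1 -> normc (g a) <= expR K.
Proof.
move=> a1; rewrite normc_outer// ler_expR -(rpoisson_cst K a1); apply: le_rpoisson => //.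
  exact: rintg_cst.
by move=> z; apply: le_trans (kK z); exact: ler_norm.
Qed.

Let cvg_seq (t : nat -> R) : (forall n, 0 < t n < 1) -> (forall n, rad R n <= t n) ->
  {ae m, forall z, normc (dil g (t n) z) @[n --> \oo] --> expR (k z)}.
Proof.
move=> t01 tr; apply: filterS (rpoisson_radial ki) => z h.
rewrite (_ : (fun n => _) = (fun n => expR (rpoisson k ((t n)%:C * (z : R[i]))))); last first.
  apply/funext => n; rewrite /dil normc_outer// normc_rz; have /andP[t0 t1] := t01 n => //.
  exact: ltW.
apply: continuous_cvg; first exact: continuous_expR.
apply/cvgrPdist_lt => e /h[r0 r01 H]; apply: filterS (rad_near r01) => n rn.
have /andP[n0 n1] := t01 n; rewrite distrC; apply: H => //; first exact: ltW.
exact: lt_le_trans rn (tr n).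
Qed.

Let L := \int[m]_z expR (k z) ^+ 2.

Let norm2_lim (e : R) : 0 < e -> exists2 r0 : R, r0 < 1 &
  forall r, 0 < r -> r0 < r -> r < 1 -> `|norm2 (dil g r) - L| < e.
Proof.
move=> e0; apply: contrapT => nH.
have /choice[t tP] : forall n, exists r, [/\ 0 < r < 1, rad R n <= r & e <= `|norm2 (dil g r) - L|].
  move=> n; apply: contrapT => nr; apply: nH; exists (rad R n).
    by have /andP[] := rad_itv R n.
  move=> r r0 rn r1; rewrite ltNge; apply/negP => h; apply: nr.
  by exists r; split=> //; [rewrite r0|exact: ltW].
have t01 n : 0 < t n < 1 by have [] := tP n.
have c : norm2 (dil g (t n)) @[n --> \oo] --> L.
  apply: (@Rint_dct R (fun n z => normc (dil g (t n) z) ^+ 2) _ (fun=> expR K ^+ 2)).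
  - by move=> n; apply: measurable_funX; apply: cmeas_normc; exact: dil_meas.
  - by apply: measurable_funX; apply: measurableT_comp.
  - apply: filterS (cvg_seq t01 (fun n => let: And3 _ h _ := tP n in h)) => z h.
    rewrite expr2 (_ : (fun n => _) = (fun n => normc (dil g (t n) z) * normc (dil g (t n) z))).
      exact: (@cvgM R).
    by apply/funext => n; rewrite expr2.
  - exact: rintg_cst.
  - apply: aeW => z n; rewrite ger0_norm ?exprn_ge0 ?normc_ge0//.
    rewrite lerXn2r ?nnegrE ?normc_ge0 ?expR_ge0// gK// normc_rz; have /andP[t0 t1] := t01 n => //.
    exact: ltW.
move/cvgrPdist_lt : c => /(_ _ e0) [N _ H].
have := H N (leqnn N); rewrite /= distrC ltNge; have [_ _ ->] := tP N; by [].
Qed.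

(** By [dil_dist2] the dilations of the outer function are Cauchy in mean
    square, because their square means converge. The limit in mean has no
    Fourier coefficients of negative index and inherits the modulus. *)
Lemma outer_boundary : exists x, [/\ cintg m setT x,
  forall n, (0 < n)%N -> cmoment x n = 0 & {ae m, forall z, normc (x z) = expR (k z)}].
Proof.
pose e n : R := (2^-1 ^+ n) ^+ 2 / 4.
have h0 n : 0 < 2^-1 ^+ n :> R by rewrite exprn_gt0// invr_gt0.
have e0 n : 0 < e n by rewrite divr_gt0// exprn_gt0.
have /choice[t tP] n : exists r0, r0 < 1 /\
    forall r, 0 < r -> r0 < r -> r < 1 -> `|norm2 (dil g r) - L| < e n.
  by have [r0 ? ?] := norm2_lim (e0 n); exists r0.
have [T [T1 tT rT TS]] : exists T : nat -> R, [/\ forall n, T n < 1,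
    forall n, t n <= T n, forall n, rad R n <= T n & forall n, T n <= T n.+1].
  pose T := fix T n := Num.max (Num.max (t n) (rad R n)) (if n is p.+1 then T p else 0).
  exists T; split=> n.
  - have tr j : Num.max (t j) (rad R j) < 1.
      by rewrite gt_max; have [-> _] := tP j; have /andP[_ ->] := rad_itv R j.
    by elim: n => [|n IH]; rewrite /= gt_max tr /=.
  - by case: n => [|n] /=; rewrite !le_max lexx.
  - by case: n => [|n] /=; rewrite !le_max lexx !orbT.
  - by rewrite /= !le_max lexx !orbT.
have T0 n : 0 < T n by apply: lt_le_trans (rT n); have /andP[] := rad_itv R n.
have [r [rg r1]] : exists r : nat -> R, (forall n, T n < r n) /\ (forall n, r n < 1).
  by exists (fun n => (T n + 1) / 2); split=> n; have := T1 n; lra.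
have r01 n : 0 < r n < 1 by rewrite r1 (lt_trans (T0 n) (rg n)).
have rrad n : rad R n <= r n by rewrite (le_trans (rT n))// ltW.
have near_ n s : T n < s -> s < 1 -> `|norm2 (dil g s) - L| < e n.
  move=> Ts s1; have [_ H] := tP n; apply: H => //.
    exact: lt_trans (T0 n) Ts.
  exact: le_lt_trans (tT n) Ts.
have di n : cintg m setT (dil g (r n)) by exact: dil_intg.
have alg (A B D q l : R) : `|A - l| < q -> `|B - l| < q -> `|D - l| < q ->
    B + A - 2 * D <= 4 * q.
  by rewrite !ltr_norml => /andP[a1 a2] /andP[b1 b2] /andP[d1 d2]; lra.
have dist n : \int[m]_z normc (dil g (r n.+1) z - dil g (r n) z) <= 2^-1 ^+ n.
  have [M HM] := dil_bounded hg (r01 n); have [M' HM'] := dil_bounded hg (r01 n.+1).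
  apply: norm1_le2; [exact: ltW|exact: cintgB| |].
    apply: (norm2_intg (M := M' + M)).
      by apply: cmeasB; exact: dil_meas.
    by move=> z; apply: le_trans (le_normcD _ _) _; rewrite normcN lerD.
  rewrite dil_dist2//.
  have Tn1 : T n < r n.+1 by exact: le_lt_trans (TS n) (rg n.+1).
  have Tp : T n < Num.sqrt (r n * r n.+1).
    rewrite -[T n]ger0_norm ?(ltW (T0 n))// -sqrtr_sqr ltr_sqrt.
      have := rg n; have := T0 n; nra.
    by have /andP[] := r01 n; have /andP[] := r01 n.+1; nra.
  have p1 : Num.sqrt (r n * r n.+1) < 1.
    rewrite -sqrtr1 ltr_sqrt//; have := r1 n; have := r1 n.+1.
    by have /andP[] := r01 n; have /andP[] := r01 n.+1; nra.
  have e4 : (2^-1 ^+ n) ^+ 2 = 4 * e n by rewrite /e mulrC divfK// pnatr_eq0.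
  have h1 := near_ n _ (rg n) (r1 n); have h2 := near_ n _ Tn1 (r1 n.+1).
  have h3 := near_ n _ Tp p1.
  rewrite e4; exact: (alg _ _ _ _ _ h1 h2 h3).
have [x [xi xae xL]] := mean_limit di dist.
exists x; split => //.
  have lx : L1radial g x.
    move=> d r0 d0 r01'; move/cvgrPdist_lt : xL => /(_ _ d0) h.
    have [n [h1 h2]] := filter_ex (filterI h (rad_near r01')).
    exists (r n); split => //; first by have /andP[] := r01 n.
      exact: lt_le_trans h2 (rrad n).
    by move: h1; rewrite sub0r normrN; apply: le_lt_trans; exact: ler_norm.
  by move=> n n0; exact: (L1radial_moment hg xi lx n0).
apply: filterS2 xae (cvg_seq r01 rrad) => z h1 h2.
exact: (cvg_unique _ (ccvg_norm h1) h2).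
Qed.

End outer.

End outer_boundary.

(** * Hardy spaces on the circle *)

Section L0_pointwise.
Variable R : realType.
Local Notation C := (circle R).
Local Notation m := (circle_measure R).
Local Notation L := (L0 m).
Implicit Types (x y w : L) (c : R[i]) (u v : C -> R[i]) (z : C).

Lemma L0D x y : {ae m, forall z, (x + y : L) z = x z + y z}.
Proof. exact: mkL0E. Qed.

Lemma L0Z c x : {ae m, forall z, (c *: x : L) z = c * x z}.
Proof. exact: mkL0E. Qed.

Lemma L0_0 : {ae m, forall z, (0 : L) z = 0}.
Proof. exact: (mkL0E m (@measurable_cst _ _ C R[i] setT 0)). Qed.

Lemma L0N x : {ae m, forall z, (- x : L) z = - x z}.
Proof. by rewrite -scaleN1r; apply: filterS (L0Z (-1) x) => z ->; rewrite mulN1r. Qed.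

Lemma L0B x y : {ae m, forall z, (x - y : L) z = x z - y z}.
Proof. by apply: filterS2 (L0D x (- y)) (L0N y) => z -> ->. Qed.

Lemma L0M x y : {ae m, forall z, mulL0 x y z = x z * y z}.
Proof. exact: mkL0E. Qed.

Lemma L0rot (a : C) x : {ae m, forall z, rotation_op a x z = x (rotation a z)}.
Proof. exact: mkL0E. Qed.

Lemma L0_meas x : measurable_fun setT (x : C -> R[i]).
Proof. exact: measurable_funPT. Qed.

Lemma ae_rot (P : C -> Prop) (a : C) : {ae m, forall z, P z} -> {ae m, forall z, P (rotation a z)}.
Proof. exact: ae_rotation. Qed.

Lemma ae_Rint (f g : C -> R) : measurable_fun setT f -> measurable_fun setT g ->
  {ae m, forall z, f z = g z} -> \int[m]_z f z = \int[m]_z g z.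
Proof.
move=> mf mg fg; congr fine; apply: ae_eq_integral => //; try exact/measurable_EFinP.
by apply: filterS fg => z -> _.
Qed.

Lemma ae_rintg (f g : C -> R) : measurable_fun setT f -> rintg m setT g ->
  {ae m, forall z, `|f z| <= `|g z|} -> rintg m setT f.
Proof.
move=> mf /integrableP[mg gi] fg; apply/integrableP; split; first exact/measurable_EFinP.
apply: le_lt_trans gi; apply: ae_ge0_le_integral => //.
- by apply: measurableT_comp => //; exact/measurable_EFinP.
- exact: measurableT_comp.
- by apply: filterS fg => z h _; rewrite /= lee_fin.
Qed.

Lemma ae_le_Rint (f g : C -> R) : rintg m setT f -> rintg m setT g ->
  {ae m, forall z, f z <= g z} -> \int[m]_z f z <= \int[m]_z g z.
Proof.
move=> fi gi fg; have mf := rintg_meas fi; have mg := rintg_meas gi.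
pose h z := Num.min (f z) (g z).
have mh : measurable_fun setT h by exact: measurable_minr.
have fh : {ae m, forall z, h z = f z}.
  by apply: filterS fg => z; rewrite /h => /min_idPl.
have hi : rintg m setT h by apply: (ae_rintg mh fi); apply: filterS fh => z ->.
rewrite -(ae_Rint mh mf fh); apply: le_Rint => // z.
by rewrite /h ge_min lexx orbT.
Qed.

Lemma ae_cintg u v : measurable_fun setT u -> cintg m setT v ->
  {ae m, forall z, u z = v z} -> cintg m setT u.
Proof.
move=> mu [ri ii] uv; split.
  by apply: (ae_rintg _ ri); [exact: cmeas_Re|apply: filterS uv => z ->].
by apply: (ae_rintg _ ii); [exact: cmeas_Im|apply: filterS uv => z ->].
Qed.

Lemma ae_cint u v : measurable_fun setT u -> measurable_fun setT v ->
  {ae m, forall z, u z = v z} -> cint m setT u = cint m setT v.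
Proof.
move=> mu mv uv; apply: complexP => /=; apply: ae_Rint.
all: try (exact: cmeas_Re || exact: cmeas_Im).
all: by apply: filterS uv => z ->.
Qed.

Lemma Lone_cintg x : Lone R x <-> cintg m setT x.
Proof.
have mx := L0_meas x; have mn := cmeas_normc mx; split=> [h|xi].
  apply: (cintg_le mx (fun z => lexx _)); apply/integrableP; split.
    exact/measurable_EFinP.
  by apply: le_lt_trans h; rewrite le_eqVlt; apply/orP; left; apply/eqP;
    apply: eq_integral => z _; rewrite /= ger0_norm ?normc_ge0.
have /integrableP[_] := cintg_norm measurableT xi; apply: le_lt_trans.
rewrite le_eqVlt; apply/orP; left; apply/eqP.
by apply: eq_integral => z _; rewrite /= ger0_norm ?normc_ge0.
Qed.

Lemma ae_cintg_le u (f : C -> R) : measurable_fun setT u -> rintg m setT f ->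
  {ae m, forall z, normc (u z) <= f z} -> cintg m setT u.
Proof.
move=> mu fi uf; have ni : rintg m setT (fun z => normc (u z)).
  apply: (ae_rintg _ fi); first exact: cmeas_normc.
  apply: filterS uf => z h; rewrite ger0_norm ?normc_ge0//.
  exact: le_trans h (ler_norm _).
exact: (cintg_le mu (fun z => lexx _) ni).
Qed.

Lemma Linfty_cintg x : Linfty R x -> cintg m setT x.
Proof.
move=> [M xM]; apply: (ae_cintg_le (L0_meas x) (rintg_cst M)); exact: xM.
Qed.

Definition norm1 x : R := \int[m]_z normc (x z).

Lemma norm1_ge0 x : 0 <= norm1 x.
Proof. by apply: Rintegral_ge0 => z _; exact: normc_ge0. Qed.

Lemma cmoment_ae u v n : measurable_fun setT u -> measurable_fun setT v ->
  {ae m, forall z, u z = v z} -> cmoment u n = cmoment v n.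
Proof.
move=> mu mv uv; apply: ae_cint.
- by apply: measurable_complexM => //; exact: cmeas_circleX.
- by apply: measurable_complexM => //; exact: cmeas_circleX.
- by apply: filterS uv => z ->.
Qed.

Lemma normc_cmoment u n : cintg m setT u -> normc (cmoment u n) <= \int[m]_z normc (u z).
Proof.
move=> ui; apply: le_trans (ler_norm_cint _ (cmoment_intg n ui)) _ => //.
apply: le_Rint; [|exact: cintg_norm|].
  by apply: cintg_norm => //; exact: cmoment_intg.
by move=> z; rewrite normcM normc_circleX mul1r.
Qed.

Lemma cmomentB u v n : cintg m setT u -> cintg m setT v ->
  cmoment (fun z => u z - v z) n = cmoment u n - cmoment v n.
Proof.
move=> ui vi; rewrite /cmoment -cintB//; [|exact: cmoment_intg|exact: cmoment_intg].
by apply: eq_cint => z _; rewrite mulrBr.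
Qed.

Lemma cmomentD u v n : cintg m setT u -> cintg m setT v ->
  cmoment (fun z => u z + v z) n = cmoment u n + cmoment v n.
Proof.
move=> ui vi; rewrite /cmoment -cintD//; [|exact: cmoment_intg|exact: cmoment_intg].
by apply: eq_cint => z _; rewrite mulrDr.
Qed.

Lemma cmomentZ c u n : cintg m setT u -> cmoment (fun z => c * u z) n = c * cmoment u n.
Proof.
move=> ui; rewrite /cmoment -cintZ//; last exact: cmoment_intg.
by apply: eq_cint => z _; rewrite mulrCA.
Qed.

Lemma at_leftP (P : R -> Prop) : (\forall r \near (1 : R)^'-, P r) <->
  exists2 r0 : R, r0 < 1 & forall r, r0 < r -> r < 1 -> P r.
Proof.
split=> [|[r0 r1 H]].
  rewrite near_withinE => /nbhs_ballP[e /= e0 H]; exists (1 - e); first by rewrite ltrBlDr ltrDl.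
  move=> r rr r1; apply: H => //; rewrite /ball /= ger0_norm ?subr_ge0 ?(ltW r1)//.
  by rewrite ltrBlDr -ltrBlDl.
near=> r; apply: H => //.
Unshelve. all: by end_near.
Qed.

Lemma radialP (f : R[i] -> R[i]) z c :
  f (r%:C * circle_val z) @[r --> (1 : R)^'-] --> c <-> radial f z c.
Proof.
split=> [/ccvgP h e e0|h].
  have /at_leftP[r0 r01 H] := h _ e0.
  by exists r0 => // r rg rr r1; exact: H.
apply/ccvgP => e e0; have [r0 r01 H] := h _ e0.
apply/at_leftP; exists (Num.max 0 r0); first by rewrite gt_max ltr01.
by move=> r; rewrite gt_max => /andP[rg rr] r1; apply: H => //; exact: ltW.
Qed.

Lemma holomorphic_discP f : holomorphic_disc f <-> hdisc (f : R[i] -> R[i]).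
Proof.
have E (z : R[i]) : (`|z| < 1) = (normc z < 1).
  by exact: normr_lt1.
by split=> h z z1; apply/holoP; apply: h; move: z1; rewrite E.
Qed.

Lemma boundary_valueP f x : boundary_value f x <-> {ae m, forall z, radial f z (x z)}.
Proof. by split=> h; apply: filterS h => z /radialP. Qed.

Lemma hardy1_L1radial f x : hardy1 f -> boundary_value f x ->
  [/\ hdisc f, cintg m setT x & L1radial f x].
Proof.
move=> [/holomorphic_discP hf [M fM]] /boundary_valueP fx.
have [] := @hardy_L1radial R f x M hf (L0_meas x) _ fx; last by split.
move=> r /andP[r0 r1]; have r01 : 0 <= r < 1 by rewrite ltW.
have r01' : 0 < r < 1 by rewrite r0.
have := fM _ r01; rewrite -lee_fin /Rintegral fineK//.
exact: integrable_fin_num (cintg_norm measurableT (dil_intg hf r01')).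
Qed.

(** If the Fourier coefficients of negative index vanish, then the Poisson
    integral is the Cauchy integral: it is holomorphic, its circle means are
    bounded by that of the boundary function, and Fatou's theorem gives the
    boundary values. *)
Lemma H1P x : H1 R x <-> cintg m setT x /\ forall n, (0 < n)%N -> cmoment x n = 0.
Proof.
split=> [[f f1 fx]|[xi x0]].
  have [hf xi fl] := hardy1_L1radial f1 fx.
  by split=> // n n0; exact: L1radial_moment hf xi fl n0.
have nxi := cintg_norm measurableT xi.
have hx := cauchy_holo xi.
have cp a : normc a < 1 -> cauchy x a = poisson x a by move=> a1; rewrite poisson_cauchy.
exists (cauchy x).
  split; first exact/holomorphic_discP.
  exists (Num.max (normc (cauchy x 0)) (norm1 x)) => r /andP[r0 r1].
  have [rE|rn] := eqVneq r 0.
    rewrite rE; under eq_integral do rewrite mul0r.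
    rewrite integral_cst//= [X in (_ * X)%E](@circle_measureT R) mule1 lee_fin le_max lexx//.
  have r01 : 0 < r < 1 by rewrite lt0r rn r0.
  have di := dil_intg hx r01; have ni := cintg_norm measurableT di.
  have -> : (\int[m]_z (normc (cauchy x (r%:C * circle_val z)))%:E)%E =
      (\int[m]_z normc (dil (cauchy x) r z))%:E.
    by rewrite /Rintegral fineK//; exact: integrable_fin_num ni.
  rewrite lee_fin le_max /norm1 -[X in _ || (_ <= X)](rpoisson_mean r01)//.
  apply/orP; right; apply: le_Rint => //; first exact: rpoisson_rintg.
  move=> z; have z1 : normc (r%:C * (z : R[i])) < 1 by rewrite normc_rz.
  by have -> : dil (cauchy x) r z = _ := cp _ z1; exact: normc_poisson_le.
apply/boundary_valueP; apply: filterS (poisson_radial xi) => z h e /h[r0 r01 H].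
by exists r0 => // r rg rr r1; rewrite cp ?normc_rz//; exact: H.
Qed.

Lemma hardy_infty_L1radial f x : hardy_infty f -> boundary_value f x ->
  [/\ hdisc f, cintg m setT x, L1radial f x & Linfty R x].
Proof.
move=> [/holomorphic_discP hf [M fM]] /boundary_valueP fx.
have E (z : R[i]) : (`|z| < 1) = (normc z < 1) by exact: normr_lt1.
have fM' (z : R[i]) : normc z < 1 -> normc (f z) <= M by move=> z1; apply: fM; rewrite E.
have xM : Linfty R x by exists M; apply: filterS fx => z h; exact: radial_normc_le h fM'.
split => //; first exact: Linfty_cintg.
exact: (bdd_L1radial hf (L0_meas x) fM' fx).
Qed.

Lemma HinftyE : Hinfty R = H1 R `&` Linfty R.
Proof.
apply/seteqP; split=> [x [f fh fx]|x [/H1P[xi x0] [M xM]]].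
  have [hf xi fl xb] := hardy_infty_L1radial fh fx; split=> //.
  by apply/H1P; split=> // n n0; exact: L1radial_moment hf xi fl n0.
have hx := cauchy_holo xi; have nxi := cintg_norm measurableT xi.
have cp a : normc a < 1 -> cauchy x a = poisson x a by move=> a1; rewrite poisson_cauchy.
exists (cauchy x).
  split; first exact/holomorphic_discP.
  exists M => a; rewrite normr_lt1 => a1.
  rewrite cp//; apply: le_trans (normc_poisson_le a1 xi) _.
  rewrite -[leRHS](rpoisson_cst M a1); apply: ae_le_Rint.
  - exact: rpoisson_intg.
  - by apply: rpoisson_intg => //; exact: rintg_cst.
  - by apply: filterS xM => z h; rewrite ler_wpM2l ?pker_ge0.
apply/boundary_valueP; apply: filterS (poisson_radial xi) => z h e /h[r0 r01 H].
by exists r0 => // r rg rr r1; rewrite cp ?normc_rz//; exact: H.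
Qed.

(** The algebra acts on the Hardy space: products of boundary values are the
    boundary values of products. *)
Lemma H1_mul x y : Hinfty R x -> H1 R y -> H1 R (mulL0 x y) /\
  cint m setT (fun z => x z * y z) = cint m setT x * cint m setT y.
Proof.
move=> [f fh fx] [g gh gy].
have [hf xi fl [K xK]] := hardy_infty_L1radial fh fx.
have [hg yi gl] := hardy1_L1radial gh gy.
have [_ [M fM]] := fh; have [_ [N gN]] := gh.
have hfg : hdisc (fun z : R[i] => f z * g z) by move=> z z1; apply: holoM; [exact: hf|exact: hg].
have M0 : 0 <= M by apply: le_trans (fM 0 _); rewrite ?normc_ge0// normr0 ltr01.
have fgh : hardy1 (fun z : R[i] => f z * g z).
  split; first exact/holomorphic_discP.
  exists (M * N) => r r01; have /andP[r0 r1] := r01.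
  have mg : measurable_fun setT (fun z : C => (normc (g (r%:C * circle_val z)))%:E).
    apply/measurable_EFinP; have [->|rn] := eqVneq r 0.
      rewrite (_ : (fun _ => _) = fun=> normc (g 0)); first exact: measurable_cst.
      by apply/funext => z; rewrite mul0r.
    by apply: cmeas_normc; apply: (dil_meas hg); rewrite lt0r rn r0.
  apply: (@le_trans _ _ (\int[m]_z (M%:E * (normc (g (r%:C * circle_val z)))%:E))%E).
    apply: ge0_le_integral => //.
    - by move=> z _; rewrite lee_fin normc_ge0.
    - have [->|rn] := eqVneq r 0.
        rewrite (_ : (fun _ => _) = fun=> (normc (f 0 * g 0))%:E); first exact: measurable_cst.
        by apply/funext => z; rewrite mul0r.
      by apply/measurable_EFinP; apply: cmeas_normc; apply: (dil_meas hfg); rewrite lt0r rn r0.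
    - exact: measurable_funeM.
    - move=> z _; rewrite -EFinM lee_fin normcM ler_wpM2r ?normc_ge0//.
      by apply: fM; rewrite normr_lt1 normc_rz.
  rewrite ge0_integralZl//; last by move=> z _; rewrite lee_fin normc_ge0.
  by rewrite EFinM lee_wpmul2l// ?lee_fin//; exact: gN.
have fgb : boundary_value (fun z : R[i] => f z * g z) (mulL0 x y).
  move/boundary_valueP : fx => fx; move/boundary_valueP : gy => gy.
  suff h : {ae m, forall z, radial (fun z : R[i] => f z * g z) z (x z * y z)}.
    by apply/boundary_valueP; apply: filterS2 h (L0M x y) => z h ->.
  apply: filterS2 fx gy => z /radialP/ccvgP h1 /radialP/ccvgP h2.
  by apply/radialP/ccvgP; exact: ccvgM.
split; first by exists (fun z : R[i] => f z * g z).
have [_ mi ml] := hardy1_L1radial fgh fgb.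
have o1 : normc (0 : R[i]) < 1 by rewrite normc_0.
have c0 u : cauchy u 0 = cint m setT u.
  by apply: eq_cint => z _; rewrite /cker mul0r subr0 invr1 mul1r.
rewrite -(c0 x) -(c0 y) -(L1radial_cauchy hf xi fl o1) -(L1radial_cauchy hg yi gl o1).
rewrite (L1radial_cauchy hfg mi ml o1) c0; apply: ae_cint.
- by apply: measurable_complexM; exact: L0_meas.
- exact: L0_meas.
- by apply: filterS (L0M x y) => z ->.
Qed.

(** A dilation is bounded and close in mean. *)
Lemma Hinfty_dense y e : H1 R y -> 0 < e -> exists2 x, Hinfty R x & norm1 (y - x) < e.
Proof.
move=> [f fh fy] e0; have [hf yi fl] := hardy1_L1radial fh fy.
have [r [r0 _ r1 H]] := fl _ 0 e0 ltr01; have r01 : 0 < r < 1 by rewrite r0.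
have md := dil_meas hf r01; have [M HM] := dil_bounded hf r01.
pose x := mkL0 m md; have xE : {ae m, forall z, x z = dil f r z} := mkL0E m md.
have di := dil_intg hf r01; have xi := ae_cintg (L0_meas x) di xE.
exists x.
  rewrite HinftyE; split; last by exists M; apply: filterS xE => z ->.
  apply/H1P; split=> // n n0; rewrite (cmoment_ae n (L0_meas x) md xE).
  exact: hdisc_moment.
apply: le_lt_trans H; rewrite le_eqVlt; apply/orP; left; apply/eqP.
apply: ae_Rint.
- by apply: cmeas_normc; exact: L0_meas.
- by apply: cmeas_nB => //; exact: L0_meas.
- by apply: filterS2 (L0B y x) xE => z -> ->; rewrite normcB.
Qed.

(** The test functions of the spectral estimates: analytic, with a modulus
    that is concentrated on a given set. *)
Lemma outer_Hinfty (E : set C) d : measurable E -> 0 < d -> exists2 x, Hinfty R x &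
  {ae m, forall z, normc (x z) = if z \in E then 1 else d}.
Proof.
move=> mE d0; pose k z : R := if z \in E then 0 else ln d.
have mk : measurable_fun setT k.
  apply: measurable_fun_ifT => //.
  by apply: (measurable_fun_bool true); rewrite setTI (_ : _ @^-1` _ = E)//;
    apply/seteqP; split=> z /=; [exact: set_mem|exact: mem_set].
have kK z : `|k z| <= `|ln d| by rewrite /k; case: ifP => // _; rewrite normr0.
have [u [ui u0 uE]] := outer_boundary mk kK.
have mu := cintg_meas ui.
have xE : {ae m, forall z, mkL0 m mu z = u z} := mkL0E m mu.
have uk : {ae m, forall z, normc (mkL0 m mu z) = if z \in E then 1 else d}.
  apply: filterS2 uE xE => z h ->; rewrite h /k; case: ifP => _; first exact: expR0.
  by rewrite lnK.
exists (mkL0 m mu) => //; rewrite HinftyE; split; last first.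
  by exists (1 + d); apply: filterS uk => z ->; case: ifP => _; rewrite ?lerDl ?lerDr ?ltW.
apply/H1P; split; first exact: ae_cintg ui xE.
by move=> n n0; rewrite (cmoment_ae n (L0_meas _) mu xE) u0.
Qed.

End L0_pointwise.

(** * Normed subspaces and powers of operators *)

Section normed_subspaces.
Variables (R : realType) (V : lmodType R[i]) (E : subnormed V).
Local Notation N := (nnorm E).
Local Notation D := (carrier E).
Implicit Types (x y : V) (c : R[i]).

Definition normed := is_submodule D /\ is_norm E.

Definition nlim (u : nat -> V) (l : V) := forall e : R, 0 < e ->
  exists n0, forall n, (n0 <= n)%N -> N (u n - l) < e.

Hypothesis hE : normed.

Lemma nmem0 : D 0. Proof. by have [[]] := hE. Qed.

Lemma nmemZ c x : D x -> D (c *: x).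
Proof. by move=> xD; have [[d0 dl] _] := hE; rewrite -[_ *: _]addr0; exact: dl. Qed.

Lemma nmemD x y : D x -> D y -> D (x + y).
Proof. by move=> xD yD; have [[d0 dl] _] := hE; rewrite -[x]scale1r; exact: dl. Qed.

Lemma nmemN x : D x -> D (- x).
Proof. by move=> xD; rewrite -scaleN1r; exact: nmemZ. Qed.

Lemma nmemB x y : D x -> D y -> D (x - y).
Proof. by move=> xD yD; apply: nmemD => //; exact: nmemN. Qed.

Lemma nmem_sum n (F : nat -> V) : (forall i, D (F i)) -> D (\sum_(0 <= i < n) F i).
Proof.
move=> FD; elim: n => [|n IH]; first by rewrite big_geq//; exact: nmem0.
by rewrite big_nat_recr//=; exact: nmemD.
Qed.

Lemma n_ge0 x : D x -> 0 <= N x.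
Proof. by have [_ []] := hE => h _ _ _; exact: h. Qed.

Lemma n_eq0 x : D x -> N x = 0 -> x = 0.
Proof. by have [_ []] := hE => _ h _ _; exact: h. Qed.

Lemma nZ c x : D x -> N (c *: x) = normc c * N x.
Proof. by have [_ []] := hE => _ _ h _; exact: h. Qed.

Lemma nD x y : D x -> D y -> N (x + y) <= N x + N y.
Proof. by have [_ []] := hE => _ _ _ h; exact: h. Qed.

Lemma n0 : N 0 = 0.
Proof. by rewrite -(scale0r (0 : V)) nZ ?normc_0 ?mul0r//; exact: nmem0. Qed.

Lemma nN x : D x -> N (- x) = N x.
Proof. by move=> xD; rewrite -scaleN1r nZ// normcN normc_1 mul1r. Qed.

Lemma nB x y : D x -> D y -> N (x - y) <= N x + N y.
Proof. by move=> xD yD; rewrite -(nN yD); apply: nD => //; exact: nmemN. Qed.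

Lemma nBC x y : D x -> D y -> N (x - y) = N (y - x).
Proof. by move=> xD yD; rewrite -opprB nN//; exact: nmemB. Qed.

Lemma n_tri x y z : D x -> D y -> D z -> N (x - z) <= N (x - y) + N (y - z).
Proof.
by move=> xD yD zD; rewrite -[x - z](subrKA y); apply: nD; exact: nmemB.
Qed.

Lemma n_leB x y : D x -> D y -> N x - N y <= N (x - y).
Proof.
by move=> xD yD; rewrite lerBlDr -{1}[x](subrK y); apply: nD => //; exact: nmemB.
Qed.

Lemma n_sum n (F : nat -> V) : (forall i, D (F i)) ->
  N (\sum_(0 <= i < n) F i) <= \sum_(0 <= i < n) N (F i).
Proof.
move=> FD; elim: n => [|n IH]; first by rewrite !big_geq// n0.
rewrite !big_nat_recr//=; apply: le_trans (nD _ _) _ => //; first exact: nmem_sum.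
by rewrite lerD2r.
Qed.

Lemma n_small x : D x -> (forall e : R, 0 < e -> N x <= e) -> x = 0.
Proof.
move=> xD h; apply: n_eq0 => //; apply/eqP; rewrite eq_le n_ge0// andbT.
by apply/ler_addgt0Pl => e e0; rewrite addr0; exact: h.
Qed.

Section contraction.
Hypothesis cE : is_complete E.
Variables (K : V -> V) (x0 : V).
Hypotheses (KD : forall x, D x -> D (K x)) (x0D : D x0).
Hypothesis K2 : forall x y, D x -> D y -> N (K x - K y) <= 2^-1 * N (x - y).

Let u n := iter n K x0.
Let uD n : D (u n). Proof. by elim: n => //= n; exact: KD. Qed.

Let step n : N (u n.+1 - u n) <= 2^-1 ^+ n * N (u 1%N - u 0%N).
Proof.
elim: n => [|n IH]; first by rewrite expr0 mul1r.
apply: le_trans (K2 (uD n.+1) (uD n)) _.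
by rewrite exprS -mulrA ler_wpM2l// invr_ge0.
Qed.

Let tail n j : N (u (n + j)%N - u n) <= 2^-1 ^+ n * N (u 1%N - u 0%N) * (2 - 2 * 2^-1 ^+ j).
Proof.
elim: j => [|j IH]; first by rewrite addn0 subrr n0 expr0 mulr1 subrr mulr0.
rewrite addnS; apply: le_trans (n_tri (uD _) (uD (n + j)%N) (uD _)) _.
apply: le_trans (lerD (step _) IH) _.
rewrite exprD [in X in _ <= X]exprS le_eqVlt; apply/orP; left; apply/eqP.
by field.
Qed.

(** Banach's fixed point theorem. The starting point and the convergence of
    the iterates are recorded because closed conditions pass to the fixed
    point. *)
Lemma contraction : exists2 x, D x & K x = x /\ nlim u x.
Proof.
pose d := N (u 1%N - u 0%N).
have d0 : 0 <= d by apply: n_ge0; exact: nmemB.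
have tl n j : N (u (n + j)%N - u n) <= 2^-1 ^+ n * (2 * d).
  apply: le_trans (tail n j) _; rewrite -mulrA ler_wpM2l ?exprn_ge0 ?invr_ge0//.
  rewrite mulrC ler_wpM2r// gerBl mulr_ge0// exprn_ge0// invr_ge0//.
have small (e : R) : 0 < e -> exists n0, forall n, (n0 <= n)%N -> 2^-1 ^+ n * (2 * d) < e.
  move=> e0; have : 2^-1 ^+ n @[n --> \oo] --> (0 : R).
    by apply: cvg_expr; rewrite ger0_norm ?invr_ge0// invf_lt1// ltr1n.
  have e' : 0 < e / (2 * d + 1) by rewrite divr_gt0// ltr_wpDl// mulr_ge0.
  move=> /cvgrPdist_lt/(_ _ e')[n0 _ H]; exists n0 => n /H /=.
  rewrite sub0r normrN ger0_norm ?exprn_ge0 ?invr_ge0// ltr_pdivlMr ?ltr_wpDl ?mulr_ge0//.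
  apply: le_lt_trans; rewrite ler_wpM2l ?exprn_ge0 ?invr_ge0// lerDl//.
have cau : forall e : R, 0 < e -> exists n0, forall p q, (n0 <= p)%N -> (n0 <= q)%N ->
    N (u p - u q) < e.
  move=> e e0; have e2 : 0 < e / 2 by rewrite divr_gt0.
  have [n0 H] := small _ e2; exists n0 => p q np nq.
  have hn := H _ (leqnn n0).
  apply: le_lt_trans (n_tri (uD p) (uD n0) (uD q)) _; rewrite [e]splitr ltrD//.
    by apply: le_lt_trans hn; rewrite -(subnKC np); exact: tl.
  rewrite nBC//; apply: le_lt_trans hn; rewrite -(subnKC nq); exact: tl.
have [l lD /cvgrPdist_lt ul] := cE uD cau.
have lim : nlim u l.
  move=> e /ul[n0 _ H]; exists n0 => n /H /=; rewrite sub0r normrN.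
  by apply: le_lt_trans; exact: ler_norm.
exists l => //; split => //; apply/eqP; rewrite -subr_eq0; apply/eqP.
apply: n_small => [|e e0]; first by apply: nmemB => //; exact: KD.
have e2 : 0 < e / 2 by rewrite divr_gt0.
have [n0 H] := lim _ e2; have h1 := H n0 (leqnn _); have h2 := H n0.+1 (leqnSn _).
apply: le_trans (n_tri (KD lD) (uD n0.+1) lD) _; rewrite [e]splitr lerD//; last exact: ltW.
apply: le_trans (K2 lD (uD n0)) _; rewrite nBC//.
have := n_ge0 (nmemB (uD n0) lD); lra.
Qed.

End contraction.

End normed_subspaces.

Section powers.
Variables (R : realType) (V : lmodType R[i]).
Implicit Types (E : subnormed V) (T W : V -> V) (x y : V) (lam : R[i]) (P : nat).

Definition lin T := forall (c : R[i]) x y, T (c *: x + y) = c *: T x + T y.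

Lemma lin0 T : lin T -> T 0 = 0.
Proof.
move=> lT; have := lT 1 0 0; rewrite !scale1r !addr0 => h.
by apply: (addIr (T 0)); rewrite add0r -h.
Qed.

Lemma linD T x y : lin T -> T (x + y) = T x + T y.
Proof. by move=> lT; have := lT 1 x y; rewrite !scale1r. Qed.

Lemma linZ T c x : lin T -> T (c *: x) = c *: T x.
Proof. by move=> lT; have := lT c x 0; rewrite !addr0 lin0// addr0. Qed.

Lemma linN T x : lin T -> T (- x) = - T x.
Proof. by move=> lT; rewrite -scaleN1r linZ// scaleN1r. Qed.

Lemma linB T x y : lin T -> T (x - y) = T x - T y.
Proof. by move=> lT; rewrite linD// linN. Qed.

Lemma lin_sum T n (F : nat -> V) : lin T ->
  T (\sum_(0 <= i < n) F i) = \sum_(0 <= i < n) T (F i).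
Proof.
move=> lT; elim: n => [|n IH]; first by rewrite !big_geq// lin0.
by rewrite !big_nat_recr//= linD// IH.
Qed.

Lemma lin_iter T n : lin T -> lin (iter n T).
Proof.
by move=> lT c x y; elim: n => [//|n IH]; rewrite !iterS IH lT.
Qed.

Lemma lin_lambda T lam : lin T -> lin (lambda_minus T lam).
Proof.
move=> lT c x y; rewrite /lambda_minus lT scalerDr scalerBr !scalerA (mulrC lam c).
by rewrite opprD addrACA.
Qed.

Lemma mem_iter E T n x : (forall x, carrier E x -> carrier E (T x)) ->
  carrier E x -> carrier E (iter n T x).
Proof. by move=> TE; elim: n => //= n IH /IH; exact: TE. Qed.

(** [lam ^ P - T ^ P] factors through [lam - T]. *)
Definition power_quot T lam P x : V := \sum_(0 <= j < P) lam ^+ (P.-1 - j) *: iter j T x.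

Lemma power_quotE T lam P x : lin T ->
  lambda_minus T lam (power_quot T lam P x) = lam ^+ P *: x - iter P T x.
Proof.
move=> lT; rewrite /lambda_minus /power_quot scaler_sumr lin_sum// -sumrB.
case: P => [|P]; first by rewrite big_geq// expr0 scale1r subrr.
pose f j := - (lam ^+ (P.+1 - j) *: iter j T x).
rewrite (eq_big_nat _ _ (F2 := fun j => f j.+1 - f j)) => [|j /andP[_ jP]].
  by rewrite telescope_sumr// /f subnn expr0 scale1r subn0 opprK addrC.
rewrite /f (linZ _ _ lT) -iterS opprK addrC scalerA -exprS /= subSS.
by rewrite -subSn.
Qed.

Lemma power_quotC T lam P x : lin T ->
  power_quot T lam P (lambda_minus T lam x) = lambda_minus T lam (power_quot T lam P x).
Proof.
move=> lT; rewrite /power_quot lin_sum; last exact: lin_lambda.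
apply: eq_big_nat => j _; rewrite [RHS]linZ; last exact: lin_lambda.
congr (_ *: _); rewrite /lambda_minus linB; last exact: lin_iter.
rewrite linZ; last exact: lin_iter.
by rewrite -iterSr iterS.
Qed.

Lemma power_quot_mem E T lam P x : normed E -> (forall x, carrier E x -> carrier E (T x)) ->
  carrier E x -> carrier E (power_quot T lam P x).
Proof. by move=> hE TE xE; apply: nmem_sum => // j; apply: nmemZ => //; exact: mem_iter. Qed.

Lemma power_bound E T n : normed E -> bounded_on E T -> exists2 M : R, 0 <= M &
  forall x, carrier E x -> nnorm E (iter n T x) <= M * nnorm E x.
Proof.
move=> hE [TE [M TM]]; exists (`|M| ^+ n) => [|x xE]; first exact: exprn_ge0.
elim: n => [|n IH]; first by rewrite expr0 mul1r.
rewrite iterS; apply: le_trans (TM _ (mem_iter n TE xE)) _.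
apply: le_trans (_ : `|M| * nnorm E (iter n T x) <= _).
  by rewrite ler_wpM2r ?ler_norm//; apply: n_ge0 => //; exact: mem_iter.
by rewrite exprS -mulrA ler_wpM2l.
Qed.

Lemma power_quot_bound E T lam P : normed E -> bounded_on E T -> exists2 M : R, 0 <= M &
  forall x, carrier E x -> nnorm E (power_quot T lam P x) <= M * nnorm E x.
Proof.
move=> hE bT; have [TE _] := bT.
have /choice[B BP] : forall j, exists M : R, 0 <= M /\
    forall x, carrier E x -> nnorm E (iter j T x) <= M * nnorm E x.
  by move=> j; have [M M0 H] := power_bound j hE bT; exists M.
exists (\sum_(0 <= j < P) normc (lam ^+ (P.-1 - j)) * B j).
  by apply: sumr_ge0 => j _; rewrite mulr_ge0 ?normc_ge0//; have [] := BP j.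
move=> x xE; have iE j : carrier E (iter j T x) by exact: mem_iter.
apply: le_trans (n_sum hE _ _) _ => [j|]; first exact: nmemZ.
rewrite mulr_suml; apply: ler_sum => j _; rewrite nZ// -mulrA ler_wpM2l ?normc_ge0//.
by have [_ ->] := BP j.
Qed.

Lemma ler_half (c a b : R) : 0 < c -> c / 2 * a <= b -> a <= 2 / c * b.
Proof.
move=> c0 h; have -> : a = 2 / c * (c / 2 * a) by field; rewrite gt_eqF.
by rewrite ler_pM2l// divr_gt0.
Qed.

(** The operator [lam ^ P - T ^ P] is bounded below, and it factors through
    [lam - T]. *)
Lemma expanding_bdd_below E T lam P (c : R) : normed E -> bounded_on E T -> lin T ->
  0 < c -> 2 * normc lam ^+ P <= c ->
  (forall x, carrier E x -> c * nnorm E x <= nnorm E (iter P T x)) ->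
  exists M : R, forall x, carrier E x -> nnorm E x <= M * nnorm E (lambda_minus T lam x).
Proof.
move=> hE bT lT c0 lc cT; have [TE _] := bT; have [M M0 QM] := power_quot_bound lam P hE bT.
exists (2 / c * M) => x xE.
have lE : carrier E (lambda_minus T lam x).
  by apply: nmemB => //; [exact: nmemZ|exact: TE].
have iE : carrier E (iter P T x) by exact: mem_iter.
have zE : carrier E (lam ^+ P *: x) by exact: nmemZ.
have h1 : nnorm E (iter P T x) - nnorm E (lam ^+ P *: x) <=
    nnorm E (power_quot T lam P (lambda_minus T lam x)).
  by rewrite power_quotC// power_quotE// nBC//; exact: n_leB.
have := le_trans h1 (QM _ lE); rewrite nZ// normcX => h2.
have nx := n_ge0 hE xE; have cx := cT _ xE.
rewrite -[leRHS]mulrA; apply: ler_half => //; apply: le_trans h2.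
have := ler_wpM2r nx lc; lra.
Qed.

(** The operator [lam ^ P - T ^ P] is invertible by the contraction principle,
    and it factors through [lam - T] on both sides. *)
Lemma contracting_invertible E T lam P : is_banach E -> bounded_on E T -> lin T -> lam != 0 ->
  (forall x, carrier E x -> nnorm E (iter P T x) <= 2^-1 * normc lam ^+ P * nnorm E x) ->
  invertible_on E (lambda_minus T lam).
Proof.
move=> [sE nE cE] bT lT l0 TP; have hE : normed E by [].
have [TE _] := bT; have [M M0 QM] := power_quot_bound lam P hE bT.
have lP : lam ^+ P != 0 by rewrite expf_neq0.
have nl : 0 < normc lam ^+ P by rewrite exprn_gt0// normc_gt0.
have below x : carrier E x ->
    nnorm E x <= 2 / normc lam ^+ P * M * nnorm E (lambda_minus T lam x).
  move=> xE; have lE : carrier E (lambda_minus T lam x).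
    by apply: nmemB => //; [exact: nmemZ|exact: TE].
  have h1 : nnorm E (lam ^+ P *: x) - nnorm E (iter P T x) <=
      nnorm E (power_quot T lam P (lambda_minus T lam x)).
    by rewrite power_quotC// power_quotE//; apply: n_leB => //; [exact: nmemZ|exact: mem_iter].
  have := le_trans h1 (QM _ lE); rewrite nZ// normcX => h2.
  rewrite -[leRHS]mulrA; apply: ler_half => //; apply: le_trans h2.
  have := TP _ xE; lra.
split.
- move=> x xE h; apply: (n_eq0 hE) => //; apply/eqP; rewrite eq_le n_ge0// andbT.
  by have := below _ xE; rewrite h n0// mulr0.
- move=> y yE; pose K u := (lam ^+ P)^-1 *: (y + iter P T u).
  have KD u : carrier E u -> carrier E (K u).
    by move=> uE; apply: nmemZ => //; apply: nmemD => //; exact: mem_iter.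
  have K2 u v : carrier E u -> carrier E v -> nnorm E (K u - K v) <= 2^-1 * nnorm E (u - v).
    move=> uE vE; have dE := nmemB hE uE vE; rewrite /K -scalerBr [y + _]addrC addrKA.
    rewrite -linB; last exact: lin_iter.
    rewrite nZ//; last exact: mem_iter.
    rewrite normcV normcX mulrC ler_pdivrMr//; apply: le_trans (TP _ dE) _.
    by rewrite mulrAC.
  have [u uE [Ku _]] := contraction hE cE KD (nmem0 hE) K2.
  exists (power_quot T lam P u); first exact: power_quot_mem.
  rewrite power_quotE//; move/(congr1 (fun v => lam ^+ P *: v)) : Ku.
  by rewrite /K scalerA divff// scale1r => <-; rewrite addrK.
- by exists (2 / normc lam ^+ P * M) => x; exact: below.
Qed.

(** A solution is a fixed point of the contraction built on the right inverse
    [W] of [T ^ P]. *)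
Lemma expanding_surjective E T W lam P : is_banach E -> bounded_on E T -> lin T -> lin W ->
  (forall x, carrier E x -> carrier E (W x)) ->
  (forall x, carrier E x -> iter P T (W x) = x) ->
  (forall x, carrier E x -> nnorm E (lam ^+ P *: W x) <= 2^-1 * nnorm E x) ->
  forall y, carrier E y -> exists2 x, carrier E x & lambda_minus T lam x = y.
Proof.
move=> [sE nE cE] bT lT lW WE TW W2 y yE; have hE : normed E by [].
have [TE _] := bT; pose K u := W (lam ^+ P *: u - y).
have KD u : carrier E u -> carrier E (K u).
  by move=> uE; apply: WE; apply: nmemB => //; exact: nmemZ.
have K2 u v : carrier E u -> carrier E v -> nnorm E (K u - K v) <= 2^-1 * nnorm E (u - v).
  move=> uE vE; rewrite /K -linB// opprB addrA subrK -scalerBr linZ//.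
  by apply: W2; exact: nmemB.
have [u uE [Ku _]] := contraction hE cE KD (nmem0 hE) K2.
exists (power_quot T lam P u); first exact: power_quot_mem.
rewrite power_quotE// -{2}Ku TW ?opprB ?subrKC//; last first.
  by apply: nmemB => //; exact: nmemZ.
Qed.

End powers.

(** * Rotations and weighted rotations *)

Section rotation_operators.
Variable R : realType.
Local Notation C := (circle R).
Local Notation m := (circle_measure R).
Local Notation L := (L0 m).
Implicit Types (x y w : L) (c : R[i]) (z : C) (k p : nat).

Definition oneL0 : L := mkL0 m (@measurable_cst _ _ C R[i] setT 1).

Lemma L0_1 : {ae m, forall z, oneL0 z = 1}.
Proof. exact: mkL0E. Qed.

Definition cpow (a : C) k : C := iter k (rotation a) point.

Lemma cpowE (a : C) k : (cpow a k : R[i]) = (a : R[i]) ^+ k.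
Proof. by elim: k => [//|k IH]; rewrite exprS -IH. Qed.

Lemma rotation_cpow (a : C) k z : rotation (cpow a k) z = iter k (rotation a) z.
Proof.
apply: val_inj; elim: k => [|k IH]; first by rewrite /= mul1r.
by rewrite iterS /= -IH /= mulrA.
Qed.

Lemma cinv_subproof (a : C) : `|conjc (a : R[i])| == 1.
Proof. by rewrite norm_normc normc_conjc circle_normc. Qed.

Definition cinv (a : C) : C := Circle (cinv_subproof a).

Lemma rotation_cinvK (a : C) z : rotation (cinv a) (rotation a z) = z.
Proof.
apply: val_inj; rewrite /= mulrA circle_conj mulVf ?mul1r//; exact: circle_neq0.
Qed.

Lemma rotationK_cinv (a : C) z : rotation a (rotation (cinv a) z) = z.
Proof.
apply: val_inj; rewrite /= mulrA circle_conj divff ?mul1r//; exact: circle_neq0.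
Qed.

Lemma rot_lin (a : C) : lin (rotation_op a : L -> L).
Proof.
move=> c x y; apply: L0P.
have h1 := ae_rot a (L0D (c *: x) y); have h2 := ae_rot a (L0Z c x).
have h3 := L0Z c (rotation_op a x); have h4 := L0D (c *: rotation_op a x) (rotation_op a y).
apply: filterS2 (filterI (filterI h1 h2) (filterI h3 h4))
  (filterI (filterI (L0rot a (c *: x + y)) (L0rot a x)) (L0rot a y)).
by move=> z [[e1 e2] [e3 e4]] [[e5 e6] e7]; rewrite e5 e1 e2 e4 e3 e6 e7.
Qed.

Lemma rot_comp (a b : C) x : rotation_op a (rotation_op b x) = rotation_op (rotation a b) x.
Proof.
apply: L0P; apply: filterS2 (filterI (L0rot a (rotation_op b x)) (L0rot (rotation a b) x))
  (ae_rot a (L0rot b x)) => z [e1 e2] e3.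
rewrite e1 e3 e2; congr (x _); apply: val_inj; rewrite /= [in RHS](mulrC (a : R[i])).
by rewrite -mulrA.
Qed.

Lemma rot_ext (a : C) x (f : C -> C) : (forall z, rotation a z = f z) ->
  {ae m, forall z, rotation_op a x z = x (f z)}.
Proof. by move=> af; apply: filterS (L0rot a x) => z ->; rewrite af. Qed.

Lemma rot_cinvK (a : C) x : rotation_op (cinv a) (rotation_op a x) = x.
Proof.
rewrite rot_comp; apply: L0P; apply: rot_ext => z.
by rewrite -[RHS](rotation_cinvK a); apply: val_inj; rewrite /= mulrA.
Qed.

Lemma rotK_cinv (a : C) x : rotation_op a (rotation_op (cinv a) x) = x.
Proof.
rewrite rot_comp; apply: L0P; apply: rot_ext => z.
by rewrite -[RHS](rotationK_cinv a); apply: val_inj; rewrite /= mulrA.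
Qed.

Lemma iter_rot (a : C) k x : iter k (rotation_op a) x = rotation_op (cpow a k) x.
Proof.
elim: k => [|k IH]; last by rewrite iterS IH rot_comp.
by apply: L0P; apply: filterS (L0rot (cpow a 0) x) => z ->; rewrite rotation_cpow.
Qed.

Lemma iter_rotE (a : C) k x :
  {ae m, forall z, iter k (rotation_op a) x z = x (iter k (rotation a) z)}.
Proof. by rewrite iter_rot; apply: rot_ext => z; rewrite rotation_cpow. Qed.

Lemma rot_mul (a : C) x y : rotation_op a (mulL0 x y) = mulL0 (rotation_op a x) (rotation_op a y).
Proof.
apply: L0P; apply: filterS2 (filterI (L0rot a (mulL0 x y)) (ae_rot a (L0M x y)))
  (filterI (L0M (rotation_op a x) (rotation_op a y)) (filterI (L0rot a x) (L0rot a y))).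
by move=> z [e1 e2] [e3 [e4 e5]]; rewrite e1 e2 e3 e4 e5.
Qed.

Lemma mulL0A x y w : mulL0 x (mulL0 y w) = mulL0 (mulL0 x y) w.
Proof.
apply: L0P; apply: filterS2 (filterI (L0M x (mulL0 y w)) (L0M y w))
  (filterI (L0M (mulL0 x y) w) (L0M x y)).
by move=> z [e1 e2] [e3 e4]; rewrite e1 e2 e3 e4 mulrA.
Qed.

Lemma mulL0C x y : mulL0 x y = mulL0 y x.
Proof. by apply: L0P; apply: filterS2 (L0M x y) (L0M y x) => z -> ->; rewrite mulrC. Qed.

Lemma mul1L0 x : mulL0 oneL0 x = x.
Proof. by apply: L0P; apply: filterS2 (L0M oneL0 x) L0_1 => z -> ->; rewrite mul1r. Qed.

Lemma mulL0_lin x : lin (mulL0 x).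
Proof.
move=> c y w; apply: L0P.
apply: filterS2 (filterI (L0M x (c *: y + w)) (filterI (L0D (c *: y) w) (L0Z c y)))
  (filterI (filterI (L0M x y) (L0M x w))
    (filterI (L0D (c *: mulL0 x y) (mulL0 x w)) (L0Z c (mulL0 x y)))).
by move=> z [e1 [e2 e3]] [[e4 e5] [e6 e7]]; rewrite e1 e2 e3 e6 e7 e4 e5; ring.
Qed.

Lemma weighted_lin w (a : C) : lin (weighted_rotation_op w a).
Proof. by move=> c x y; rewrite /weighted_rotation_op rot_lin mulL0_lin. Qed.

(** The weights of the powers of a weighted rotation. *)
Fixpoint wprod w (a : C) k : L :=
  if k is p.+1 then mulL0 w (rotation_op a (wprod w a p)) else oneL0.

Lemma weighted_iter w (a : C) k x :
  iter k (weighted_rotation_op w a) x = mulL0 (wprod w a k) (iter k (rotation_op a) x).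
Proof.
elim: k => [|k IH]; first by rewrite /= mul1L0.
by rewrite iterS IH /weighted_rotation_op rot_mul mulL0A.
Qed.

Lemma wprodD w (a : C) p k :
  wprod w a (p + k) = mulL0 (wprod w a p) (iter p (rotation_op a) (wprod w a k)).
Proof.
elim: p => [|p IH]; first by rewrite /= mul1L0.
by rewrite addSn /= IH rot_mul mulL0A.
Qed.

Lemma wprod_bound w (a : C) (M : R) k : {ae m, forall z, normc (w z) <= M} ->
  {ae m, forall z, normc (wprod w a k z) <= M ^+ k}.
Proof.
move=> wM; elim: k => [|k IH].
  by apply: filterS L0_1 => z ->; rewrite normc_1 expr0.
have h := ae_rot a IH; have wr := L0rot a (wprod w a k).
apply: filterS2 (filterI wM (L0M w (rotation_op a (wprod w a k)))) (filterI h wr).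
move=> z [h1 h2] [h3 h4]; rewrite /= h2 h4 normcM exprS ler_pM ?normc_ge0//.
Qed.

Lemma L0rot_meas (a : C) x : measurable_fun setT (fun z => x (rotation a z)).
Proof. exact: measurableT_comp (L0_meas x) (measurable_rotation a). Qed.

Lemma norm1_rot (a : C) x : cintg m setT x -> norm1 (rotation_op a x) = norm1 x.
Proof.
move=> xi; rewrite /norm1 -[RHS](Rintegral_rotation a); last exact: cintg_norm.
apply: ae_Rint.
- by apply: cmeas_normc; exact: L0_meas.
- by apply: cmeas_normc; exact: L0rot_meas.
- by apply: filterS (L0rot a x) => z ->.
Qed.

Lemma cintg_rot (a : C) x : cintg m setT x -> cintg m setT (rotation_op a x).
Proof.
by move=> xi; apply: (ae_cintg (L0_meas _) (cintg_rotation a xi)); exact: L0rot.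
Qed.

Lemma cmoment_rot (a : C) x n : cintg m setT x ->
  cmoment x n = (a : R[i]) ^+ n * cmoment (rotation_op a x) n.
Proof.
move=> xi; rewrite (cmoment_ae n (L0_meas _) (L0rot_meas a x) (L0rot a x)).
rewrite -cmomentZ; last exact: cintg_rotation.
rewrite /cmoment -(cint_rotation a (cmoment_intg n xi)).
by apply: eq_cint => z _; rewrite /= exprMn; ring.
Qed.

(** A rotation multiplies each Fourier coefficient by a unimodular number. *)
Lemma H1_rot (a : C) x : H1 R x -> H1 R (rotation_op a x).
Proof.
move=> /H1P[xi x0]; apply/H1P; split; first exact: cintg_rot.
move=> n n0; have := cmoment_rot a n xi; rewrite x0// => /esym/eqP.
by rewrite mulf_eq0 expf_eq0 (negPf (circle_neq0 a)) andbF/= => /eqP.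
Qed.

Lemma H1_weighted w (a : C) x : Hinfty R w -> H1 R x -> H1 R (weighted_rotation_op w a x).
Proof. by move=> wH xH; have [] := H1_mul wH (H1_rot a xH). Qed.

Lemma L1_submodule : is_submodule (Lone R).
Proof.
split.
  apply/Lone_cintg; apply: (ae_cintg (L0_meas _) (cintg_bounded (M := 0) _ _) (L0_0 R)) => //.
  by move=> z; rewrite normc_0.
move=> c x y /Lone_cintg xi /Lone_cintg yi; apply/Lone_cintg.
apply: (ae_cintg (L0_meas _) (cintgD measurableT (cintgZ c measurableT xi) yi)).
by apply: filterS2 (L0D (c *: x) y) (L0Z c x) => z -> ->.
Qed.

Definition Lone_space : subnormed L := Subnormed (Lone R) (@norm1 R).

Lemma norm1_meas x : measurable_fun setT (fun z => normc (x z)).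
Proof. by apply: cmeas_normc; exact: L0_meas. Qed.

Lemma norm1D x y : cintg m setT x -> cintg m setT y -> norm1 (x + y) <= norm1 x + norm1 y.
Proof.
move=> xi yi; have nx := cintg_norm measurableT xi; have ny := cintg_norm measurableT yi.
rewrite /norm1 -RintegralD//; apply: ae_le_Rint; [|exact: rintgD|].
  apply: cintg_norm => //; apply: (ae_cintg (L0_meas _) (cintgD measurableT xi yi)).
  exact: L0D.
by apply: filterS (L0D x y) => z ->; exact: le_normcD.
Qed.

Lemma Lone_normed : normed Lone_space.
Proof.
split; first exact: L1_submodule.
split.
- by move=> x _; exact: norm1_ge0.
- move=> x /Lone_cintg xi h; apply: L0P.
  have nx := cintg_norm measurableT xi.
  have : ae_eq m setT (EFin \o (fun z => normc ((x : L) z))) (cst 0%E).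
    apply/(ae_eq_integral_abs m measurableT).
      by apply/measurable_EFinP; exact: norm1_meas.
    under eq_integral do rewrite /= ger0_norm ?normc_ge0//.
    have := integrable_fin_num measurableT nx.
    by move=> /fineK <-; congr (_%:E).
  move=> h2; apply: filterS2 h2 (L0_0 R) => z /(_ Logic.I)/=[/eqP]; rewrite normc_eq0.
  by move=> /eqP -> ->.
- move=> c x /Lone_cintg xi; rewrite /= /norm1 -RintegralZl//; last exact: cintg_norm.
  apply: ae_Rint; [exact: norm1_meas| |].
    by apply: measurable_funM => //; exact: norm1_meas.
  by apply: filterS (L0Z c x) => z ->; rewrite normcM.
- by move=> x y /Lone_cintg xi /Lone_cintg yi; exact: norm1D.
Qed.

Lemma H1_submodule : is_submodule (H1 R).
Proof.
have [m0 mD] := L1_submodule; split.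
  apply/H1P; split; first exact/Lone_cintg.
  move=> n _; rewrite (@cmoment_ae R _ (fun=> 0) n (L0_meas _) _ (L0_0 R))//.
  by rewrite /cmoment; under eq_cint do rewrite mulr0; exact: cint_cst.
move=> c x y /H1P[xi x0] /H1P[yi y0]; apply/H1P; split.
  by apply/Lone_cintg; apply: mD; exact/Lone_cintg.
move=> n n0; have ci := cintgZ c measurableT xi.
rewrite (@cmoment_ae R _ (fun z => c * (x : L) z + (y : L) z) n (L0_meas _)).
- by rewrite cmomentD// cmomentZ// x0// y0// mulr0 addr0.
- by apply: measurable_complexD; [apply: measurable_complexM|] => //; exact: L0_meas.
- by apply: filterS2 (L0D (c *: x) y) (L0Z c x) => z -> ->.
Qed.

Lemma cmomentB_L0 x y n : cintg m setT x -> cintg m setT y ->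
  cmoment (x - y : L) n = cmoment x n - cmoment y n.
Proof.
move=> xi yi; rewrite -cmomentB//; apply: cmoment_ae; first exact: L0_meas.
  by apply: cmeasB; exact: L0_meas.
exact: L0B.
Qed.

(** Fourier coefficients are continuous in mean. *)
Lemma H1_closed x : cintg m setT x ->
  (forall e : R, 0 < e -> exists2 y, H1 R y & norm1 (x - y) < e) -> H1 R x.
Proof.
move=> xi h; apply/H1P; split=> // n n0; apply/eqP.
rewrite -normc_eq0 eq_le normc_ge0 andbT; apply/ler_addgt0Pl => e e0; rewrite addr0.
have [y /H1P[yi y0] xy] := h _ e0; apply: ltW; apply: le_lt_trans xy.
rewrite -[cmoment x n]subr0 -(y0 n n0) -cmomentB_L0//; apply: normc_cmoment.
apply/Lone_cintg; apply: (nmemB Lone_normed); exact/Lone_cintg.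
Qed.

End rotation_operators.

(** * Banach ideal spaces and the growth of rotations *)

Section ideal_spaces.
Variable R : realType.
Local Notation C := (circle R).
Local Notation m := (circle_measure R).
Local Notation L := (L0 m).
Implicit Types (x y w : L) (c : R[i]) (z : C).

Definition absL0 x : L := mkL0 m (cmeas_real (norm1_meas x)).

Lemma absL0E x : {ae m, forall z, absL0 x z = (normc (x z))%:C}.
Proof. exact: mkL0E. Qed.

Lemma normc_abs x : {ae m, forall z, normc (absL0 x z) = normc (x z)}.
Proof. by apply: filterS (absL0E x) => z ->; rewrite normc_rC ?normc_ge0. Qed.

Definition nneg x := {ae m, forall z, x z = (normc (x z))%:C}.

Lemma nneg_abs x : nneg (absL0 x).
Proof. by apply: filterS2 (absL0E x) (normc_abs x) => z -> ->. Qed.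

Lemma nneg0 : nneg 0.
Proof. by apply: filterS (L0_0 R) => z ->; rewrite normc_0. Qed.

Lemma normcD_real (s t : R) : 0 <= s -> 0 <= t -> normc (s%:C + t%:C) = s + t.
Proof. by move=> s0 t0; rewrite -(rmorphD (real_complex R)) normcR ger0_norm// addr_ge0. Qed.

Lemma nnegD x y : nneg x -> nneg y -> nneg (x + y).
Proof.
move=> x0 y0; apply: filterS2 (filterI x0 y0) (L0D x y) => z [ex ey] ->.
rewrite {1 2}ex {1 2}ey normcD_real ?normc_ge0//.
by rewrite [LHS](_ : _ = (normc (x z) + normc (y z))%:C)// rmorphD.
Qed.

Lemma nnegZ (t : R) x : 0 <= t -> nneg x -> nneg (t%:C *: x).
Proof.
move=> t0 x0; apply: filterS2 x0 (L0Z t%:C x) => z ex ->.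
by rewrite normcM normc_rC// {1}ex rmorphM.
Qed.

Lemma nneg_rot (a : C) x : nneg x -> nneg (rotation_op a x).
Proof. by move=> x0; apply: filterS2 (ae_rot a x0) (L0rot a x) => z e1 ->. Qed.

Lemma abs_rot (a : C) x : absL0 (rotation_op a x) = rotation_op a (absL0 x).
Proof.
apply: L0P; apply: filterS2 (filterI (absL0E (rotation_op a x)) (L0rot a x))
  (filterI (L0rot a (absL0 x)) (ae_rot a (absL0E x))).
by move=> z [e1 e2] [e3 e4]; rewrite e1 e2 e3 e4.
Qed.

Lemma abs_iter_rot (a : C) k x : absL0 (iter k (rotation_op a) x) = iter k (rotation_op a) (absL0 x).
Proof. by rewrite !iter_rot abs_rot. Qed.

Lemma nneg_le x y : nneg x -> nneg (y - x) -> {ae m, forall z, normc (x z) <= normc (y z)}.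
Proof.
move=> x0 d0; apply: filterS2 (filterI x0 d0) (L0B y x) => z [ex ed] eB.
have -> : y z = (normc (y z - x z) + normc (x z))%:C.
  by rewrite rmorphD/= -ex -eB -ed eB subrK.
by rewrite normcR ger0_norm ?addr_ge0 ?normc_ge0// lerDr normc_ge0.
Qed.

Section space.
Variable X : subnormed L.
Hypothesis hX : banach_ideal_space X.
Local Notation N := (nnorm X).
Local Notation D := (carrier X).

Lemma ideal_normed : normed X.
Proof. by have [_ [? ? _] _] := hX. Qed.

Lemma ideal_complete : is_complete X.
Proof. by have [_ [_ _ ?] _] := hX. Qed.

Lemma ideal_mem x y : {ae m, forall z, normc (x z) <= normc (y z)} -> D y -> D x.
Proof. by have [[_ h] _ _] := hX; exact: h. Qed.

Lemma ideal_le x y : {ae m, forall z, normc (x z) <= normc (y z)} -> D y -> N x <= N y.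
Proof.
move=> xy yD; have [_ _ h] := hX; apply: h => //; exact: ideal_mem xy yD.
Qed.

Lemma ideal_leZ (M : R) x y : 0 <= M -> {ae m, forall z, normc (x z) <= M * normc (y z)} ->
  D y -> D x /\ N x <= M * N y.
Proof.
move=> M0 xy yD; have zD : D (M%:C *: y) by apply: nmemZ => //; exact: ideal_normed.
have h : {ae m, forall z, normc (x z) <= normc ((M%:C *: y : L) z)}.
  by apply: filterS2 xy (L0Z M%:C y) => z h ->; rewrite normcM normc_rC.
split; first exact: ideal_mem h zD.
apply: le_trans (ideal_le h zD) _; rewrite nZ//; last exact: ideal_normed.
by rewrite normc_rC.
Qed.

Lemma ideal_abs x : D x -> D (absL0 x) /\ N (absL0 x) = N x.
Proof.
move=> xD; have h1 : {ae m, forall z, normc (absL0 x z) <= normc (x z)}.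
  by apply: filterS (normc_abs x) => z ->.
have aD := ideal_mem h1 xD; split=> //; apply/eqP; rewrite eq_le ideal_le//=.
by apply: ideal_le => //; apply: filterS (normc_abs x) => z ->.
Qed.

Lemma nneg_lim (u : nat -> L) x : (forall n, D (u n)) -> D x -> nlim X u x ->
  (forall n, nneg (u n)) -> nneg x.
Proof.
move=> uD xD ux u0; have hN := ideal_normed.
have [aD _] := ideal_abs xD.
suff : x - absL0 x = 0.
  move=> h; apply: filterS2 (absL0E x) (filterI (L0B x (absL0 x)) (L0_0 R)) => z e1 [e2 e3].
  by move: e2; rewrite h e3 e1 => /esym/eqP; rewrite subr_eq0 => /eqP.
apply: (n_small hN); first exact: nmemB.
move=> e e0; have e2 : 0 < e / 2 by rewrite divr_gt0.
have [n0 H] := ux _ e2; have {}H := H _ (leqnn n0).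
have h : {ae m, forall z, normc ((x - absL0 x : L) z) <= 2 * normc ((u n0 - x : L) z)}.
  apply: filterS2 (filterI (L0B x (absL0 x)) (absL0E x)) (filterI (u0 n0) (L0B (u n0) x)).
  move=> z [-> ->] [e1 ->]; rewrite [normc (u n0 z - x z)]normcB.
  apply: le_trans (normc_leD3 _ (u n0 z) _) _; rewrite mulr_natl mulr2n lerD2l.
  rewrite {1}e1 -(rmorphB (real_complex R)) normcR distrC; exact: ler_dist_normc.
have [_ h2] := ideal_leZ (ler0n _ _) h (nmemB hN (uD n0) xD).
by apply: le_trans h2 _; move: H; lra.
Qed.

Lemma sum_half_tail p n : \sum_(p <= k < p + n) 2^-1 ^+ k <= 2 * 2^-1 ^+ p :> R.
Proof.
have -> : \sum_(p <= k < p + n) 2^-1 ^+ k = 2^-1 ^+ p * \sum_(0 <= k < n) 2^-1 ^+ k :> R.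
  rewrite -{1}[p]add0n big_addn addKn mulr_sumr; apply: eq_bigr => k _.
  by rewrite exprD mulrC.
rewrite mulrC ler_wpM2r ?exprn_ge0 ?invr_ge0// sum_half.
by rewrite gerBl mulr_ge0// exprn_ge0// invr_ge0.
Qed.

(** An ideal space of integrable functions embeds continuously: otherwise the
    sum of a summable sequence of positive elements would have infinite mean. *)
Lemma ideal_L1 : D `<=` Lone R -> exists2 K : R, 0 < K & forall x, D x -> norm1 x <= K * N x.
Proof.
move=> DL; have hN := ideal_normed; apply: contrapT => nK.
have /choice[x xP] : forall n, exists x, D x /\ 4 ^+ n * N x < norm1 x.
  move=> n; apply: contrapT => nx; apply: nK; exists (4 ^+ n); first exact: exprn_gt0.
  by move=> x xD; rewrite leNgt; apply/negP => h; apply: nx; exists x.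
have xD n : D (x n) by have [] := xP n.
have xi y : D y -> cintg m setT y by move=> /DL/Lone_cintg.
have n1ae y y' : {ae m, forall z, normc (y z) = normc (y' z)} -> norm1 y = norm1 y'.
  by move=> h; apply: ae_Rint => //; exact: norm1_meas.
have Nx n : 0 < N (x n).
  rewrite lt_neqAle n_ge0// andbT eq_sym; apply/eqP => h.
  have [_] := xP n; rewrite h mulr0 (n_eq0 hN (xD n) h).
  have -> : norm1 (0 : L) = 0 := n0 (@Lone_normed R).
  by rewrite ltxx.
pose t n : R := 2^-1 ^+ n / N (x n).
have t0 n : 0 < t n by rewrite divr_gt0// exprn_gt0// invr_gt0.
pose y n := (t n)%:C *: absL0 (x n).
have aD n : D (absL0 (x n)) by have [] := ideal_abs (xD n).
have yD n : D (y n) by exact: nmemZ.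
have Ny n : N (y n) = 2^-1 ^+ n.
  rewrite nZ// normc_rC ?(ltW (t0 n))//; have [_ ->] := ideal_abs (xD n).
  by rewrite /t divfK// gt_eqF.
have y0 n : nneg (y n) by apply: nnegZ; [exact: ltW|exact: nneg_abs].
have ny n : 2 ^+ n <= norm1 (y n).
  have -> : norm1 (y n) = t n * norm1 (x n).
    rewrite [norm1 (y n)](nZ (@Lone_normed R)); last exact: DL.
    rewrite normc_rC ?(ltW (t0 n))//; congr (_ * _); exact: n1ae (normc_abs (x n)).
  have [_ h] := xP n; apply: le_trans (ler_wpM2l (ltW (t0 n)) (ltW h)).
  have e4 : 4 ^+ n = 2 ^+ n * 2 ^+ n :> R by rewrite -exprMn; congr (_ ^+ _); ring.
  have e1 : 2^-1 ^+ n * 2 ^+ n = 1 :> R by rewrite -exprMn mulVf// expr1n.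
  rewrite /t mulrACA mulVf ?gt_eqF// e4 mulr1.
  by rewrite mulrA e1 mul1r.
pose s n := \sum_(0 <= k < n) y k.
have sD n : D (s n) by exact: nmem_sum.
have sE n j : s (n + j)%N - s n = \sum_(0 <= k < j) y (n + k)%N.
  rewrite /s (big_cat_nat (n := n)) ?leq_addr//= addrAC subrr add0r.
  by rewrite -{1}[n]add0n big_addn addKn; apply: eq_bigr => k _; rewrite addnC.
have tl n j : N (s (n + j)%N - s n) <= 2 * 2^-1 ^+ n.
  rewrite sE; apply: le_trans (n_sum hN _ _) _ => //.
  apply: le_trans (sum_half_tail n j).
  have -> : \sum_(n <= k < n + j) 2^-1 ^+ k = \sum_(0 <= k < j) 2^-1 ^+ (n + k) :> R.
    by rewrite -{1}[n]add0n big_addn addKn; apply: eq_bigr => k _; rewrite addnC.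
  by apply: ler_sum => k _; rewrite Ny.
have cau : forall e : R, 0 < e -> exists n0, forall p q, (n0 <= p)%N -> (n0 <= q)%N ->
    N (s p - s q) < e.
  move=> e e0; have e4 : 0 < e / 4 by rewrite divr_gt0.
  have : 2^-1 ^+ n @[n --> \oo] --> (0 : R).
    by apply: cvg_expr; rewrite ger0_norm ?invr_ge0// invf_lt1// ltr1n.
  move=> /cvgrPdist_lt/(_ _ e4)[n0 _ H]; exists n0 => p q np nq.
  have := H n0 (leqnn n0); rewrite /= sub0r normrN ger0_norm ?exprn_ge0 ?invr_ge0// => h.
  apply: le_lt_trans (n_tri hN (sD p) (sD n0) (sD q)) _.
  have h1 := tl n0 (p - n0)%N; have h2 := tl n0 (q - n0)%N.
  rewrite subnKC// in h1; rewrite subnKC// in h2; rewrite [X in _ + X]nBC//.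
  by move: h h1 h2; lra.
have [l lD /cvgrPdist_lt ul] := ideal_complete sD cau.
have lim n : nlim X (fun j => s (n + j)%N - s n) (l - s n).
  move=> e /ul[n0 _ H]; exists n0 => j jn.
  have := H (n + j)%N (leq_trans jn (leq_addl _ _)); rewrite /= sub0r normrN.
  have -> : s (n + j)%N - s n - (l - s n) = s (n + j)%N - l by rewrite opprB addrA subrK.
  by apply: le_lt_trans; exact: ler_norm.
have s0 n (F : nat -> L) : (forall k, nneg (F k)) -> nneg (\sum_(0 <= k < n) F k).
  move=> F0; elim: n => [|n IH]; first by rewrite big_geq//; exact: nneg0.
  by rewrite big_nat_recr//=; exact: nnegD.
have ls n : nneg (l - s n).
  apply: nneg_lim (lim n) _ => [j||j]; [exact: nmemB|exact: nmemB|].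
  by rewrite sE; exact: s0.
have bnd n : 2 ^+ n <= norm1 l.
  apply: le_trans (ny n) _; apply: ae_le_Rint.
  - by apply: cintg_norm => //; exact: xi.
  - by apply: cintg_norm => //; exact: xi.
  - apply: nneg_le => //; have -> : l - y n = (l - s n.+1) + s n.
      by rewrite /s big_nat_recr//= opprD addrA addrAC subrK.
    by apply: nnegD; [exact: ls|exact: s0].
have := bnd (Num.truncn (norm1 l)).+1; apply/negP; rewrite -ltNge.
apply: lt_le_trans (truncnS_gt _) _; rewrite -natrX ler_nat; apply: ltnW.
by rewrite ltn_expl.
Qed.

Section growth.
Variable a : C.
Local Notation U := (@rotation_op R a).
Hypothesis bU : bounded_on X U.
Hypothesis resU : forall lam : R, 1 < lam -> resolvent_set U X lam%:C.

Definition growth (rho : R) := exists2 K : R, 0 < K &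
  forall k x, D x -> N (iter k U x) <= K * rho ^+ k * N x.

(** Positivity of the resolvent at [lam]. *)
Let pos (lam : R) := 1 < lam /\ forall x, D x -> nneg x ->
  exists y, [/\ D y, nneg y & lam%:C *: y - U y = x].

Let hN := ideal_normed.
Let UD x : D x -> D (U x). Proof. by have [h _] := bU; exact: h. Qed.

(** If [lam y - U y = |x|] with [y] positive, then [U ^ k |x| <= lam ^ k.+1 y]
    by induction on [k]. *)
Let pos_growth lam : pos lam -> growth lam.
Proof.
move=> [lam1 hl]; have [_ _ [M HM]] := resU lam1.
have l0 : 0 < lam by exact: lt_trans lam1.
exists (lam * (`|M| + 1)); first by rewrite mulr_gt0// ltr_wpDl.
move=> k x xD; have [aD aN] := ideal_abs xD.
have [y [yD y0 yE]] := hl _ aD (nneg_abs x).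
have kD : D (iter k U x) by exact: mem_iter.
have kaD : D (iter k U (absL0 x)) by exact: mem_iter.
have key j : nneg ((lam ^+ j.+1)%:C *: y - iter j U (absL0 x)).
  elim: j => [|j IH].
    by rewrite expr1 /= -yE subKr; exact: nneg_rot.
  rewrite (_ : _ - _ = (lam ^+ j.+1)%:C *: absL0 x +
      U ((lam ^+ j.+1)%:C *: y - iter j U (absL0 x))).
    by apply: nnegD; [apply: nnegZ; [rewrite exprn_ge0// ltW|exact: nneg_abs]|exact: nneg_rot].
  rewrite (linB _ _ (rot_lin a)) (linZ _ _ (rot_lin a)) -yE scalerBr subrKA iterS.
  by rewrite scalerA -rmorphM/= -exprSr yE.
have [_ <-] := ideal_abs kD; rewrite abs_iter_rot.
have k0 : nneg (iter k U (absL0 x)) by rewrite iter_rot; apply: nneg_rot; exact: nneg_abs.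
have h1 := ideal_le (nneg_le k0 (key k)) (nmemZ hN _ yD).
apply: le_trans h1 _; rewrite nZ// normc_rC ?exprn_ge0 ?(ltW l0)//.
have := HM _ yD; rewrite /lambda_minus yE aN => h2.
have h3 : N y <= (`|M| + 1) * N x.
  apply: le_trans h2 _; rewrite ler_wpM2r ?n_ge0//.
  by apply: le_trans (ler_norm _) _; rewrite lerDl.
rewrite (_ : _ * N x = lam ^+ k.+1 * ((`|M| + 1) * N x)); last by rewrite exprS; ring.
by rewrite ler_wpM2l// exprn_ge0// ltW.
Qed.

(** The iterates started at 0 are positive, and so is their limit. *)
Let fixed_pos (K : L -> L) : (forall x, D x -> D (K x)) -> (forall x, nneg x -> D x -> nneg (K x)) ->
  (forall x y, D x -> D y -> N (K x - K y) <= 2^-1 * N (x - y)) ->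
  exists y, [/\ D y, nneg y & K y = y].
Proof.
move=> KD K0 K2; have [y yD [Ky yl]] := contraction hN ideal_complete KD (nmem0 hN) K2.
have iD n : D (iter n K 0) by apply: mem_iter => //; exact: nmem0.
exists y; split => //; apply: (nneg_lim iD yD yl) => n.
elim: n => [|n IH]; first exact: nneg0.
by rewrite iterS; apply: K0.
Qed.

(** For large [lam] the equation is a fixed point problem for a positive
    contraction. *)
Let pos_large : exists lam, pos lam.
Proof.
have [_ [M HM]] := bU; pose lam := 2 * `|M| + 2; exists lam.
have l1 : 1 < lam by rewrite /lam; have := normr_ge0 M; lra.
have l0 : 0 < lam by exact: lt_trans l1.
have lC : lam%:C != 0 by rewrite -normc_gt0 normc_rC// ltW.
split=> // x xD x0; pose K y := (lam^-1)%:C *: (x + U y).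
have [|||y [yD y0 Ky]] := @fixed_pos K.
- by move=> y yD; apply: nmemZ => //; apply: nmemD => //; exact: UD.
- move=> y y0 _; apply: nnegZ; first by rewrite invr_ge0 ltW.
  by apply: nnegD => //; exact: nneg_rot.
- move=> y y' yD yD'; have dD := nmemB hN yD yD'.
  rewrite /K -scalerBr [x + _]addrC addrKA -(linB _ _ (rot_lin a)) nZ//; last exact: UD.
  rewrite normc_rC ?invr_ge0 ?(ltW l0)// mulrC ler_pdivrMr//.
  apply: le_trans (HM _ dD) _.
  apply: le_trans (ler_wpM2r (n_ge0 hN dD) (ler_norm M)) _.
  have := n_ge0 hN dD; rewrite /lam; have := normr_ge0 M; nra.
exists y; split => //; rewrite -{1}Ky /K scalerA.
have -> : lam%:C * (lam^-1)%:C = 1 by rewrite fmorphV divff.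
by rewrite scale1r addrK.
Qed.

(** Moving from [s] down to [lam] is a fixed point problem for the positive
    resolvent at [s], which is a contraction when [lam] is close to [s]. *)
Let pos_down (lam s B : R) : pos s -> 1 < lam -> lam < s -> 0 < B ->
  (forall x, D x -> N x <= B * N (lambda_minus U s%:C x)) -> (s - lam) * B <= 2^-1 -> pos lam.
Proof.
move=> [s1 hs] lam1 ls B0 HB sB; split=> // x xD x0.
have [inj sur _] := resU s1.
have /choice[Q QP] : forall u, exists v, D u -> [/\ D v, lambda_minus U s%:C v = u & nneg u -> nneg v].
  move=> u; have [uD|uD] := pselect (D u); last by exists 0.
  have [u0|u0] := pselect (nneg u).
    by have [v [vD v0 vE]] := hs _ uD u0; exists v.
  by have [v vD vE] := sur _ uD; exists v.
have dl : 0 <= s - lam by rewrite subr_ge0 ltW.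
have aD y : D y -> D (x + (s - lam)%:C *: y) by move=> yD; apply: nmemD => //; exact: nmemZ.
have [|||y [yD y0 Ky]] := @fixed_pos (fun y => Q (x + (s - lam)%:C *: y)).
- by move=> y /aD/QP[].
- move=> y y0 /aD/QP[_ _]; apply; apply: nnegD => //; exact: nnegZ.
- move=> y y' yD yD'; have dD := nmemB hN yD yD'.
  have [qD qE _] := QP _ (aD _ yD); have [qD' qE' _] := QP _ (aD _ yD').
  apply: le_trans (HB _ (nmemB hN qD qD')) _.
  rewrite (linB _ _ (lin_lambda _ (rot_lin a))) qE qE' [x + _]addrC addrKA.
  rewrite -scalerBr nZ// normc_rC// mulrA ler_wpM2r ?n_ge0//.
  by rewrite mulrC.
exists y; split => //; have [_ + _] := QP _ (aD _ yD); rewrite Ky /lambda_minus.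
rewrite rmorphB/= scalerBl => h; apply: (addIr (s%:C *: y - lam%:C *: y)).
by rewrite -h addrC addrA subrK.
Qed.

(** The resolvent of the positive operator [U] is positive for large [lam]. By
    continuation it stays positive as long as it exists, that is for all [lam
    > 1]; positivity at [lam] bounds the growth by [lam ^ k]. *)
Lemma rotation_growth rho : 1 < rho -> growth rho.
Proof.
move=> rho1; pose S := [set lam | pos lam].
have S1 : lbound S 1 by move=> lam [/ltW].
have hS : has_inf S by split; [exact: pos_large|exists 1].
have s_ge1 : 1 <= inf S by apply: lb_le_inf => //; exact: pos_large.
suff h : inf S < rho.
  have [lam Sl lr] := inf_lt pos_large h; have [K K0 HK] := pos_growth Sl.
  have [l1 _] := Sl; exists K => // k x xD; apply: le_trans (HK k x xD) _.
  rewrite ler_wpM2r ?n_ge0// ler_pM2l//.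
  have l0 := lt_trans ltr01 l1; have r0 := lt_trans ltr01 rho1.
  by apply: lerXn2r; rewrite ?nnegrE ltW.
apply: le_lt_trans rho1; rewrite leNgt; apply/negP => s1; set s := inf S in s1 s_ge1.
have [_ _ [M HM]] := resU s1; pose B := `|M| + 1.
have B0 : 0 < B by rewrite ltr_wpDl.
have HB x : D x -> N x <= B * N (lambda_minus U s%:C x).
  move=> xD; apply: le_trans (HM _ xD) _; rewrite ler_wpM2r//.
    by apply: n_ge0 => //; apply: nmemB => //; [exact: nmemZ|exact: UD].
  by apply: le_trans (ler_norm _) _; rewrite lerDl.
(* Start from a point just above the infimum: the bound [B] of the resolvent
   at the infimum is at most doubled there, and a step of length [2 * eta]
   downwards is admissible. *)
pose eta := (8 * B)^-1; have eta0 : 0 < eta by rewrite invr_gt0 mulr_gt0.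
have etaB : eta * B = 8^-1 by rewrite /eta invfM divfK// gt_eqF.
have se : s < s + eta by rewrite ltrDl.
have [s' Ss' ss'] := inf_lt pos_large se.
have sle : s <= s' by apply: ge_inf Ss'; exists 1.
have HB' x : D x -> N x <= 2 * B * N (lambda_minus U s'%:C x).
  move=> xD; have lD t : D (lambda_minus U t x).
    by apply: nmemB => //; [exact: nmemZ|exact: UD].
  have h1 : N (lambda_minus U s%:C x) <= N (lambda_minus U s'%:C x) + (s' - s) * N x.
    rewrite (_ : lambda_minus U s%:C x = lambda_minus U s'%:C x - (s' - s)%:C *: x).
      apply: le_trans (nB hN _ _) _ => //; first exact: nmemZ.
      by rewrite nZ// normc_rC// subr_ge0.
    by rewrite /lambda_minus rmorphB/= scalerBl opprB [RHS]addrC addrA subrK.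
  have := HB _ xD; have := ler_wpM2l (ltW B0) h1; have nx := n_ge0 hN xD.
  have h3 : B * ((s' - s) * N x) <= 8^-1 * N x.
    rewrite mulrA ler_wpM2r// -etaB mulrC ler_pM2r//.
    by rewrite lerBlDl ltW.
  rewrite mulrDr; move: h3; move: (B * (_ * _)) => q; rewrite -mulrA; lra.
pose lam := Num.max (s - eta) ((1 + s) / 2).
have lam1 : 1 < lam by rewrite lt_max; apply/orP; right; lra.
have lams : lam < s by rewrite gt_max; apply/andP; split; lra.
have pl : pos lam.
  apply: (@pos_down lam s' (2 * B)) => //; [exact: lt_le_trans sle|exact: mulr_gt0|].
  have : s - eta <= lam by rewrite le_max lexx.
  have := etaB; nra.
have hb : has_lbound S by exists 1.
by have := ge_inf hb pl; rewrite -/s leNgt lams.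
Qed.

End growth.

End space.

End ideal_spaces.

(** * Admissible spaces *)

Section admissible_spaces.
Variable R : realType.
Local Notation C := (circle R).
Local Notation m := (circle_measure R).
Local Notation L := (L0 m).
Implicit Types (x y w : L) (c : R[i]) (z : C).

Definition Linfty_space : subnormed L := Subnormed (Linfty R) (@Linfty_norm R).

Lemma Linf_le x (M : R) : {ae m, forall z, normc (x z) <= M} -> Linfty_norm x <= M.
Proof.
move=> xM.
have h1 : (ess_sup m (fun z => (normc (x z))%:E) <= M%:E)%E.
  by apply/ess_supP; apply: filterS xM => z h; rewrite lee_fin.
have h0 : (0 <= ess_sup m (fun z => (normc (x z))%:E))%E.
  apply: ess_sup_gee; first by rewrite [X in (_ < X)%E](@circle_measureT R) lte01.
  by apply: aeW => z; rewrite lee_fin normc_ge0.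
rewrite -lee_fin /Linfty_norm fineK// ge0_fin_numE//.
by apply: le_lt_trans h1 _; exact: ltry.
Qed.

Lemma Linf_ge x : Linfty R x -> {ae m, forall z, normc (x z) <= Linfty_norm x}.
Proof.
move=> [M xM].
have h1 : (ess_sup m (fun z => (normc (x z))%:E) <= M%:E)%E.
  by apply/ess_supP; apply: filterS xM => z h; rewrite lee_fin.
have h0 : (0 <= ess_sup m (fun z => (normc (x z))%:E))%E.
  apply: ess_sup_gee; first by rewrite [X in (_ < X)%E](@circle_measureT R) lte01.
  by apply: aeW => z; rewrite lee_fin normc_ge0.
have hf : ess_sup m (fun z => (normc (x z))%:E) \is a fin_num.
  by rewrite ge0_fin_numE//; apply: le_lt_trans h1 _; exact: ltry.
apply: filterS (ess_sup_ge m (fun z => (normc (x z))%:E)) => z h.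
by rewrite -lee_fin /Linfty_norm fineK.
Qed.

Lemma Linf_ge0 x : Linfty R x -> 0 <= Linfty_norm x.
Proof.
move=> xL; have := Linf_ge xL; move=> h; have [z hz] : exists z : C, normc (x z) <= Linfty_norm x.
  apply: contrapT => nz; have {h} : {ae m, forall z : C, False}.
    by apply: filterS h => z hz; apply: nz; exists z.
  move=> [A [mA A0 h]]; have : m setT = 0%E.
    by apply: (subset_measure0 _ mA) => // z _; apply: h => -[].
  rewrite [X in X = _](@circle_measureT R) => -[/eqP]; by rewrite oner_eq0.
exact: le_trans (normc_ge0 _) hz.
Qed.

Lemma Linfty_submodule : is_submodule (Linfty R).
Proof.
split; first by exists 0; apply: filterS (L0_0 R) => z ->; rewrite normc_0.
move=> c x y [M xM] [M' yM]; exists (normc c * M + M').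
apply: filterS2 (filterI xM yM) (filterI (L0D (c *: x) y) (L0Z c x)) => z [h1 h2] [-> ->].
by apply: le_trans (le_normcD _ _) _; rewrite lerD// normcM ler_wpM2l ?normc_ge0.
Qed.

Let ZLinf c x : Linfty R x -> Linfty_norm (c *: x) <= normc c * Linfty_norm x.
Proof.
move=> xL; apply: Linf_le; apply: filterS2 (Linf_ge xL) (L0Z c x) => z h ->.
by rewrite normcM ler_wpM2l ?normc_ge0.
Qed.

Lemma Linfty_normed : normed Linfty_space.
Proof.
have [sm0 smD] := Linfty_submodule.
have smZ c x : Linfty R x -> Linfty R (c *: x).
  by move=> h; rewrite -[_ *: _]addr0; exact: smD.
split; first exact: Linfty_submodule.
split.
- exact: Linf_ge0.
- move=> x xL h; apply: L0P; apply: filterS2 (Linf_ge xL) (L0_0 R) => z + ->.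
  rewrite [Linfty_norm x]h => h2; apply/eqP; rewrite -normc_eq0 eq_le h2; exact: normc_ge0.
- move=> c x xL /=; apply/eqP; rewrite eq_le ZLinf//=.
  have [->|c0] := eqVneq c 0.
    by rewrite normc_0 mul0r; apply: Linf_ge0; exact: smZ.
  have := ZLinf c^-1 (smZ c _ xL); rewrite scalerA mulVf// scale1r normcV.
  by rewrite mulrC ler_pdivlMr ?normc_gt0// mulrC.
- move=> x y xL yL; apply: Linf_le; apply: filterS2 (filterI (Linf_ge xL) (Linf_ge yL)) (L0D x y).
  by move=> z [h1 h2] ->; apply: le_trans (le_normcD _ _) _; rewrite lerD.
Qed.

(** A Cauchy sequence has a subsequence that converges almost everywhere, and
    the uniform bounds pass to that limit. *)
Lemma Linfty_complete : is_complete Linfty_space.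
Proof.
move=> u uL cau; have hN := Linfty_normed.
have /choice[n nP] : forall k, exists n0, forall p q, (n0 <= p)%N -> (n0 <= q)%N ->
    Linfty_norm (u p - u q) < 2^-1 ^+ k.
  by move=> k; apply: cau; rewrite exprn_gt0// invr_gt0.
pose M k := (\sum_(0 <= i < k.+1) (n i + i))%N.
have nM k : (n k + k <= M k)%N by rewrite /M big_nat_recr//= leq_addl.
have MS k : (M k <= M k.+1)%N by rewrite /M [X in (_ <= X)%N]big_nat_recr//= leq_addr.
have nM1 k : (n k <= M k)%N by apply: leq_trans (nM k); exact: leq_addr.
pose v k : C -> R[i] := (u (M k) : L).
have vi k : cintg m setT (v k) by apply: Linfty_cintg; exact: uL.
have dv k : \int[m]_z normc (v k.+1 z - v k z) <= 2^-1 ^+ k.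
  have dL : Linfty R (u (M k.+1) - u (M k)) by apply: (nmemB hN); exact: uL.
  rewrite -[leRHS]Rint_cst; apply: ae_le_Rint; [|exact: rintg_cst|].
    by apply: cintg_norm => //; exact: cintgB.
  apply: filterS2 (Linf_ge dL) (L0B (u (M k.+1)) (u (M k))) => z h1 e1.
  rewrite -[_ - _]e1; apply: le_trans h1 _; apply: ltW; apply: nP => //.
  exact: leq_trans (nM1 k) (MS k).
have [x [xi xae _]] := mean_limit vi dv.
have mx := cintg_meas xi; pose l := mkL0 m mx; have lE : {ae m, forall z, l z = x z} := mkL0E m mx.
have lim e : 0 < e -> exists n0, forall p, (n0 <= p)%N -> {ae m, forall z, normc ((u p - l : L) z) <= e}.
  move=> e0; have [n0 H] := cau _ e0; exists n0 => p np.
  have hk : {ae m, forall z, forall k, (n0 <= k)%N -> normc ((u p : L) z - v k z) <= e}.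
    apply: (ae_foralln (P := fun k z => (n0 <= k)%N -> normc ((u p : L) z - v k z) <= e)) => k.
    have [nk|nk] := leqP n0 k; last by apply: aeW.
    have kM : (n0 <= M k)%N by apply: leq_trans nk (leq_trans (leq_addl _ _) (nM k)).
    apply: filterS2 (Linf_ge (nmemB hN (uL p) (uL (M k)))) (L0B (u p) (u (M k))) => z h1 e1 _.
    by rewrite -[_ - _]e1; apply: le_trans h1 _; apply: ltW; exact: H.
  apply: filterS2 (filterI hk xae) (filterI lE (L0B (u p) l)) => z [h1 h2] [e1 e2].
  rewrite e2 e1; apply/ler_addgt0Pl => d d0; have [N _ HN] := h2 _ d0.
  have h3 := HN (maxn n0 N) (leq_maxr _ _); have h4 := h1 _ (leq_maxl n0 N).
  by apply: le_trans (normc_leD3 _ (v (maxn n0 N) z) _) _; rewrite addrC lerD// ltW.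
have lL : Linfty R l.
  have [n0 H] := lim _ ltr01; have h1 := H _ (leqnn n0); have [B hB] := uL n0.
  exists (1 + B); apply: filterS2 (filterI h1 hB) (L0B (u n0) l) => z [h2 h3] e1.
  rewrite e1 in h2; apply: le_trans (normc_leDBr ((u n0 : L) z) _) _; exact: lerD.
exists l => //; apply/cvgrPdist_lt => e e0; have e2 : 0 < e / 2 by rewrite divr_gt0.
have [n0 H] := lim _ e2; exists n0 => // p /= np.
rewrite sub0r normrN ger0_norm; last by apply: Linf_ge0; exact: (nmemB hN).
apply: le_lt_trans (Linf_le (H _ np)) _; lra.
Qed.

Lemma Linfty_ideal : banach_ideal_space Linfty_space.
Proof.
split.
- split; first exact: Linfty_submodule.
  by move=> x y xy [M yM]; exists M; apply: filterS2 xy yM => z; exact: le_trans.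
- have [? ?] := Linfty_normed; split => //; exact: Linfty_complete.
- move=> x y xL yL xy; apply: Linf_le; apply: filterS2 xy (Linf_ge yL) => z; exact: le_trans.
Qed.

(** The properties of the space used in the spectral analysis: besides the
    lattice structure, subexponential growth of the powers of the rotation and
    of its inverse. *)
Definition subexponential (X : subnormed L) (a : C) :=
  (forall x, carrier X x -> carrier X (rotation_op a x)) /\
  forall rho : R, 1 < rho -> growth X a rho.

Definition admissible (a : C) (X : subnormed L) :=
  [/\ banach_ideal_space X, Linfty R `<=` carrier X, carrier X `<=` Lone R,
    subexponential X a & subexponential X (cinv a)].

Lemma Linfty_rot (a : C) x : Linfty R x -> Linfty R (rotation_op a x) /\
  Linfty_norm (rotation_op a x) <= Linfty_norm x.
Proof.
move=> xL; have h : {ae m, forall z, normc (rotation_op a x z) <= Linfty_norm x}.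
  by apply: filterS2 (ae_rot a (Linf_ge xL)) (L0rot a x) => z h ->.
by split; [exists (Linfty_norm x)|exact: Linf_le].
Qed.

Lemma Linfty_growth (a : C) (rho : R) : 1 < rho -> growth Linfty_space a rho.
Proof.
move=> rho1; exists 1 => // k x xL; rewrite mul1r iter_rot.
have [_ h] := Linfty_rot (cpow a k) xL; apply: le_trans h _.
by rewrite ler_peMl ?Linf_ge0// exprn_ege1// ltW.
Qed.

Lemma Linfty_admissible (a : C) : admissible a Linfty_space.
Proof.
have sub b : subexponential Linfty_space b.
  by split=> [x /(Linfty_rot b)[]//|rho]; exact: Linfty_growth.
split => //; first exact: Linfty_ideal.
by move=> x /Linfty_cintg xi; exact/Lone_cintg.
Qed.

(** The spectral hypothesis is symmetric under inversion: for [lam > 1] the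
    equation for the inverse rotation at [lam] is the one for the rotation at
    [lam^-1]. *)
Lemma spectrum_admissible (a : C) (X : subnormed L) : banach_ideal_space X ->
  Linfty R `<=` carrier X -> carrier X `<=` Lone R -> bounded_on X (rotation_op a) ->
  spectrum (rotation_op a) X `<=` [set z : R[i] | `|z| = 1] -> admissible a X.
Proof.
move=> hX LX XL bU sU; have hN := ideal_normed hX; have [UD [MU HU]] := bU.
have res (lam : R) : 0 <= lam -> lam != 1 -> resolvent_set (rotation_op a) X lam%:C.
  move=> l0 l1; apply: contrapT => /sU /=; rewrite norm_normc normc_rC// => -[].
  by apply/eqP.
have rl := rot_lin a; have il := rot_lin (cinv a).
have nL (b : C) t x : lambda_minus (rotation_op b) t x = t *: x - rotation_op b x by [].
have bV : bounded_on X (rotation_op (cinv a)).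
  have [inj sur [M HM]] := res 0 (lexx 0) (ltac:(by rewrite eq_sym oner_eq0)).
  have VD x : carrier X x -> carrier X (rotation_op (cinv a) x).
    move=> xD; have [y yD yE] := sur _ xD; rewrite -yE nL scale0r sub0r linN//.
    by rewrite rot_cinvK; exact: nmemN.
  split => //; exists M => x xD; have := HM _ (VD _ xD).
  by rewrite nL scale0r sub0r rotK_cinv nN.
have [VD0 _] := bV.
split => //; split=> // rho; apply: rotation_growth => // lam lam1.
  by apply: res; [exact: ltW (lt_trans ltr01 lam1)|rewrite gt_eqF].
have l0 : 0 < lam := lt_trans ltr01 lam1.
have lC : lam%:C != 0 by rewrite -normc_gt0 normc_rC// ltW.
have [VD [MV HV]] := bV.
have liE : (lam^-1)%:C = lam%:C^-1 :> R[i] by exact: fmorphV.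
have [inj sur [M HM]] : resolvent_set (rotation_op a) X (lam^-1)%:C.
  by apply: res; [rewrite invr_ge0 ltW|rewrite lt_eqF// invf_lt1].
have key x : lambda_minus (rotation_op a) (lam^-1)%:C x =
    - (lam%:C^-1 *: rotation_op a (lambda_minus (rotation_op (cinv a)) lam%:C x)).
  rewrite !nL (linB _ _ rl) (linZ _ _ rl) rotK_cinv scalerBr scalerA mulVf// scale1r liE.
  by rewrite opprB.
split.
- move=> x xD h; apply: inj => //.
  by rewrite key h (lin0 rl) scaler0 oppr0.
- move=> y yD; have uD : carrier X (- (lam%:C^-1 *: rotation_op a y)).
    by apply: nmemN => //; apply: nmemZ => //; exact: UD.
  have [x xD xE] := sur _ uD; exists x => //.
  move: xE; rewrite key => /oppr_inj/(congr1 (fun v => lam%:C *: v)).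
  rewrite !scalerA divff// !scale1r => /(congr1 (rotation_op (cinv a))).
  by rewrite !rot_cinvK.
- exists (`|M| * (lam^-1 * `|MU|)) => x xD.
  have dD : carrier X (lambda_minus (rotation_op (cinv a)) lam%:C x).
    by apply: nmemB => //; [exact: nmemZ|exact: VD].
  have aD := UD _ dD; have zD := nmemZ hN lam%:C^-1 aD.
  apply: le_trans (HM _ xD) _; apply: le_trans (ler_wpM2r _ (ler_norm M)) _.
    by rewrite key; apply: n_ge0 => //; exact: nmemN.
  rewrite key nN// nZ// -liE normc_rC ?invr_ge0 ?(ltW l0)// -!mulrA.
  rewrite ler_wpM2l// ler_wpM2l ?invr_ge0 ?(ltW l0)//.
  apply: le_trans (HU _ dD) _; rewrite ler_wpM2r ?ler_norm//; exact: n_ge0.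
Qed.

Section hardy_part.
Variables (a : C) (X : subnormed L) (w : L).
Hypothesis aX : admissible a X.
Hypothesis wH : Hinfty R w.
Local Notation Y := (H1_inter X).
Local Notation T := (weighted_rotation_op w a).

Let hX : banach_ideal_space X. Proof. by have [] := aX. Qed.
Let hN := ideal_normed hX.

Lemma adm_cintg x : carrier X x -> cintg m setT x.
Proof. by have [_ _ XL _ _] := aX; move=> /XL/Lone_cintg. Qed.

Lemma adm_L1 : exists2 K : R, 0 < K & forall x, carrier X x -> norm1 x <= K * nnorm X x.
Proof. by have [_ _ XL _ _] := aX; exact: ideal_L1. Qed.

Lemma adm_bounded_rot (b : C) : subexponential X b -> bounded_on X (rotation_op b).
Proof.
move=> [UD g]; split=> //; have [K K0 HK] := g 2 (ltac:(by rewrite ltr1n)).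
by exists (K * 2 ^+ 1) => x xD; exact: (HK 1%N).
Qed.

Lemma weight_bounded : exists2 M : R, 0 <= M & {ae m, forall z, normc (w z) <= M}.
Proof.
have : Linfty R w by move: wH; rewrite HinftyE => -[].
move=> [M wM]; exists `|M| => //; apply: filterS wM => z h; apply: le_trans h _; exact: ler_norm.
Qed.

Lemma mul_bounded (v : L) (M : R) x : 0 <= M -> {ae m, forall z, normc (v z) <= M} ->
  carrier X x -> carrier X (mulL0 v x) /\ nnorm X (mulL0 v x) <= M * nnorm X x.
Proof.
move=> M0 vM xD; apply: (ideal_leZ hX) => //.
by apply: filterS2 vM (L0M v x) => z h ->; rewrite normcM ler_wpM2r ?normc_ge0.
Qed.

Lemma weighted_bounded : bounded_on X T.
Proof.
have [M M0 wM] := weight_bounded; have [_ _ _ sa _] := aX.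
have [UD [K HK]] := adm_bounded_rot sa; split=> [x xD|].
  by have [] := mul_bounded M0 wM (UD _ xD).
exists (M * K) => x xD; have [_ h] := mul_bounded M0 wM (UD _ xD).
by apply: le_trans h _; rewrite -mulrA ler_wpM2l// HK.
Qed.

(** Convergence in an ideal space implies convergence in mean, in which the
    Hardy space is closed. *)
Lemma hardy_banach : is_banach Y.
Proof.
have [[sm0 smD] [ng ne nz nd]] := hN; have [h0 hD] := @H1_submodule R.
split.
- split; first by split.
  by move=> c x y [xH xD] [yH yD]; split; [exact: hD|exact: smD].
- by split=> [x []|x []|c x []|x y [_ xD] [_ yD]] => //; [move=> _; exact: ng|move=> _; exact: ne|
    move=> _; exact: nz|exact: nd].
move=> u uY cau; have uD n : carrier X (u n) by have [] := uY n.
have [l lD ul] := ideal_complete hX uD cau; exists l; last exact: ul.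
split; last exact: lD.
have [K K0 HK] := adm_L1.
apply: H1_closed => [|e e0]; first exact: adm_cintg.
have eK : 0 < e / K by rewrite divr_gt0.
move/cvgrPdist_lt : ul => /(_ _ eK)[n0 _ H]; have := H n0 (leqnn n0) => /= h.
exists (u n0); first by have [] := uY n0.
apply: le_lt_trans (HK _ (nmemB hN lD (uD n0))) _.
rewrite -ltr_pdivlMl// mulrC; apply: le_lt_trans h.
by rewrite sub0r normrN nBC//; exact: ler_norm.
Qed.

Lemma hardy_normed : normed Y.
Proof. by have [] := hardy_banach. Qed.

Lemma hardy_weighted_bounded : bounded_on Y T.
Proof.
have [TD [M HM]] := weighted_bounded.
by split=> [x [xH xD]|]; [split; [exact: H1_weighted|exact: TD]|exists M => x [_ /HM]].
Qed.

End hardy_part.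

Lemma Hinfty_spaceE : Hinfty_space R = H1_inter Linfty_space.
Proof. by rewrite /Hinfty_space HinftyE. Qed.

End admissible_spaces.

(** * Codimensions cut out by functionals *)

Section codimension.

(** Increase the truncation until the rank stops growing; rows that are
    dependent for all truncations are dependent. *)
Lemma trunc_row_free (K : fieldType) n (F : 'I_n -> nat -> K) :
  (forall c : 'rV[K]_n, (forall k, \sum_i c 0 i * F i k = 0) -> c = 0) ->
  exists N, row_free (\matrix_(i < n, k < N) F i k).
Proof.
move=> Find; pose M N := \matrix_(i < n, k < N) F i k.
have MV N (c : 'rV[K]_n) : (c *m M N == 0) = [forall k : 'I_N, \sum_i c 0 i * F i k == 0].
  apply/eqP/forallP => [h k|h].
    have := congr1 (fun A : 'rV_N => A 0 k) h; rewrite !mxE => /eqP.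
    by rewrite (eq_bigr (fun i => c 0 i * F i k))// => i _; rewrite mxE.
  apply/rowP => k; rewrite !mxE; have /eqP hk := h k; rewrite -[RHS]hk.
  by apply: eq_bigr => i _; rewrite mxE.
suff /(_ n (leqnn n))[N nN] : forall d, (d <= n)%N -> exists N, (d <= \rank (M N))%N.
  by exists N; rewrite /row_free eqn_leq rank_leq_row nN.
elim=> [|d IH] dn; first by exists 0%N.
have [N dN] := IH (ltnW dn); have [h|h] := ltnP d (\rank (M N)); first by exists N.
have nf : kermx (M N) != 0.
  rewrite -mxrank_eq0 mxrank_ker subn_eq0 -ltnNge; exact: leq_ltn_trans h dn.
have /rowV0Pn[c cK c0] := nf.
have [k hk] : exists k, \sum_i c 0 i * F i k != 0.
  apply: contrapT => nk; move/eqP : c0; apply; apply: Find => k.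
  by apply: contrapT => /eqP h'; apply: nk; exists k.
pose N' := maxn N k.+1; exists N'.
have sub : (kermx (M N') <= kermx (M N))%MS.
  apply/rV_subP => u /sub_kermxP/eqP; rewrite MV => /forallP hu.
  apply/sub_kermxP/eqP; rewrite MV; apply/forallP => j.
  have jN : (j < N')%N by apply: leq_trans (ltn_ord j) (leq_maxl _ _).
  exact: (hu (Ordinal jN)).
have nc : ~~ (c <= kermx (M N'))%MS.
  apply/negP => /sub_kermxP/eqP; rewrite MV => /forallP hc.
  by have := hc (Ordinal (leq_maxr N k.+1)); rewrite /= (negPf hk).
have : (kermx (M N') < kermx (M N))%MS.
  by rewrite /ltmx sub /=; apply: contra nc; apply: submx_trans.
rewrite ltmxErank => /andP[_]; rewrite !mxrank_ker.
have := rank_leq_row (M N); have := rank_leq_row (M N'); lia.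
Qed.

Variables (R : realType) (V : lmodType R[i]).
Implicit Types (B : set V) (f : nat -> V -> R[i]).

Definition flin B f := forall k (c : R[i]) x y, B x -> B y -> f k (c *: x + y) = c * f k x + f k y.

(** The subspaces whose codimension is compared are common kernels of
    countably many functionals. *)
Definition fker B f : set V := [set y | B y /\ forall k, f k y = 0].

Lemma flin_sum B f n (c : 'I_n -> R[i]) (v : 'I_n -> V) k : is_submodule B -> flin B f ->
  (forall i, B (v i)) -> B (\sum_i c i *: v i) /\ f k (\sum_i c i *: v i) = \sum_i c i * f k (v i).
Proof.
move=> [B0 BD] fl Bv.
have f0 : f k 0 = 0.
  have := fl k 1 0 0 B0 B0; rewrite scale1r addr0 mul1r => h.
  by apply: (addIr (f k 0)); rewrite add0r -h.
elim/big_ind2 : _ => //; last first.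
  move=> i _; have := BD (c i) _ _ (Bv i) B0; rewrite addr0 => h; split=> //.
  by have := fl k (c i) _ _ (Bv i) B0; rewrite addr0 f0 addr0.
move=> x a y b [Bx fx] [By fy]; have := BD 1 _ _ Bx By; rewrite scale1r => h; split=> //.
by have := fl k 1 _ _ Bx By; rewrite scale1r mul1r => ->; rewrite fx fy.
Qed.

Lemma flinB B f k x y : is_submodule B -> flin B f -> B x -> B y ->
  B (x - y) /\ f k (x - y) = f k x - f k y.
Proof.
move=> [B0 BD] fl Bx By; have := BD (-1) _ _ By Bx; have := fl k (-1) _ _ By Bx.
by rewrite scaleN1r mulN1r [- y + x]addrC [- f k y + _]addrC.
Qed.

(** Coordinates modulo the common kernel are finite combinations of the
    functionals. *)
Lemma fker_dual B f n (v : 'I_n -> V) : is_submodule B -> flin B f -> (forall i, B (v i)) ->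
  (forall c, fker B f (\sum_i c i *: v i) -> forall i, c i = 0) ->
  exists N (G : 'I_N -> 'I_n -> R[i]),
    forall i j, \sum_(k < N) f k (v i) * G k j = (i == j)%:R.
Proof.
move=> sB fl Bv ind.
have [c h|N /row_freeP[G MG]] := @trunc_row_free _ n (fun i k => f k (v i)).
  apply/rowP => i; rewrite mxE; apply: (ind (fun i => c 0 i)); split.
    by have [] := flin_sum (fun i => c 0 i) 0%N sB fl Bv.
  by move=> k; have [_ ->] := flin_sum (fun i => c 0 i) k sB fl Bv.
exists N, (fun k j => G k j) => i j; have := congr1 (fun A : 'M[R[i]]_n => A i j) MG.
by rewrite !mxE => <-; apply: eq_bigr => k _; rewrite mxE.
Qed.

Lemma fker_coord B f n (v : 'I_n -> V) N (G : 'I_N -> 'I_n -> R[i]) y : is_submodule B ->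
  flin B f -> (forall i, B (v i)) -> (forall i j, \sum_(k < N) f k (v i) * G k j = (i == j)%:R) ->
  B y -> (exists c, fker B f (y - \sum_i c i *: v i)) ->
  forall k, f k y = \sum_i (\sum_(j < N) f j y * G j i) * f k (v i).
Proof.
move=> sB fl Bv GE By [c [_ h]] k.
have hk l : f l y = \sum_i c i * f l (v i).
  have [Bs fs] := flin_sum c l sB fl Bv; have [_ e] := flinB l sB fl By Bs.
  by apply/eqP; rewrite -subr_eq0 -fs -e h.
rewrite hk; apply: eq_bigr => i _; congr (_ * _).
transitivity (\sum_(j < N) \sum_i0 (c i0 * f j (v i0) * G j i)); last first.
  by apply: eq_bigr => j _; rewrite hk mulr_suml.
rewrite exchange_big /= (bigD1 i)//= [X in _ + X]big1 => [|l li].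
  rewrite addr0 (eq_bigr (fun j : 'I_N => c i * (f j (v i) * G j i))) => [|j _]; last by rewrite mulrA.
  by rewrite -mulr_sumr GE eqxx mulr1.
rewrite (eq_bigr (fun j : 'I_N => c l * (f j (v l) * G j i))) => [|j _]; last by rewrite mulrA.
by rewrite -mulr_sumr GE (negPf li) mulr0.
Qed.

Definition fdense B' B f := forall y, B y -> forall N (e : R), 0 < e ->
  exists2 y', B' y' & forall k, (k < N)%N -> normc (f k y - f k y') < e.

Lemma fdense_eq0 B' B f N (t : 'I_N -> R[i]) : fdense B' B f ->
  (forall y, B' y -> \sum_(k < N) t k * f k y = 0) ->
  forall y, B y -> \sum_(k < N) t k * f k y = 0.
Proof.
move=> fd h y By; apply/eqP; rewrite -normc_eq0 eq_le normc_ge0 andbT.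
pose S := \sum_(k < N) normc (t k) + 1.
have S0 : 0 < S by rewrite ltr_wpDl// sumr_ge0// => k _; exact: normc_ge0.
apply/ler_addgt0Pl => e e0; rewrite addr0.
have [y' By' hy] := fd y By N _ (divr_gt0 e0 S0).
have -> : \sum_(k < N) t k * f k y = \sum_(k < N) (t k * f k y - t k * f k y').
  by rewrite sumrB [X in _ - X](h y' By') subr0.
apply: (@le_trans _ _ (\sum_(k < N) normc (t k) * (e / S))).
  elim/big_ind2 : _ => [|a b p q h1 h2|k _]; first by rewrite normc_0.
    by apply: le_trans (le_normcD _ _) _; exact: lerD.
  by rewrite -mulrBr normcM ler_wpM2l ?normc_ge0// ltW// hy.
rewrite -mulr_suml -[leRHS](divfK (lt0r_neq0 S0)) [leRHS]mulrC ler_wpM2r ?divr_ge0 ?ltW//.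
by rewrite /S ltrDl.
Qed.

(** Finitely many functionals determine the coordinates modulo the common
    kernel. A basis of the quotient can therefore be approximated inside the
    dense subspace without losing independence, and a basis in the subspace
    still spans because the coordinate identities extend by density. *)
Lemma dim_transfer B B' f n : is_submodule B -> is_submodule B' -> B' `<=` B -> flin B f ->
  fdense B' B f -> dim_mod B (fker B f) n <-> dim_mod B' (fker B' f) n.
Proof.
move=> sB sB' B'B fl fd.
have fl' : flin B' f by move=> k c x y /B'B Bx /B'B By; exact: fl.
split=> -[v [Bv ind span]].
- have [N [G GE]] := fker_dual sB fl Bv ind.
  pose g y i := \sum_(j < N) f j y * G j i.
  have crd z (Bz : B z) := fker_coord sB fl Bv GE Bz (span z Bz).
  pose K : R := \sum_(j < N) \sum_i normc (G j i) + 1.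
  have K0 : 0 < K.
    by rewrite ltr_wpDl// sumr_ge0// => j _; rewrite sumr_ge0// => i _; exact: normc_ge0.
  have e0 : 0 < (n.+1%:R * K)^-1 by rewrite invr_gt0 mulr_gt0.
  have /choice[v' v'P] : forall i, exists y', B' y' /\
      forall k, (k < N)%N -> normc (f k (v i) - f k y') < (n.+1%:R * K)^-1.
    by move=> i; have [y' ? ?] := fd _ (Bv i) N _ e0; exists y'.
  have Bv' i : B' (v' i) by have [] := v'P i.
  have BBv' i : B (v' i) by exact: B'B.
  have gv i j : g (v i) j = (i == j)%:R by exact: GE.
  (* the coordinates of the approximating vectors, a matrix close to the
     identity *)
  pose H : 'M[R[i]]_n := \matrix_(i, j) g (v' i) j.
  have near i j : normc ((i == j)%:R - H i j) <= n.+1%:R^-1.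
    rewrite mxE -gv /g -sumrB.
    apply: (@le_trans _ _ (\sum_(k < N) (n.+1%:R * K)^-1 * normc (G k j))).
      elim/big_ind2 : _ => [|a b p q h1 h2|k _]; first by rewrite normc_0.
        by apply: le_trans (le_normcD _ _) _; exact: lerD.
      by rewrite -mulrBl normcM ler_wpM2r ?normc_ge0// ltW//; have [_ ->] := v'P i.
    rewrite -mulr_sumr invfM -mulrA ger_pMr ?invr_gt0 ?ltr0n// mulrC ler_pdivrMr// mul1r /K.
    apply: ler_wpDr => //; apply: ler_sum => k _.
    by rewrite (bigD1 j)//= lerDl sumr_ge0// => i0 _; exact: normc_ge0.
  (* In a linear relation between the rows, the largest coefficient would be
     dominated by a smaller multiple of itself. *)
  have Hfree : row_free H.
    rewrite -kermx_eq0; apply/rowV0P => c /sub_kermxP cH.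
    case: n => [|n'] in v ind span Bv G GE g crd K K0 e0 v' v'P Bv' BBv' gv H near c cH *.
      by apply/rowP => -[].
    pose i0 := [arg max_(i > ord0) normc (c 0 i)]%O.
    have cmax i : normc (c 0 i) <= normc (c 0 i0).
      by rewrite /i0; case: arg_maxP => // j _; apply.
    have c0 : c 0 i0 = 0.
      have e : c 0 i0 = \sum_j c 0 j * ((j == i0)%:R - H j i0).
        have := congr1 (fun A : 'rV_n'.+1 => A 0 i0) cH; rewrite !mxE => h.
        rewrite (eq_bigr (fun j => c 0 j * (j == i0)%:R - c 0 j * H j i0)) => [|j _]; last by rewrite mulrBr.
        rewrite sumrB h subr0 (bigD1 i0)//= eqxx mulr1 big1 ?addr0// => j /negPf ->.
        by rewrite mulr0.
      have : normc (c 0 i0) <= n'.+1%:R * (n'.+2%:R^-1 * normc (c 0 i0)).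
        rewrite {1}e; apply: (@le_trans _ _ (\sum_(j < n'.+1) n'.+2%:R^-1 * normc (c 0 i0))).
          elim/big_ind2 : _ => [|a b p q h1 h2|k _]; first by rewrite normc_0.
            by apply: le_trans (le_normcD _ _) _; exact: lerD.
          by rewrite normcM mulrC ler_pM ?normc_ge0.
        by rewrite sumr_const card_ord mulr_natl.
      move=> h; apply/eqP; rewrite -normc_eq0 eq_le normc_ge0 andbT leNgt; apply/negP => c0.
      move: h; rewrite mulrA ler_pMl// leNgt => /negP; apply.
      by rewrite ltr_pdivrMr ?ltr0n// mul1r ltr_nat.
    apply/rowP => i; rewrite mxE; apply/eqP; rewrite -normc_eq0 eq_le normc_ge0 andbT.
    by rewrite (le_trans (cmax i))// c0 normc_0.
  have Hu : H \in unitmx by rewrite -row_free_unit.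
  have glin c i : g (\sum_j c j *: v' j) i = \sum_j c j * H j i.
    rewrite /g (eq_bigr (fun k : 'I_N => \sum_j c j * (f k (v' j) * G k i))) => [|k _].
      rewrite exchange_big /=; apply: eq_bigr => j _.
      by rewrite -mulr_sumr mxE.
    have [_ ->] := flin_sum c k sB fl BBv'; rewrite mulr_suml.
    by apply: eq_bigr => j _; rewrite mulrA.
  exists v'; split=> //.
    move=> c [Bs hs] i.
    have : (\row_j c j) *m H = 0.
      apply/rowP => j; rewrite !mxE (eq_bigr (fun i => c i * H i j)) => [|l _]; last by rewrite mxE.
      by rewrite -glin /g big1// => k _; rewrite hs mul0r.
    move/(congr1 (fun A => A *m invmx H)); rewrite mulmxK// mul0mx => /rowP/(_ i).
    by rewrite !mxE.
  move=> y' By'; pose c := (\row_j g y' j) *m invmx H.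
  have cE i : \sum_j c 0 j * H j i = g y' i.
    by have := mulmxKV Hu (\row_j g y' j) => /rowP/(_ i); rewrite !mxE.
  exists (fun j => c 0 j); have [Bs _] := flin_sum (fun j => c 0 j) 0%N sB' fl' Bv'.
  split; first by have [] := flinB 0%N sB' fl' By' Bs.
  move=> k; have [_ ->] := flinB k sB' fl' By' Bs.
  rewrite (crd _ (B'B _ By')) (crd _ (B'B _ Bs)).
  rewrite -sumrB big1// => i _; rewrite -/(g _ _) -/(g _ _) glin cE subrr//.
- have [N [G GE]] := fker_dual sB' fl' Bv ind.
  have BBv i : B (v i) by exact: B'B.
  exists v; split=> // [c [_ hs]|y By].
    apply: ind; split=> //.
    by have [] := flin_sum c 0%N sB' fl' Bv.
  pose g y i := \sum_(j < N) f j y * G j i.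
  exists (g y); have [Bs _] := flin_sum (g y) 0%N sB fl BBv.
  split; first by have [] := flinB 0%N sB fl By Bs.
  move=> k; have [_ ->] := flinB k sB fl By Bs; have [_ ->] := flin_sum (g y) k sB fl BBv.
  pose N' := maxn N k.+1.
  pose Gx j i : R[i] := if insub j is Some j' then G j' i else 0.
  pose t (j : 'I_N') : R[i] := (nat_of_ord j == k)%:R - \sum_i Gx j i * f k (v i).
  have tE z : \sum_(j < N') t j * f j z = f k z - \sum_i g z i * f k (v i).
    rewrite (eq_bigr (fun j : 'I_N' => (nat_of_ord j == k)%:R * f j z -
      \sum_i (f j z * Gx j i) * f k (v i))) => [|j _]; last first.
      rewrite mulrBl; congr (_ - _); rewrite mulr_suml; apply: eq_bigr => i _; ring.
    rewrite sumrB; congr (_ - _).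
      rewrite (bigD1 (Ordinal (leq_maxr N k.+1)))//= eqxx mul1r big1 ?addr0// => j jk.
      by rewrite (_ : nat_of_ord j == k = false) ?mul0r//; apply: contraNF jk => /eqP h;
        apply/eqP/val_inj.
    rewrite exchange_big /=; apply: eq_bigr => i _; rewrite -mulr_suml; congr (_ * _).
    pose F j := f j z * Gx j i.
    rewrite /g (eq_bigr (fun j : 'I_N => F j)) => [|j _]; last by rewrite /F /Gx valK.
    rewrite (big_ord_widen N' F (leq_maxl _ _)) [RHS]big_mkcond /= big_mkcond /=.
    apply: eq_bigr => j _; case: ifP => // jN.
    by rewrite /Gx insubF// mulr0.
  by rewrite -tE; apply: (fdense_eq0 fd) By => y' By'; rewrite tE (fker_coord sB' fl' Bv GE By' (span _ By') k) subrr.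
Qed.

End codimension.

(** * Contracting and expanding weights *)

Section contracting_expanding.
Variable R : realType.
Local Notation C := (circle R).
Local Notation m := (circle_measure R).
Local Notation L := (L0 m).
Implicit Types (x y w : L) (lam : R[i]) (z : C) (p n : nat).

Lemma root_gt1 (B : R) p : 1 < B -> (0 < p)%N -> exists2 rho : R, 1 < rho & rho ^+ p < B.
Proof.
move=> B1 p0; have lB : 0 < ln B by exact: ln_gt0.
have pR : 0 < p%:R :> R by rewrite ltr0n.
exists (expR (ln B / (2 * p%:R))).
  by rewrite -[X in X < _]expR0 ltr_expR divr_gt0// mulr_gt0.
rewrite -expRM_natl -[ltRHS]lnK ?posrE ?(lt_trans ltr01 B1)// ltr_expR.
rewrite (_ : _ * _ = ln B / 2); last by field; rewrite gt_eqF.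
by rewrite ltr_pdivrMr// ltr_pMr// ltr1n.
Qed.

Lemma ae_iter_rot (P : C -> Prop) (a : C) p : {ae m, forall z, P z} ->
  {ae m, forall z, P (iter p (rotation a) z)}.
Proof. by move=> h; apply: filterS (ae_rot (cpow a p) h) => z; rewrite rotation_cpow. Qed.

Lemma wprodD_ae w (a : C) p n : {ae m, forall z,
  wprod w a (p + n) z = wprod w a p z * wprod w a n (iter p (rotation a) z)}.
Proof.
rewrite wprodD; apply: filterS2 (L0M (wprod w a p) (iter p (rotation_op a) (wprod w a n)))
  (iter_rotE a p (wprod w a n)) => z -> ->; by [].
Qed.

Lemma wprod_pow_le w (a : C) p n (c : R) : 0 <= c ->
  {ae m, forall z, normc (wprod w a p z) <= c} ->
  {ae m, forall z, normc (wprod w a (p * n) z) <= c ^+ n}.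
Proof.
move=> c0 h; elim: n => [|n IH].
  by rewrite muln0; apply: filterS (L0_1 R) => z ->; rewrite normc_1 expr0.
rewrite mulnS; apply: filterS2 (wprodD_ae w a p (p * n)) (filterI h (ae_iter_rot a p IH)).
by move=> z -> [h1 h2]; rewrite normcM exprS ler_pM ?normc_ge0.
Qed.

Lemma wprod_pow_ge w (a : C) p n (c : R) : 0 <= c ->
  {ae m, forall z, c <= normc (wprod w a p z)} ->
  {ae m, forall z, c ^+ n <= normc (wprod w a (p * n) z)}.
Proof.
move=> c0 h; elim: n => [|n IH].
  by rewrite muln0; apply: filterS (L0_1 R) => z ->; rewrite normc_1 expr0.
rewrite mulnS; apply: filterS2 (wprodD_ae w a p (p * n)) (filterI h (ae_iter_rot a p IH)).
by move=> z -> [h1 h2]; rewrite normcM exprS ler_pM ?exprn_ge0.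
Qed.

(** The two alternatives involve the weight only, not the space on which the
    operator acts. *)
Definition contracts w (a : C) lam := exists p (c : R),
  [/\ (0 < p)%N, 0 <= c, c < normc lam ^+ p &
    {ae m, forall z, normc (wprod w a p z) <= c}].

Definition expands w (a : C) lam := exists p (c : R),
  [/\ (0 < p)%N, normc lam ^+ p < c &
    {ae m, forall z, c <= normc (wprod w a p z)}].

(** The exponential of a logarithm replaces the inverse of the modulus, which
    is convenient for measurability. *)
Lemma L0_inverse (c : R) (v : L) : 0 < c -> {ae m, forall z, c <= normc (v z)} ->
  exists u : L, {ae m, forall z, v z * u z = 1} /\ {ae m, forall z, normc (u z) <= c^-1}.
Proof.
move=> c0 vc; pose f z : R[i] := (expR (- (2 * ln (normc (v z)))))%:C * conjc (v z).
have mf : measurable_fun setT f.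
  apply: measurable_complexM; last by apply: cmeas_conjc; exact: L0_meas.
  apply: cmeas_real; apply: measurableT_comp => //; apply: measurableT_comp => //.
  by apply: measurable_funM => //; apply: measurableT_comp => //; exact: norm1_meas.
exists (mkL0 m mf).
have h : {ae m, forall z, v z * mkL0 m mf z = 1}.
  apply: filterS2 vc (mkL0E m mf) => z vz ->; have v0 : 0 < normc (v z) by exact: lt_le_trans vz.
  rewrite /f mulrCA mulc_conjc -rmorphM/= (_ : _ * _ = 1)//.
  by rewrite expRN mulr_natl mulr2n expRD lnK ?posrE// -expr2 mulVf// expf_neq0// gt_eqF.
split=> //; apply: filterS2 h vc => z h vz; have v0 : 0 < normc (v z) by exact: lt_le_trans vz.
have := congr1 (@normc R) h; rewrite normcM normc_1 => e.
have -> : normc (mkL0 m mf z) = (normc (v z))^-1.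
  by apply: (mulfI (lt0r_neq0 v0)); rewrite e divff// gt_eqF.
by rewrite lef_pV2 ?posrE.
Qed.

Section admissible.
Variables (a : C) (X : subnormed L) (w : L) (lam : R[i]).
Hypothesis aX : admissible a X.
Hypothesis wH : Hinfty R w.
Local Notation Y := (H1_inter X).
Local Notation T := (weighted_rotation_op w a).
Local Notation S := (lambda_minus T lam).
Local Notation N := (nnorm X).

Let hX : banach_ideal_space X. Proof. by have [] := aX. Qed.
Let hN := ideal_normed hX.
Let bT : bounded_on X T. Proof. exact: weighted_bounded aX wH. Qed.
Let lT : lin T. Proof. exact: weighted_lin. Qed.

(** The subexponential growth of the rotation is absorbed by the gap between
    [c] and [|lam| ^ p] after passing to a high power. *)
Lemma contracts_invertible : contracts w a lam -> invertible_on Y S.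
Proof.
move=> [p [c [p0 c0 cl wc]]]; set l := normc lam ^+ p in cl.
have l0 : 0 < l by exact: le_lt_trans cl.
have lam0 : lam != 0.
  by apply/eqP => e0; move: l0; rewrite /l e0 normc_0 expr0n gtn_eqF// ltxx.
pose d := (c + l) / 2; have d0 : 0 < d by rewrite /d; lra.
have B1 : 1 < l / d by rewrite ltr_pdivlMr// mul1r /d; lra.
have [rho rho1 rp] := root_gt1 B1 p0.
have rho0 : 0 < rho := lt_trans ltr01 rho1.
have [_ _ _ [UD g] _] := aX; have [K K0 HK] := g _ rho1.
pose th := c * rho ^+ p / l.
have th0 : 0 <= th.
  by apply: divr_ge0; [apply: mulr_ge0 => //; apply: exprn_ge0; exact: ltW|exact: ltW].
have th1 : th < 1.
  rewrite ltr_pdivrMr// mul1r; move: rp; rewrite ltr_pdivlMr// => rp.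
  apply: le_lt_trans rp; rewrite mulrC ler_wpM2l ?exprn_ge0 ?(ltW rho0)// /d; lra.
have h2 : 0 < 2^-1 :> R by rewrite invr_gt0.
have [n nK] := geom_small K th0 th1 h2.
apply: (@contracting_invertible _ _ _ T lam (p * n)).
- exact: hardy_banach aX.
- exact: hardy_weighted_bounded aX wH.
- exact: lT.
- exact: lam0.
- move=> x [_ xD] /=; rewrite weighted_iter.
  have [_ h] := mul_bounded aX (exprn_ge0 n c0) (wprod_pow_le n c0 wc) (mem_iter (p * n) UD xD).
  apply: le_trans h _; apply: le_trans (ler_wpM2l (exprn_ge0 n c0) (HK _ _ xD)) _.
  rewrite mulrA ler_wpM2r ?n_ge0// exprM -/l exprM.
  have -> : c ^+ n * (K * rho ^+ p ^+ n) = K * th ^+ n * l ^+ n.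
    have e : th ^+ n * l ^+ n = (c * rho ^+ p) ^+ n by rewrite -exprMn /th divfK ?gt_eqF.
    by rewrite -mulrA e exprMn; ring.
  by apply: ler_wpM2r; [apply: exprn_ge0; exact: ltW|exact: ltW].
Qed.

(** Divide by the weight, which is bounded away from 0, and rotate back. *)
Lemma expands_inverse : expands w a lam -> exists P (W : L -> L) (c : R),
  [/\ lin W, 0 < c, 2 * normc lam ^+ P <= c,
    forall x, carrier X x -> carrier X (W x) /\ N (W x) <= c^-1 * N x &
    (forall x, iter P T (W x) = x) /\ (forall x, W (iter P T x) = x)].
Proof.
move=> [p [c [p0 cl wc]]]; set l := normc lam ^+ p in cl.
have l0 : 0 <= l by rewrite exprn_ge0 ?normc_ge0.
have c0 : 0 < c by exact: le_lt_trans cl.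
pose d := (c + l) / 2; have d0 : 0 < d by rewrite /d; lra.
have B1 : 1 < c / d by rewrite ltr_pdivlMr// mul1r /d; lra.
have [rho rho1 rp] := root_gt1 B1 p0.
have rho0 : 0 < rho := lt_trans ltr01 rho1.
have [_ _ _ _ [VD g]] := aX; have [K K0 HK] := g _ rho1.
pose th := l * rho ^+ p / c.
have th0 : 0 <= th.
  by apply: divr_ge0; [apply: mulr_ge0 => //; apply: exprn_ge0; exact: ltW|exact: ltW].
have th1 : th < 1.
  rewrite ltr_pdivrMr// mul1r; move: rp; rewrite ltr_pdivlMr// => rp.
  apply: le_lt_trans rp; rewrite mulrC ler_wpM2l ?exprn_ge0 ?(ltW rho0)// /d; lra.
have h2 : 0 < 2^-1 :> R by rewrite invr_gt0.
have [n nK] := geom_small K th0 th1 h2.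
have cn0 : 0 < c ^+ n by rewrite exprn_gt0.
have [u [uw uc]] := L0_inverse cn0 (wprod_pow_ge n (ltW c0) wc).
pose V := iter (p * n) (rotation_op (cinv a)).
have VU x : V (iter (p * n) (rotation_op a) x) = x.
  rewrite /V; elim: (p * n)%N x => [//|k IH] x; rewrite iterSr iterS rot_cinvK; exact: IH.
have UV x : iter (p * n) (rotation_op a) (V x) = x.
  rewrite /V; elim: (p * n)%N x => [//|k IH] x; rewrite iterSr iterS rotK_cinv; exact: IH.
have uwK x : mulL0 u (mulL0 (wprod w a (p * n)) x) = x.
  apply: L0P; apply: filterS2 (filterI uw (L0M u (mulL0 (wprod w a (p * n)) x)))
    (L0M (wprod w a (p * n)) x) => z [h ->] ->; by rewrite mulrA [u z * _]mulrC h mul1r.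
have wuK x : mulL0 (wprod w a (p * n)) (mulL0 u x) = x.
  apply: L0P; apply: filterS2 (filterI uw (L0M (wprod w a (p * n)) (mulL0 u x)))
    (L0M u x) => z [h ->] ->; by rewrite mulrA h mul1r.
exists (p * n)%N, (fun x => V (mulL0 u x)), (c ^+ n / (K * rho ^+ (p * n))).
have Kr : 0 < K * rho ^+ (p * n) by rewrite mulr_gt0// exprn_gt0.
split.
- by move=> k x y; rewrite mulL0_lin /V lin_iter//; exact: rot_lin.
- by rewrite divr_gt0.
- rewrite ler_pdivlMr// exprM -/l exprM.
  have -> : 2 * l ^+ n * (K * rho ^+ p ^+ n) = 2 * (K * th ^+ n) * c ^+ n.
    have e : th ^+ n * c ^+ n = (l * rho ^+ p) ^+ n by rewrite -exprMn /th divfK ?gt_eqF.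
    have -> : 2 * (K * th ^+ n) * c ^+ n = 2 * K * (th ^+ n * c ^+ n) by ring.
    by rewrite e exprMn; ring.
  rewrite -[leRHS]mul1r ler_wpM2r ?(ltW cn0)//; move: nK; lra.
- move=> x xD; have ci0 : 0 <= (c ^+ n)^-1 by rewrite invr_ge0 ltW.
  have [uD un] := mul_bounded aX ci0 uc xD.
  split; first exact: mem_iter.
  apply: le_trans (HK _ _ uD) _.
  rewrite (_ : _^-1 * N x = K * rho ^+ (p * n) * ((c ^+ n)^-1 * N x)); last first.
    by rewrite invf_div mulrA.
  by apply: ler_wpM2l un; exact: ltW.
- split=> x; first by rewrite weighted_iter UV wuK.
  by rewrite weighted_iter uwK VU.
Qed.

Lemma expands_below : expands w a lam ->
  exists M : R, forall x, carrier X x -> N x <= M * N (S x).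
Proof.
move=> /expands_inverse[P [W [c [lW c0 lc WD [TW WT]]]]].
apply: (@expanding_bdd_below _ _ _ _ _ P c) => // x xD.
have [TD _] := bT; have [_ h] := WD _ (mem_iter P TD xD).
by move: h; rewrite WT ler_pdivlMl.
Qed.

Lemma expands_surj : expands w a lam ->
  forall y, carrier X y -> exists2 x, carrier X x & S x = y.
Proof.
move=> /expands_inverse[P [W [c [lW c0 lc WD [TW WT]]]]].
have [sN nN] := hN.
apply: (@expanding_surjective _ _ _ _ W _ P) => //.
- by split => //; exact: ideal_complete.
- by move=> x /WD[].
- by move=> x _; exact: TW.
- move=> x xD; have [WxD h] := WD _ xD; rewrite nZ// normcX.
  apply: le_trans (ler_wpM2l (exprn_ge0 _ (normc_ge0 _)) h) _.
  rewrite mulrA ler_wpM2r ?n_ge0// ler_pdivrMr//; move: lc; lra.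
Qed.

Lemma expands_below_L1 : expands w a lam ->
  exists M : R, forall x, Lone R x -> norm1 x <= M * norm1 (S x).
Proof.
move=> [p [c [p0 cl wc]]]; set l := normc lam ^+ p in cl.
have l0 : 0 <= l by rewrite exprn_ge0 ?normc_ge0.
have c0 : 0 < c by exact: le_lt_trans cl.
pose th := l / c; have th0 : 0 <= th by rewrite divr_ge0// ltW.
have th1 : th < 1 by rewrite ltr_pdivrMr// mul1r.
have h2 : 0 < 2^-1 :> R by rewrite invr_gt0.
have [n nK] := geom_small 1 th0 th1 h2.
have cn0 : 0 < c ^+ n by rewrite exprn_gt0.
have [Mw Mw0 wM] := weight_bounded wH.
have TD x : Lone R x -> Lone R (T x) /\ norm1 (T x) <= Mw * norm1 x.
  move=> /Lone_cintg xi; have ri := cintg_rot a xi; have nr := cintg_norm measurableT ri.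
  have h : {ae m, forall z, normc (T x z) <= Mw * normc (rotation_op a x z)}.
    apply: filterS2 wM (L0M w (rotation_op a x)) => z h ->.
    by rewrite normcM ler_wpM2r ?normc_ge0.
  have i2 : rintg m setT (fun z => Mw * normc (rotation_op a x z)) by exact: rintgZ.
  have Ti := ae_cintg_le (L0_meas (T x)) i2 h; split; first exact/Lone_cintg.
  rewrite -(norm1_rot a xi) /norm1 -RintegralZl//; apply: ae_le_Rint => //.
  exact: cintg_norm.
apply: (@expanding_bdd_below _ _ (Lone_space R) _ _ (p * n) (c ^+ n)) => //.
- exact: Lone_normed.
- by split=> [x /TD[]//|]; exists Mw => x /TD[].
- rewrite exprM -/l -(@ler_pM2r _ (c ^+ n)^-1) ?invr_gt0// divff ?gt_eqF//.
  by rewrite -mulrA -exprVn -exprMn; move: nK; rewrite mul1r; lra.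
- move=> x /Lone_cintg xi /=; rewrite weighted_iter.
  have ri : cintg m setT (iter (p * n) (rotation_op a) x) by rewrite iter_rot; exact: cintg_rot.
  have -> : norm1 x = norm1 (iter (p * n) (rotation_op a) x) by rewrite iter_rot norm1_rot.
  have ti : Lone R (iter (p * n) T x).
    by apply: (@mem_iter _ _ (Lone_space R)) => [y /TD[]//|]; exact/Lone_cintg.
  move: ti; rewrite weighted_iter => /Lone_cintg ti.
  have nr := cintg_norm measurableT ri.
  rewrite /norm1 -RintegralZl//; apply: ae_le_Rint; [exact: rintgZ|exact: cintg_norm|].
  apply: filterS2 (wprod_pow_ge n (ltW c0) wc) (L0M (wprod w a (p * n)) (iter (p * n) (rotation_op a) x)).
  by move=> z h ->; rewrite normcM ler_wpM2r ?normc_ge0.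
Qed.

End admissible.

(** When the weighted rotation is expanding, the codimension of the range on
    the Hardy part does not depend on the space: it is the dimension of the
    space of sequences of negative Fourier coefficients of preimages. *)
Section expanding_codim.
Variables (a : C) (X : subnormed L) (w : L) (lam : R[i]).
Hypothesis aX : admissible a X.
Hypothesis wH : Hinfty R w.
Hypothesis ex : expands w a lam.
Local Notation Y := (H1_inter X).
Local Notation Y0 := (H1_inter (Linfty_space R)).
Local Notation T := (weighted_rotation_op w a).
Local Notation S := (lambda_minus T lam).

Let hX : banach_ideal_space X. Proof. by have [] := aX. Qed.
Let aL : admissible a (Linfty_space R). Proof. exact: Linfty_admissible. Qed.
Let lS : lin S. Proof. apply: lin_lambda; exact: weighted_lin. Qed.

Let L1_inj x : Lone R x -> S x = 0 -> x = 0.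
Proof.
move=> xL Sx; have [M HM] := expands_below_L1 wH ex.
apply: (n_eq0 (@Lone_normed R)) => //; apply/eqP; rewrite eq_le n_ge0//; last exact: Lone_normed.
have := HM _ xL; rewrite Sx; have -> : norm1 (0 : L) = 0 := n0 (@Lone_normed R).
by rewrite mulr0 andbT.
Qed.

Lemma expanding_codim n : codim_range Y S n <-> codim_range Y0 S n.
Proof.
have [_ LX XL _ _] := aX; have hN := ideal_normed hX; have nL1 := @Lone_normed R.
have /choice[g gP] : forall y, exists x, carrier X y -> carrier X x /\ S x = y.
  move=> y; have [yD|yD] := pselect (carrier X y); last by exists 0.
  by have [x xD xE] := expands_surj aX wH ex yD; exists x.
have inj x x' : Lone R x -> Lone R x' -> S x = S x' -> x = x'.
  move=> xL xL' e; apply/eqP; rewrite -subr_eq0; apply/eqP; apply: L1_inj.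
    exact: (nmemB nL1).
  by rewrite linB// e subrr.
have gi y : carrier X y -> cintg m setT (g y).
  by move=> /gP[/XL/Lone_cintg].
pose f k y := cmoment (g y) k.+1.
have gl c x y : carrier X x -> carrier X y -> g (c *: x + y) = c *: g x + g y.
  move=> xD yD; have [gx Sx] := gP _ xD; have [gy Sy] := gP _ yD.
  have zD : carrier X (c *: x + y) by apply: nmemD => //; exact: nmemZ.
  have [gz Sz] := gP _ zD; apply: inj.
  - exact: XL.
  - by apply: XL; apply: nmemD => //; exact: nmemZ.
  - by rewrite Sz lS Sx Sy.
have rangeE X' : admissible a X' -> carrier X' `<=` carrier X ->
    range_on (H1_inter X') S = fker (carrier (H1_inter X')) f.
  move=> aX' sX; apply/seteqP; split=> [_ [x [xH xD] <-]|y [[yH yD] fy]].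
    have [TD _] := hardy_weighted_bounded aX' wH.
    have yD : carrier (H1_inter X') (S x).
      by apply: (nmemB (hardy_normed aX')); [exact: (nmemZ (hardy_normed aX'))|exact: TD].
    split=> // k; have [_ /sX yX] := yD; have [gx Sg] := gP _ yX.
    have -> : f k (S x) = cmoment (x : L) k.+1.
      rewrite /f; congr (cmoment (L0_fun _) _).
      by apply: inj; [exact: XL|exact/XL/sX|exact: Sg].
    by move/H1P : xH => [_ ->].
  have [gx Sg] := gP _ (sX _ yD).
  have [x xD xE] := expands_surj aX' wH ex yD.
  have e : x = g y by apply: inj; [exact/XL/sX|exact: XL|rewrite xE Sg].
  exists (g y); last exact: Sg.
  split; last by rewrite -e.
  apply/H1P; split; first exact: gi (sX _ yD).
  by case=> // k _; exact: fy.
rewrite /codim_range (rangeE X)// (rangeE (Linfty_space R))//.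
have [M HM] := expands_below_L1 wH ex.
apply: dim_transfer.
- by have [] := hardy_normed aX.
- by have [] := hardy_normed aL.
- by move=> x [xH /LX xD]; split.
- move=> k c x y [_ xD] [_ yD]; rewrite /f gl//.
  have xi := gi _ xD; have yi := gi _ yD; have ci := cintgZ c measurableT xi.
  rewrite (@cmoment_ae R _ (fun z => c * (g x) z + (g y) z) _ (L0_meas _)).
  + by rewrite cmomentD// cmomentZ.
  + by apply: measurable_complexD; [apply: measurable_complexM|] => //; exact: L0_meas.
  + by apply: filterS2 (L0D (c *: g x) (g y)) (L0Z c (g x)) => z -> ->.
- move=> y [yH yD] K e e0.
  have e1 : 0 < e / (`|M| + 1) by rewrite divr_gt0// ltr_wpDl.
  have [y' yH' yy'] := Hinfty_dense yH e1.
  move: yH'; rewrite HinftyE => -[yH' yL'].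
  exists y'; first by split.
  have yX' := LX _ yL'; have [gy Sy] := gP _ yD; have [gy' Sy'] := gP _ yX'.
  move=> k _; rewrite /f -cmomentB_L0//; [|exact: gi|exact: gi].
  have dL : Lone R (g y - g y') by apply: (nmemB nL1); exact: XL.
  apply: le_lt_trans (normc_cmoment _ _) _; first exact/Lone_cintg.
  apply: le_lt_trans (HM _ dL) _; rewrite linB// Sy Sy'.
  apply: le_lt_trans (_ : (`|M| + 1) * norm1 (y - y') < _).
    rewrite ler_wpM2r ?norm1_ge0//; apply: le_trans (ler_norm _) _; by rewrite lerDl.
  by rewrite -ltr_pdivlMl ?ltr_wpDl// mulrC.
Qed.

End expanding_codim.

End contracting_expanding.

(** * Open mappings onto closed ranges *)

Section open_mapping.
Variables (R : realType) (V : lmodType R[i]) (E : subnormed V) (S : V -> V).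
Local Notation N := (nnorm E).
Local Notation D := (carrier E).
Hypothesis bE : is_banach E.
Hypothesis bS : bounded_on E S.
Hypothesis lS : lin S.
Implicit Types (x y z : V) (e r : R) (k n : nat).

Let hE : normed E. Proof. by have [] := bE. Qed.
Let cE : is_complete E. Proof. by have [] := bE. Qed.
Let SD x : D x -> D (S x). Proof. by have [h _] := bS; exact: h. Qed.

Lemma geometric_tail (u : nat -> V) (d : R) n j : (forall n, D (u n)) ->
  (forall n, N (u n.+1 - u n) <= 2^-1 ^+ n * d) ->
  N (u (n + j)%N - u n) <= 2^-1 ^+ n * d * (2 - 2 * 2^-1 ^+ j).
Proof.
move=> uD ud; elim: j => [|j IH].
  by rewrite addn0 subrr n0// expr0 mulr1 subrr mulr0.
rewrite addnS; apply: le_trans (n_tri hE (uD _) (uD (n + j)%N) (uD _)) _.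
apply: le_trans (lerD (ud _) IH) _.
rewrite exprD [in X in _ <= X]exprS le_eqVlt; apply/orP; left; apply/eqP.
by field.
Qed.

Lemma geometric_lim (u : nat -> V) (d : R) : (forall n, D (u n)) ->
  (forall n, N (u n.+1 - u n) <= 2^-1 ^+ n * d) ->
  exists2 l, D l & forall n, N (u n - l) <= 2^-1 ^+ n * (2 * d).
Proof.
move=> uD ud.
have d0 : 0 <= d by have := ud 0%N; rewrite expr0 mul1r; apply: le_trans; apply: n_ge0 => //; exact: nmemB.
have tl n j : N (u (n + j)%N - u n) <= 2^-1 ^+ n * (2 * d).
  apply: le_trans (geometric_tail n j uD ud) _; rewrite -mulrA ler_wpM2l ?exprn_ge0 ?invr_ge0//.
  by rewrite mulrC ler_wpM2r// gerBl mulr_ge0// exprn_ge0// invr_ge0.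
have cau : forall e : R, 0 < e -> exists n0, forall p q, (n0 <= p)%N -> (n0 <= q)%N ->
    N (u p - u q) < e.
  move=> e e0; have e2 : 0 < e / 2 by rewrite divr_gt0.
  have h12 : 2^-1 < 1 :> R by rewrite invf_lt1// ltr1n.
  have [n hn] := geom_small (2 * d) (ltac:(by rewrite invr_ge0) : 0 <= 2^-1 :> R) h12 e2.
  rewrite mulrC in hn.
  exists n => p q np nq.
  apply: le_lt_trans (n_tri hE (uD p) (uD n) (uD q)) _; rewrite [e]splitr ltrD//.
    by apply: le_lt_trans hn; rewrite -(subnKC np); exact: tl.
  rewrite nBC//; apply: le_lt_trans hn; rewrite -(subnKC nq); exact: tl.
have [l lD /cvgrPdist_lt ul] := cE uD cau.
exists l => // n; apply/ler_addgt0Pr => e /ul[n0 _ H].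
have := H (n + n0)%N (leq_addl _ _); rewrite /= sub0r normrN => h.
apply: le_trans (n_tri hE (uD n) (uD (n + n0)%N) lD) _; apply: lerD.
  by rewrite nBC//; exact: tl.
by apply: ltW; apply: le_lt_trans h; exact: ler_norm.
Qed.

Hypothesis clS : closed_in E (range_on E S).

Let Z := range_on E S.
Let ZD z : Z z -> D z. Proof. by move=> [x xD <-]; exact: SD. Qed.
Let ZB z z' : Z z -> Z z' -> Z (z - z').
Proof. by move=> [x xD <-] [y yD <-]; exists (x - y); [exact: nmemB|rewrite linB]. Qed.
Let Zsc c z : Z z -> Z (c *: z).
Proof. by move=> [x xD <-]; exists (c *: x); [exact: nmemZ|rewrite linZ]. Qed.

Let near (k : R) z := forall e, 0 < e -> exists x, [/\ D x, N x <= k & N (z - S x) < e].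

(** Baire's argument, by nested balls. *)
Let baire : exists (k : nat) z0 r, [/\ Z z0, 0 < r &
  forall z, Z z -> N (z - z0) < r -> near k%:R z].
Proof.
apply: contrapT => nB.
have step : forall s : nat * (V * R), exists s' : V * R, Z s.2.1 -> 0 < s.2.2 ->
    [/\ Z s'.1, 0 < s'.2, s'.2 <= s.2.2 / 2, N (s'.1 - s.2.1) <= s.2.2 / 2 &
      forall x, D x -> N x <= s.1%:R -> s'.2 < N (s'.1 - S x)].
  move=> [k [z r]] /=; have [[zZ r0]|nh] := pselect (Z z /\ 0 < r); last first.
    by exists (z, r) => zZ r0; case: nh.
  have [z' [zZ' zr' [e e0 He]]] : exists z', [/\ Z z', N (z' - z) < r / 2 &
      exists2 e, 0 < e & forall x, D x -> N x <= k%:R -> e <= N (z' - S x)].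
    apply: contrapT => nz; apply: nB; exists k, z, (r / 2); split=> //; first by rewrite divr_gt0.
    move=> z' zZ' zr' e e0; apply: contrapT => nx; apply: nz; exists z'; split=> //.
    exists e => // x xD xk; rewrite leNgt; apply/negP => h; apply: nx; by exists x.
  exists (z', Num.min (r / 2) (e / 2)) => _ _ /=; split=> //.
  - by rewrite lt_min !divr_gt0.
  - by rewrite ge_min lexx.
  - exact: ltW.
  - move=> x xD xk; apply: lt_le_trans (He x xD xk); rewrite gt_min; apply/orP; right.
    by rewrite ltr_pdivrMr// ltr_pMr// ltr1n.
have /choice[h hP] := step.
pose s := fix s n := if n is p.+1 then h (p, s p) else (0 : V, 1 : R).
have sE n : s n.+1 = h (n, s n) by [].
have s0E : s 0%N = (0, 1) by [].
clearbody s.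
have sP n : Z (s n).1 /\ 0 < (s n).2.
  elim: n => [|n [zZ r0]]; first by rewrite s0E; split=> //=; exists 0; [exact: nmem0|exact: lin0].
  by rewrite sE; have [] := hP (n, s n) zZ r0.
have sS n : [/\ (s n.+1).2 <= (s n).2 / 2, N ((s n.+1).1 - (s n).1) <= (s n).2 / 2 &
    forall x, D x -> N x <= n%:R -> (s n.+1).2 < N ((s n.+1).1 - S x)].
  by have [zZ r0] := sP n; rewrite sE; have [] := hP (n, s n) zZ r0.
have rh n j : (s (n + j)%N).2 <= 2^-1 ^+ j * (s n).2.
  elim: j => [|j IH]; first by rewrite addn0 expr0 mul1r.
  have [h1 _ _] := sS (n + j)%N; rewrite addnS exprS.
  by apply: le_trans h1 _; move: IH; move: (_ ^+ _) => q; lra.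
have tail n j : N ((s (n + j)%N).1 - (s n).1) <= (s n).2.
  pose u i := (s (n + i)%N).1; have uD i : D (u i) by apply: ZD; have [] := sP (n + i)%N.
  have ud i : N (u i.+1 - u i) <= 2^-1 ^+ i * ((s n).2 / 2).
    have [_ h1 _] := sS (n + i)%N; rewrite /u addnS; apply: le_trans h1 _.
    have := rh n i; lra.
  have := geometric_tail 0 j uD ud; rewrite add0n /u addn0 expr0 mul1r => /le_trans; apply.
  have [_ r0] := sP n; have : 0 <= 2^-1 ^+ j :> R by rewrite exprn_ge0// invr_ge0.
  move: r0; move: (s n).2 (_ ^+ _) => p q; nra.
have uD n : D (s n).1 by apply: ZD; have [] := sP n.
have [l lD ul] : exists2 l, D l & forall n, N ((s n).1 - l) <= 2^-1 ^+ n * (2 * 2^-1).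
  apply: (@geometric_lim (fun n => (s n).1)) => // n.
  have [_ h1 _] := sS n; apply: le_trans h1 _.
  by have := rh 0%N n; rewrite add0n s0E /= mulr1; lra.
have h12 : 2^-1 < 1 :> R by rewrite invf_lt1// ltr1n.
have h02 : 0 <= 2^-1 :> R by rewrite invr_ge0.
have lim e : 0 < e -> exists n0, forall n, (n0 <= n)%N -> N ((s n).1 - l) < e.
  move=> e0; have [n0 hn] := geom_small 1 h02 h12 e0; exists n0 => n nn.
  apply: le_lt_trans (ul n) _; rewrite divff ?pnatr_eq0// mulr1; apply: le_lt_trans hn.
  by rewrite mul1r ler_wiXn2l// ltW.
have ln n : N ((s n).1 - l) <= (s n).2.
  apply/ler_addgt0Pr => e e0; have [n0 H] := lim _ e0.
  apply: le_trans (n_tri hE (uD n) (uD (n + n0)%N) lD) _; apply: lerD.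
    by rewrite nBC//; exact: tail.
  by apply: ltW; apply: H; exact: leq_addl.
have [x xD xl] : Z l.
  apply: clS => // e e0; have [n0 H] := lim _ e0; exists (s n0).1; first by have [] := sP n0.
  by rewrite nBC//; exact: H.
pose n := (Num.truncn (N x)).+1.
have xn : N x <= n%:R by apply: ltW; exact: truncnS_gt.
have [_ _ H] := sS n; have := H x xD xn; rewrite xl ltNge => /negP; apply; exact: ln.
Qed.

(** By Baire's argument the image of a ball is dense in a ball of the range;
    successive approximation then gives exact solutions. *)
Lemma open_mapping : exists2 K : R, 0 <= K &
  forall x, D x -> exists x', [/\ D x', S x' = S x & N x' <= K * N (S x)].
Proof.
have [k [z0 [r [zZ r0 H]]]] := baire.
pose K := 4 * k%:R / r; have K0 : 0 <= K by rewrite divr_ge0 ?mulr_ge0// ltW.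
have ball z : Z z -> N z < r -> forall e, 0 < e -> exists x, [/\ D x, N x <= 2 * k%:R & N (z - S x) < e].
  move=> zz zr e e0; have e2 : 0 < e / 2 by rewrite divr_gt0.
  have Zs : Z (z0 + z) by rewrite -[z]opprK; apply: ZB => //; rewrite -scaleN1r; exact: Zsc.
  have [x [xD xk xe]] := H _ Zs (ltac:(by rewrite addrC addKr) : N (z0 + z - z0) < r) _ e2.
  have z00 : N (z0 - z0) < r by rewrite subrr n0.
  have [y [yD yk ye]] := H _ zZ z00 _ e2.
  exists (x - y); split; first exact: nmemB.
    by apply: le_trans (nB hE xD yD) _; rewrite mulr_natl mulr2n lerD.
  rewrite linB// (_ : z - _ = (z0 + z - S x) - (z0 - S y)).
    apply: le_lt_trans (nB hE _ _) _; [by apply: nmemB; [|exact: ZD|exact: SD]|by apply: nmemB; [|exact: ZD|exact: SD]|].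
    by rewrite [e]splitr ltrD.
  rewrite -[z0 + z - _]addrA [in RHS]opprB [RHS]addrC [RHS]addrA subrK [RHS]addrC.
  by rewrite opprB addrA addrAC.
have half z : Z z -> exists x, [/\ D x, N x <= K * N z & N (z - S x) <= 2^-1 * N z].
  move=> zz; have zD := ZD zz; have [z00|zn] := eqVneq z 0.
    exists 0; rewrite lin0// subr0 z00 n0// !mulr0; split=> //; exact: nmem0.
  have nz : 0 < N z.
    by rewrite lt_neqAle n_ge0// andbT eq_sym; apply: contra zn => /eqP h; apply/eqP; exact: n_eq0 h.
  pose t := r / (2 * N z); have t0 : 0 < t by rewrite divr_gt0// mulr_gt0.
  have tz : N (t%:C *: z) < r.
    rewrite nZ// normc_rC ?(ltW t0)// /t invfM mulrA divfK ?gt_eqF//.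
    by rewrite ltr_pdivrMr// ltr_pMr// ltr1n.
  have e0 : 0 < t * (2^-1 * N z) by rewrite mulr_gt0// mulr_gt0// invr_gt0.
  have [x [xD xk xe]] := ball _ (Zsc t%:C zz) tz _ e0.
  have ti : 0 <= t^-1 by rewrite invr_ge0 ltW.
  have tC : t%:C != 0 :> R[i] by rewrite -normc_gt0 normc_rC// ltW.
  have tiC : (t^-1)%:C = t%:C^-1 :> R[i] by exact: fmorphV.
  exists ((t^-1)%:C *: x); split; first exact: nmemZ.
    rewrite nZ// normc_rC//; apply: le_trans (ler_wpM2l ti xk) _.
    by rewrite /t invf_div /K le_eqVlt; apply/orP; left; apply/eqP; field; rewrite gt_eqF.
  rewrite (_ : z - _ = (t^-1)%:C *: (t%:C *: z - S x)).
    have dD : D (t%:C *: z - S x) by apply: nmemB => //; [exact: nmemZ|exact: SD].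
    rewrite nZ// normc_rC// mulrC ler_pdivrMr// mulrC; exact: ltW.
  by rewrite scalerBr scalerA tiC mulVf// scale1r linZ.
have /choice[G GP] : forall z, exists x, Z z -> [/\ D x, N x <= K * N z & N (z - S x) <= 2^-1 * N z].
  move=> z; have [/half[x hx]|nz] := pselect (Z z); last by exists 0.
  by exists x.
exists (2 * K); first by rewrite mulr_ge0.
move=> x xD; pose z := S x; have zz : Z z by exists x.
pose zeta n := iter n (fun y => y - S (G y)) z.
have zZn n : Z (zeta n).
  elim: n => [//|n IH]; rewrite /zeta iterS -/(zeta n); apply: ZB => //.
  by have [gD _ _] := GP _ IH; exists (G (zeta n)).
have zn n : N (zeta n) <= 2^-1 ^+ n * N z.
  elim: n => [|n IH]; first by rewrite expr0 mul1r.
  have [_ _ h] := GP _ (zZn n); rewrite /zeta iterS -/(zeta n); apply: le_trans h _.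
  by rewrite exprS -mulrA ler_wpM2l// invr_ge0.
pose u n := \sum_(0 <= i < n) G (zeta i).
have gD n : D (G (zeta n)) by have [] := GP _ (zZn n).
have uD n : D (u n) by exact: nmem_sum.
have uS n : u n.+1 = u n + G (zeta n) by rewrite /u big_nat_recr.
have Su n : S (u n) = z - zeta n.
  elim: n => [|n IH]; first by rewrite /u big_geq// lin0// subrr.
  by rewrite uS linD// IH /zeta iterS opprB [RHS]addrA [RHS]addrAC.
have ud n : N (u n.+1 - u n) <= 2^-1 ^+ n * (K * N z).
  rewrite uS addrC addKr; have [_ h _] := GP _ (zZn n).
  by apply: le_trans h _; rewrite mulrCA ler_wpM2l.
have [l lD ul] := geometric_lim uD ud.
exists l; split => //; last first.
  by have := ul 0%N; rewrite /u big_geq// sub0r nN// expr0 mul1r mulrA.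
have [SD' [M HM]] := bS.
apply/eqP; rewrite -subr_eq0; apply/eqP; apply: (n_small hE).
  by apply: nmemB => //; exact: SD.
move=> e e0; have h12 : 2^-1 < 1 :> R by rewrite invf_lt1// ltr1n.
have h02 : 0 <= 2^-1 :> R by rewrite invr_ge0.
have [n hn] := geom_small (`|M| * (2 * (K * N z)) + N z) h02 h12 e0.
apply: le_trans _ (ltW hn); rewrite -/z.
have SlD := SD lD; have SuD := SD (uD n).
rewrite (_ : S l - z = (S l - S (u n)) - zeta n); last first.
  by rewrite Su opprB addrA addrAC addrK.
have ZnD := ZD (zZn n).
apply: le_trans (nB hE (nmemB hE SlD SuD) ZnD) _.
rewrite -linB// mulrDl; apply: lerD; last by rewrite mulrC.
have dD := nmemB hE lD (uD n).
apply: le_trans (HM _ dD) _; apply: le_trans (ler_wpM2r (n_ge0 hE dD) (ler_norm M)) _.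
by rewrite -mulrA ler_wpM2l// nBC// mulrC.
Qed.

End open_mapping.

(** * The kernel and the lowest Fourier coefficient *)

Section lowest_coefficient.
Variable R : realType.
Local Notation C := (circle R).
Local Notation m := (circle_measure R).
Local Notation L := (L0 m).
Implicit Types (x y w : L) (lam : R[i]) (z : C) (n k : nat).

Lemma cmeas_circleV n : measurable_fun setT (fun z : C => (z : R[i])^-1 ^+ n).
Proof.
rewrite (_ : (fun _ => _) = fun z : C => conjc (z : R[i]) ^+ n).
  by apply: cmeasX; apply: cmeas_conjc; exact: measurable_circle_val.
by apply/funext => z; rewrite circle_conj.
Qed.

Lemma normc_circleV n z : normc ((z : R[i])^-1 ^+ n) = 1.
Proof. by rewrite normcX normcV circle_normc invr1 expr1n. Qed.

Definition zpow n : L := mkL0 m (@cmeas_circleX R n).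
Definition zneg n : L := mkL0 m (cmeas_circleV n).

Lemma zpowE n : {ae m, forall z, zpow n z = (z : R[i]) ^+ n}.
Proof. exact: mkL0E. Qed.

Lemma znegE n : {ae m, forall z, zneg n z = (z : R[i])^-1 ^+ n}.
Proof. exact: mkL0E. Qed.

Lemma normc_zpow n : {ae m, forall z, normc (zpow n z) = 1}.
Proof. by apply: filterS (zpowE n) => z ->; rewrite normc_circleX. Qed.

Lemma normc_zneg n : {ae m, forall z, normc (zneg n z) = 1}.
Proof. by apply: filterS (znegE n) => z ->; rewrite normc_circleV. Qed.

Lemma circleVK n z : (z : R[i]) ^+ n * (z : R[i])^-1 ^+ n = 1.
Proof. by rewrite -exprMn divff ?expr1n//; exact: circle_neq0. Qed.

(** The coefficients of nonnegative index; [cmoment] has the others. *)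
Definition fcoef n x : R[i] := cint m setT (fun z : C => (z : R[i])^-1 ^+ n * x z).

Lemma fcoef_intg n x : cintg m setT x -> cintg m setT (fun z : C => (z : R[i])^-1 ^+ n * x z).
Proof.
move=> xi; apply: (cintg_bddM (M := 1) (cmeas_circleV n)) xi => z.
by rewrite normc_circleV.
Qed.

Lemma normc_fcoef n x : cintg m setT x -> normc (fcoef n x) <= norm1 x.
Proof.
move=> xi; apply: le_trans (ler_norm_cint _ (fcoef_intg n xi)) _ => //.
apply: le_Rint; [|exact: cintg_norm|].
  by apply: cintg_norm => //; exact: fcoef_intg.
by move=> z; rewrite normcM normc_circleV mul1r.
Qed.

Lemma fcoefB n x y : cintg m setT x -> cintg m setT y -> fcoef n (x - y : L) = fcoef n x - fcoef n y.
Proof.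
move=> xi yi; rewrite /fcoef -cintB//; [|exact: fcoef_intg|exact: fcoef_intg].
apply: ae_cint.
- by apply: measurable_complexM; [exact: cmeas_circleV|exact: L0_meas].
- by apply: cmeasB; apply: measurable_complexM; try exact: cmeas_circleV; exact: L0_meas.
- by apply: filterS (L0B x y) => z ->; rewrite mulrBr.
Qed.

Lemma fcoefZ n c x : cintg m setT x -> fcoef n (c *: x : L) = c * fcoef n x.
Proof.
move=> xi; rewrite /fcoef -cintZ//; last exact: fcoef_intg.
apply: ae_cint.
- by apply: measurable_complexM; [exact: cmeas_circleV|exact: L0_meas].
- apply: measurable_complexM => //; apply: measurable_complexM; [exact: cmeas_circleV|exact: L0_meas].
- by apply: filterS (L0Z c x) => z ->; rewrite mulrCA.
Qed.

Lemma fcoef_zneg n x : fcoef n x = cint m setT (mulL0 (zneg n) x).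
Proof.
apply: ae_cint; last by apply: filterS2 (L0M (zneg n) x) (znegE n) => z -> ->.
  by apply: measurable_complexM; [exact: cmeas_circleV|exact: L0_meas].
exact: L0_meas.
Qed.

Lemma fcoef_zpow_lt N n x : H1 R x -> (n < N)%N -> fcoef n (mulL0 (zpow N) x) = 0.
Proof.
move=> /H1P[xi x0] nN; rewrite -(x0 (N - n)%N); last by rewrite subn_gt0.
apply: ae_cint.
- by apply: measurable_complexM; [exact: cmeas_circleV|exact: L0_meas].
- by apply: measurable_complexM; [exact: cmeas_circleX|exact: L0_meas].
- apply: filterS2 (L0M (zpow N) x) (zpowE N) => z -> ->.
  rewrite -{1}(subnK (ltnW nN)) exprD mulrA; congr (_ * _).
  by rewrite mulrC -mulrA circleVK mulr1.
Qed.

Lemma H1_zneg n x : H1 R x -> (forall k, (k < n)%N -> fcoef k x = 0) -> H1 R (mulL0 (zneg n) x).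
Proof.
move=> /H1P[xi x0] low; apply/H1P; split.
  apply: (ae_cintg (L0_meas _) (fcoef_intg n xi)).
  by apply: filterS2 (L0M (zneg n) x) (znegE n) => z -> ->.
move=> k k0; rewrite (@cmoment_ae R _ (fun z : C => (z : R[i])^-1 ^+ n * x z) k (L0_meas _)); last 2 first.
- by apply: measurable_complexM; [exact: cmeas_circleV|exact: L0_meas].
- by apply: filterS2 (L0M (zneg n) x) (znegE n) => z -> ->.
have [kn|nk] := leqP n k.
  have -> : cmoment (fun z : C => (z : R[i])^-1 ^+ n * x z) k =
      cint m setT (fun z : C => (z : R[i]) ^+ (k - n) * x z).
    apply: eq_cint => z _; rewrite mulrA; congr (_ * _).
    by rewrite -{1}(subnK kn) exprD -mulrA circleVK mulr1.
  have [e|kn'] := eqVneq k n; last by apply: x0; rewrite subn_gt0 ltn_neqAle eq_sym kn' kn.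
  rewrite e subnn -[RHS](low 0%N) -?e//; apply: eq_cint => z _; by rewrite !expr0.
rewrite -[RHS](low (n - k)%N); last by rewrite ltn_subrL k0 (leq_trans _ nk).
apply: eq_cint => z _; rewrite mulrA; congr (_ * _).
by rewrite -{1}(subnK (ltnW nk)) exprD mulrCA circleVK mulr1.
Qed.

Lemma H1_zpow n x : H1 R x -> H1 R (mulL0 (zpow n) x).
Proof.
move=> /H1P[xi x0]; apply/H1P; split.
  apply: (ae_cintg (L0_meas _) (cmoment_intg n xi)).
  by apply: filterS2 (L0M (zpow n) x) (zpowE n) => z -> ->.
move=> k k0; rewrite -(x0 (k + n)%N); last by rewrite addn_gt0 k0.
apply: ae_cint.
- by apply: measurable_complexM; [exact: cmeas_circleX|exact: L0_meas].
- by apply: measurable_complexM; [exact: cmeas_circleX|exact: L0_meas].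
- by apply: filterS2 (L0M (zpow n) x) (zpowE n) => z -> ->; rewrite exprD mulrA.
Qed.

Lemma fcoef_eq0 x : H1 R x -> (forall n, fcoef n x = 0) -> x = 0.
Proof.
move=> /H1P[xi x0] f0; apply: L0P.
have h : {ae m, forall z, x z = 0}.
  apply: fourier_unique => // n; rewrite -[RHS](conjc0 R) -(f0 n) /fcoef -cint_conjcE; last first.
    exact: fcoef_intg.
  by apply: eq_cint => z _; rewrite conjcM rmorphXn/= -circle_conj conjcK.
by apply: filterS2 h (L0_0 R) => z -> ->.
Qed.

(** The order of vanishing at the centre of the disc. *)
Lemma H1_order x : H1 R x -> x != 0 -> exists n, fcoef n x != 0 /\
  forall k, (k < n)%N -> fcoef k x = 0.
Proof.
move=> xH x0; have ex : exists n, fcoef n x != 0.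
  apply: contrapT => nx; move/eqP : x0; apply; apply: fcoef_eq0 => // n.
  by apply: contrapT => /eqP h; apply: nx; exists n.
exists (ex_minn ex); case: ex_minnP => n fn min; split=> // k kn.
by apply: contrapT => /eqP /min; rewrite leqNgt kn.
Qed.

(** On leading terms the operator multiplies by the mean of [w], the value of
    its extension at the centre, and rotates. *)
Lemma fcoef_weighted (a : C) w x n : Hinfty R w -> H1 R x ->
  (forall k, (k < n)%N -> fcoef k x = 0) ->
  fcoef n (weighted_rotation_op w a x) = (a : R[i]) ^+ n * cint m setT w * fcoef n x.
Proof.
move=> wH xH low; have uH := H1_zneg xH low; set u := mulL0 (zneg n) x in uH.
have [_ e] := H1_mul wH (H1_rot a uH).
have /H1P[ui _] := uH.
have eu : cint m setT (rotation_op a u) = fcoef n x.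
  have := cmoment_rot a 0 ui; rewrite expr0 mul1r /cmoment => h.
  rewrite fcoef_zneg -/u; transitivity (cint m setT (fun z : C => (z : R[i]) ^+ 0 * rotation_op a u z)).
    by apply: eq_cint => z _; rewrite expr0 mul1r.
  by rewrite -h; apply: eq_cint => z _; rewrite expr0 mul1r.
rewrite -mulrA -eu -e -cintZ//; last first.
  have /H1P[mi _] := H1_weighted a wH uH.
  apply: (ae_cintg _ mi); first by apply: measurable_complexM; exact: L0_meas.
  by apply: filterS (L0M w (rotation_op a u)) => z ->.
apply: ae_cint.
- by apply: measurable_complexM; [exact: cmeas_circleV|exact: L0_meas].
- by apply: measurable_complexM => //; apply: measurable_complexM; exact: L0_meas.
- have h1 := L0M w (rotation_op a x); have h2 := L0rot a x; have h3 := L0rot a u.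
  have h4 := ae_rot a (L0M (zneg n) x); have h5 := ae_rot a (znegE n).
  apply: filterS2 (filterI h1 h2) (filterI h3 (filterI h4 h5)) => z [e1 e2] [e3 [e4 e5]].
  rewrite e1 e2 e3 e4 e5 /= invfM exprMn.
  have a0 : (a : R[i]) ^+ n * (a : R[i])^-1 ^+ n = 1 by exact: circleVK.
  rewrite -[LHS]mul1r -a0; ring.
Qed.

Section eigenvectors.
Variables (a : C) (X : subnormed L) (w : L) (lam : R[i]).
Hypothesis aX : admissible a X.
Hypothesis wH : Hinfty R w.
Hypothesis w0 : w != 0.
Hypothesis aroot : forall n : nat, (0 < n)%N -> (a : R[i]) ^+ n != 1.
Local Notation Y := (H1_inter X).
Local Notation T := (weighted_rotation_op w a).
Local Notation S := (lambda_minus T lam).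
Local Notation N := (nnorm X).

Let hX : banach_ideal_space X. Proof. by have [] := aX. Qed.
Let hN := ideal_normed hX.
Let lT : lin T. Proof. exact: weighted_lin. Qed.
Let lS : lin S. Proof. exact: lin_lambda. Qed.

Lemma rotation_order_inj n k : (a : R[i]) ^+ n = (a : R[i]) ^+ k -> n = k.
Proof.
wlog nk : n k / (n <= k)%N => [H e|].
  have [h|/ltnW h] := leqP n k; first exact: H.
  by apply/esym; apply: H.
rewrite -{1}(subnKC nk) exprD => e; apply/eqP; rewrite eqn_leq nk leqNgt /= -subn_gt0.
apply/negP => h; have /eqP := aroot h; apply.
have an : (a : R[i]) ^+ n != 0 by rewrite expf_neq0//; exact: circle_neq0.
by apply: (mulfI an); rewrite -e mulr1.
Qed.

Let mem_cintg x : H1 R x -> cintg m setT x. Proof. by move=> /H1P[]. Qed.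

(** Compare leading coefficients. To exclude the eigenvalue 0, divide [w] by
    its leading power of [z]. *)
Lemma kernel_order x n : H1 R x -> S x = 0 -> fcoef n x != 0 ->
  (forall k, (k < n)%N -> fcoef k x = 0) -> lam = (a : R[i]) ^+ n * cint m setT w /\ lam != 0.
Proof.
move=> xH /subr0_eq Sx fx low.
have e : lam = (a : R[i]) ^+ n * cint m setT w.
  apply: (mulIf fx); rewrite -(fcoef_weighted a wH xH low) -Sx fcoefZ//; exact: mem_cintg.
split=> //; apply/eqP => l0.
have [wH1 wL] : H1 R w /\ Linfty R w by move: wH; rewrite HinftyE.
have [v [fw loww]] := H1_order wH1 w0.
have w'H : Hinfty R (mulL0 (zneg v) w).
  rewrite HinftyE; split; first exact: H1_zneg.
  move: wL => [M wM]; exists M.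
  apply: filterS2 (filterI wM (L0M (zneg v) w)) (normc_zneg v) => z [h ->] e1.
  by rewrite normcM e1 mul1r.
have := fcoef_weighted a w'H xH low.
have -> : weighted_rotation_op (mulL0 (zneg v) w) a x = 0.
  rewrite /weighted_rotation_op -mulL0A -/(weighted_rotation_op w a x) -Sx l0 scale0r.
  exact: lin0 (mulL0_lin _).
rewrite -fcoef_zneg -[0 in X in X -> _](scale0r (0 : L)) fcoefZ ?mul0r; last first.
  by apply: mem_cintg; have [] := @H1_submodule R.
move=> /esym/eqP; rewrite !mulf_eq0 (negPf fw) (negPf fx) expf_eq0.
by rewrite (negPf (circle_neq0 a)) andbF.
Qed.

(** The numbers [a ^ n] are distinct, so the eigenvalue determines the order.
    *)
Lemma kernel_line : exists n0, forall x, H1 R x -> S x = 0 ->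
  x = 0 \/ (fcoef n0 x != 0 /\ forall k, (k < n0)%N -> fcoef k x = 0).
Proof.
have [[n0 e0]|nn] := pselect (exists n0, lam = (a : R[i]) ^+ n0 * cint m setT w).
  exists n0 => x xH Sx; have [->|x0] := eqVneq x 0; first by left.
  have [n [fn low]] := H1_order xH x0; have [e l0] := kernel_order xH Sx fn low.
  right; suff -> : n0 = n by [].
  apply: rotation_order_inj; have w00 : cint m setT w != 0.
    by apply: contraNneq l0 => h; rewrite e h mulr0.
  by apply: (mulIf w00); rewrite -e0 -e.
exists 0%N => x xH Sx; have [->|x0] := eqVneq x 0; first by left.
have [n [fn low]] := H1_order xH x0; have [e _] := kernel_order xH Sx fn low.
by case: nn; exists n.
Qed.

(** The open mapping theorem gives a bounded preimage of [S x], which differs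
    from [x] by an element of the kernel. That element is determined by one
    coefficient, which is known when [x] vanishes to high order. *)
Lemma closed_range_below : closed_in Y (range_on Y S) -> exists n0 (K : R), 0 < K /\
  forall x, carrier Y x -> (forall k, (k < n0)%N -> fcoef k x = 0) -> N x <= K * N (S x).
Proof.
move=> cl; have hY := hardy_normed aX; have bY := hardy_banach aX.
have bS : bounded_on Y S.
  have [TD [M HM]] := hardy_weighted_bounded aX wH; split.
    by move=> x xD; apply: (nmemB hY); [exact: (nmemZ hY)|exact: TD].
  exists (normc lam + M) => x xD; apply: le_trans (nB hY _ (TD _ xD)) _; first exact: (nmemZ hY).
  by rewrite (nZ hY)// mulrDl lerD2l HM.
have [K K0 HK] := open_mapping bY bS lS cl.
have [n0 Hn0] := kernel_line.
have [K1 K10 HK1] := adm_L1 aX.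
have xi x : carrier Y x -> cintg m setT x by move=> [/mem_cintg].
exists n0.+1.
have [[f0 [f0Y Sf0 f00]]|nf] := pselect (exists f0, [/\ carrier Y f0, S f0 = 0 & f0 != 0]).
  have [/eqP|[ff flow]] := Hn0 _ (proj1 f0Y) Sf0; first by rewrite (negPf f00).
  pose B := normc (fcoef n0 f0)^-1 * N f0.
  have B0 : 0 <= B by rewrite mulr_ge0 ?normc_ge0//; apply: (n_ge0 hY).
  exists ((1 + K1 * B) * K + 1); split.
    by rewrite ltr_wpDl// mulr_ge0// addr_ge0// mulr_ge0// ltW.
  move=> x xD low; have [u [uD Su uK]] := HK _ xD.
  have kD : carrier Y (x - u) by exact: (nmemB hY).
  have fu : fcoef n0 (x - u : L) = - fcoef n0 u
    by rewrite fcoefB; [rewrite low// sub0r|exact: xi|exact: xi].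
  pose t := - fcoef n0 u * (fcoef n0 f0)^-1.
  have xu : x - u = t *: f0.
    have dD : carrier Y (x - u - t *: f0) by exact: (nmemB hY kD (nmemZ hY t f0Y)).
    have Sd : S (x - u - t *: f0) = 0
      by rewrite (linB _ _ lS) (linB _ _ lS) (linZ _ _ lS) Su Sf0 subrr scaler0 subr0.
    have [/subr0_eq//|[/eqP h _]] := Hn0 _ (proj1 dD) Sd; case: h.
    rewrite fcoefB; [|exact: xi|exact: (xi _ (nmemZ hY t f0Y))].
    by rewrite fcoefZ; [rewrite fu /t divfK// subrr|exact: xi].
  have -> : x = u + t *: f0 by rewrite -xu addrC subrK.
  apply: le_trans (nD hY uD (nmemZ hY t f0Y)) _; rewrite (nZ hY)//.
  have SxD : carrier Y (S x) by have [h _] := bS; exact: h.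
  have -> : S (u + t *: f0) = S x by rewrite (linD _ _ lS) (linZ _ _ lS) Sf0 scaler0 addr0.
  have h1 : normc t * nnorm Y f0 <= K1 * nnorm Y u * B.
    rewrite /t normcM normcN -mulrA; apply: ler_wpM2r => //.
    by apply: le_trans (normc_fcoef _ (xi _ uD)) _; apply: HK1; have [] := uD.
  apply: (@le_trans _ _ ((1 + K1 * B) * nnorm Y u)).
    by rewrite mulrDl mul1r lerD2l; apply: le_trans h1 _; rewrite mulrAC.
  apply: (@le_trans _ _ ((1 + K1 * B) * (K * nnorm Y (S x)))).
    by rewrite ler_wpM2l// addr_ge0// mulr_ge0// ltW.
  by rewrite mulrA ler_wpM2r ?lerDl//; exact: (n_ge0 hY).
exists (K + 1); split; first by rewrite ltr_wpDl.
move=> x xD _; have [u [uD Su uK]] := HK _ xD.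
have kD : carrier Y (x - u) by exact: (nmemB hY).
have : x - u = 0.
  apply: contrapT => /eqP h; apply: nf; exists (x - u); split => //.
  by rewrite (linB _ _ lS) Su subrr.
move=> /subr0_eq ->; rewrite Su; apply: le_trans uK _.
rewrite ler_wpM2r ?lerDl//; apply: (n_ge0 hY); have [h _] := bS; exact: h.
Qed.

End eigenvectors.

End lowest_coefficient.

(** * Ergodicity of rotations and the pointwise hump estimate *)

Section ergodicity.
Variable R : realType.
Local Notation C := (circle R).
Local Notation m := (circle_measure R).
Local Notation L := (L0 m).
Implicit Types (x y w : L) (z : C) (n : nat).

Definition ind (G : set C) : C -> R := fun z => if z \in G then 1 else 0.

Lemma ind_ge0 G z : 0 <= ind G z. Proof. by rewrite /ind; case: ifP. Qed.

Lemma ind_le1 G z : ind G z <= 1. Proof. by rewrite /ind; case: ifP. Qed.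

Lemma ind_meas G : measurable G -> measurable_fun setT (ind G).
Proof.
move=> mG; apply: measurable_fun_ifT => //.
by apply: (measurable_fun_bool true); rewrite setTI (_ : _ @^-1` _ = G)//;
  apply/seteqP; split=> z /=; [exact: set_mem|exact: mem_set].
Qed.

Lemma ind_intg G : measurable G -> rintg m setT (ind G).
Proof.
move=> mG; apply: (@rintg_le _ _ _ _ _ _ (fun=> 1)) => //; last exact: rintg_cst.
  exact: ind_meas.
by move=> z _; rewrite ger0_norm ?ind_ge0 ?ind_le1.
Qed.

Definition indL0 G (mG : measurable G) : L := mkL0 m (cmeas_real (ind_meas mG)).

Lemma indL0E G (mG : measurable G) : {ae m, forall z, indL0 mG z = (ind G z)%:C}.
Proof. exact: mkL0E. Qed.

(** Irrational rotations are ergodic: the Fourier coefficients of an invariant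
    function vanish. *)
Lemma rotation_ergodic (b : C) (G : set C) : (forall n, (0 < n)%N -> (b : R[i]) ^+ n != 1) ->
  measurable G -> {ae m, forall z, G z -> G (rotation b z)} ->
  {ae m, forall z, G z} \/ {ae m, forall z, ~ G z}.
Proof.
move=> broot mG inv; have gi := ind_intg mG.
have gri := rintg_rotation b gi; have mg := ind_meas mG.
have mgr : measurable_fun setT (fun z => ind G (rotation b z)).
  exact: measurableT_comp mg (measurable_rotation b).
have le : {ae m, forall z, ind G z <= ind G (rotation b z)}.
  apply: filterS inv => z h; rewrite {1}/ind; case: ifPn => [/set_mem/h hz|_]; last exact: ind_ge0.
  by rewrite /ind mem_set.
pose d : L := mkL0 m (cmeas_real (measurable_funB mgr mg)).
have dE : {ae m, forall z, d z = (ind G (rotation b z) - ind G z)%:C} := mkL0E m _.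
have di : rintg m setT (fun z => ind G (rotation b z) - ind G z) by exact: rintgB.
have d0 : d = 0.
  apply: (n_eq0 (@Lone_normed R)).
    by apply/Lone_cintg; apply: (ae_cintg (L0_meas d) _ dE); exact: cintg_real.
  transitivity (\int[m]_z (ind G (rotation b z) - ind G z)).
    apply: ae_Rint; [exact: norm1_meas|exact: measurable_funB|].
    by apply: filterS2 dE le => z -> h; rewrite normcR ger0_norm// subr_ge0.
  by rewrite (RintegralB measurableT gri gi) (Rintegral_rotation b gi) subrr.
have geq : {ae m, forall z, ind G (rotation b z) = ind G z}.
  apply: filterS2 dE (L0_0 R) => z; rewrite d0 => -> /eqP.
  by rewrite -normc_eq0 normcR normr_eq0 subr_eq0 => /eqP.
set c := \int[m]_z ind G z.
have xm : measurable_fun setT (fun z => ind G z - c) by apply: measurable_funB.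
pose x : L := mkL0 m (cmeas_real xm).
have xE : {ae m, forall z, x z = (ind G z - c)%:C} := mkL0E m _.
have xri : rintg m setT (fun z => ind G z - c) by apply: rintgB => //; exact: rintg_cst.
have xi : cintg m setT x by apply: (ae_cintg (L0_meas x) _ xE); exact: cintg_real.
have xrot : rotation_op b x = x.
  apply: L0P; apply: filterS2 (filterI (L0rot b x) (ae_rot b xE)) (filterI xE geq).
  by move=> z [-> ->] [-> ->].
have mom n : (0 < n)%N -> cmoment x n = 0.
  move=> n0; have := cmoment_rot b n xi; rewrite xrot => /eqP.
  rewrite -{1}[cmoment x n]mul1r -subr_eq0 -mulrBl mulf_eq0 subr_eq0 eq_sym.
  by rewrite (negPf (broot _ n0)) => /eqP.
have x0 : {ae m, forall z, x z = 0}.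
  apply: fourier_unique => // n.
  have -> : cmoment (fun z => conjc (x z)) n = cmoment x n.
    apply: cmoment_ae; [by apply: cmeas_conjc; exact: L0_meas|exact: L0_meas|].
    by apply: filterS xE => z ->; exact: conjc_real.
  case: n => [|n]; last exact: mom.
  transitivity (cint m setT (fun z => (ind G z - c)%:C)).
    apply: ae_cint.
    - by apply: measurable_complexM; [exact: cmeas_circleX|exact: L0_meas].
    - exact: cmeas_real.
    - by apply: filterS xE => z ->; rewrite expr0 mul1r.
  rewrite cint_real (RintegralB measurableT gi (rintg_cst c)) Rint_cst -/c subrr//.
have gc : {ae m, forall z, ind G z = c}.
  apply: filterS2 xE x0 => z -> /eqP; rewrite -normc_eq0 normcR normr_eq0 subr_eq0.
  by move=> /eqP.
have [c0|c0] := eqVneq c 0; [right|left].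
  apply: filterS gc => z h Gz; move: h; rewrite c0 /ind mem_set// => /eqP.
  by rewrite oner_eq0.
apply: filterS gc => z; rewrite /ind; case: ifPn => [/set_mem//|_ h].
by rewrite -h eqxx in c0.
Qed.

Lemma L0_sum n (F : nat -> L) :
  {ae m, forall z, (\sum_(0 <= k < n) F k : L) z = \sum_(k < n) F k z}.
Proof.
elim: n => [|n IH]; first by rewrite big_geq//; apply: filterS (L0_0 R) => z ->; rewrite big_ord0.
rewrite big_nat_recr//=; apply: filterS2 IH (L0D (\sum_(0 <= k < n) F k) (F n)) => z h ->.
by rewrite big_ord_recr h.
Qed.

(** The pointwise estimate behind the hump: at most one of the values [v k] is
    not small, and the increments [d k] of the coefficients [c k] are small
    relative to [c k], except at both ends. *)
Lemma hump_pointwise P (v : nat -> R[i]) (beta c d : nat -> R) (chi : nat -> bool)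
  (eta delta B q : R) :
  (0 < P)%N -> 0 <= eta -> 0 <= delta -> 0 <= B ->
  (forall k, (k <= P)%N -> 0 <= beta k <= B) -> (forall k, 0 <= c k) ->
  (forall k, (k <= P)%N -> normc (v k) = beta k * (if chi k then 1 else delta)) ->
  (forall i j, (i <= P)%N -> (j <= P)%N -> chi i -> chi j -> i = j) ->
  `|d 0%N| <= 1 -> `|d P| <= q -> (forall k, (0 < k < P)%N -> `|d k| <= eta * c k) ->
  beta 0%N <= 1 ->
  let F := \sum_(k < P) (c k)%:C * v k in
  let Q1 := B * \sum_(k < P) c k in
  let Q2 := B * (\sum_(k < P.+1) `|d k|) + eta * Q1 in
  (forall j, (j < P)%N -> chi j -> c j * beta j <= normc F + delta * Q1) /\
  normc (\sum_(k < P.+1) (d k)%:C * v k) <=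
    eta * normc F + (chi 0%N)%:R + q * beta P * (chi P)%:R + delta * Q2.
Proof.
move=> P0 eta0 delta0 B0 bB c0 vE chi1 d0 dP dk b01 F Q1 Q2.
have Q10 : 0 <= Q1 by rewrite mulr_ge0// sumr_ge0.
have vsmall k : (k <= P)%N -> ~~ chi k -> normc (v k) <= delta * B.
  move=> kP nk; rewrite vE// (negPf nk) mulrC ler_wpM2l//; by have /andP[] := bB _ kP.
have tri n (u : 'I_n -> R[i]) (Pr : pred 'I_n) (b : 'I_n -> R) :
    (forall i, Pr i -> normc (u i) <= b i) ->
    normc (\sum_(i < n | Pr i) u i) <= \sum_(i < n | Pr i) b i.
  move=> h; elim/big_ind2 : _ => [|x1 x2 y1 y2 h1 h2|i Pi]; first by rewrite normc_0.
    by apply: le_trans (le_normcD _ _) _; exact: lerD.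
  exact: h.
have one j : (j < P)%N -> chi j -> c j * beta j <= normc F + delta * Q1.
  move=> jP cj; have jP' := ltnW jP.
  have -> : c j * beta j = normc ((c j)%:C * v j).
    by rewrite normcM normc_rC// vE// cj mulr1.
  have -> : (c j)%:C * v j = F - \sum_(k < P | k != Ordinal jP) (c k)%:C * v k.
    by rewrite /F (bigD1 (Ordinal jP))//= addrK.
  apply: le_trans (le_normcD _ _) _; rewrite normcN lerD2l.
  apply: (@le_trans _ _ (\sum_(k < P | k != Ordinal jP) c k * (delta * B))).
    apply: tri => k kj; rewrite normcM normc_rC// ler_wpM2l//.
    apply: vsmall; first exact: ltnW.
    apply: contra kj => ck; apply/eqP/val_inj.
    exact: (chi1 _ _ (ltnW (ltn_ord k)) jP' ck cj).
  rewrite -mulr_suml mulrC /Q1 -mulrA ler_wpM2l// ler_wpM2l//.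
  by rewrite [leRHS](bigD1 (Ordinal jP))//= lerDr.
split=> //.
have nd k : (k <= P)%N -> ~~ chi k -> normc ((d k)%:C * v k) <= `|d k| * (delta * B).
  by move=> kP nk; rewrite normcM normcR ler_wpM2l// vsmall.
have SD : \sum_(k < P.+1) `|d k| * (delta * B) = delta * (B * \sum_(k < P.+1) `|d k|).
  by rewrite -mulr_suml; ring.
have q0 : 0 <= q by apply: le_trans dP.
have bP0 : 0 <= beta P by have /andP[] := bB P (leqnn P).
have eF : 0 <= eta * normc F by rewrite mulr_ge0// normc_ge0.
have main j : (j <= P)%N -> chi j ->
    normc (\sum_(k < P.+1) (d k)%:C * v k) <= `|d j| * beta j + delta * (B * \sum_(k < P.+1) `|d k|).
  move=> jP cj; have jP1 : (j < P.+1)%N by [].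
  rewrite (bigD1 (Ordinal jP1))//=; apply: le_trans (le_normcD _ _) _; apply: lerD.
    by rewrite normcM normcR vE// cj mulr1.
  rewrite -SD [leRHS](bigD1 (Ordinal jP1))//=; apply: ler_wpDl.
    by apply: mulr_ge0 => //; exact: mulr_ge0.
  apply: tri => k kj; apply: nd; first by rewrite -ltnS.
  apply: contra kj => ck; apply/eqP/val_inj.
  have kP : (k <= P)%N by rewrite -ltnS.
  exact: (chi1 _ _ kP jP ck cj).
have dQ : delta * Q2 = delta * (B * \sum_(k < P.+1) `|d k|) + eta * (delta * Q1).
  by rewrite /Q2; ring.
have eQ : 0 <= eta * (delta * Q1) by apply: mulr_ge0 => //; exact: mulr_ge0.
have qP : 0 <= q * beta P * (chi P)%:R by apply: mulr_ge0 => //; exact: mulr_ge0.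
have chi00 : 0 <= (chi 0%N)%:R :> R by [].
have [[j [jP cj]]|nj] := pselect (exists j, (j <= P)%N /\ chi j).
  apply: le_trans (main j jP cj) _; rewrite dQ.
  have [j0|jn0] := eqVneq j 0%N.
    have : `|d j| * beta j <= (chi 0%N)%:R.
      rewrite -j0 cj j0 -[leRHS]mulr1; apply: ler_pM => //; by have /andP[] := bB 0%N isT.
    move: qP; move: (q * _ * _) => A; lra.
  have [jE|jnP] := eqVneq j P.
    have : `|d j| * beta j <= q * beta P * (chi P)%:R by rewrite -jE cj mulr1 jE ler_wpM2r.
    move: (q * _ * _) => A; lra.
  have jlt : (j < P)%N by rewrite ltn_neqAle jnP.
  have h1 := one j jlt cj.
  have h2 : `|d j| * beta j <= eta * (c j * beta j).
    have /andP[bj _] := bB j jP; rewrite mulrA ler_wpM2r// dk// lt0n jn0//.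
  have := ler_wpM2l eta0 h1; rewrite mulrDr; move: h2 qP; move: (q * _ * _) => A; lra.
have nchi k : (k <= P)%N -> ~~ chi k by move=> kP; apply/negP => ck; apply: nj; exists k.
apply: le_trans (_ : delta * (B * \sum_(k < P.+1) `|d k|) <= _).
  rewrite -SD; apply: tri => k _; have kP : (k <= P)%N by have := ltn_ord k.
  exact: (nd _ kP (nchi _ kP)).
rewrite dQ; move: qP; move: (q * _ * _) => A; lra.
Qed.

End ergodicity.

(** * Humps along orbits *)

Section telescoping.
Variables (R : realType) (V : lmodType R[i]).

Lemma telescope_sum P (c : nat -> R) (u : nat -> V) :
  \sum_(0 <= k < P) (c k)%:C *: (u k - u k.+1) =
  \sum_(0 <= k < P.+1) ((if (k < P)%N then c k else 0) - (if (0 < k)%N then c k.-1 else 0))%:C *: u k.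
Proof.
transitivity (\sum_(0 <= k < P.+1) (if (k < P)%N then c k else 0)%:C *: u k -
    \sum_(0 <= k < P.+1) (if (0 < k)%N then c k.-1 else 0)%:C *: u k); last first.
  by rewrite -sumrB; apply: eq_bigr => k _; rewrite rmorphB scalerBl.
rewrite big_nat_recr//= ltnn scale0r addr0 [X in _ - X]big_nat_recl//= scale0r add0r -sumrB.
by apply: eq_big_nat => k /andP[_ kP]; rewrite kP scalerBr.
Qed.

End telescoping.

Section hump.
Variable R : realType.
Local Notation C := (circle R).
Local Notation m := (circle_measure R).
Local Notation L := (L0 m).
Variables (a : C) (X : subnormed L) (w : L) (lam : R[i]) (n0 : nat) (K : R).
Hypothesis aX : admissible a X.
Hypothesis wH : Hinfty R w.
Hypothesis lam0 : lam != 0.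
Local Notation Y := (H1_inter X).
Local Notation T := (weighted_rotation_op w a).
Local Notation S := (lambda_minus T lam).
Local Notation N := (nnorm X).
Local Notation U := (rotation_op a).
Local Notation l := (normc lam).

Let hX : banach_ideal_space X. Proof. by have [] := aX. Qed.
Let hN := ideal_normed hX.
Let lT : lin T. Proof. exact: weighted_lin. Qed.
Let lS : lin S. Proof. exact: lin_lambda. Qed.

(** The functions on which the operator is bounded below when its range is
    closed. *)
Definition vanishing : subnormed L :=
  Subnormed (carrier Y `&` [set x : L | forall k, (k < n0)%N -> fcoef k x = 0]) N.

Let Yintg (x : L) : carrier Y x -> cintg m setT x.
Proof. by move=> [/H1P[]]. Qed.

Lemma vanishing_normed : normed vanishing.
Proof.
have [[Y0 YD] [ng ne nz nd]] := hardy_normed aX.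
split; [split|split].
- split; first exact: Y0.
  move=> k _; have [/H1P[xi _] _] := Y0.
  by rewrite -(scale0r (0 : L)) fcoefZ// mul0r.
- move=> c x y [xY xv] [yY yv]; split; first exact: YD.
  move=> k kn; have yiN : carrier Y (- y) by exact: (nmemN (hardy_normed aX)).
  have cxY : carrier Y (c *: x) by exact: (nmemZ (hardy_normed aX)).
  rewrite -[y]opprK fcoefB; [|exact: Yintg|exact: Yintg].
  rewrite fcoefZ; last exact: Yintg.
  have -> : - y = (-1) *: y by rewrite scaleN1r.
  rewrite (fcoefZ k (-1) (Yintg yY)).
  by rewrite xv// yv// !mulr0 subr0.
- by move=> x [xY _]; exact: ng.
- by move=> x [xY _]; exact: ne.
- by move=> c x [xY _]; exact: nz.
- by move=> x y [xY _] [yY _]; exact: nd.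
Qed.

Lemma vanishing_weighted x : carrier vanishing x -> carrier vanishing (T x).
Proof.
move=> [xY xv]; have [TD _] := hardy_weighted_bounded aX wH; split; first exact: TD.
move=> k kn; rewrite (fcoef_weighted a wH (proj1 xY)); first by rewrite xv// mulr0.
by move=> j jk; apply: xv; exact: ltn_trans kn.
Qed.

(** Normalized moduli of the weights of the powers. *)
Definition wratio k z : R := normc (wprod w a k z) / l ^+ k.

Lemma wratio_ge0 k z : 0 <= wratio k z.
Proof. by apply: divr_ge0; [exact: normc_ge0|apply: exprn_ge0; exact: normc_ge0]. Qed.

Lemma wratio_meas k : measurable_fun setT (wratio k).
Proof. by apply: measurable_funM => //; exact: norm1_meas. Qed.

Lemma wratio0 : {ae m, forall z, wratio 0 z = 1}.
Proof. by apply: filterS (L0_1 R) => z h; rewrite /wratio h normc_1 expr0 divr1. Qed.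

Lemma wratio_bound P : exists2 B : R, 0 <= B &
  {ae m, forall z, forall k, (k <= P)%N -> wratio k z <= B}.
Proof.
have [M M0 wM] := weight_bounded wH; have l0 : 0 < l by rewrite normc_gt0.
have Ml : 0 <= M / l by rewrite divr_ge0// ltW.
exists ((1 + M / l) ^+ P); first by rewrite exprn_ge0// addr_ge0.
apply: (ae_foralln (P := fun k z => (k <= P)%N -> wratio k z <= (1 + M / l) ^+ P)) => k.
apply: filterS (wprod_bound a k wM) => z h kP.
apply: (@le_trans _ _ ((M / l) ^+ k)).
  by rewrite /wratio expr_div_n; apply: ler_wpM2r => //; rewrite invr_ge0 exprn_ge0// normc_ge0.
apply: (@le_trans _ _ ((1 + M / l) ^+ k)).
  by apply: lerXn2r; rewrite ?nnegrE ?addr_ge0// lerDr.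
by apply: ler_weXn2l => //; rewrite lerDl.
Qed.

(** Normalized so that [T] shifts the sequence, up to the factor [lam]. *)
Definition orbit_vec k (g : L) : L := lam^-1 ^+ k *: iter k T g.

Lemma orbit_vecS k g : S (orbit_vec k g) = lam *: (orbit_vec k g - orbit_vec k.+1 g).
Proof.
rewrite /lambda_minus (linZ _ _ lT) scalerBr; congr (_ - _).
by rewrite /orbit_vec iterS scalerA exprS mulrA divff// mul1r.
Qed.

Lemma orbit_vecE g k : {ae m, forall z, normc (orbit_vec k g z) =
  wratio k z * normc (g (iter k (rotation a) z))}.
Proof.
rewrite /orbit_vec weighted_iter.
apply: filterS2 (filterI (L0Z (lam^-1 ^+ k) (mulL0 (wprod w a k) (iter k U g)))
  (L0M (wprod w a k) (iter k U g))) (iter_rotE a k g) => z [-> ->] ->.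
by rewrite !normcM normcX normcV exprVn /wratio; ring.
Qed.

(** The set [E] carries the test function. On the orbit segment of length [2
    p] the weight is at least [s] in the middle and at most [t] at the end,
    and the hump of ratio [1 + eta] is tested against the lower bound. The
    translates of [E] along the segment are disjoint. *)
Section step.
Variables (E : set C) (mE : measurable E) (p : nat) (s t eta rho CU CV : R).
Hypothesis p0 : (0 < p)%N.
Hypothesis s0 : 0 <= s.
Hypothesis t0 : 0 <= t.
Hypothesis eta0 : 0 <= eta.
Hypothesis KE : 0 < K.
Hypothesis Keta : K * l * eta <= 1 / 2.
Hypothesis below : forall x, carrier vanishing x -> N x <= K * N (S x).
Hypothesis E1 : forall z i j, (i <= p.*2)%N -> (j <= p.*2)%N ->
  E (iter i (rotation a) z) -> E (iter j (rotation a) z) -> i = j.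
Hypothesis Es : {ae m, forall z, E (iter p (rotation a) z) -> s <= wratio p z}.
Hypothesis Et : {ae m, forall z, E (iter p.*2 (rotation a) z) -> wratio p.*2 z <= t}.
Hypothesis rho0 : 0 < rho.
Hypothesis CV0 : 0 < CV.
Hypothesis gU : forall k x, carrier X x -> N (iter k U x) <= CU * rho ^+ k * N x.
Hypothesis gV : forall k x, carrier X x ->
  N (iter k (rotation_op (cinv a)) x) <= CV * rho ^+ k * N x.

Let q : R := 1 + eta.
Let P := p.*2.
Let c k : R := q ^+ minn k (P - k).
(** The differences of consecutive coefficients, with those at the two ends of
    the segment. *)
Let d k : R := (if (k < P)%N then c k else 0) - (if (0 < k)%N then c k.-1 else 0).

Let q1 : 1 <= q. Proof. by rewrite lerDl. Qed.
Let q0 : 0 <= q. Proof. exact: le_trans q1. Qed.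
Let c0 k : 0 <= c k. Proof. exact: exprn_ge0. Qed.
Let P0 : (0 < P)%N. Proof. by rewrite /P double_gt0. Qed.

Let d0E : `|d 0%N| <= 1.
Proof. by rewrite /d P0 /= subr0 /c min0n expr0 normr1. Qed.

Let dPE : `|d P| <= q.
Proof.
rewrite /d ltnn P0 sub0r normrN ger0_norm// /c.
have -> : minn P.-1 (P - P.-1) = 1%N by rewrite /P; move: p0; clear; lia.
by rewrite expr1.
Qed.

Let dE k : (0 < k < P)%N -> `|d k| <= eta * c k.
Proof.
move=> /andP[k0 kP]; rewrite /d kP k0.
have [kp|pk] := leqP k p.
  have e1 : c k = q * c k.-1.
    rewrite /c -exprS; congr (_ ^+ _); move: kp k0; rewrite /P; clear; lia.
  have h : c k.-1 <= c k by rewrite e1 ler_peMl.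
  rewrite ger0_norm ?subr_ge0// [X in X - _]e1 /q mulrDl mul1r addrAC subrr add0r.
  by rewrite ler_wpM2l.
have e1 : c k.-1 = q * c k.
  rewrite /c -exprS; congr (_ ^+ _); move: pk kP k0; rewrite /P; clear; lia.
rewrite e1 /q mulrDl mul1r opprD addrA subrr sub0r normrN ger0_norm//; exact: mulr_ge0.
Qed.

Let one_mem : carrier X (oneL0 R).
Proof.
have [_ h _ _ _] := aX; apply: h; exists 1.
by apply: filterS (L0_1 R) => z ->; rewrite normc_1.
Qed.

Let ind_mem : carrier X (indL0 mE).
Proof.
have [_ h _ _ _] := aX; apply: h; exists 1.
by apply: filterS (indL0E mE) => z ->; rewrite normcR ger0_norm ?ind_ge0// ind_le1.
Qed.

(** Compare the norm of the hump with that of its image. The image is small by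
    the choice of [eta], up to the contributions of both ends; [delta] is the
    modulus of the test function off [E]. *)
Lemma hump_approx : exists Z : R, 0 <= Z /\ forall delta : R, 0 < delta ->
  q ^+ p * s * N (indL0 mE) <= CV * rho ^+ p *
    (2 * K * l * (1 + q * t * (CU * rho ^+ P)) * N (indL0 mE)) + delta * Z.
Proof.
have [B B0 wB] := wratio_bound P.
pose Q1 := B * \sum_(k < P) c k.
pose Q2 := B * (\sum_(k < P.+1) `|d k|) + eta * Q1.
have Q10 : 0 <= Q1 by apply: mulr_ge0 => //; apply: sumr_ge0.
have Q20 : 0 <= Q2.
  by apply: addr_ge0; apply: mulr_ge0 => //; apply: sumr_ge0.
have [[UD _] [VD _]] : subexponential X a /\ subexponential X (cinv a) by have [] := aX.
have N10 := n_ge0 hN one_mem; have Ni0 := n_ge0 hN ind_mem.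
have l0 : 0 < l by rewrite normc_gt0.
exists (CV * rho ^+ p * (2 * K * l * Q2 * N (oneL0 R) + Q1 * N (oneL0 R))).
have CVr : 0 <= CV * rho ^+ p by rewrite mulr_ge0 ?(ltW CV0)// exprn_ge0// ltW.
have Kl0 : 0 <= 2 * K * l by rewrite !mulr_ge0// ltW.
split; first by apply: mulr_ge0 => //; apply: addr_ge0; apply: mulr_ge0 => //; exact: mulr_ge0.
move=> delta delta0; have [f fH fE] := outer_Hinfty mE delta0.
pose g := mulL0 (zpow R n0) f.
have gv : carrier vanishing g.
  have [fH1 fL] : H1 R f /\ Linfty R f by move: fH; rewrite HinftyE.
  split; last by move=> k kn; exact: fcoef_zpow_lt.
  split; first exact: H1_zpow.
  have [_ LX _ _ _] := aX; apply: LX; move: fL => [M fM]; exists M.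
  apply: filterS2 (filterI fM (L0M (zpow R n0) f)) (normc_zpow R n0) => z [h ->] e.
  by rewrite normcM e mul1r.
have gE : {ae m, forall z, normc (g z) = if z \in E then 1 else delta}.
  apply: filterS2 (filterI fE (L0M (zpow R n0) f)) (normc_zpow R n0) => z [h ->] e.
  by rewrite normcM e mul1r.
have ov k : carrier vanishing (orbit_vec k g).
  apply: (nmemZ vanishing_normed); exact: (mem_iter _ vanishing_weighted gv).
pose F : L := \sum_(0 <= k < P) (c k)%:C *: orbit_vec k g.
pose G : L := \sum_(0 <= k < P.+1) (d k)%:C *: orbit_vec k g.
have Fv : carrier vanishing F.
  by apply: (nmem_sum vanishing_normed) => k; exact: (nmemZ vanishing_normed).
have Gv : carrier vanishing G.
  by apply: (nmem_sum vanishing_normed) => k; exact: (nmemZ vanishing_normed).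
have [FX GX] : carrier X F /\ carrier X G by split; [have [[]] := Fv|have [[]] := Gv].
have SF : S F = lam *: G.
  rewrite /G -(telescope_sum P c (orbit_vec^~ g)) /F scaler_sumr.
  move: P => P'; elim: P' => [|n IH]; first by rewrite !big_geq// (lin0 lS).
  rewrite !big_nat_recr//= (linD _ _ lS) IH (linZ _ _ lS) orbit_vecS.
  by congr (_ + _); rewrite !scalerA mulrC.
have pw n (e : nat -> R) : {ae m, forall z,
    (\sum_(0 <= k < n) (e k)%:C *: orbit_vec k g : L) z = \sum_(k < n) (e k)%:C * orbit_vec k g z}.
  have h : {ae m, forall z, forall k, ((e k)%:C *: orbit_vec k g : L) z = (e k)%:C * orbit_vec k g z}.
    by apply: ae_foralln => k; exact: L0Z.
  apply: filterS2 (L0_sum n (fun k => (e k)%:C *: orbit_vec k g)) h => z -> h.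
  by apply: eq_bigr => k _; exact: h.
have FE := pw P c; have GE := pw P.+1 d; rewrite -/F in FE; rewrite -/G in GE.
clearbody F G.
have vE : {ae m, forall z, forall k, normc (orbit_vec k g z) =
    wratio k z * (if iter k (rotation a) z \in E then 1 else delta)}.
  apply: ae_foralln => k; apply: filterS2 (orbit_vecE g k) (ae_iter_rot a k gE) => z -> ->; by [].
have key : {ae m, forall z,
    (E (iter p (rotation a) z) -> q ^+ p * s <= normc (F z) + delta * Q1) /\
    normc (G z) <= eta * normc (F z) + ind E z + q * t * ind E (iter P (rotation a) z) + delta * Q2}.
  apply: filterS2 (filterI (filterI wB vE) (filterI FE GE)) (filterI wratio0 (filterI Es Et)).
  move=> z [[hB hv] [hF hG]] [h0 [hs ht]].
  have := @hump_pointwise R P (fun k => orbit_vec k g z) (wratio^~ z) c d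
    (fun k => iter k (rotation a) z \in E) eta delta B q P0 eta0 (ltW delta0) B0.
  case=> //.
  - by move=> k kP; rewrite wratio_ge0 hB.
  - by move=> i j iP jP /set_mem Ei /set_mem Ej; exact: E1 Ei Ej.
  - by rewrite h0.
  rewrite -hF -hG -/Q1 -/Q2 => h1 h2; split.
    move=> Ep; have pP : (p < P)%N by rewrite /P; move: p0; clear; lia.
    apply: le_trans (h1 p pP (mem_set Ep)).
    have -> : c p = q ^+ p by rewrite /c /P; congr (_ ^+ _); clear; lia.
    by apply: ler_wpM2l; [exact: exprn_ge0|exact: hs].
  apply: le_trans h2 _; rewrite lerD2r; apply: lerD; first by rewrite lerD2l /ind /=; case: ifP.
  rewrite /ind; case: ifPn => [/set_mem h|_]; last by rewrite !mulr0.
  by rewrite !mulr1 ler_wpM2l// ht.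
have iU k : carrier X (iter k U (indL0 mE)) by exact: (mem_iter _ UD ind_mem).
have iUE k : {ae m, forall z, iter k U (indL0 mE) z = (ind E (iter k (rotation a) z))%:C}.
  by apply: filterS2 (iter_rotE a k (indL0 mE)) (ae_iter_rot a k (indL0E mE)) => z -> ->.
have [aFX aFN] := ideal_abs hX FX.
have rc (x : R) : 0 <= x -> normc x%:C = x by move=> x0; rewrite normcR ger0_norm.
have qt0 : 0 <= q * t by exact: mulr_ge0.
have dQ1 : 0 <= delta * Q1 by rewrite mulr_ge0// ltW.
have dQ2 : 0 <= delta * Q2 by rewrite mulr_ge0// ltW.
have qs0 : 0 <= q ^+ p * s by apply: mulr_ge0 => //; exact: exprn_ge0.
(* the value at the centre of the orbit segment bounds the hump from below *)
have low : q ^+ p * s * N (indL0 mE) <= CV * rho ^+ p * (N F + delta * Q1 * N (oneL0 R)).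
  have h1 : N ((q ^+ p * s)%:C *: iter p U (indL0 mE)) <= N (absL0 F + (delta * Q1)%:C *: oneL0 R).
    apply: (ideal_le hX); last by apply: (nmemD hN) => //; exact: (nmemZ hN).
    apply: filterS2 (filterI key (filterI (iUE p) (L0Z (q ^+ p * s)%:C (iter p U (indL0 mE)))))
      (filterI (filterI (L0D (absL0 F) ((delta * Q1)%:C *: oneL0 R)) (absL0E F))
        (filterI (L0Z (delta * Q1)%:C (oneL0 R)) (L0_1 R))).
    move=> z [[h _] [e1 e2]] [[e3 e4] [e5 e6]].
    have f0 : 0 <= normc (F z) + delta * Q1 by apply: addr_ge0 => //; exact: normc_ge0.
    rewrite e2 e1 e3 e4 e5 e6 mulr1 -(rmorphD (real_complex R)) normcM (rc _ qs0) (rc _ f0).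
    rewrite (rc _ (ind_ge0 _ _)).
    rewrite /ind; case: ifPn => [/set_mem /h|_]; first by rewrite mulr1.
    by rewrite mulr0 addr_ge0 ?normc_ge0.
  have VU : N (indL0 mE) <= CV * rho ^+ p * N (iter p U (indL0 mE)).
    have -> : N (indL0 mE) = N (iter p (rotation_op (cinv a)) (iter p U (indL0 mE))).
      congr (nnorm X _); elim: p => [//|k IH]; rewrite iterSr iterS rot_cinvK; exact: IH.
    exact: gV.
  have h2 : q ^+ p * s * N (iter p U (indL0 mE)) <= N F + delta * Q1 * N (oneL0 R).
    have := le_trans h1 (nD hN aFX (nmemZ hN (delta * Q1)%:C one_mem)).
    by rewrite !(nZ hN)// aFN !rc//; apply: mulr_ge0 => //; exact: exprn_ge0.
  apply: le_trans (ler_wpM2l qs0 VU) _; rewrite mulrCA; exact: ler_wpM2l.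
(* the ends of the orbit segment bound the image of the hump from above *)
have up : N G <= eta * N F + N (indL0 mE) + q * t * N (iter P U (indL0 mE)) + delta * Q2 * N (oneL0 R).
  pose H1 : L := eta%:C *: absL0 F + indL0 mE.
  pose H2 : L := (q * t)%:C *: iter P U (indL0 mE).
  pose H3 : L := (delta * Q2)%:C *: oneL0 R.
  have m1 : carrier X (eta%:C *: absL0 F) by exact: (nmemZ hN).
  have m2 : carrier X H1 by exact: (nmemD hN).
  have m3 : carrier X H2 by exact: (nmemZ hN).
  have m4 : carrier X H3 by exact: (nmemZ hN).
  have m5 : carrier X (H1 + H2) by exact: (nmemD hN).
  have m6 : carrier X (H1 + H2 + H3) by exact: (nmemD hN).
  have h : N G <= N (H1 + H2 + H3).
    apply: (ideal_le hX) => //.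
    apply: filterS2 (filterI key (filterI (L0D (H1 + H2) H3) (filterI (L0D H1 H2)
        (L0D (eta%:C *: absL0 F) (indL0 mE)))))
      (filterI (filterI (filterI (L0Z eta%:C (absL0 F)) (absL0E F)) (filterI (indL0E mE) (iUE P)))
        (filterI (L0Z (q * t)%:C (iter P U (indL0 mE))) (filterI (L0Z (delta * Q2)%:C (oneL0 R)) (L0_1 R)))).
    move=> z [[_ h] [e1 [e2 e3]]] [[[e4 e5] [e6 e7]] [e8 [e9 e10]]].
    rewrite e1 e2 e3 e4 e5 e6 e8 e9 e10 e7 mulr1 -!(rmorphM (real_complex R)) -!(rmorphD (real_complex R)) rc//.
    apply: le_trans h; exact: normc_ge0.
  apply: le_trans h _; apply: le_trans (nD hN m5 m4) _; rewrite /H3 (nZ hN _ one_mem) rc//.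
  rewrite lerD2r; apply: le_trans (nD hN m2 m3) _; rewrite /H2 (nZ hN _ (iU P)) rc//.
  rewrite lerD2r; apply: le_trans (nD hN m1 ind_mem) _; by rewrite (nZ hN _ aFX) rc// aFN.
have NP := gU P ind_mem.
have NF := below Fv; rewrite SF (nZ hN _ GX) in NF.
have NF0 := n_ge0 hN FX.
have NF2 : N F <= 2 * K * l * (1 + q * t * (CU * rho ^+ P)) * N (indL0 mE) +
    delta * (2 * K * l * Q2 * N (oneL0 R)).
  have Kl : 0 <= K * l by rewrite mulr_ge0// ltW.
  have h1 := ler_wpM2l Kl up.
  have h2 := ler_wpM2l (mulr_ge0 Kl qt0) NP.
  have h3 := ler_wpM2r NF0 Keta.
  move: NF h1 h2 h3; move: (N F) (N G) (N (indL0 mE)) (N (iter P U _)) (N (oneL0 R)) => x1 x2 x3 x4 x5.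
  move: (CU * rho ^+ P) (q * t) => x6 x7; lra.
apply: le_trans low _; apply: le_trans (ler_wpM2l CVr (lerD NF2 (lexx _))) _.
rewrite le_eqVlt; apply/orP; left; apply/eqP; ring.
Qed.

Lemma hump_set : q ^+ p * s * N (indL0 mE) <= CV * rho ^+ p *
    (2 * K * l * (1 + q * t * (CU * rho ^+ P)) * N (indL0 mE)).
Proof.
have [Z [Z0 H]] := hump_approx; apply/ler_addgt0Pl => e e0.
have Z1 : 0 < Z + 1 by rewrite ltr_wpDl.
have := H _ (divr_gt0 e0 Z1) => h; apply: le_trans h _; rewrite addrC lerD2r.
rewrite mulrAC ler_pdivrMr// ler_wpM2l ?(ltW e0)// lerDl//.
Qed.

End step.

Hypothesis aroot : forall n : nat, (0 < n)%N -> (a : R[i]) ^+ n != 1.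

(** A finite part of the orbit of a point is separated, uniformly in the
    point. *)
Lemma rotation_gap n : exists2 e : R, 0 < e & forall i j, (i < j <= n)%N ->
  e <= normc ((a : R[i]) ^+ i - (a : R[i]) ^+ j).
Proof.
have [e e0 H] : exists2 e : R, 0 < e & forall k, (0 < k <= n)%N -> e <= normc (1 - (a : R[i]) ^+ k).
  elim: n => [|n [e e0 H]]; first by exists 1 => // k; case: k.
  have h : 0 < normc (1 - (a : R[i]) ^+ n.+1) by rewrite normc_gt0 subr_eq0 eq_sym aroot.
  exists (Num.min e (normc (1 - (a : R[i]) ^+ n.+1))); first by rewrite lt_min e0.
  move=> k /andP[k0]; rewrite leq_eqVlt => /orP[/eqP ->|kn]; first by rewrite ge_min lexx orbT.
  by rewrite ge_min H// k0.
exists e => // i j /andP[ij jn].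
have -> : (a : R[i]) ^+ i - (a : R[i]) ^+ j = (a : R[i]) ^+ i * (1 - (a : R[i]) ^+ (j - i)).
  by rewrite mulrBr mulr1 -exprD subnKC// ltnW.
rewrite normcM normcX circle_normc expr1n mul1r; apply: H.
by rewrite subn_gt0 ij (leq_trans (leq_subr _ _)).
Qed.

Lemma small_cell (x : R) n : 0 <= x -> (0 < n)%N -> exists i : nat, i%:R <= x * n%:R <= i.+1%:R.
Proof.
move=> x0 n0'; have h : 0 <= x * n%:R by apply: mulr_ge0.
by exists (Num.truncn (x * n%:R)); have /andP[-> /ltW ->] := truncn_itv h.
Qed.

Section null_sets.
Variable p : nat.
Hypothesis p0 : (0 < p)%N.
(* what the hump estimate yields when its gain exceeds the constants *)
Hypothesis null : forall (s t : R) (E : set C), measurable E -> 0 <= s -> 0 <= t ->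
  (forall z i j, (i <= p.*2)%N -> (j <= p.*2)%N ->
    E (iter i (rotation a) z) -> E (iter j (rotation a) z) -> i = j) ->
  {ae m, forall z, E (iter p (rotation a) z) -> s <= wratio p z} ->
  {ae m, forall z, E (iter p.*2 (rotation a) z) -> wratio p.*2 z <= t} ->
  1 + t < 3 * s -> {ae m, forall z, ~ E z}.

Let mRe : measurable_fun setT (fun z : C => complex.Re (z : R[i])).
Proof. by apply: cmeas_Re; exact: measurable_circle_val. Qed.

Let mIm : measurable_fun setT (fun z : C => complex.Im (z : R[i])).
Proof. by apply: cmeas_Im; exact: measurable_circle_val. Qed.

(** Otherwise the inequality fails with a margin on a set of positive measure,
    whose intersection with one of countably many small cells has disjoint
    translates. *)
Lemma wratio_orbit : {ae m, forall z,
  3 * wratio p (iter p (rotation a) z) <= 1 + wratio p.*2 z}.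
Proof.
have [e e0 gap] := rotation_gap p.*2.
(* Two points in a cell of side [1 / n] are closer than any two points of an
   orbit segment. *)
pose n := (Num.truncn (2 / e)).+1.
have n0' : 0 < n%:R :> R by rewrite ltr0n.
have ne : 2 / n%:R < e.
  have h : 0 <= 2 / e by rewrite divr_ge0// ltW.
  have /andP[_ h1] := truncn_itv h.
  by rewrite ltr_pdivrMr// mulrC -ltr_pdivrMr.
pose b := cinv (cpow a p.*2).
pose t k r : R := r.+1%:R / k.+1%:R.
pose s k r : R := (1 + t k r) / 3 + 1 / k.+1%:R.
have k0 k : 0 < k.+1%:R :> R by rewrite ltr0n.
have t0 k r : 0 <= t k r by rewrite divr_ge0.
have s0 k r : 0 <= s k r.
  by apply: addr_ge0; apply: divr_ge0 => //; apply: addr_ge0.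
pose A (k r i j : nat) (z : C) : bool :=
  [&& s k r <= wratio p (rotation (cpow a p) z), wratio p.*2 z <= t k r,
    (i%:R <= (complex.Re (z : R[i]) + 1) * n%:R) && ((complex.Re (z : R[i]) + 1) * n%:R <= i.+1%:R) &
    (j%:R <= (complex.Im (z : R[i]) + 1) * n%:R) && ((complex.Im (z : R[i]) + 1) * n%:R <= j.+1%:R)].
have mA k r i j : measurable_fun setT (A k r i j).
  have mc (c : R) : measurable_fun setT (fun _ : C => c) by [].
  have mr : measurable_fun setT (fun z : C => (complex.Re (z : R[i]) + 1) * n%:R).
    by apply: measurable_funM => //; exact: measurable_funD.
  have mi : measurable_fun setT (fun z : C => (complex.Im (z : R[i]) + 1) * n%:R).
    by apply: measurable_funM => //; exact: measurable_funD.
  repeat apply: measurable_and; apply: measurable_fun_ler => //; try exact: wratio_meas.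
  by apply: (measurableT_comp (wratio_meas p)); exact: measurable_rotation.
have A1 k r i j x y : A k r i j x -> A k r i j y -> normc ((x : R[i]) - (y : R[i])) < e.
  move=> /and4P[_ _ /andP[x1 x2] /andP[x3 x4]] /and4P[_ _ /andP[y1 y2] /andP[y3 y4]].
  apply: le_lt_trans ne; apply: le_trans (ler_normc_ReIm _) _.
  rewrite ler_pdivlMr//= mulrDl -(ger0_norm (ltW n0')) -!normrM raddfB raddfB/=.
  rewrite (natrD _ 1 i : i.+1%:R = 1 + i%:R :> R) in x2 y2.
  rewrite (natrD _ 1 j : j.+1%:R = 1 + j%:R :> R) in x4 y4.
  have h1 : `|(complex.Re (x : R[i]) - complex.Re (y : R[i])) * n%:R| <= 1 by rewrite ler_norml; lra.
  have h2 : `|(complex.Im (x : R[i]) - complex.Im (y : R[i])) * n%:R| <= 1 by rewrite ler_norml; lra.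
  lra.
have nullA k r i j : {ae m, forall z, ~ A k r i j z}.
  pose E := [set y : C | A k r i j (rotation b y)].
  have mE : measurable E.
    have h : measurable_fun setT (fun y => A k r i j (rotation b y)).
      exact: (measurableT_comp (mA k r i j) (measurable_rotation b)).
    by rewrite -[E]setTI; exact: (h measurableT [set true]).
  have rC x y z : rotation x (rotation y z) = rotation y (rotation x z) :> C.
    by apply: val_inj; rewrite /= mulrCA.
  have b2 z : rotation b (iter p.*2 (rotation a) z) = z by rewrite -rotation_cpow rotation_cinvK.
  have hE : {ae m, forall z, ~ E z}.
    apply: (null mE (s0 k r) (t0 k r)).
    - have E1 z i' j' : (i' < j' <= p.*2)%N -> E (iter i' (rotation a) z) ->
          E (iter j' (rotation a) z) -> False.
        move=> ij h1 h2; have := A1 _ _ _ _ _ _ h1 h2; rewrite ltNge => /negP; apply.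
        have -> : (rotation b (iter i' (rotation a) z) : R[i]) -
            (rotation b (iter j' (rotation a) z) : R[i]) =
            ((a : R[i]) ^+ i' - (a : R[i]) ^+ j') * ((b : R[i]) * (z : R[i])).
          by rewrite -!rotation_cpow /= !cpowE; ring.
        by rewrite normcM normcM !circle_normc !mulr1; exact: gap.
      move=> z i' j' ip jp h1 h2; case: (ltngtP i' j') => [lt|lt|e1]; last exact: e1.
        by have ij : (i' < j' <= p.*2)%N; [rewrite lt jp|case: (E1 z i' j' ij h1 h2)].
      by have ij : (j' < i' <= p.*2)%N; [rewrite lt ip|case: (E1 z j' i' ij h2 h1)].
    - apply: aeW => z; rewrite /E /= => /and4P[h _ _ _]; move: h.
      by rewrite rC rotation_cpow -iterD addnn b2.
    - by apply: aeW => z; rewrite /E /= b2 => /and4P[_ h _ _].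
    - rewrite /s mulrDr mulrC divfK ?pnatr_eq0// ltrDl; apply: mulr_gt0 => //; exact: divr_gt0.
  by apply: filterS (ae_iter_rot a p.*2 hE) => z; rewrite /E /= b2.
have all4 : {ae m, forall z, forall k r i j, ~ A k r i j z}.
  by do 4 (apply: ae_foralln => ?); exact: nullA.
apply: filterS all4 => z nz; rewrite leNgt; apply/negP => bad.
set u := wratio p.*2 z in bad; set v := wratio p _ in bad.
have u0 : 0 <= u by exact: wratio_ge0.
pose g := 3 * v - 1 - u; have g0 : 0 < g by rewrite /g; lra.
pose k := Num.truncn (4 / g).
have kg : 4 / k.+1%:R < g.
  have h : 0 <= 4 / g by rewrite divr_ge0// ltW.
  have /andP[_ h1] := truncn_itv h.
  by rewrite ltr_pdivrMr// mulrC -ltr_pdivrMr.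
have [r /andP[r1 r2]] := small_cell u0 (ltn0Sn k).
have bd (x : R) : `|x| <= 1 -> 0 <= x + 1 by rewrite ler_norml; lra.
have z1 : normc (z : R[i]) = 1 by exact: circle_normc.
have [i i12] : exists i : nat, i%:R <= (complex.Re (z : R[i]) + 1) * n%:R <= i.+1%:R.
  by apply: small_cell => //; apply: bd; rewrite -z1; exact: ler_ReN.
have [j j12] : exists j : nat, j%:R <= (complex.Im (z : R[i]) + 1) * n%:R <= j.+1%:R.
  by apply: small_cell => //; apply: bd; rewrite -z1; exact: ler_ImN.
apply: (nz k r i j); rewrite /A i12 j12 !andbT rotation_cpow -/v -/u; apply/andP; split.
  rewrite /s /t; have e1 : r.+1%:R / k.+1%:R <= u + 1 / k.+1%:R.
    by rewrite ler_pdivrMr// mulrDl divfK ?gt_eqF// -natr1 lerD2r.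
  have e2 : 4 / k.+1%:R = 4 * (1 / k.+1%:R) :> R by rewrite mulrA mulr1.
  move: kg e1; rewrite e2 /g; move: (1 / k.+1%:R) (r.+1%:R / k.+1%:R) => x y; lra.
by rewrite /t ler_pdivlMr.
Qed.

(** Where [wratio p z] is at most [3 / 2] the inequality makes the next value
    at most [2 / 3]; ergodicity decides between this range and its complement.
    *)
Lemma null_dichotomy : contracts w a lam \/ expands w a lam.
Proof.
have l0 : 0 < l by rewrite normc_gt0.
have lp : 0 < l ^+ p by rewrite exprn_gt0.
have h : {ae m, forall z, 3 * wratio p (iter p (rotation a) z) <=
    1 + wratio p z * wratio p (iter p (rotation a) z)}.
  apply: filterS2 wratio_orbit (wprodD_ae w a p p) => z h e; apply: le_trans h _.
  by rewrite lerD2l /wratio -addnn e normcM exprD invfM mulrACA.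
pose G := [set z | wratio p z <= 2 / 3].
have mG : measurable G.
  have mg : measurable_fun setT (fun z => wratio p z <= 2 / 3).
    by apply: measurable_fun_ler => //; exact: wratio_meas.
  by rewrite -[G]setTI; exact: (mg measurableT [set true]).
have broot n : (0 < n)%N -> (cpow a p : R[i]) ^+ n != 1.
  by move=> n1; rewrite cpowE -exprM aroot// muln_gt0 p0.
have half z : 3 * wratio p (iter p (rotation a) z) <= 1 + wratio p z * wratio p (iter p (rotation a) z) ->
    wratio p z <= 3 / 2 -> wratio p (iter p (rotation a) z) <= 2 / 3.
  have := wratio_ge0 p (iter p (rotation a) z); move: (wratio p z) (wratio p _) => x y y0 h1 h2.
  have := ler_wpM2r y0 h2; lra.
have inv : {ae m, forall z, G z -> G (rotation (cpow a p) z)}.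
  apply: filterS h => z /half hz Gz; rewrite /G /= rotation_cpow; apply: hz.
  by apply: le_trans Gz _; lra.
have [hG|hG] := rotation_ergodic broot mG inv.
- left; exists p, (2 / 3 * l ^+ p); split => //.
  + by apply: mulr_ge0 => //; exact: ltW.
  + by rewrite gtr_pMl//; lra.
  + by apply: filterS hG => z; rewrite /G /= /wratio ler_pdivrMr.
- right; exists p, (3 / 2 * l ^+ p); split => //.
  + by rewrite ltr_pMl//; lra.
  + apply: filterS2 (filterI h hG) (ae_iter_rot a p hG) => z [/half hz _] h2.
    rewrite -ler_pdivlMr// -/(wratio p z) leNgt; apply/negP => h3; apply: h2.
    by rewrite /G /=; apply: hz; exact: ltW.
Qed.

End null_sets.

(** The gain [q ^ p] of the hump in the middle beats the growth of the norms
    of the rotations, which enter with the total exponent [3 p]. *)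
Lemma below_dichotomy : 0 < K -> (forall x, carrier vanishing x -> N x <= K * N (S x)) ->
  contracts w a lam \/ expands w a lam.
Proof.
move=> K0 below; have l0 : 0 < l by rewrite normc_gt0.
have Kl : 0 < K * l by rewrite mulr_gt0.
pose eta := Num.min 1 (1 / (2 * (K * l))).
have eta0 : 0 < eta by rewrite lt_min ltr01 divr_gt0// mulr_gt0.
have eta1 : eta <= 1 by rewrite ge_min lexx.
have Keta : K * l * eta <= 1 / 2.
  have : eta <= 1 / (2 * (K * l)) by rewrite ge_min lexx orbT.
  rewrite ler_pdivlMr ?mulr_gt0//; move: (K * l) => x; lra.
pose q := 1 + eta; pose rho := 1 + eta / 7.
have rho1 : 1 < rho by rewrite ltrDl divr_gt0.
have rho0 : 0 < rho := lt_trans ltr01 rho1.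
have q0 : 0 < q by rewrite addr_gt0.
(* The factor 1 / 7 leaves room for the third power. *)
have rq : rho ^+ 3 < q by rewrite /rho /q !exprS expr0; nra.
have [_ _ _ [_ gU] [_ gV]] := aX.
have [CU CU0 HU] := gU _ rho1; have [CV CV0 HV] := gV _ rho1.
pose D := CV * (2 * K * l) * (1 + 2 * CU).
have D0 : 0 < D by rewrite !mulr_gt0// addr_gt0// mulr_gt0.
have th0 : 0 <= rho ^+ 3 / q by rewrite divr_ge0 ?exprn_ge0// ltW.
have th1 : rho ^+ 3 / q < 1 by rewrite ltr_pdivrMr// mul1r.
have e3 : 0 < 3^-1 :> R by rewrite invr_gt0.
have [n nD] := geom_small D th0 th1 e3.
pose p := n.+1.
have hp : 3 * (D * rho ^+ (3 * p)) <= q ^+ p.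
  have h1 : D * (rho ^+ 3 / q) ^+ p <= 3^-1.
    apply: le_trans (ltW nD); apply: ler_wpM2l; first exact: ltW.
    by rewrite /p [leLHS]exprS; apply: ler_piMl; [exact: exprn_ge0|exact: ltW].
  have qp : 0 < q ^+ p by rewrite exprn_gt0.
  move: h1; rewrite expr_div_n -exprM (mulrA D) ler_pdivrMr// => h1.
  by rewrite -ler_pdivlMl.
apply: (@null_dichotomy p) => // s t E mE s0 t0 E1 Es Et st.
have := hump_set mE (ltn0Sn n) s0 t0 (ltW eta0) K0 Keta below E1 Es Et rho0 CV0 HU HV.
rewrite -/q -/p; set e := N _ => H.
have iE : carrier X (indL0 mE).
  have [_ h _ _ _] := aX; apply: h; exists 1.
  by apply: filterS (indL0E mE) => z ->; rewrite normcR ger0_norm ?ind_ge0// ind_le1.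
have e0 : 0 <= e by exact: (n_ge0 hN).
suff e_eq0 : e = 0.
  have [_ [_ h _ _]] := hN; have ind0 := h _ iE e_eq0.
  apply: filterS2 (indL0E mE) (L0_0 R) => z; rewrite ind0 => -> h1 Ez.
  move: h1; rewrite /ind mem_set// => /eqP; by rewrite oner_eq0.
apply/eqP; rewrite eq_le e0 andbT leNgt; apply/negP => ep.
have : q ^+ p * s <= D * rho ^+ (3 * p) * (1 + t).
  rewrite -(ler_pM2r ep); apply: le_trans H _.
  have rp : 1 <= rho ^+ p.*2 by rewrite exprn_ege1// ltW.
  have -> : rho ^+ (3 * p) = rho ^+ p * rho ^+ p.*2 by rewrite -exprD -mul2n -mulSn.
  have h1 : 1 + q * t * (CU * rho ^+ p.*2) <= rho ^+ p.*2 * ((1 + 2 * CU) * (1 + t)).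
    have -> : (1 + 2 * CU) * (1 + t) = 1 + 2 * t * CU + (t + 2 * CU) by ring.
    have tC : 0 <= t * CU by rewrite mulr_ge0// ltW.
    rewrite mulrDr; apply: ler_wpDr; first by apply: mulr_ge0; [exact: le_trans rp|lra].
    rewrite mulrDr mulr1; apply: lerD => //.
    have -> : q * t * (CU * rho ^+ p.*2) = rho ^+ p.*2 * (q * (t * CU)) by ring.
    apply: ler_wpM2l; first exact: le_trans rp.
    by rewrite -mulrA; apply: ler_wpM2r => //; rewrite /q; lra.
  have h2 : 0 <= CV * rho ^+ p * (2 * K * l) * e.
    by rewrite !mulr_ge0 ?exprn_ge0 ?(ltW CV0) ?(ltW rho0) ?(ltW K0) ?(ltW l0).
  have := ler_wpM2l h2 h1; rewrite /D; move: (1 + _) => x; move: (rho ^+ p) (rho ^+ p.*2) => x1 x2.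
  move=> h3; rewrite -subr_ge0 in h3; rewrite -subr_ge0; apply: le_trans h3 _.
  by rewrite le_eqVlt; apply/orP; left; apply/eqP; ring.
have qp : 0 < q ^+ p by rewrite exprn_gt0.
have t1 : 0 <= 1 + t by rewrite addr_ge0.
have := ler_wpM2r t1 hp => h1 h2.
have h3 : q ^+ p * (3 * s) <= q ^+ p * (1 + t) by lra.
by move: h3; rewrite ler_pM2l//; lra.
Qed.

End hump.

(** * Comparison of the spectra *)

Section semi_fredholm_comparison.
Variables (R : realType) (V : lmodType R[i]).
Implicit Types (E : subnormed V) (S T : V -> V) (A B : set V) (n : nat).

Lemma dim_mod_refl A n : is_submodule A -> dim_mod A A n <-> n = 0%N.
Proof.
move=> [A0 AD]; split=> [[v [Av ind _]]|->].
  case: n v Av ind => [//|n] v Av ind.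
  have h : A (\sum_i (if i == ord0 then 1 else 0) *: v i).
    rewrite (bigD1 ord0)//= scale1r big1 ?addr0// => i /negPf ->; by rewrite scale0r.
  by have /eqP := ind _ h ord0; rewrite /= oner_eq0.
exists (fun=> 0); split=> [[]//|c _ []//|y Ay]; exists (fun=> 0).
by rewrite big_ord0 subr0.
Qed.

Lemma codim_range0 E S : codim_range E S 0 <-> carrier E `<=` range_on E S.
Proof.
split=> [[v [_ _ h]] y /h[c]|h]; first by rewrite big_ord0 subr0.
by exists (fun=> 0); split=> [[]//|c _ []//|y /h]; exists (fun=> 0); rewrite big_ord0 subr0.
Qed.

Lemma dim_mod_dependent B n (x : 'I_n.+1 -> V) : dim_mod B [set 0] n -> (forall i, B (x i)) ->
  exists2 c : 'I_n.+1 -> R[i], \sum_i c i *: x i = 0 & exists i, c i != 0.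
Proof.
move=> [v [_ _ span]] Bx.
have /choice[f fE] : forall i, exists c : 'I_n -> R[i], x i = \sum_j c j *: v j.
  by move=> i; have [c /subr0_eq h] := span _ (Bx i); exists c.
pose M := \matrix_(i < n.+1, j < n) f i j.
have kM : kermx M != 0.
  rewrite -mxrank_eq0 mxrank_ker -lt0n subn_gt0 ltnS; exact: rank_leq_col.
have /rowV0Pn[u uk u0] := kM; move/sub_kermxP : uk => uM.
exists (fun i => u 0 i); last first.
  by move/matrix0Pn : u0 => [i0 [j h]]; exists j; rewrite -(ord1 i0).
transitivity (\sum_j (u *m M) 0 j *: v j).
  under eq_bigr do rewrite fE scaler_sumr.
  rewrite exchange_big; apply: eq_bigr => j _; rewrite mxE scaler_suml.
  by apply: eq_bigr => i _; rewrite scalerA mxE.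
by rewrite uM; apply: big1 => j _; rewrite mxE scale0r.
Qed.

(** Preimages of a Cauchy sequence form a Cauchy sequence. *)
Lemma closed_range_of_below E S (M : R) : is_banach E -> bounded_on E S -> lin S ->
  (forall x, carrier E x -> nnorm E x <= M * nnorm E (S x)) -> closed_in E (range_on E S).
Proof.
move=> [sE nE cE] [SE [B HB]] lS below y yE h; have hE : normed E by [].
have /choice[x xP] : forall n, exists x, carrier E x /\ nnorm E (y - S x) < 2^-1 ^+ n.
  move=> n; have e0 : 0 < 2^-1 ^+ n :> R by rewrite exprn_gt0// invr_gt0.
  by have [_ [x xE <-] hx] := h _ e0; exists x.
have xE n : carrier E (x n) by have [] := xP n.
have small e : 0 < e -> exists N0, forall n, (N0 <= n)%N -> nnorm E (y - S (x n)) < e.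
  move=> e0; have [N0 hN0] := geom_small 1 (ltac:(by rewrite invr_ge0) : 0 <= 2^-1 :> R)
    (ltac:(by rewrite invf_lt1// ltr1n) : 2^-1 < 1 :> R) e0.
  exists N0 => n nN; have [_ hn] := xP n; apply: lt_trans hn _; apply: le_lt_trans hN0.
  by rewrite mul1r; apply: ler_wiXn2l => //; rewrite ?invr_ge0// invf_le1// ler1n.
have M1 : 0 < `|M| + 1 by rewrite ltr_wpDl.
have [l lE xl] : exists2 l, carrier E l & nnorm E (x n - l) @[n --> \oo] --> (0 : R).
  apply: cE => // e e0; have e1 : 0 < e / (`|M| + 1) / 2 by rewrite !divr_gt0.
  have [N0 HN] := small _ e1; exists N0 => p q pN qN.
  have SpE := SE _ (xE p); have SqE := SE _ (xE q).
  apply: le_lt_trans (below _ (nmemB hE (xE p) (xE q))) _.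
  rewrite (linB _ _ lS); have dE := nmemB hE SpE SqE.
  apply: (@le_lt_trans _ _ ((`|M| + 1) * nnorm E (S (x p) - S (x q)))).
    by apply: ler_wpM2r; [exact: n_ge0|apply: ler_wpDr => //; exact: ler_norm].
  rewrite mulrC -ltr_pdivlMr//; apply: le_lt_trans (n_tri hE SpE yE SqE) _.
  rewrite (nBC hE SpE yE); have := HN _ pN; have := HN _ qN; move: (nnorm E _) (nnorm E _) => u v.
  lra.
exists l => //; apply/esym/subr0_eq.
have SlE := SE _ lE; apply: (n_small hE); first exact: nmemB.
move=> e e0; have e2 : 0 < e / 2 by rewrite divr_gt0.
have B1 : 0 < `|B| + 1 by rewrite ltr_wpDl.
have eB : 0 < e / 2 / (`|B| + 1) by rewrite divr_gt0.
have [N0 HN] := small _ e2; move/cvgrPdist_lt : xl => /(_ _ eB)[N1 _ HN1].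
pose n := maxn N0 N1; have h1 := HN n (leq_maxl _ _); have /= h2 := HN1 n (leq_maxr _ _).
have SnE := SE _ (xE n); apply: ltW; apply: le_lt_trans (n_tri hE yE SnE SlE) _.
have : nnorm E (S (x n) - S l) < e / 2.
  rewrite -(linB _ _ lS); have dE := nmemB hE (xE n) lE; apply: le_lt_trans (HB _ dE) _.
  move: h2; rewrite sub0r normrN ger0_norm; last exact: n_ge0.
  rewrite ltr_pdivlMr// => h2; apply: le_lt_trans h2; rewrite mulrC.
  by apply: ler_wpM2l; [exact: n_ge0|apply: ler_wpDr => //; exact: ler_norm].
move: h1; move: (nnorm E _) (nnorm E _) => u v; lra.
Qed.

(** If neither range is closed then the nullities and deficiencies may differ,
    but no Fredholm property holds; hence the two alternatives. *)
Definition comparable_operators E E' S :=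
  (~ closed_in E (range_on E S) /\ ~ closed_in E' (range_on E' S)) \/
  [/\ closed_in E (range_on E S) /\ closed_in E' (range_on E' S),
    forall n, dim_ker E S n <-> dim_ker E' S n,
    forall n, codim_range E S n <-> codim_range E' S n &
    invertible_on E S <-> invertible_on E' S].

Lemma invertible_closed E S : invertible_on E S -> closed_in E (range_on E S).
Proof. by move=> [_ sur _] y yE _; have [x xE Sx] := sur _ yE; exists x. Qed.

Lemma comparableP E E' S : comparable_operators E E' S ->
  [/\ invertible_on E S <-> invertible_on E' S, semi_fredholm E S <-> semi_fredholm E' S,
    Phi_plus E S <-> Phi_plus E' S, fredholm E S <-> fredholm E' S & weyl E S <-> weyl E' S].
Proof.
move=> [[nc nc']|[[cl cl'] hk hc hi]].
  have i F : invertible_on F S -> closed_in F (range_on F S) := @invertible_closed F S.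
  have sf F : semi_fredholm F S -> closed_in F (range_on F S) by case.
  have pp F : Phi_plus F S -> closed_in F (range_on F S) by case=> /sf.
  have fr F : fredholm F S -> closed_in F (range_on F S) by case=> /pp.
  have we F : weyl F S -> closed_in F (range_on F S) by case=> /fr.
  have no P Q : (P -> closed_in E (range_on E S)) -> (Q -> closed_in E' (range_on E' S)) -> P <-> Q.
    by move=> hP hQ; split=> [/hP/nc|/hQ/nc'].
  by split; apply: no; (exact: i || exact: sf || exact: pp || exact: fr || exact: we).
have ek : (exists n, dim_ker E S n) <-> exists n, dim_ker E' S n.
  by split=> -[n /hk hn]; exists n.
have ec : (exists n, codim_range E S n) <-> exists n, codim_range E' S n.
  by split=> -[n /hc hn]; exists n.
have sf : semi_fredholm E S <-> semi_fredholm E' S by rewrite /semi_fredholm; tauto.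
have pp : Phi_plus E S <-> Phi_plus E' S by rewrite /Phi_plus; tauto.
have pm : Phi_minus E S <-> Phi_minus E' S by rewrite /Phi_minus; tauto.
have fr : fredholm E S <-> fredholm E' S by rewrite /fredholm; tauto.
split=> //; rewrite /weyl.
have : (exists n, dim_ker E S n /\ codim_range E S n) <->
    (exists n, dim_ker E' S n /\ codim_range E' S n).
  by split=> -[n [/hk h1 /hc h2]]; exists n.
tauto.
Qed.

Lemma spectra_eq E E' T : (forall lam, comparable_operators E E' (lambda_minus T lam)) ->
  spectrum T E = spectrum T E' /\
  [/\ sigma1 T E = sigma1 T E', sigma2 T E = sigma2 T E', sigma3 T E = sigma3 T E',
    sigma4 T E = sigma4 T E' & sigma5 T E = sigma5 T E'].
Proof.
move=> h; have h' lam := comparableP (h lam).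
have hr : resolvent_set T E = resolvent_set T E'.
  by apply/seteqP; split=> lam; rewrite /resolvent_set/=; have [] := h' lam; tauto.
have hs : spectrum T E = spectrum T E' by rewrite /spectrum hr.
have h1 : sigma1 T E = sigma1 T E'.
  by apply/seteqP; split=> lam; rewrite /sigma1/=; have [] := h' lam; tauto.
split=> //; split => //.
- by apply/seteqP; split=> lam; rewrite /sigma2/=; have [] := h' lam; tauto.
- by apply/seteqP; split=> lam; rewrite /sigma3/=; have [] := h' lam; tauto.
- by apply/seteqP; split=> lam; rewrite /sigma4/=; have [] := h' lam; tauto.
- by rewrite /sigma5 hs h1 hr.
Qed.

End semi_fredholm_comparison.

Section weighted_rotations.
Variable R : realType.
Local Notation C := (circle R).
Local Notation m := (circle_measure R).
Local Notation L := (L0 m).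
Variables (a : C) (w : L).
Hypothesis wH : Hinfty R w.
Hypothesis aroot : forall n : nat, (0 < n)%N -> (a : R[i]) ^+ n != 1.
Local Notation T := (weighted_rotation_op w a).
Local Notation S := (lambda_minus T).

Section one_space.
Variable X : subnormed L.
Hypothesis aX : admissible a X.
Local Notation Y := (H1_inter X).
Local Notation N := (nnorm X).

Let hX : banach_ideal_space X. Proof. by have [] := aX. Qed.
Let hN := ideal_normed hX.

Let bounded_mem (x : L) (M : R) : {ae m, forall z, normc (x z) <= M} -> carrier X x.
Proof. by move=> xM; have [_ h _ _ _] := aX; apply: h; exists M. Qed.

(** At [lam = 0] the lower bound, tested on an outer function that lives where
    the weight is small at the previous point of the orbit, bounds the weight
    below. *)
Lemma below_weight n0 (K : R) : 0 < K ->
  (forall x, carrier (vanishing X n0) x -> N x <= K * N (T x)) -> expands w a 0.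
Proof.
move=> K0 below; have [_ _ _ [UD gU] _] := aX.
have [CU CU0 HU] := gU 2 (ltac:(by rewrite ltr1n)).
have [M M0 wM] := weight_bounded wH.
(* with this threshold the norm of the indicator is at most half of itself *)
pose c := 1 / (2 * (K * (CU * 2))).
have KC : 0 < K * (CU * 2) by rewrite !mulr_gt0.
have c0 : 0 < c by rewrite divr_gt0// mulr_gt0.
have cE : K * (CU * 2) * c = 1 / 2 by rewrite /c; field; rewrite !gt_eqF.
pose b := cinv a.
pose E := [set y : C | normc (w (rotation b y)) <= c].
have mE : measurable E.
  have mg : measurable_fun setT (fun y => normc (w (rotation b y)) <= c).
    apply: measurable_fun_ler => //.
    exact: (measurableT_comp (norm1_meas w) (measurable_rotation b)).
  by rewrite -[E]setTI; exact: (mg measurableT [set true]).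
have oneX : carrier X (oneL0 R).
  by apply: (bounded_mem (M := 1)); apply: filterS (L0_1 R) => z ->; rewrite normc_1.
have indX : carrier X (indL0 mE).
  apply: (bounded_mem (M := 1)); apply: filterS (indL0E mE) => z ->.
  by rewrite normcR ger0_norm ?ind_ge0// ind_le1.
have UiX := UD _ indX.
have e0 := n_ge0 hN indX; have o0 := n_ge0 hN oneX.
suff ie0 : N (indL0 mE) = 0.
  have [_ [_ h _ _]] := hN; have ind0 := h _ indX ie0.
  have nE : {ae m, forall y, ~ E y}.
    apply: filterS2 (indL0E mE) (L0_0 R) => z; rewrite ind0 => -> h1 Ez.
    by move: h1; rewrite /ind mem_set// => /eqP; rewrite oner_eq0.
  exists 1%N, c; split; [by []|by rewrite expr1 normc_0|].
  apply: filterS2 (ae_rot a nE) (filterI (L0M w (rotation_op a (oneL0 R)))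
    (filterI (L0rot a (oneL0 R)) (ae_rot a (L0_1 R)))) => z h1 [e1 [e2 e3]].
  rewrite /= e1 e2 e3 mulr1 ltW// ltNge; apply/negP => h2; apply: h1.
  by rewrite /E /= rotation_cinvK.
have key (delta : R) : 0 < delta ->
    N (indL0 mE) <= K * (c * (CU * 2 * N (indL0 mE)) + delta * (M * N (oneL0 R))).
  move=> d0; have [f fH fE] := outer_Hinfty mE d0.
  pose g : L := mulL0 (zpow R n0) f.
  have [fH1 fL] : H1 R f /\ Linfty R f by move: fH; rewrite HinftyE.
  have gE : {ae m, forall z, normc (g z) = if z \in E then 1 else delta}.
    apply: filterS2 (filterI fE (L0M (zpow R n0) f)) (normc_zpow R n0) => z [h ->] e.
    by rewrite normcM e mul1r.
  have gX : carrier X g.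
    apply: (bounded_mem (M := 1 + delta)); apply: filterS gE => z ->; case: ifP => _.
      by rewrite lerDl ltW.
    by rewrite lerDr.
  have gv : carrier (vanishing X n0) g.
    split; last by move=> k kn; exact: fcoef_zpow_lt.
    by split; [exact: H1_zpow|exact: gX].
  have h1 : N (indL0 mE) <= N g.
    apply: (ideal_le hX) => //; apply: filterS2 (indL0E mE) gE => z -> ->.
    rewrite normcR ger0_norm ?ind_ge0// /ind; case: ifP => // _; exact: ltW.
  apply: le_trans h1 _; apply: le_trans (below _ gv) _; apply: ler_wpM2l; first exact: ltW.
  have c1 : carrier X (c%:C *: rotation_op a (indL0 mE)) by exact: (nmemZ hN).
  have c2 : carrier X ((delta * M)%:C *: oneL0 R) by exact: (nmemZ hN).
  have dM : 0 <= delta * M by rewrite mulr_ge0// ltW.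
  apply: (@le_trans _ _ (N (c%:C *: rotation_op a (indL0 mE) + (delta * M)%:C *: oneL0 R))).
    apply: (ideal_le hX); last exact: (nmemD hN).
    apply: filterS2 (filterI (filterI (L0M w (rotation_op a g)) (L0rot a g)) (filterI (ae_rot a gE) wM))
      (filterI (filterI (L0D (c%:C *: rotation_op a (indL0 mE)) ((delta * M)%:C *: oneL0 R))
        (filterI (L0Z c%:C (rotation_op a (indL0 mE))) (L0Z (delta * M)%:C (oneL0 R))))
        (filterI (filterI (L0rot a (indL0 mE)) (ae_rot a (indL0E mE))) (L0_1 R))).
    move=> z [[e1 e2] [e3 h2]] [[e4 [e5 e6]] [[e7 e8] e9]].
    rewrite e1 e2 e4 e5 e6 e7 e8 e9 mulr1 normcM e3 -(rmorphM (real_complex R)) -(rmorphD (real_complex R)) normcR.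
    rewrite ger0_norm; last first.
      by apply: addr_ge0 => //; apply: mulr_ge0; [exact: ltW|exact: ind_ge0].
    rewrite /ind; case: ifPn => [/set_mem|_]; last by rewrite mulr0 add0r mulrC ler_wpM2l// ltW.
    by rewrite /E /= rotation_cinvK !mulr1 => h3; apply: ler_wpDr.
  apply: le_trans (nD hN c1 c2) _; rewrite (nZ hN _ UiX) (nZ hN _ oneX) !normcR.
  rewrite (ger0_norm dM) (gtr0_norm c0) -[delta * M * _]mulrA lerD2r; apply: ler_wpM2l; first exact: ltW.
  by have := HU 1%N _ indX; rewrite expr1.
apply/eqP; rewrite eq_le e0 andbT; apply/ler_addgt0Pl => e e1; rewrite addr0.
pose Z := K * (M * N (oneL0 R)); have Z0 : 0 <= Z by rewrite !mulr_ge0// ltW.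
have Z1 : 0 < 2 * (Z + 1) by rewrite mulr_gt0// ltr_wpDl.
have := key _ (divr_gt0 e1 Z1).
have -> : K * (c * (CU * 2 * N (indL0 mE)) + e / (2 * (Z + 1)) * (M * N (oneL0 R))) =
    K * (CU * 2) * c * N (indL0 mE) + e * (Z / (2 * (Z + 1))) by rewrite /Z; ring.
have : Z / (2 * (Z + 1)) <= 1 / 2.
  by rewrite ler_pdivrMr//; lra.
rewrite cE => /(ler_wpM2l (ltW e1)); lra.
Qed.

Lemma closed_range_dichotomy lam : w != 0 -> closed_in Y (range_on Y (S lam)) ->
  contracts w a lam \/ expands w a lam.
Proof.
move=> w0 cl; have [n0 [K [K0 below]]] := closed_range_below aX wH w0 aroot cl.
have below' x : carrier (vanishing X n0) x -> N x <= K * N (S lam x).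
  by move=> [xY xv]; exact: below.
have [l0|l0] := eqVneq lam 0; last exact: below_dichotomy aX wH l0 aroot K0 below'.
right; rewrite l0; apply: (@below_weight n0 K K0) => x xv; apply: le_trans (below' _ xv) _.
have TX : carrier X (T x).
  by have [TD _] := weighted_bounded aX wH; apply: TD; have [[]] := xv.
by rewrite l0 /lambda_minus scale0r sub0r (nN hN TX).
Qed.

Lemma hardy_lambda_bounded lam : bounded_on Y (S lam).
Proof.
have hY := hardy_normed aX; have [TD [M HM]] := hardy_weighted_bounded aX wH; split.
  by move=> x xD; apply: (nmemB hY); [exact: (nmemZ hY)|exact: TD].
exists (normc lam + M) => x xD; apply: le_trans (nB hY (nmemZ hY lam xD) (TD _ xD)) _.
by rewrite (nZ hY _ xD) mulrDl lerD2l HM.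
Qed.

Lemma contracts_closed lam : contracts w a lam ->
  [/\ invertible_on Y (S lam), closed_in Y (range_on Y (S lam)), ker_on Y (S lam) = [set 0] &
    forall n, codim_range Y (S lam) n <-> n = 0%N].
Proof.
move=> ct; have inv := contracts_invertible aX wH ct.
have hY := hardy_normed aX; have [inj sur _] := inv; have [sY _] := hY.
have lS : lin (S lam) by apply: lin_lambda; exact: weighted_lin.
split; [exact: inv|exact: invertible_closed inv| |].
  apply/seteqP; split=> [x [xY Sx]|x ->]; first exact: inj.
  by split; [exact: (nmem0 hY)|exact: lin0 lS].
move=> n; rewrite /codim_range; have -> : range_on Y (S lam) = carrier Y; last exact: dim_mod_refl.
apply/seteqP; split=> [_ [x xY <-]|y yY]; first by have [h _] := hardy_lambda_bounded lam; exact: h.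
by have [x xY xE] := sur _ yY; exists x.
Qed.

Lemma expands_closed lam : expands w a lam ->
  [/\ closed_in Y (range_on Y (S lam)), ker_on Y (S lam) = [set 0] &
    invertible_on Y (S lam) <-> codim_range Y (S lam) 0].
Proof.
move=> ex; have hY := hardy_normed aX; have [sY _] := hY.
have lS : lin (S lam) by apply: lin_lambda; exact: weighted_lin.
have [M below] := expands_below aX wH ex.
have belowY x : carrier Y x -> N x <= M * N (S lam x) by move=> [_]; exact: below.
have inj x : carrier Y x -> S lam x = 0 -> x = 0.
  move=> xY Sx; have [_ xX] := xY; have [_ [_ h _ _]] := hN; apply: h => //.
  apply/eqP; rewrite eq_le (n_ge0 hN xX) andbT; have := below _ xX.
  by rewrite Sx (n0 hN) mulr0.
split.
- exact: closed_range_of_below (hardy_banach aX) (hardy_lambda_bounded lam) lS belowY.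
- apply/seteqP; split=> [x [xY Sx]|x ->]; first exact: inj.
  by split; [exact: (nmem0 hY)|exact: lin0 lS].
- split=> [[_ sur _]|/codim_range0 h].
    by apply/codim_range0 => y /sur[x xY xE]; exists x.
  split; [exact: inj| |by exists M].
  by move=> y /h[x xY xE]; exists x.
Qed.

Lemma zpow_mem n : carrier Y (zpow R n).
Proof.
have one1 : mulL0 (zpow R n) (oneL0 R) = zpow R n by rewrite mulL0C mul1L0.
split; last by apply: (bounded_mem (M := 1)); apply: filterS (normc_zpow R n) => z ->.
rewrite -one1; apply: H1_zpow; apply/H1P; split.
  by apply: Linfty_cintg; exists 1; apply: filterS (L0_1 R) => z ->; rewrite normc_1.
move=> k k0; rewrite (@cmoment_ae R _ (fun=> 1) k (L0_meas _) _ (L0_1 R))//.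
by rewrite /cmoment; under eq_cint do rewrite mulr1; exact: cint_circleX.
Qed.

Lemma fcoef_zpow n : fcoef n (zpow R n) = 1.
Proof.
rewrite -[RHS](@cint_cst R 1); apply: ae_cint.
- by apply: measurable_complexM; [exact: cmeas_circleV|exact: L0_meas].
- exact: measurable_cst.
- by apply: filterS (zpowE R n) => z ->; rewrite mulrC circleVK.
Qed.

(** The powers of [z] are independent: the lowest index in a linear relation
    has a vanishing coefficient. *)
Lemma hardy_infinite n : ~ dim_mod (carrier Y) [set 0] n.
Proof.
move=> dn; have hY := hardy_normed aX.
have [c c0 [i ci]] := dim_mod_dependent dn (fun i : 'I_n.+1 => zpow_mem i).
have exc : exists k : nat, [exists j : 'I_n.+1, (j == k :> nat) && (c j != 0)].
  by exists i; apply/existsP; exists i; rewrite eqxx.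
case: (ex_minnP exc) => k /existsP[j /andP[/eqP jk cj]] min; subst k.
have hv := vanishing_normed j.+1 aX.
have rest : carrier (vanishing X j.+1) (\sum_(i0 < n.+1 | i0 != j) c i0 *: zpow R i0).
  elim/big_ind : _ => [|x y xv yv|k kj]; first exact: (nmem0 hv).
    exact: (nmemD hv).
  have [->|ck] := eqVneq (c k) 0; first by rewrite scale0r; exact: (nmem0 hv).
  have jk : (j < k)%N.
    rewrite ltn_neqAle eq_sym kj /=; apply: min; apply/existsP; exists k; by rewrite eqxx.
  apply: (nmemZ hv); split; first exact: zpow_mem.
  move=> r rj; have one1 : mulL0 (zpow R k) (oneL0 R) = zpow R k by rewrite mulL0C mul1L0.
  have one0 : mulL0 (zpow R 0) (oneL0 R) = oneL0 R.
    apply: L0P; apply: filterS2 (L0M (zpow R 0) (oneL0 R)) (zpowE R 0) => z -> ->.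
    by rewrite expr0 mul1r.
  rewrite -one1; apply: fcoef_zpow_lt; last exact: leq_trans rj jk.
  have : zpow R 0 = oneL0 R by rewrite -one0 mulL0C mul1L0.
  by move=> <-; have [] := zpow_mem 0.
have zi : cintg m setT (zpow R j) by have [/H1P[]] := zpow_mem j.
have : carrier (vanishing X j.+1) (c j *: zpow R j).
  have -> : c j *: zpow R j = - \sum_(i0 < n.+1 | i0 != j) c i0 *: zpow R i0.
    by apply/eqP; rewrite -addr_eq0; apply/eqP; rewrite -[RHS]c0 [RHS](bigD1 j).
  exact: (nmemN hv).
move=> [_ /(_ j (leqnn _))]; rewrite (fcoefZ _ _ zi) fcoef_zpow mulr1 => /eqP.
by rewrite (negPf cj).
Qed.

Lemma zero_operator : S 0 = (fun=> 0) :> (L -> L) ->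
  [/\ closed_in Y (range_on Y (S 0)), ~ invertible_on Y (S 0) &
    forall n, ~ dim_ker Y (S 0) n /\ ~ codim_range Y (S 0) n].
Proof.
move=> ->; have hY := hardy_normed aX; have Y0 := nmem0 hY.
have r0 : range_on Y (fun=> 0) = [set 0].
  by apply/seteqP; split=> [_ [x _ <-]//|x ->]; exists 0.
have k0 : ker_on Y (fun=> 0 : L) = carrier Y by apply/seteqP; split=> [x []|x].
split.
- rewrite r0 => y yY h; apply: (n_eq0 hY yY).
  apply/eqP; rewrite eq_le (n_ge0 hY yY) andbT; apply/ler_addgt0Pl => e e0.
  by have [_ -> h2] := h _ e0; rewrite addr0 ltW// -[y]subr0.
- move=> [inj _ _]; have z0 := inj _ (zpow_mem 0) erefl.
  have := fcoef_zpow 0; rewrite z0 -(scale0r (0 : L)) fcoefZ ?mul0r; last by have [/H1P[]] := Y0.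
  by move=> /esym/eqP; rewrite oner_eq0.
- move=> n; split; first by rewrite /dim_ker k0; exact: hardy_infinite.
  by rewrite /codim_range r0; exact: hardy_infinite.
Qed.

End one_space.

(** Without contraction or expansion the range is closed on neither space, by
    the dichotomy applied to each of them. *)
Lemma weighted_comparable (X : subnormed L) lam : admissible a X ->
  comparable_operators (H1_inter X) (H1_inter (Linfty_space R)) (S lam).
Proof.
move=> aX; have aL := Linfty_admissible a.
have [ct|nct] := pselect (contracts w a lam).
  have [i1 cl1 k1 r1] := contracts_closed aX ct.
  have [i2 cl2 k2 r2] := contracts_closed aL ct.
  right; split=> // n; first by rewrite /dim_ker k1 k2.
  by rewrite r1 r2.
have [ex|nex] := pselect (expands w a lam).
  have [cl1 k1 i1] := expands_closed aX ex.
  have [cl2 k2 i2] := expands_closed aL ex.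
  right; split=> //.
  - by move=> n; rewrite /dim_ker k1 k2.
  - exact: expanding_codim.
  - by rewrite i1 i2; exact: expanding_codim.
have [w0|w0] := eqVneq w 0; last first.
  by left; split=> /closed_range_dichotomy => [/(_ aX w0)[]|/(_ aL w0)[]].
have T0 x : T x = 0.
  by rewrite /weighted_rotation_op w0 mulL0C (lin0 (mulL0_lin _)).
have [l0|l0] := eqVneq lam 0; last first.
  exfalso; apply: nct; exists 1%N, 0; split=> //; first by rewrite expr1 normc_gt0.
  apply: filterS2 (L0M 0 (rotation_op a (oneL0 R))) (L0_0 R) => z e1 e2.
  by rewrite /= w0 e1 e2 mul0r normc_0.
have S0 : S 0 = (fun=> 0).
  by apply/funext => x; rewrite /lambda_minus T0 scale0r subr0.
rewrite l0; have [cl1 i1 d1] := zero_operator aX S0; have [cl2 i2 d2] := zero_operator aL S0.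
right; split=> // n; by have [? ?] := d1 n; have [? ?] := d2 n; split.
Qed.

End weighted_rotations.

Theorem corollary7p5 (R : realType) (X : subnormed (L0 (circle_measure R)))
  (alpha : circle R) (w : L0 (circle_measure R)) :
  let U := rotation_op alpha in
  let T := weighted_rotation_op w alpha in
  let Y := H1_inter X in
  let H := Hinfty_space R in
  banach_ideal_space X ->
  Linfty R `<=` carrier X -> carrier X `<=` Lone R ->
  (forall n : nat, (0 < n)%N -> (alpha : R[i]) ^+ n != 1) ->
  bounded_on X U ->
  spectrum U X `<=` [set z : R[i] | `|z| = 1] ->
  Hinfty R w ->
  spectrum T Y = spectrum T H /\
  [/\ sigma1 T Y = sigma1 T H, sigma2 T Y = sigma2 T H,
      sigma3 T Y = sigma3 T H, sigma4 T Y = sigma4 T H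
    & sigma5 T Y = sigma5 T H].
Proof.
move=> U T Y H hX LX XL aroot bU sU wH.
have aX : admissible alpha X := spectrum_admissible hX LX XL bU sU.
rewrite /H Hinfty_spaceE; apply: spectra_eq => lam.
exact: weighted_comparable.
Qed.
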